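(* Let $R$ be an $\mathbf{E}_1$-ring and let $M$ be a homologically even $R$-module. Put $C_{-1}:=M$ and suppose given, inductively for $i\ge -1$, a $\pi_*$-even envelope $C_i\to E_{i+1}$ together with $C_{i+1}:=\mathrm{cofib}(C_i\to E_{i+1})$. Let $E_0\to E_1\to E_2\to\cdots$ be the resulting sequence of $R$-modules, with maps the composites $E_i\to C_i\to E_{i+1}$ (consecutive composites are null). Then for all $p\ge0$ and $q\in\mathbb{Z}$ there is a canonical isomorphism $$\mathrm{H}^{p,q}_{ev}(R,M)\simeq\mathrm{H}^{p}(\pi_{2q}E_\bullet)$$ between the $(p,q)$-th even cohomology of $M$ and the cohomology, computed in the $p$-th spot, of the cochain complex $$\pi_{2q}E_0\to\pi_{2q}E_1\to\pi_{2q}E_2\to\cdots.$$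
   Context: An $\mathbf{E}_1$-ring is an $\mathbf{E}_1$-algebra in spectra; $R$-modules are left $R$-module spectra. An $R$-module is perfect even if it lies in the smallest full subcategory $\mathrm{Perf}(R)_{ev}\subseteq\mathrm{Mod}_R$ containing $\Sigma^{2k}R$ for all $k\in\mathbb{Z}$ and closed under extensions and retracts. A map in $\mathrm{Perf}(R)_{ev}$ is an even epimorphism if its fibre in $\mathrm{Mod}_R$ is perfect even; $\mathrm{Perf}(R)_{ev}$ carries the Grothendieck topology whose covering families are single even epimorphisms. For an $R$-module $M$ and $q\in\frac12\mathbb{Z}$, the even sheaf $\mathcal{F}_M(q)$ of weight $q$ is the sheafification of the presheaf of abelian groups $A\mapsto\pi_{2q}\mathrm{map}_{\mathrm{Mod}_R}(A,M)$ on $\mathrm{Perf}(R)_{ev}$; it is an additive sheaf. $M$ is homologically even if $\mathcal{F}_M(q)=0$ for all $q\in\frac12+\mathbb{Z}$. Even cohomology is sheaf cohomology $\mathrm{H}^{p,q}_{ev}(R,M):=\mathrm{H}^p_{\mathrm{Perf}(R)_{ev}}(R,\mathcal{F}_M(q))$, the right derived functors of sections over $R$ on the abelian category of additive sheaves of abelian groups. An $R$-module is even flat if it is a filtered colimit of perfect even $R$-modules. A map $N\to E$ of $R$-modules is a $\pi_*$-even envelope if (1) $\mathrm{cofib}(N\to E)$ is even flat; (2) $\pi_*E$ is concentrated in even degrees; (3) every map $N\to F$ of $R$-modules with $\pi_*F$ concentrated in even degrees factors, up to homotopy, through $N\to E$. *)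

(* Defs.v *)
From HB Require Import structures.
From mathcomp Require Import all_boot all_algebra.
From mathcomp Require Import boolp.
From Stdlib Require List.

Set Implicit Arguments.
Unset Strict Implicit.
Unset Printing Implicit Defensive.

Import GRing.Theory.
Local Open Scope ring_scope.

(** * Quotients *)

Record equivalence (T : Type) (e : T -> T -> Prop) : Prop := Equivalence {
  eqv_refl : forall x, e x x;
  eqv_sym : forall x y, e x y -> e y x;
  eqv_trans : forall x y z, e x y -> e y z -> e x z }.

Section Quotient.
Variables (T : Type) (e : T -> T -> Prop) (He : equivalence e).

Definition eqvb : rel {classic T} := fun x y => `[< e x y >].

Lemma eqvb_refl : reflexive eqvb.
Proof. by move=> x; apply/asboolP; apply: eqv_refl. Qed.

Lemma eqvb_sym : symmetric eqvb.
Proof. by move=> x y; apply/asboolP/asboolP; apply: eqv_sym. Qed.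

Lemma eqvb_trans : transitive eqvb.
Proof.
by move=> y x z /asboolP xy /asboolP yz; apply/asboolP; apply: eqv_trans xy yz.
Qed.

Definition eqvb_rel := EquivRel eqvb eqvb_refl eqvb_sym eqvb_trans.

Definition quot : Type := {eq_quot eqvb_rel}%qT.
Definition cls (x : T) : quot :=
  (\pi_({eq_quot eqvb_rel}) (x : {classic T}))%qT.
Definition rep (c : quot) : T := repr (c : {eq_quot eqvb_rel}%qT).

Lemma repK c : cls (rep c) = c.
Proof. exact: reprK. Qed.

Lemma clsP x y : cls x = cls y <-> e x y.
Proof.
split=> [/eqmodP /asboolP //|exy].
by apply/eqmodP; apply/asboolP.
Qed.

Lemma rep_cls x : e (rep (cls x)) x.
Proof. by apply/clsP; rewrite repK. Qed.

End Quotient.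

(** A type with operations satisfying the laws of an abelian group up to an
    equivalence relation, and the quotient group. *)
Record pregroup := PreGroup {
  pg_car :> Type;
  pg_eq : pg_car -> pg_car -> Prop;
  pg_eqv : equivalence pg_eq;
  pg0 : pg_car;
  pgN : pg_car -> pg_car;
  pgD : pg_car -> pg_car -> pg_car;
  pgN_cong : forall x x', pg_eq x x' -> pg_eq (pgN x) (pgN x');
  pgD_cong : forall x x' y y',
    pg_eq x x' -> pg_eq y y' -> pg_eq (pgD x y) (pgD x' y');
  pgDA : forall x y z, pg_eq (pgD x (pgD y z)) (pgD (pgD x y) z);
  pgDC : forall x y, pg_eq (pgD x y) (pgD y x);
  pg0D : forall x, pg_eq (pgD pg0 x) x;
  pgND : forall x, pg_eq (pgD (pgN x) x) pg0 }.

Section QuotientGroup.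
Variable G : pregroup.

Definition qgroup : Type := quot (pg_eqv G).
Definition qcls (x : G) : qgroup := cls (pg_eqv G) x.
Definition qrep (c : qgroup) : G := rep c.
Definition qzero : qgroup := qcls (pg0 G).
Definition qopp (a : qgroup) : qgroup := qcls (pgN (qrep a)).
Definition qadd (a b : qgroup) : qgroup := qcls (pgD (qrep a) (qrep b)).

Lemma qclsP x y : qcls x = qcls y <-> pg_eq x y.
Proof. exact: clsP. Qed.

Lemma qrepK c : qcls (qrep c) = c.
Proof. exact: repK. Qed.

Lemma qrep_cls x : pg_eq (qrep (qcls x)) x.
Proof. exact: rep_cls. Qed.

Lemma qaddE x y : qadd (qcls x) (qcls y) = qcls (pgD x y).
Proof. by apply/qclsP; apply: pgD_cong; apply: qrep_cls. Qed.

Lemma qoppE x : qopp (qcls x) = qcls (pgN x).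
Proof. by apply/qclsP; apply: pgN_cong; apply: qrep_cls. Qed.

Lemma qaddA : associative qadd.
Proof.
move=> a b c; rewrite -(qrepK a) -(qrepK b) -(qrepK c) !qaddE.
by apply/qclsP; apply: pgDA.
Qed.

Lemma qaddC : commutative qadd.
Proof.
by move=> a b; rewrite -(qrepK a) -(qrepK b) !qaddE; apply/qclsP/pgDC.
Qed.

Lemma qadd0 : left_id qzero qadd.
Proof. by move=> a; rewrite -(qrepK a) qaddE; apply/qclsP/pg0D. Qed.

Lemma qaddN : left_inverse qzero qopp qadd.
Proof. by move=> a; rewrite -(qrepK a) qoppE qaddE; apply/qclsP/pgND. Qed.

HB.instance Definition _ := gen_eqMixin qgroup.
HB.instance Definition _ := gen_choiceMixin qgroup.
HB.instance Definition _ :=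
  GRing.isZmodule.Build qgroup qaddA qaddC qadd0 qaddN.

Lemma qclsD x y : qcls (pgD x y) = (qcls x + qcls y)%R.
Proof. by rewrite -qaddE. Qed.

Lemma qclsN x : qcls (pgN x) = (- qcls x)%R.
Proof. by rewrite -qoppE. Qed.

End QuotientGroup.

Section QuotientGroupMap.
Variables (G H : pregroup) (f : G -> H).
Hypotheses (f_cong : forall x y, pg_eq x y -> pg_eq (f x) (f y))
  (fD : forall x y, f (pgD x y) = pgD (f x) (f y))
  (fN : forall x, f (pgN x) = pgN (f x)).

Definition qmap_fun (a : qgroup G) : qgroup H := qcls (f (qrep a)).

Lemma qmap_funE x : qmap_fun (qcls x) = qcls (f x).
Proof. by apply/qclsP/f_cong/qrep_cls. Qed.

Lemma qmap_fun_is_zmod_morphism : zmod_morphism qmap_fun.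
Proof.
move=> a b; rewrite -(qrepK a) -(qrepK b) -qclsN -qclsD !qmap_funE fD fN.
by rewrite qclsD qclsN.
Qed.

Definition qmap : {additive qgroup G -> qgroup H} :=
  HB.pack qmap_fun
    (GRing.isZmodMorphism.Build _ _ qmap_fun qmap_fun_is_zmod_morphism).

Lemma qmapE x : qmap (qcls x) = qcls (f x).
Proof. exact: qmap_funE. Qed.

End QuotientGroupMap.

(** * Categories *)

Record category := Category {
  obj :> Type;
  mor : obj -> obj -> Type;
  idc : forall A, mor A A;
  compm : forall A B C, mor B C -> mor A B -> mor A C;
  compA : forall A B C D (h : mor C D) (g : mor B C) (f : mor A B),
    compm h (compm g f) = compm (compm h g) f;
  comp1f : forall A B (f : mor A B), compm (idc B) f = f;
  compf1 : forall A B (f : mor A B), compm f (idc A) = f }.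

Arguments mor {c} A B.
Arguments idc {c} A.
Notation "g \oc f" := (compm g f) (at level 50, left associativity).

Definition is_iso (C : category) (A B : C) (f : mor A B) : Prop :=
  exists g : mor B A, g \oc f = idc A /\ f \oc g = idc B.

Definition isomorphic (C : category) (A B : C) : Prop :=
  exists f : mor A B, is_iso f.

Record functor (C D : category) := Functor {
  fobj :> C -> D;
  fmap : forall A B, mor A B -> mor (fobj A) (fobj B);
  fmap1 : forall A, fmap (idc A) = idc (fobj A);
  fmapM : forall A B X (g : mor B X) (f : mor A B),
    fmap (g \oc f) = fmap g \oc fmap f }.

Section FullSubcategory.
Variables (C : category) (P : C -> Prop).

Definition full_subcategory : category :=
  @Category {A : C | P A} (fun A B => mor (sval A) (sval B))
    (fun A => idc (sval A)) (fun A B X g f => g \oc f)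
    (fun A B X D h g f => compA h g f) (fun A B f => comp1f f)
    (fun A B f => compf1 f).

End FullSubcategory.

Record filtered (J : category) : Prop := Filtered {
  filtered_obj : exists j : J, True;
  filtered_join : forall j k : J,
    exists (l : J) (f : mor j l) (g : mor k l), True;
  filtered_coeq : forall (j k : J) (f g : mor j k),
    exists (l : J) (h : mor k l), h \oc f = h \oc g }.

Section Biproduct.
Variable C : category.

Definition is_zero_obj (Z : C) : Prop :=
  forall A : C, (exists! f : mor A Z, True) /\ (exists! f : mor Z A, True).

Definition is_zero_hom (A B : C) (f : mor A B) : Prop :=
  exists Z : C, is_zero_obj Z /\
    exists (g : mor Z B) (h : mor A Z), f = g \oc h.

Record biproduct (X Y P : C) (i1 : mor X P) (i2 : mor Y P)
    (p1 : mor P X) (p2 : mor P Y) : Prop := Biproduct {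
  biprod11 : p1 \oc i1 = idc X;
  biprod22 : p2 \oc i2 = idc Y;
  biprod12 : is_zero_hom (p1 \oc i2);
  biprod21 : is_zero_hom (p2 \oc i1);
  biprod_prod : forall (A : C) (f : mor A X) (g : mor A Y),
    exists! u : mor A P, p1 \oc u = f /\ p2 \oc u = g;
  biprod_coprod : forall (A : C) (f : mor X A) (g : mor Y A),
    exists! v : mor P A, v \oc i1 = f /\ v \oc i2 = g }.

End Biproduct.

(** The hom groups of an additive category.

    Addition of parallel maps [f, g : A -> B] in an additive category is not
    extra structure: it is the composite of [(f, g) : A -> B (+) B] with the
    codiagonal.  [add_hom A B] is the abelian group generated by the maps
    [A -> B], with a relation
      [v u] = [v i1 p1 u] + [v i2 p2 u]
    for each factorisation [A -u-> X (+) Y -v-> B] through a biproduct.  The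
    case [X = Y = B], [v] the codiagonal, is [f + g] = [f] + [g]; conversely
    all the relations hold for the addition of an additive category, so that
    for additive [C] the map [f |-> gen f] is a bijection from [mor A B] onto
    [add_hom A B].  Presenting the group makes the group laws hold by
    construction, without a prior proof that [C] is additive. *)
Section AddHom.
Variable C : category.

Inductive hterm (A B : C) : Type :=
| hgen of mor A B
| hzero
| hopp of hterm A B
| hadd of hterm A B & hterm A B.

Arguments hzero {A B}.

Inductive heq (A B : C) : hterm A B -> hterm A B -> Prop :=
| heq_refl x : heq x x
| heq_sym x y : heq x y -> heq y x
| heq_trans x y z : heq x y -> heq y z -> heq x z
| heq_opp x x' : heq x x' -> heq (hopp x) (hopp x')
| heq_add x x' y y' : heq x x' -> heq y y' -> heq (hadd x y) (hadd x' y')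
| heq_addA x y z : heq (hadd x (hadd y z)) (hadd (hadd x y) z)
| heq_addC x y : heq (hadd x y) (hadd y x)
| heq_add0 x : heq (hadd hzero x) x
| heq_addN x : heq (hadd (hopp x) x) hzero
| heq_biprod (X Y P : C) i1 i2 p1 p2 (u : mor A P) (v : mor P B) :
    @biproduct C X Y P i1 i2 p1 p2 ->
    heq (hgen (v \oc u))
        (hadd (hgen (v \oc i1 \oc p1 \oc u)) (hgen (v \oc i2 \oc p2 \oc u))).

Lemma heq_equivalence A B : equivalence (@heq A B).
Proof. by split; [apply: heq_refl|apply: heq_sym|apply: heq_trans]. Qed.

Definition hterm_pregroup (A B : C) : pregroup :=
  @PreGroup (hterm A B) (@heq A B) (heq_equivalence A B) hzero
    (@hopp A B) (@hadd A B) (@heq_opp A B) (@heq_add A B) (@heq_addA A B)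
    (@heq_addC A B) (@heq_add0 A B) (@heq_addN A B).

Definition add_hom (A B : C) : zmodType := qgroup (hterm_pregroup A B).

Definition gen (A B : C) (f : mor A B) : add_hom A B :=
  qcls (hgen f : hterm_pregroup A B).

Fixpoint hterm_map (A B A' B' : C) (F : mor A B -> mor A' B')
    (x : hterm A B) : hterm A' B' :=
  match x with
  | hgen f => hgen (F f)
  | hzero => hzero
  | hopp y => hopp (hterm_map F y)
  | hadd y z => hadd (hterm_map F y) (hterm_map F z)
  end.

Lemma hterm_map_heq (A B A' B' : C) (g : mor B B') (f : mor A' A)
    (x y : hterm A B) : heq x y ->
  heq (hterm_map (fun h => g \oc h \oc f) x)
      (hterm_map (fun h => g \oc h \oc f) y).
Proof.
elim=> {x y} /=.
- by move=> x; apply: heq_refl.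
- by move=> x y _; apply: heq_sym.
- by move=> x y z _ xy _; apply: heq_trans.
- by move=> x x' _; apply: heq_opp.
- by move=> x x' y y' _ xx' _; apply: heq_add.
- by move=> x y z; apply: heq_addA.
- by move=> x y; apply: heq_addC.
- by move=> x; apply: heq_add0.
- by move=> x; apply: heq_addN.
move=> X Y P i1 i2 p1 p2 u v bP.
have := @heq_biprod _ _ X Y P i1 i2 p1 p2 (u \oc f) (g \oc v) bP.
by rewrite !compA.
Qed.

(** Composition [h |-> g \oc h \oc f] as a homomorphism. *)
Definition add_hom_map (A B A' B' : C) (g : mor B B') (f : mor A' A) :
    {additive add_hom A B -> add_hom A' B'} :=
  @qmap (hterm_pregroup A B) (hterm_pregroup A' B')
    (hterm_map (fun h => g \oc h \oc f)) (@hterm_map_heq A B A' B' g f)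
    (fun _ _ => erefl) (fun _ => erefl).

Lemma add_hom_mapE (A B A' B' : C) (g : mor B B') (f : mor A' A)
    (h : mor A B) : add_hom_map g f (gen h) = gen (g \oc h \oc f).
Proof. exact: qmapE. Qed.

Lemma add_hom_map1 (A B : C) (x : add_hom A B) :
  add_hom_map (idc B) (idc A) x = x.
Proof.
rewrite -(qrepK x) [LHS]qmapE; congr (qcls _).
by elim: (qrep x) => //= [h|y ->|y -> z ->] //; rewrite comp1f compf1.
Qed.

Lemma add_hom_mapM (A B A' B' A'' B'' : C) (g : mor B B') (f : mor A' A)
    (g' : mor B' B'') (f' : mor A'' A') (x : add_hom A B) :
  add_hom_map (g' \oc g) (f \oc f') x = add_hom_map g' f' (add_hom_map g f x).
Proof.
rewrite -(qrepK x) [LHS]qmapE [add_hom_map g f _]qmapE [RHS]qmapE.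
congr (qcls _).
by elim: (qrep x) => //= [h|y ->|y -> z ->] //; rewrite !compA.
Qed.

End AddHom.

(** * Localization of a category at a class of morphisms *)

Section Localization.
Variables (C : category) (W : forall A B : C, mor A B -> Prop).

Inductive zigzag : C -> C -> Type :=
| znil A : zigzag A A
| zfwd A B X (f : mor A B) (z : zigzag B X) : zigzag A X
| zbwd A B X (w : mor B A) (Ww : W w) (z : zigzag B X) : zigzag A X.

Inductive zeq : forall A B, zigzag A B -> zigzag A B -> Prop :=
| zeq_refl A B (z : zigzag A B) : zeq z z
| zeq_sym A B (y z : zigzag A B) : zeq y z -> zeq z y
| zeq_trans A B (x y z : zigzag A B) : zeq x y -> zeq y z -> zeq x z
| zeq_fwd A B X (f : mor A B) (y z : zigzag B X) :
    zeq y z -> zeq (zfwd f y) (zfwd f z)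
| zeq_bwd A B X (w : mor B A) (Ww : W w) (y z : zigzag B X) :
    zeq y z -> zeq (zbwd Ww y) (zbwd Ww z)
| zeq_id A X (z : zigzag A X) : zeq (zfwd (idc A) z) z
| zeq_comp A B D X (f : mor A B) (g : mor B D) (z : zigzag D X) :
    zeq (zfwd f (zfwd g z)) (zfwd (g \oc f) z)
| zeq_fwd_bwd A B X (w : mor A B) (Ww : W w) (z : zigzag A X) :
    zeq (zfwd w (zbwd Ww z)) z
| zeq_bwd_fwd A B X (w : mor B A) (Ww : W w) (z : zigzag A X) :
    zeq (zbwd Ww (zfwd w z)) z.

Lemma zeq_equivalence A B : equivalence (@zeq A B).
Proof. by split; [apply: zeq_refl|apply: zeq_sym|apply: zeq_trans]. Qed.

Fixpoint zcat A B X (y : zigzag A B) : zigzag B X -> zigzag A X :=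
  match y with
  | znil _ => fun z => z
  | zfwd _ _ _ f y' => fun z => zfwd f (zcat y' z)
  | zbwd _ _ _ w Ww y' => fun z => zbwd Ww (zcat y' z)
  end.

Lemma zcat_nil A B (y : zigzag A B) : zcat y (znil B) = y.
Proof. by elim: y => //= [? ? ? ? ? ->|? ? ? ? ? ? ->]. Qed.

Lemma zcatA A B X Y (x : zigzag A B) (y : zigzag B X) (z : zigzag X Y) :
  zcat (zcat x y) z = zcat x (zcat y z).
Proof.
by elim: x y => //= [? ? ? ? ? IH|? ? ? ? ? ? IH] y; rewrite IH.
Qed.

Lemma zcat_zeqr A B X (y : zigzag A B) (z z' : zigzag B X) :
  zeq z z' -> zeq (zcat y z) (zcat y z').
Proof.
by elim: y z z' => //= [? ? ? ? ? IH|? ? ? ? ? ? IH] z z' zz';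
  [apply: zeq_fwd|apply: zeq_bwd]; apply: IH.
Qed.

Lemma zcat_zeql A B X (y y' : zigzag A B) (z : zigzag B X) :
  zeq y y' -> zeq (zcat y z) (zcat y' z).
Proof.
move=> yy'; elim: yy' z => {A B y y'} /=.
- by move=> *; apply: zeq_refl.
- by move=> ? ? ? ? _ IH z; apply: zeq_sym.
- by move=> ? ? ? ? ? _ IH1 _ IH2 z; apply: zeq_trans (IH1 z) (IH2 z).
- by move=> ? ? ? ? ? ? _ IH z; apply: zeq_fwd.
- by move=> ? ? ? ? ? ? ? _ IH z; apply: zeq_bwd.
- by move=> *; apply: zeq_id.
- by move=> *; apply: zeq_comp.
- by move=> *; apply: zeq_fwd_bwd.
- by move=> *; apply: zeq_bwd_fwd.
Qed.

Definition lhom (A B : C) : Type := quot (zeq_equivalence A B).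
Definition lcls A B (z : zigzag A B) : lhom A B := cls (zeq_equivalence A B) z.
Definition lcomp A B X (g : lhom B X) (f : lhom A B) : lhom A X :=
  lcls (zcat (rep f) (rep g)).

Lemma lcompE A B X (z : zigzag B X) (y : zigzag A B) :
  lcomp (lcls z) (lcls y) = lcls (zcat y z).
Proof.
apply/clsP; apply: (@zeq_trans _ _ _ (zcat y (rep (lcls z)))).
  by apply: zcat_zeql; apply: (rep_cls (zeq_equivalence A B)).
by apply: zcat_zeqr; apply: (rep_cls (zeq_equivalence B X)).
Qed.

Lemma lcompA A B X Y (h : lhom X Y) (g : lhom B X) (f : lhom A B) :
  lcomp h (lcomp g f) = lcomp (lcomp h g) f.
Proof.
rewrite -(repK h) -(repK g) -(repK f) -!/(lcls _).
by rewrite !lcompE zcatA.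
Qed.

Lemma lcomp1f A B (f : lhom A B) : lcomp (lcls (znil B)) f = f.
Proof. by rewrite -(repK f) -/(lcls _) lcompE zcat_nil. Qed.

Lemma lcompf1 A B (f : lhom A B) : lcomp f (lcls (znil A)) = f.
Proof. by rewrite -(repK f) -/(lcls _) lcompE. Qed.

Definition localization : category :=
  @Category C lhom (fun A => lcls (znil A)) lcomp lcompA lcomp1f lcompf1.

Definition loc_hom (A B : C) (f : mor A B) :
    @mor localization A B := lcls (zfwd f (znil B)).

End Localization.

(** A functor preserving the class [W] induces a functor on localizations. *)
Section LocalizedFunctor.
Variables (C : category) (W : forall A B : C, mor A B -> Prop).
Variable F : functor C C.
Hypothesis FW : forall (A B : C) (f : mor A B), W f -> W (fmap F f).

Fixpoint zmap A B (z : zigzag W A B) : zigzag W (F A) (F B) :=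
  match z with
  | znil A => znil W (F A)
  | zfwd _ _ _ f z' => zfwd (fmap F f) (zmap z')
  | zbwd _ _ _ w Ww z' => zbwd (FW Ww) (zmap z')
  end.

Lemma zmap_zeq A B (y z : zigzag W A B) : zeq y z -> zeq (zmap y) (zmap z).
Proof.
elim=> {A B y z} /=.
- by move=> *; apply: zeq_refl.
- by move=> ? ? ? ? _; apply: zeq_sym.
- by move=> ? ? ? ? ? _ IH1 _; apply: zeq_trans.
- by move=> ? ? ? ? ? ? _; apply: zeq_fwd.
- by move=> ? ? ? ? ? ? ? _; apply: zeq_bwd.
- by move=> *; rewrite fmap1; apply: zeq_id.
- by move=> *; rewrite fmapM; apply: zeq_comp.
- by move=> *; apply: zeq_fwd_bwd.
- by move=> *; apply: zeq_bwd_fwd.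
Qed.

Lemma zmap_cat A B X (y : zigzag W A B) (z : zigzag W B X) :
  zmap (zcat y z) = zcat (zmap y) (zmap z).
Proof.
by elim: y z => //= [? ? ? ? ? IH|? ? ? ? ? ? IH] z; rewrite IH.
Qed.

Definition lmap A B (f : lhom W A B) : lhom W (F A) (F B) :=
  lcls (zmap (rep f)).

Lemma lmapE A B (z : zigzag W A B) : lmap (lcls z) = lcls (zmap z).
Proof.
by apply/clsP; apply: zmap_zeq; apply: (rep_cls (zeq_equivalence W A B)).
Qed.

Lemma lmapM A B X (g : lhom W B X) (f : lhom W A B) :
  lmap (lcomp g f) = lcomp (lmap g) (lmap f).
Proof.
rewrite -(repK g) -(repK f) -!/(lcls _).
by rewrite lcompE !lmapE lcompE zmap_cat.
Qed.

Definition loc_functor : functor (localization W) (localization W) :=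
  @Functor (localization W) (localization W) F lmap
    (fun A => lmapE (znil W A)) lmapM.

End LocalizedFunctor.

Section IterFunctor.
Variables (C : category) (F : functor C C).

Fixpoint iter_fmap k (A B : C) (f : mor A B) :
    mor (iter k F A) (iter k F B) :=
  match k with
  | 0 => f
  | k'.+1 => fmap F (iter_fmap k' f)
  end.

Lemma iter_fmap1 k (A : C) : iter_fmap k (idc A) = idc (iter k F A).
Proof. by elim: k => //= k ->; rewrite fmap1. Qed.

Lemma iter_fmapM k (A B X : C) (g : mor B X) (f : mor A B) :
  iter_fmap k (g \oc f) = iter_fmap k g \oc iter_fmap k f.
Proof. by elim: k => //= k ->; rewrite fmapM. Qed.

End IterFunctor.

(** * Pointed simplicial sets *)

(** The ordinal [n] = {0 < ... < n} (a [Set]: ['I_n.+1] would raise the universe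
    of loop spaces above that of the simplicial sets themselves). *)
Definition simp (n : nat) : Set := {i : nat | (i <= n)%N}.

Record ordmap (m n : nat) : Set := OrdMap {
  om :> simp m -> simp n;
  om_mono : forall i j : simp m,
    (sval i <= sval j)%N -> (sval (om i) <= sval (om j))%N }.

Definition om_id n : ordmap n n := @OrdMap n n id (fun _ _ le_ij => le_ij).

Definition om_comp k m n (b : ordmap m n) (a : ordmap k m) : ordmap k n :=
  @OrdMap k n (fun i => b (a i))
    (fun i j le_ij => om_mono b (om_mono a le_ij)).

Definition vertex0 n : simp n := exist _ 0%N (leq0n n).

Definition to0 n : ordmap n 0 :=
  @OrdMap n 0 (fun _ => vertex0 0) (fun _ _ _ => leqnn 0).

Lemma coface_proof n i (j : simp n) : (bump i (sval j) <= n.+1)%N.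
Proof.
by rewrite /bump; case: (i <= _)%N; rewrite ?add1n ?ltnS ?leqW ?(valP j).
Qed.

Lemma coface_mono n i (j k : simp n) :
  (sval j <= sval k)%N -> (bump i (sval j) <= bump i (sval k))%N.
Proof. by rewrite leq_bump2. Qed.

Definition coface n (i : nat) : ordmap n n.+1 :=
  @OrdMap n n.+1 (fun j => exist _ (bump i (sval j)) (coface_proof i j))
    (@coface_mono n i).

Record psset := PSSet {
  car :> nat -> Type;
  sact : forall m n, ordmap m n -> car n -> car m;
  act_id : forall n (a : ordmap n n) (x : car n),
    (forall i, a i = i) -> sact a x = x;
  act_comp : forall k m n (a : ordmap k m) (b : ordmap m n) (c : ordmap k n)
    (x : car n), (forall i, c i = b (a i)) -> sact c x = sact a (sact b x);
  bpt : forall n, car n;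
  act_bpt : forall m n (a : ordmap m n), sact a (bpt n) = bpt m }.

Arguments bpt {p} n.

(** A horn missing the [k]-th face is given by its faces [x i],
    [i <= n + 1], [i <> k], that agree on common subsimplices. *)
Definition is_horn (X : psset) n (k : nat) (x : nat -> X n) : Prop :=
  forall i j m (a b : ordmap m n),
    (i <= n.+1)%N -> i <> k -> (j <= n.+1)%N -> j <> k ->
    (forall l, coface n i (a l) = coface n j (b l)) ->
    sact a (x i) = sact b (x j).

Definition kan_complex (X : psset) : Prop :=
  forall n k (x : nat -> X n), (k <= n.+1)%N -> is_horn k x ->
    exists z : X n.+1,
      forall i, (i <= n.+1)%N -> i <> k -> sact (coface n i) z = x i.

Definition kan_fibration (X Y : psset) (f : forall n, X n -> Y n) : Prop :=
  forall n k (x : nat -> X n) (y : Y n.+1), (k <= n.+1)%N -> is_horn k x ->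
    (forall i, (i <= n.+1)%N -> i <> k -> sact (coface n i) y = f n (x i)) ->
    exists z : X n.+1,
      (forall i, (i <= n.+1)%N -> i <> k -> sact (coface n i) z = x i) /\
      f n.+1 z = y.

(** Simplices of dimension [n] whose boundary is constant at the vertex [v];
    modulo [homotopic], these form [pi_n (X, v)] when [X] is a Kan complex. *)
Definition sphere (X : psset) n (v : X 0) (s : X n) : Prop :=
  forall m (a : ordmap m n), ~ (forall j, exists i, a i = j) ->
    sact a s = sact (to0 m) v.

Definition homotopic (X : psset) n (v : X 0) (s t : X n) : Prop :=
  exists z : X n.+1,
    [/\ forall i, (i < n)%N -> sact (coface n i) z = sact (to0 n) v,
        sact (coface n n) z = s & sact (coface n n.+1) z = t].

(** Isomorphism on homotopy groups at all base points, for Kan complexes. *)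
Definition weak_equiv (X Y : psset) (f : forall n, X n -> Y n) : Prop :=
  forall n (v : X 0),
    (forall t : Y n, sphere (f 0 v) t ->
       exists s : X n, sphere v s /\ homotopic (f 0 v) (f n s) t) /\
    (forall s s' : X n, sphere v s -> sphere v s' ->
       homotopic (f 0 v) (f n s) (f n s') -> homotopic v s s').

(** [n]-simplices of the loop space: maps [Delta^n x Delta^1 -> X] that are
    constant at the base point on [Delta^n x boundary Delta^1]. *)
Record loop (X : psset) (n : nat) := Loop {
  lp : forall k, ordmap k n -> ordmap k 1 -> X k;
  lp_act : forall k l (c : ordmap k l) (a : ordmap l n) (t : ordmap l 1)
    (a' : ordmap k n) (t' : ordmap k 1),
    (forall i, a' i = a (c i)) -> (forall i, t' i = t (c i)) ->
    lp a' t' = sact c (lp a t);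
  lp_end : forall k (a : ordmap k n) (t : ordmap k 1),
    (forall i j, t i = t j) -> lp a t = bpt k }.

Lemma loop_eq (X : psset) n (x y : loop X n) :
  (forall k (a : ordmap k n) (t : ordmap k 1), lp x a t = lp y a t) -> x = y.
Proof.
case: x => f f1 f2; case: y => g g1 g2 /= fg.
have {}fg : f = g.
  apply/functional_extensionality_dep => k; apply/funext => a.
  by apply/funext => t; apply: fg.
by case: g / fg g1 g2 => g1 g2; congr Loop; apply: Prop_irrelevance.
Qed.

Lemma lp_ext (X : psset) n (x : loop X n) k (a a' : ordmap k n)
    (t t' : ordmap k 1) :
  (forall i, a' i = a i) -> (forall i, t' i = t i) -> lp x a' t' = lp x a t.
Proof.
move=> aa' tt'; rewrite (lp_act (c := om_id k) x (a := a) (t := t)) //.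
exact: act_id.
Qed.

Section LoopSpace.
Variable X : psset.

Definition loop_act m n (b : ordmap m n) (x : loop X n) : loop X m.
Proof.
apply: (@Loop X m (fun k a t => lp x (om_comp b a) t)).
- by move=> k l c a t a' t' aa' tt'; apply: lp_act => //= i; rewrite aa'.
- by move=> k a t tc; apply: lp_end.
Defined.

Definition loop_bpt n : loop X n.
Proof.
apply: (@Loop X n (fun k _ _ => bpt k)) => //.
by move=> k l c *; rewrite act_bpt.
Defined.

Lemma loop_act_id n (a : ordmap n n) (x : loop X n) :
  (forall i, a i = i) -> loop_act a x = x.
Proof. by move=> aE; apply: loop_eq => k b t /=; apply: lp_ext => //= i. Qed.

Lemma loop_act_comp k m n (a : ordmap k m) (b : ordmap m n) (c : ordmap k n)
    (x : loop X n) :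
  (forall i, c i = b (a i)) -> loop_act c x = loop_act a (loop_act b x).
Proof.
by move=> cE; apply: loop_eq => l d t /=; apply: lp_ext => //= i.
Qed.

Lemma loop_act_bpt m n (a : ordmap m n) :
  loop_act a (loop_bpt n) = loop_bpt m.
Proof. exact: loop_eq. Qed.

Definition loop_space : psset :=
  @PSSet (loop X) loop_act loop_act_id loop_act_comp loop_bpt loop_act_bpt.

End LoopSpace.

(** * Symmetric ring spectra and their modules

    The levels of a symmetric spectrum are indexed by finite sets and the
    symmetric group actions by functoriality in bijections; the level [n] of
    the usual indexing is the value at a set with [n] elements. *)

Record finite_set := FiniteSet {
  fs_car :> Set;
  fs_fin : exists s : seq fs_car, forall a, List.In a s }.

Lemma fs_sum_fin (A B : finite_set) :
  exists s : seq (A + B), forall x, List.In x s.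
Proof.
case: (fs_fin A) => s sA; case: (fs_fin B) => t tB.
exists (List.app (List.map inl s) (List.map inr t)) => x.
apply: List.in_or_app; case: x => [a|b].
  by left; apply: List.in_map.
by right; apply: List.in_map.
Qed.

Definition fs_sum (A B : finite_set) : finite_set :=
  FiniteSet (fs_sum_fin A B).

Lemma fs_void_fin : exists s : seq Empty_set, forall x, List.In x s.
Proof. by exists nil; case. Qed.

Lemma fs_unit_fin : exists s : seq unit, forall x, List.In x s.
Proof. by exists [:: tt]; case; left. Qed.

Definition fs_void : finite_set := FiniteSet fs_void_fin.
Definition fs_unit : finite_set := FiniteSet fs_unit_fin.

Record bij (A B : finite_set) : Set := Bij {
  bf :> A -> B;
  binv : B -> A;
  bfK : cancel bf binv;
  binvK : cancel binv bf }.

Definition bij_id A : bij A A :=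
  @Bij A A id id (fun _ => erefl) (fun _ => erefl).

Definition bij_inv A B (f : bij A B) : bij B A :=
  Bij (@binvK _ _ f) (@bfK _ _ f).

Definition bij_comp A B C (g : bij B C) (f : bij A B) : bij A C :=
  Bij (can_comp (@bfK _ _ g) (@bfK _ _ f))
      (can_comp (@binvK _ _ f) (@binvK _ _ g)).

Definition sum_map (A A' B B' : Set) (f : A -> A') (g : B -> B') (x : A + B) :
    A' + B' :=
  match x with inl a => inl (f a) | inr b => inr (g b) end.

Definition bij_sum A A' B B' (f : bij A A') (g : bij B B') :
  bij (fs_sum A B) (fs_sum A' B').
Proof.
by refine (@Bij (fs_sum A B) (fs_sum A' B') (sum_map f g)
    (sum_map (binv f) (binv g)) _ _);
  case=> x /=; rewrite ?bfK ?binvK.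
Defined.

Definition bij_sumA A B C :
  bij (fs_sum (fs_sum A B) C) (fs_sum A (fs_sum B C)).
Proof.
refine (@Bij (fs_sum (fs_sum A B) C) (fs_sum A (fs_sum B C))
  (fun x => match x with
     | inl (inl a) => inl a | inl (inr b) => inr (inl b) | inr c => inr (inr c)
     end)
  (fun x => match x with
     | inl a => inl (inl a) | inr (inl b) => inl (inr b) | inr (inr c) => inr c
     end) _ _); [by case=> [[]|]|by case=> [|[]]].
Defined.

Definition bij_sum0l A : bij (fs_sum fs_void A) A.
Proof.
refine (@Bij (fs_sum fs_void A) A
  (fun x => match x with inl e => match e with end | inr a => a end) inr _ _).
  by case=> [[]|].
by [].
Defined.

Definition bij_sum0r A : bij (fs_sum A fs_void) A.
Proof.
refine (@Bij (fs_sum A fs_void) A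
  (fun x => match x with inl a => a | inr e => match e with end end) inl _ _).
  by case=> [|[]].
by [].
Defined.

Definition bij_sumC A B : bij (fs_sum A B) (fs_sum B A).
Proof.
by refine (@Bij (fs_sum A B) (fs_sum B A)
  (fun x => match x with inl a => inr a | inr b => inl b end)
  (fun x => match x with inl a => inr a | inr b => inl b end) _ _); case.
Defined.

Record symseq := SymSeq {
  lev :> finite_set -> psset;
  tr : forall A B : finite_set, bij A B -> forall n, lev A n -> lev B n;
  tr_act : forall (A B : finite_set) (f : bij A B) m n (a : ordmap m n)
    (x : lev A n), tr f (sact a x) = sact a (tr f x);
  tr_bpt : forall (A B : finite_set) (f : bij A B) n,
    tr f (bpt n) = bpt n :> lev B n;
  tr_id : forall (A : finite_set) (f : bij A A) n (x : lev A n),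
    (forall a, f a = a) -> tr f x = x;
  tr_comp : forall (A B C : finite_set) (f : bij A B) (g : bij B C)
    (h : bij A C) n (x : lev A n),
    (forall a, h a = g (f a)) -> tr h x = tr g (tr f x) }.

Lemma tr_tr (X : symseq) (A B C : finite_set) (f : bij A B) (g : bij B C) n
    (x : X A n) : tr g (tr f x) = tr (bij_comp g f) x.
Proof. by symmetry; apply: tr_comp. Qed.

Lemma tr_ext (X : symseq) (A B : finite_set) (f g : bij A B) n (x : X A n) :
  (forall a, f a = g a) -> tr f x = tr g x.
Proof. by move=> fg; rewrite (tr_comp (f := g) (g := bij_id B)) // tr_id. Qed.

(** Multiplications [R_A /\ R_B -> R_(A + B)], unit maps [S^0 -> R_0] (a
    vertex) and [S^1 = Delta^1 / boundary -> R_1] (an edge with trivial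
    endpoints), subject to associativity, unitality and centrality. *)
Record symmetric_ring_spectrum := SymRing {
  rseq :> symseq;
  rmul : forall (A B : finite_set) n,
    rseq A n -> rseq B n -> rseq (fs_sum A B) n;
  rmul_act : forall (A B : finite_set) m n (a : ordmap m n)
    (x : rseq A n) (y : rseq B n),
    rmul (sact a x) (sact a y) = sact a (rmul x y);
  rmul_tr : forall (A A' B B' : finite_set) (f : bij A A') (g : bij B B') n
    (x : rseq A n) (y : rseq B n),
    rmul (tr f x) (tr g y) = tr (bij_sum f g) (rmul x y);
  rmul_bptl : forall (A B : finite_set) n (y : rseq B n),
    rmul (bpt n : rseq A n) y = bpt n;
  rmul_bptr : forall (A B : finite_set) n (x : rseq A n),
    rmul x (bpt n : rseq B n) = bpt n;
  rmulA : forall (A B C : finite_set) n (x : rseq A n) (y : rseq B n)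
    (z : rseq C n),
    tr (bij_sumA A B C) (rmul (rmul x y) z) = rmul x (rmul y z);
  rone : rseq fs_void 0;
  rmul1l : forall (A : finite_set) n (x : rseq A n),
    tr (bij_sum0l A) (rmul (sact (to0 n) rone) x) = x;
  rmul1r : forall (A : finite_set) n (x : rseq A n),
    tr (bij_sum0r A) (rmul x (sact (to0 n) rone)) = x;
  rsusp : rseq fs_unit 1;
  rsusp_end : forall v : ordmap 0 1, sact v rsusp = bpt 0;
  rsusp_central : forall (A : finite_set) n (t : ordmap n 1) (x : rseq A n),
    tr (bij_sumC fs_unit A) (rmul (sact t rsusp) x) = rmul x (sact t rsusp) }.

Section Modules.
Variable R : symmetric_ring_spectrum.

Record premodule := PreModule {
  mseq :> symseq;
  smul : forall (A B : finite_set) n, R A n -> mseq B n -> mseq (fs_sum A B) n;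
  smul_act : forall (A B : finite_set) m n (a : ordmap m n)
    (r : R A n) (x : mseq B n),
    smul (sact a r) (sact a x) = sact a (smul r x);
  smul_tr : forall (A A' B B' : finite_set) (f : bij A A') (g : bij B B') n
    (r : R A n) (x : mseq B n),
    smul (tr f r) (tr g x) = tr (bij_sum f g) (smul r x);
  smul_bptl : forall (A B : finite_set) n (x : mseq B n),
    smul (bpt n : R A n) x = bpt n;
  smul_bptr : forall (A B : finite_set) n (r : R A n),
    smul r (bpt n : mseq B n) = bpt n;
  smulA : forall (A B C : finite_set) n (r : R A n) (s : R B n) (x : mseq C n),
    tr (bij_sumA A B C) (smul (rmul r s) x) = smul r (smul s x);
  smul1 : forall (A : finite_set) n (x : mseq A n),
    tr (bij_sum0l A) (smul (sact (to0 n) (rone R)) x) = x }.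

Lemma rsusp_const n (t : ordmap n 1) :
  (forall i j, t i = t j) -> sact t (rsusp R) = bpt n.
Proof.
move=> tc; 
  pose v := @OrdMap 0 1 (fun _ => t (vertex0 n)) (fun _ _ _ => leqnn _).
rewrite (act_comp (a := to0 n) (b := v)) ?rsusp_end ?act_bpt //.
by move=> i; apply: tc.
Qed.

(** The adjoint structure map [M_B -> Omega M_(1 + B)], followed by the
    isomorphism to [Omega M_C] given by a bijection [1 + B = C]. *)
Definition adjoint (M : premodule) (B C : finite_set)
    (e : bij (fs_sum fs_unit B) C) n (x : M B n) : loop_space (M C) n.
Proof.
apply: (@Loop (M C) n
  (fun k a t => tr e (smul (sact t (rsusp R)) (sact a x)))).
- move=> k l c a t a' t' aa' tt'; rewrite -tr_act -smul_act.
  by rewrite -(act_comp _ tt') -(act_comp _ aa').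
- by move=> k a t tc; rewrite rsusp_const // smul_bptl tr_bpt.
Defined.

(** Omega-spectra with Kan levels: the fibrant objects of the (projective)
    stable model structure on [R]-modules.  Between them the stable
    equivalences are the levelwise weak equivalences. *)
Record fibrant (M : premodule) : Prop := Fibrant {
  fib_kan : forall A : finite_set, kan_complex (M A);
  fib_omega : forall (B C : finite_set) (e : bij (fs_sum fs_unit B) C),
    weak_equiv (@adjoint M B C e) }.

Record module := Module {
  mpre :> premodule;
  mfib : fibrant mpre }.

Record module_map (M N : module) := ModuleMap {
  mm :> forall (A : finite_set) n, M A n -> N A n;
  mm_act : forall (A : finite_set) m n (a : ordmap m n) (x : M A n),
    mm (sact a x) = sact a (mm x);
  mm_bpt : forall (A : finite_set) n, @mm A n (bpt n) = bpt n;
  mm_tr : forall (A B : finite_set) (f : bij A B) n (x : M A n),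
    mm (tr f x) = tr f (mm x);
  mm_smul : forall (A B : finite_set) n (r : R A n) (x : M B n),
    mm (smul r x) = smul r (mm x) }.

Lemma module_map_eq M N (f g : module_map M N) :
  (forall A n (x : M A n), f A n x = g A n x) -> f = g.
Proof.
case: f => f f1 f2 f3 f4; case: g => g g1 g2 g3 g4 /= fg.
have {}fg : f = g.
  apply/functional_extensionality_dep => A.
  by apply/functional_extensionality_dep => n; apply/funext => x; apply: fg.
by case: g / fg g1 g2 g3 g4 => g1 g2 g3 g4;
  congr ModuleMap; apply: Prop_irrelevance.
Qed.

Definition mm_id M : module_map M M :=
  @ModuleMap M M (fun _ _ x => x) (fun _ _ _ _ _ => erefl) (fun _ _ => erefl)
    (fun _ _ _ _ _ => erefl) (fun _ _ _ _ _ => erefl).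

Definition mm_comp M N L (g : module_map N L) (f : module_map M N) :
  module_map M L.
Proof.
apply: (@ModuleMap M L (fun A n x => g A n (f A n x))).
- by move=> *; rewrite !mm_act.
- by move=> *; rewrite !mm_bpt.
- by move=> *; rewrite !mm_tr.
- by move=> *; rewrite !mm_smul.
Defined.

Definition module_cat : category.
Proof.
refine (@Category module module_map mm_id mm_comp _ _ _).
- by move=> *; apply: module_map_eq.
- by move=> *; apply: module_map_eq.
- by move=> *; apply: module_map_eq.
Defined.

Definition level_equiv (M N : module_cat) (f : mor M N) : Prop :=
  forall A : finite_set, weak_equiv (f A).

(** The homotopy category of the stable infinity-category of [R]-modules.  A
    presheaf of sets or abelian groups on a full subcategory of the latter is
    the same as one on the homotopy category, and a Grothendieck topology on an
    infinity-category is by definition one on its homotopy category. *)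
Definition Ho : category := localization level_equiv.

Definition to_Ho (M N : module_cat) (f : mor M N) : @mor Ho M N :=
  loc_hom level_equiv f.

(** The shift [(sh M)_B = M_(B + 1)].  On Omega-spectra it models the
    suspension: the natural maps [M_B -> Omega M_(B + 1)] are weak equivalences
    and, [rsusp] being central, maps of [R]-modules. *)
Section Shift.
Variable M : premodule.

Definition sh_seq : symseq.
Proof.
apply: (@SymSeq (fun B => M (fs_sum B fs_unit))
  (fun A B f => @tr M _ _ (bij_sum f (bij_id fs_unit)))).
- by move=> *; rewrite tr_act.
- by move=> *; rewrite tr_bpt.
- by move=> A f n x fE; apply: tr_id; case=> //= a; rewrite fE.
- by move=> A B C f g h n x hE; apply: tr_comp; case=> //= a; rewrite hE.
Defined.

Definition sh_smul (A B : finite_set) n (r : R A n) (x : sh_seq B n) :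
    sh_seq (fs_sum A B) n :=
  @tr M (fs_sum A (fs_sum B fs_unit)) (fs_sum (fs_sum A B) fs_unit)
    (bij_inv (bij_sumA A B fs_unit)) n (smul r x).

Definition sh_pre : premodule.
Proof.
apply: (@PreModule sh_seq sh_smul).
- by move=> *; rewrite /sh_smul smul_act tr_act.
- move=> A A' B B' f g n r x; rewrite /sh_smul /= smul_tr !tr_tr.
  by apply: tr_ext; case=> [|[]].
- by move=> *; rewrite /sh_smul smul_bptl tr_bpt.
- by move=> *; rewrite /sh_smul smul_bptr tr_bpt.
- move=> A B C n r s x; rewrite /sh_smul /=.
  rewrite -[X in smul X (tr _ _)](@tr_id R A (bij_id A)) // smul_tr.
  rewrite -smulA !tr_tr.
  by apply: tr_ext; case=> [[|]|[]].
- move=> A n x; rewrite /sh_smul /= -[RHS]smul1 tr_tr.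
  by apply: tr_ext; case=> [[]|[]].
Defined.

Lemma sh_fibrant : fibrant M -> fibrant sh_pre.
Proof.
case=> kanM omM; split=> [A|B C e]; first exact: kanM.
pose e' : bij (fs_sum fs_unit (fs_sum B fs_unit)) (fs_sum C fs_unit) :=
  bij_comp (bij_sum e (bij_id fs_unit)) (bij_inv (bij_sumA fs_unit B fs_unit)).
have -> : @adjoint sh_pre B C e =
    @adjoint M (fs_sum B fs_unit) (fs_sum C fs_unit) e'.
  apply/functional_extensionality_dep => n; apply/funext => x.
  apply: loop_eq => k a t /=; rewrite /sh_smul tr_tr.
  exact: tr_ext.
exact: omM.
Qed.

End Shift.

Definition sh_obj (M : module) : module := Module (sh_fibrant (mfib M)).

Definition sh_mm (M N : module) (f : module_map M N) :
  module_map (sh_obj M) (sh_obj N).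
Proof.
apply: (@ModuleMap (sh_obj M) (sh_obj N) (fun B => f (fs_sum B fs_unit))).
- by move=> *; rewrite mm_act.
- by move=> *; rewrite mm_bpt.
- by move=> *; rewrite mm_tr.
- by move=> *; rewrite mm_tr mm_smul.
Defined.

Definition sh_functor : functor module_cat module_cat.
Proof.
apply: (@Functor module_cat module_cat sh_obj sh_mm).
- by move=> *; apply: module_map_eq.
- by move=> *; apply: module_map_eq.
Defined.

Lemma sh_level_equiv (M N : module_cat) (f : mor M N) :
  level_equiv f -> level_equiv (fmap sh_functor f).
Proof. by move=> fe A; apply: fe. Qed.

Definition shiftHo : functor Ho Ho := loc_functor sh_level_equiv.

Definition strict_fibre (F E B : module_cat) (i : mor F E) (p : mor E B) :
    Prop :=
  forall (A : finite_set) n, injective (@mm _ _ i A n) /\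
    forall y : E A n, p A n y = bpt n <-> exists x, i A n x = y.

(** [X -f-> Y -g-> Z] underlies a (co)fibre sequence: it is isomorphic in the
    homotopy category to the sequence of a levelwise Kan fibration and its
    fibre. *)
Definition fibre_sequence (X Y Z : Ho) (f : mor X Y) (g : mor Y Z) : Prop :=
  exists (F E B : module_cat) (i : mor F E) (p : mor E B)
    (a : @mor Ho X F) (b : @mor Ho Y E) (c : @mor Ho Z B),
    [/\ forall A : finite_set, kan_fibration (p A), strict_fibre i p,
        [/\ is_iso a, is_iso b & is_iso c],
        to_Ho i \oc a = b \oc f & to_Ho p \oc b = c \oc g].

(** [L] is the colimit of the diagram [D], computed on each set of simplices.
    For filtered [J] it is also the homotopy colimit of [D]. *)
Definition levelwise_filtered_colimit (J : category)
    (D : functor J module_cat) (L : module_cat) (lam : forall j, mor (D j) L) :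
    Prop :=
  [/\ filtered J,
      forall j k (h : mor j k), lam k \oc fmap D h = lam j,
      forall (A : finite_set) n (y : L A n),
        exists j (x : (D j : module) A n), lam j A n x = y
    & forall (A : finite_set) n j k (x : (D j : module) A n)
        (y : (D k : module) A n), lam j A n x = lam k A n y ->
        exists l (g : mor j l) (h : mor k l),
          fmap D g A n x = fmap D h A n y].

End Modules.

Definition regular (R : symmetric_ring_spectrum) : premodule R :=
  @PreModule R R (@rmul R) (@rmul_act R) (@rmul_tr R) (@rmul_bptl R)
    (@rmul_bptr R) (@rmulA R) (@rmul1l R).

(** Every [E_1]-ring is modelled by a symmetric ring spectrum whose underlying
    spectrum is an Omega-spectrum with Kan levels. *)
Record e1_ring := E1Ring {
  e1_ring_car :> symmetric_ring_spectrum;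
  e1_ring_fib : fibrant (regular e1_ring_car) }.

Definition unit_module (R : e1_ring) : Ho R := Module (e1_ring_fib R).

(** * Perfect even and even flat modules *)

Section PerfectEven.
Variable R : e1_ring.

(** [X] is the suspension [Sigma^(2 k) R], [k : int]. *)
Definition is_even_shift (k : int) (X : Ho R) : Prop :=
  match k with
  | Posz k => isomorphic X (iter k.*2 (shiftHo R) (unit_module R))
  | Negz k => isomorphic (iter k.+1.*2 (shiftHo R) X) (unit_module R)
  end.

Inductive perfect_even : Ho R -> Prop :=
| perfect_even_shift k X : is_even_shift k X -> perfect_even X
| perfect_even_ext (X Y Z : Ho R) (f : mor X Y) (g : mor Y Z) :
    fibre_sequence f g -> perfect_even X -> perfect_even Z -> perfect_even Y
| perfect_even_retract (X Y : Ho R) (s : mor X Y) (r : mor Y X) :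
    r \oc s = idc X -> perfect_even Y -> perfect_even X.

Definition even_flat (X : Ho R) : Prop :=
  exists (J : category) (D : functor J (module_cat R)) (L : module_cat R)
    (lam : forall j, mor (D j) L),
    [/\ levelwise_filtered_colimit lam, forall j, perfect_even (D j)
      & @isomorphic (Ho R) L X].

Definition Perf_ev : category := full_subcategory perfect_even.

Lemma perfect_even_unit : perfect_even (unit_module R).
Proof.
apply: (@perfect_even_shift 0); exists (idc (unit_module R)).
by exists (idc (unit_module R)); rewrite comp1f.
Qed.

Definition unit_Perf_ev : Perf_ev :=
  exist (fun X => perfect_even X) (unit_module R) perfect_even_unit.

Definition even_epi (B A : Perf_ev) (f : mor B A) : Prop :=
  exists (X : Ho R) (i : @mor (Ho R) X (sval B)),
    fibre_sequence i (f : @mor (Ho R) (sval B) (sval A)) /\ perfect_even X.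

(** [pi_n map_R (A, M)], computed as [[Sigma^n A, M]] for [n >= 0] and
    [[A, Sigma^(-n) M]] for [n < 0]. *)
Definition pi_map (n : int) (A M : Ho R) : zmodType :=
  match n with
  | Posz k => add_hom (iter k (shiftHo R) A) M
  | Negz k => add_hom A (iter k.+1 (shiftHo R) M)
  end.

Definition pi_map_map (n : int) (A M A' M' : Ho R) (g : mor M M')
    (f : mor A' A) : {additive pi_map n A M -> pi_map n A' M'} :=
  match n with
  | Posz k => add_hom_map g (iter_fmap (shiftHo R) k f)
  | Negz k => add_hom_map (iter_fmap (shiftHo R) k.+1 g) f
  end.

Lemma pi_map_map1 n (A M : Ho R) (x : pi_map n A M) :
  pi_map_map n (idc M) (idc A) x = x.
Proof.
case: n x => k x; rewrite /pi_map_map iter_fmap1; exact: add_hom_map1.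
Qed.

Lemma pi_map_mapM n (A M A' M' A'' M'' : Ho R) (g : mor M M') (f : mor A' A)
    (g' : mor M' M'') (f' : mor A'' A') (x : pi_map n A M) :
  pi_map_map n (g' \oc g) (f \oc f') x
  = pi_map_map n g' f' (pi_map_map n g f x).
Proof.
case: n x => k x; rewrite /pi_map_map iter_fmapM; exact: add_hom_mapM.
Qed.

(** The homotopy groups of [M], as [pi_n map_R (R, M)]. *)
Definition homotopy_group (n : int) (M : Ho R) : zmodType :=
  pi_map n (unit_module R) M.

Definition homotopy_group_map (n : int) (M N : Ho R) (f : mor M N) :
    {additive homotopy_group n M -> homotopy_group n N} :=
  pi_map_map n f (idc (unit_module R)).

Definition pi_even (M : Ho R) : Prop :=
  forall (k : int) (x : homotopy_group (k * 2 + 1) M), x = 0.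

Record pi_even_envelope (N E : Ho R) (j : mor N E) : Prop := PiEvenEnvelope {
  envelope_cofib : exists (C : Ho R) (c : mor E C),
    fibre_sequence j c /\ even_flat C;
  envelope_even : pi_even E;
  envelope_factor : forall (F : Ho R) (g : mor N F), pi_even F ->
    exists h : mor E F, h \oc j = g }.

End PerfectEven.

(** * Sheaves of abelian groups *)

Record presheaf (C : category) := Presheaf {
  psh :> C -> zmodType;
  res : forall A B : C, mor B A -> {additive psh A -> psh B};
  res1 : forall A (x : psh A), res (idc A) x = x;
  resM : forall (A B D : C) (f : mor B A) (g : mor D B) (x : psh A),
    res (f \oc g) x = res g (res f x) }.

Arguments res {C} p {A B} f.

Record presheaf_map (C : category) (F G : presheaf C) := PresheafMap {
  pm :> forall A, {additive F A -> G A};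
  pm_nat : forall (A B : C) (f : mor B A) (x : F A),
    pm B (res F f x) = res G f (pm A x) }.

Section Sheaves.
(** The covering families are the single maps satisfying [cov]. *)
Variables (C : category) (cov : forall B A : C, mor B A -> Prop).

Definition is_sheaf (F : presheaf C) : Prop :=
  forall (A B : C) (f : mor B A), cov f -> forall x : F B,
    (forall (D : C) (g h : mor D B),
       f \oc g = f \oc h -> res F g x = res F h x) ->
    exists! y : F A, res F f y = x.

(** Finite direct sums are sent to products. *)
Definition is_additive (F : presheaf C) : Prop :=
  (forall Z : C, is_zero_obj Z -> forall x : F Z, x = 0) /\
  (forall (X Y P : C) i1 i2 p1 p2, @biproduct C X Y P i1 i2 p1 p2 ->
     bijective (fun x : F P => (res F i1 x, res F i2 x))).

Record additive_sheaf := AdditiveSheaf {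
  ash :> presheaf C;
  ash_sheaf : is_sheaf ash;
  ash_additive : is_additive ash }.

Definition is_sheafification (P F : presheaf C) (eta : presheaf_map P F) :
    Prop :=
  is_sheaf F /\
  forall (G : presheaf C) (phi : presheaf_map P G), is_sheaf G ->
    (exists psi : presheaf_map F G, forall A x, psi A (eta A x) = phi A x) /\
    (forall psi psi' : presheaf_map F G,
       (forall A x, psi A (eta A x) = psi' A (eta A x)) ->
       forall A x, psi A x = psi' A x).

Definition sheaf_mono (F G : additive_sheaf) (j : presheaf_map F G) : Prop :=
  forall A, injective (j A).

Definition injective_sheaf (I : additive_sheaf) : Prop :=
  forall (F G : additive_sheaf) (j : presheaf_map F G) (f : presheaf_map F I),
    sheaf_mono j ->
    exists g : presheaf_map G I, forall A x, g A (j A x) = f A x.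

(** Exactness of sheaves: sections in the kernel lift locally. *)
Definition sheaf_exact (F G H : additive_sheaf) (f : presheaf_map F G)
    (g : presheaf_map G H) : Prop :=
  (forall A x, g A (f A x) = 0) /\
  (forall A (y : G A), g A y = 0 -> exists (B : C) (u : mor B A),
     cov u /\ exists x : F B, f B x = res G u y).

Record injective_resolution (F : additive_sheaf) := InjectiveResolution {
  ires : nat -> additive_sheaf;
  ires_d : forall n, presheaf_map (ires n) (ires n.+1);
  ires_aug : presheaf_map F (ires 0);
  ires_inj : forall n, injective_sheaf (ires n);
  ires_mono : sheaf_mono ires_aug;
  ires_exact0 : sheaf_exact ires_aug (ires_d 0);
  ires_exact : forall n, sheaf_exact (ires_d n) (ires_d n.+1) }.

End Sheaves.

(** * Cohomology of cochain complexes

    [cohomology d n] is the kernel of [d n] modulo the cocycles in the image of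
    [d n.-1], so that it does not take a proof of [d \o d = 0]. *)

Section Cohomology.
Variables (K : nat -> zmodType) (d : forall n, {additive K n -> K n.+1}).

Definition cocycle (n : nat) : Type := {x : K n | d n x = 0}.

Definition coboundary (n : nat) : K n -> Prop :=
  match n with
  | 0 => fun x => x = 0
  | m.+1 => fun x => exists y : K m, d m y = x
  end.

Definition cohomologous n (x y : cocycle n) : Prop :=
  coboundary (sval x - sval y).

Lemma coboundary0 n : @coboundary n 0.
Proof. by case: n => //= n; exists 0; rewrite raddf0. Qed.

Lemma coboundaryN n (x : K n) : coboundary x -> coboundary (- x).
Proof.
case: n x => /= [x -> |n x [y <-]]; first by rewrite oppr0.
by exists (- y); rewrite raddfN.
Qed.

Lemma coboundaryD n (x y : K n) :
  coboundary x -> coboundary y -> coboundary (x + y).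
Proof.
case: n x y => /= [x y -> ->|n x y [u <-] [v <-]]; first by rewrite addr0.
by exists (u + v); rewrite raddfD.
Qed.

Lemma cohomologous_equivalence n : equivalence (@cohomologous n).
Proof.
split=> [x|x y xy|x y z xy yz]; rewrite /cohomologous.
- by rewrite subrr; apply: coboundary0.
- by rewrite -opprB; apply: coboundaryN.
- by rewrite -(subrKA (sval y)); apply: coboundaryD.
Qed.

Definition cocycle0 n : cocycle n := exist _ 0 (raddf0 (d n)).

Lemma cocycleN_proof n (x : cocycle n) : d n (- sval x) = 0.
Proof. by rewrite raddfN (svalP x) oppr0. Qed.

Definition cocycleN n (x : cocycle n) : cocycle n :=
  exist _ (- sval x) (cocycleN_proof x).

Lemma cocycleD_proof n (x y : cocycle n) : d n (sval x + sval y) = 0.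
Proof. by rewrite raddfD (svalP x) (svalP y) addr0. Qed.

Definition cocycleD n (x y : cocycle n) : cocycle n :=
  exist _ (sval x + sval y) (cocycleD_proof x y).

Lemma cohomologous_eq n (x y : cocycle n) :
  sval x = sval y -> cohomologous x y.
Proof. by rewrite /cohomologous => ->; rewrite subrr; apply: coboundary0. Qed.

Definition cocycle_pregroup (n : nat) : pregroup.
Proof.
apply: (@PreGroup (cocycle n) (@cohomologous n) (cohomologous_equivalence n)
  (cocycle0 n) (@cocycleN n) (@cocycleD n)).
- move=> x x' xx'; rewrite /cohomologous /= -opprD.
  exact: coboundaryN.
- move=> x x' y y' xx' yy'; rewrite /cohomologous /= opprD addrACA.
  exact: coboundaryD.
- by move=> x y z; apply: cohomologous_eq; rewrite /= addrA.
- by move=> x y; apply: cohomologous_eq; rewrite /= addrC.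
- by move=> x; apply: cohomologous_eq; rewrite /= add0r.
- by move=> x; apply: cohomologous_eq; rewrite /= addNr.
Defined.

Definition cohomology (n : nat) : zmodType := qgroup (cocycle_pregroup n).

Definition cohomology_class n (x : K n) (dx : d n x = 0) : cohomology n :=
  qcls (exist _ x dx : cocycle_pregroup n).

End Cohomology.

(** * Even cohomology *)

Section EvenCohomology.
Variable R : e1_ring.

Definition pi_presheaf (n : int) (M : Ho R) : presheaf (Perf_ev R) :=
  @Presheaf (Perf_ev R) (fun A => pi_map n (sval A) M)
    (fun A B f => pi_map_map n (idc M) (f : @mor (Ho R) (sval B) (sval A)))
    (fun A x => pi_map_map1 x)
    (fun A B D f g x =>
       etrans (congr1 (fun h => pi_map_map n h _ x) (esym (comp1f (idc M))))
         (pi_map_mapM (idc M) f (idc M) g x)).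

Definition pi_presheaf_map (n : int) (M N : Ho R) (g : mor M N)
    (A : Perf_ev R) : {additive pi_presheaf n M A -> pi_presheaf n N A} :=
  pi_map_map n g (idc (sval A)).

(** The even sheaf of weight [n / 2] is a sheafification of
    [pi_presheaf n M]; it vanishes for all odd [n]. *)
Definition homologically_even (M : Ho R) : Prop :=
  forall (k : int) (F : presheaf (Perf_ev R))
    (eta : presheaf_map (pi_presheaf (k * 2 + 1) M) F),
    is_sheafification (@even_epi R) eta -> forall A (x : F A), x = 0.

(** The choices entering the computation of [H^(p,q)_ev (R, M)] as a right
    derived functor: the even sheaf of weight [q] and an injective resolution
    of it by additive sheaves. *)
Record even_resolution (M : Ho R) (q : int) := EvenResolution {
  even_sheaf : additive_sheaf (@even_epi R);
  even_unit : presheaf_map (pi_presheaf (q * 2) M) even_sheaf;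
  even_sheafification : is_sheafification (@even_epi R) even_unit;
  even_ires :> injective_resolution even_sheaf }.

Definition even_cohomology (M : Ho R) (q : int) (D : even_resolution M q)
    (p : nat) : zmodType :=
  cohomology (fun n => ires_d D n (unit_Perf_ev R)) p.

(** [C_(i - 1)], where [C_(-1) = M]. *)
Definition prev_cofib (M : Ho R) (C : nat -> Ho R) (i : nat) : Ho R :=
  if i is j.+1 then C j else M.

Section Envelopes.
Variables (M : Ho R) (C E : nat -> Ho R).
Variables (e : forall i, mor (prev_cofib M C i) (E i))
  (c : forall i, mor (E i) (C i)).

Definition envelope_d (i : nat) : mor (E i) (E i.+1) :=
  (e i.+1 : mor (C i) (E i.+1)) \oc c i.

(** Maps from the complex of presheaves [pi_(2 q) map_R (-, E_i)] to an
    injective resolution of the even sheaf of [M], compatible with the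
    augmentations from [pi_(2 q) map_R (-, M)]. *)
Definition is_comparison (q : int) (D : even_resolution M q)
    (phi : forall i, presheaf_map (pi_presheaf (q * 2) (E i)) (ires D i)) :
    Prop :=
  (forall A (x : pi_presheaf (q * 2) M A),
     phi 0 A (pi_presheaf_map (q * 2) (e 0) A x)
     = ires_aug D A (even_unit D A x)) /\
  (forall i A (x : pi_presheaf (q * 2) (E i) A),
     phi i.+1 A (pi_presheaf_map (q * 2) (envelope_d i) A x)
     = ires_d D i A (phi i A x)).

(** [H^p (pi_(2 q) E_bullet)]. *)
Definition envelope_cohomology (q : int) (p : nat) : zmodType :=
  cohomology (fun i => homotopy_group_map (q * 2) (envelope_d i)) p.

(** [theta] sends the class of a cocycle to that of its image under any
    comparison map: it is the canonical map, from the cohomology of an acyclic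
    resolution to that of an injective one. *)
Definition is_canonical (q : int) (D : even_resolution M q) (p : nat)
    (theta : {additive envelope_cohomology q p -> even_cohomology D p}) :
    Prop :=
  (exists phi, @is_comparison q D phi) /\
  (forall phi, @is_comparison q D phi ->
   forall (x : homotopy_group (q * 2) (E p))
     (dx : homotopy_group_map (q * 2) (envelope_d p) x = 0)
     (dy : ires_d D p (unit_Perf_ev R) (phi p (unit_Perf_ev R) x) = 0),
     theta (cohomology_class
       (d := fun i => homotopy_group_map (q * 2) (envelope_d i)) dx)
     = cohomology_class (d := fun i => ires_d D i (unit_Perf_ev R)) dy).

End Envelopes.

End EvenCohomology.

(* Main.v *)
Require Import Defs.
From HB Require Import structures.
From mathcomp Require Import all_boot all_algebra boolp classical_sets zify.
Import Defs.

(** An acyclic resolution computes sheaf cohomology; the work is to see that the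
    presheaves [pi_(2 q) map (-, E_i)] form an acyclic resolution of the even
    sheaf of [M].

    If [A] is perfect even and [P] is perfect even, every map [A -> Sigma P] is
    killed by an even epimorphism, namely by the map from its fibre to [A].  Perfect even modules are
    compact, so the same holds for maps from [A] to [Sigma] of an even flat
    module, and therefore an envelope [C_i -> E_(i+1)] is locally injective on
    maps out of perfect even modules.  If [E] has even homotopy, all maps from
    perfect even modules to odd shifts of [E] vanish; so [pi_(2 q) map (-, E)] is
    already a sheaf, and sections over the fibre of an even epimorphism [B -> A]
    extend to [B].  The last property, shared by injective sheaves, makes a
    locally exact complex of such sheaves exact on sections; it is applied to
    the cone of a comparison map from the complex to an injective resolution.

    The homotopy category of modules is analysed through an abstract category of
    fibrant objects with a loop functor and an inverse shift: every map is a
    fraction of a map by a trivial fibration, two maps are equal if and only if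
    they become homotopic along a trivial fibration, and fibre sequences can be
    rotated and are exact in both variables.  Injective sheaves are summands of
    presheaves coinduced from [Q / Z]. *)

Set Implicit Arguments.
Unset Strict Implicit.
Unset Printing Implicit Defensive.

(** The homotopy category is a localization by zigzags of fibrant modules, without cofibrant
    replacements. Equality of zigzags is therefore detected by their action on spans whose backward
    leg is a trivial fibration, on which weak equivalences act bijectively. This asks only for path
    objects and for pullbacks along fibrations, and the cogluing lemma for Kan complexes keeps the
    latter among the Omega-spectra. Weak equivalences, given through homotopy groups, are first
    turned into a lifting property relative to boundaries, which is easier to compose and to pull
    back.

    No group structure on maps is given in advance: a difference of two maps is read off from pairs
    of based paths with a common end point, and the presented hom groups are then identified with
    the groups so obtained.

    Being homologically even is a condition on sheafifications, and a derived functor needs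
    injective resolutions, so both must be shown to exist. One construction serves both: an
    injective hull of a presheaf modulo its locally trivial sections. The sheafification consists of
    the sections of the hull that lie locally in the image. *)

(** * Ordinal maps and maps of pointed simplicial sets *)

Lemma simp_eq n (i j : simp n) : sval i = sval j -> i = j.
Proof.
case: i j => [i Hi] [j Hj] /= E; case: j / E Hj => Hj.
by congr exist; apply: Prop_irrelevance.
Qed.

Lemma om_ext m n (a b : ordmap m n) :
  (forall i, sval (a i) = sval (b i)) -> a = b.
Proof.
case: a b => [a Ha] [b Hb] /= E.
have {}E : a = b by apply/funext => i; apply/simp_eq/E.
by case: b / E Hb => Hb; congr OrdMap; apply: Prop_irrelevance.
Qed.

Lemma nom_le m n (f : nat -> nat) :
  (forall i, i <= m -> f i <= n) -> forall i : simp m, f (sval i) <= n.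
Proof. by move=> H [i Hi]; apply: H. Qed.

Lemma nom_mono m n (f : nat -> nat) (H : forall i, i <= m -> f i <= n) :
  (forall i j, i <= j -> j <= m -> f i <= f j) ->
  forall i j : simp m, sval i <= sval j ->
    sval (exist (fun l => l <= n) (f (sval i)) (nom_le H i)) <=
    sval (exist (fun l => l <= n) (f (sval j)) (nom_le H j)).
Proof. by move=> H2 [i Hi] [j Hj] /= ij; apply: H2. Qed.

Definition nom m n (f : nat -> nat) (H : forall i, i <= m -> f i <= n)
  (H2 : forall i j, i <= j -> j <= m -> f i <= f j) : ordmap m n :=
  @OrdMap m n (fun i => exist _ (f (sval i)) (nom_le H i)) (nom_mono H H2).

Lemma om_compA k l m n (c : ordmap m n) (b : ordmap l m) (a : ordmap k l) :
  om_comp (om_comp c b) a = om_comp c (om_comp b a).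
Proof. exact: om_ext. Qed.

Lemma om_compf1 m n (a : ordmap m n) : om_comp a (om_id m) = a.
Proof. exact: om_ext. Qed.

Lemma om_comp1f m n (a : ordmap m n) : om_comp (om_id n) a = a.
Proof. exact: om_ext. Qed.

Lemma sactA (X : psset) k m n (a : ordmap k m) (b : ordmap m n) (x : X n) :
  sact a (sact b x) = sact (om_comp b a) x.
Proof. by symmetry; apply: act_comp. Qed.

Lemma sact1 (X : psset) n (x : X n) : sact (om_id n) x = x.
Proof. exact: act_id. Qed.

Record psmap (X Y : psset) := PsMap {
  pf :> forall n, X n -> Y n;
  pf_act : forall m n (a : ordmap m n) x, pf (sact a x) = sact a (pf x);
  pf_pt : forall n, @pf n (bpt n) = bpt n }.

Definition ps_id X : psmap X X :=
  @PsMap X X (fun _ x => x) (fun _ _ _ _ => erefl) (fun _ => erefl).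

Definition ps_comp X Y Z (g : psmap Y Z) (f : psmap X Y) : psmap X Z.
Proof.
apply: (@PsMap X Z (fun n x => g n (f n x))) => *; by rewrite ?pf_act ?pf_pt.
Defined.

(** * Sieves and extension problems *)

Definition sieve n := forall k, ordmap k n -> Prop.

Definition misses k n (a : ordmap k n) (j : nat) : Prop :=
  forall l, sval (a l) <> j.

Definition bd n : sieve n := fun k a => exists2 j, j <= n & misses a j.

Definition hn n (i : nat) : sieve n :=
  fun k a => exists2 j, j <= n & j <> i /\ misses a j.

(** A map defined on the subobject [S] of the simplex, encoded as a total family that is constrained
    on [S] only; its values elsewhere are arbitrary. *)
Definition pmapn (X : psset) n (S : sieve n)
    (x : forall k, ordmap k n -> X k) : Prop :=
  forall k l (a : ordmap k n) (b : ordmap l k), S k a ->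
    x l (om_comp a b) = sact b (x k a).

Definition ext (X Y : psset) (f : forall n, X n -> Y n) n (S : sieve n) :=
  forall (x : forall k, ordmap k n -> X k) (y : Y n), pmapn S x ->
    (forall k a, S k a -> f k (x k a) = sact a y) ->
    exists z : X n, f n z = y /\ forall k a, S k a -> sact a z = x k a.

(** Trivial fibrations. For [n = 0] the boundary is empty, so surjectivity on vertices is
    included. *)
Definition tf (X Y : psset) (f : forall n, X n -> Y n) : Prop :=
  forall n, ext f (@bd n).

Definition kf (X Y : psset) (f : forall n, X n -> Y n) : Prop :=
  forall n k, k <= n.+1 -> ext f (@hn n.+1 k).

Lemma ext_sub (X Y : psset) (f : forall n, X n -> Y n) n (S S' : sieve n) :
  (forall k a, S k a -> S' k a) -> (forall k a, S' k a -> S k a) ->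
  ext f S -> ext f S'.
Proof.
move=> SS' S'S E x y xn xy; case: (E x y).
- by move=> k l a b /SS'; apply: xn.
- by move=> k a /SS'; apply: xy.
by move=> z [zy zx]; exists z; split=> // k a /S'S; apply: zx.
Qed.

Lemma misses_comp k l n (a : ordmap k n) (b : ordmap l k) j :
  misses a j -> misses (om_comp a b) j.
Proof. by move=> H i; apply: H. Qed.

Lemma bd_comp k l n (a : ordmap k n) (b : ordmap l k) :
  bd a -> bd (om_comp a b).
Proof. by case=> j jn H; exists j => //; apply: misses_comp. Qed.

Lemma hn_comp k l n i (a : ordmap k n) (b : ordmap l k) :
  hn i a -> hn i (om_comp a b).
Proof. by case=> j jn [ji H]; exists j => //; split=> //; apply: misses_comp. Qed.

Lemma hn_bd k n i (a : ordmap k n) : hn i a -> bd a.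
Proof. by case=> j jn [_ H]; exists j. Qed.

(** The inverse of composition with [coface n j] on simplices that miss [j]. The truncation by
    [minn] makes it total, so that no proof has to be carried along. *)
Definition om_un k n (j : nat) (a : ordmap k n.+1) : ordmap k n.
Proof.
apply: (@OrdMap k n (fun i => exist (fun l => l <= n)
   (minn n (sval (a i) - (j < sval (a i)))) (geq_minl _ _))).
by move=> i i' /(om_mono a) /=; lia.
Defined.

Lemma om_unK k n j (a : ordmap k n.+1) : j <= n.+1 -> misses a j ->
  om_comp (coface n j) (om_un j a) = a.
Proof.
move=> jn H; apply: om_ext => i /=; have := H i.
by case: (a i) => /= l Hl; rewrite /bump; lia.
Qed.

Lemma om_un_comp k l n j (a : ordmap k n.+1) (b : ordmap l k) :
  om_un j (om_comp a b) = om_comp (om_un j a) b.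
Proof. exact: om_ext. Qed.

Lemma om_un_coface n j : j <= n.+1 -> om_un j (coface n j) = om_id n.
Proof.
by move=> jn; apply: om_ext => -[i Hi] /=; rewrite /bump; lia.
Qed.

Lemma misses_coface n j : misses (coface n j) j.
Proof. by move=> i /=; rewrite /bump; lia. Qed.

Lemma kfP (X Y : psset) (f : psmap X Y) : kan_fibration f <-> kf f.
Proof.
split=> [K n k kn x y xn xy|K n k x y kn xh xy].
  have hc i : i <= n.+1 -> i <> k -> hn k (coface n i).
    by move=> i1 ik; exists i => //; split=> //; apply: misses_coface.
  case: (K n k (fun i => x n (coface n i)) y kn).
  - move=> i j m a b i1 ik j1 jk E.
    rewrite -!xn; try exact: hc.
    by congr (x m _); apply: om_ext => l; rewrite /= -[RHS]/(sval (coface n j (b l))) -E.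
  - by move=> i i1 ik; rewrite xy //; apply: hc.
  move=> z [zx zy]; exists z; split=> // m a [j j1 [jk aj]].
  have E := om_unK j1 aj; rewrite -E -sactA zx // xn //; exact: hc.
(* Each simplex of the horn lies in some face; a face is chosen, and [is_horn] shows that the choice
   does not matter. Off the horn the value is the base point. *)
pose X' m (a : ordmap m n.+1) : X m :=
  match pselect (exists j, [/\ j <= n.+1, j <> k & misses a j]) with
  | left h => sact (om_un (sval (cid h)) a) (x (sval (cid h)))
  | right _ => bpt m end.
have X'E m (a : ordmap m n.+1) j : j <= n.+1 -> j <> k -> misses a j ->
    X' m a = sact (om_un j a) (x j).
  move=> j1 jk aj; rewrite /X'; case: pselect => [h|]; last by case; exists j.
  case: (cid h) => i [i1 ik ai] /=; apply: xh => // l.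
  apply/simp_eq; rewrite -[LHS]/(sval (om_comp (coface n i) (om_un i a) l)).
  by rewrite -[RHS]/(sval (om_comp (coface n j) (om_un j a) l)) !om_unK.
case: (K n k kn X' y).
- move=> m l a b [j j1 [jk aj]].
  by rewrite (X'E _ a j) // (X'E _ _ j) ?om_un_comp ?sactA //; apply: misses_comp.
- move=> m a [j j1 [jk aj]]; rewrite (X'E _ a j) // pf_act -xy // sactA.
  by rewrite om_unK.
move=> z [zy zx]; exists z; split=> // i i1 ik.
rewrite zx; last by exists i => //; split=> //; apply: misses_coface.
by rewrite (X'E _ _ i) // ?om_un_coface ?sact1 //; apply: misses_coface.
Qed.

Lemma hn_coface k m n (b : ordmap m n) : k <= n.+1 ->
  bd b -> hn k (om_comp (coface n k) b).
Proof.
move=> kn [j jn bj]; exists (bump k j); first by rewrite /bump; lia.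
by split=> [|l /=]; [|have := bj l]; rewrite /bump; lia.
Qed.

Lemma bd_hnE k m n (a : ordmap m n.+1) : k <= n.+1 -> bd a ->
  hn k a \/ exists b, a = om_comp (coface n k) b.
Proof.
move=> kn [j j1 aj]; case: (eqVneq j k) => [jk|/eqP jk]; last by left; exists j.
by right; exists (om_un k a); rewrite om_unK // -jk.
Qed.

(** A filler of the missing face turns horn data into boundary data. *)
Lemma horn_glue (X : psset) n k (x : forall m, ordmap m n.+1 -> X m) (z : X n) :
  k <= n.+1 -> pmapn (@hn n.+1 k) x ->
  (forall m (b : ordmap m n), bd b -> sact b z = x m (om_comp (coface n k) b)) ->
  exists x', [/\ pmapn (@bd n.+1) x',
    forall m (a : ordmap m n.+1), hn k a -> x' m a = x m a &
    forall m (b : ordmap m n), x' m (om_comp (coface n k) b) = sact b z].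
Proof.
move=> kn xn zx.
pose x' m (a : ordmap m n.+1) :=
  if `[< hn k a >] then x m a else sact (om_un k a) z.
have x'h m (a : ordmap m n.+1) : hn k a -> x' m a = x m a.
  by rewrite /x' => H; case: asboolP.
have x'c m (b : ordmap m n) : x' m (om_comp (coface n k) b) = sact b z.
  rewrite /x'; case: asboolP => [H|]; last first.
    by rewrite om_un_comp om_un_coface // om_comp1f.
  rewrite zx //; case: H => j jn [jk bj].
  exists (unbump k j); first by rewrite /unbump; lia.
  by move=> l; have := bj l => /=; rewrite /bump /unbump; lia.
exists x'; split=> // m l a b /(bd_hnE kn)[H|[c ->]].
  by rewrite !x'h ?xn //; apply: hn_comp.
by rewrite om_compA !x'c sactA.
Qed.

(** The missing face is lifted first, against its own boundary. Together with the horn it forms the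
    whole boundary, against which the interior is lifted. *)
Lemma tf_kf (X Y : psset) (f : psmap X Y) : tf f -> kf f.
Proof.
move=> T n k kn x y xn xy; have hc m b := @hn_coface k m n b kn.
case: (T n (fun m b => x m (om_comp (coface n k) b)) (sact (coface n k) y)).
- by move=> m l a b /hc H; rewrite -om_compA xn.
- by move=> m a /hc H; rewrite xy // sactA.
move=> z [zy zx]; have [x' [x'n x'h x'c]] := horn_glue kn xn zx.
case: (T n.+1 x' y) => //.
  move=> m a /(bd_hnE kn)[H|[c ->]]; first by rewrite x'h ?xy.
  by rewrite x'c pf_act zy sactA.
move=> w [wy wx]; exists w; split=> // m a H; rewrite wx ?x'h //.
exact: hn_bd H.
Qed.

(** * Path spaces *)

Record path (X : psset) (n : nat) := Path {
  pv : forall k, ordmap k n -> ordmap k 1 -> X k;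
  pv_act : forall k l (c : ordmap k l) a t,
    pv (om_comp a c) (om_comp t c) = sact c (pv a t) }.

Lemma path_eq (X : psset) n (x y : path X n) :
  (forall k (a : ordmap k n) t, pv x a t = pv y a t) -> x = y.
Proof.
case: x => f f1; case: y => g g1 /= fg.
have {}fg : f = g.
  apply/functional_extensionality_dep => k; apply/funext => a.
  by apply/funext => t; apply: fg.
by case: g / fg g1 => g1; congr Path; apply: Prop_irrelevance.
Qed.

Definition path_act (X : psset) m n (b : ordmap m n) (x : path X n) : path X m.
Proof.
apply: (@Path X m (fun k a t => pv x (om_comp b a) t)).
by move=> k l c a t; rewrite -om_compA pv_act.
Defined.

Definition path_bpt (X : psset) n : path X n.
Proof.
apply: (@Path X n (fun k _ _ => bpt k)).
by move=> *; rewrite act_bpt.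
Defined.

Definition pathS (X : psset) : psset.
Proof.
apply: (@PSSet (path X) (@path_act X) _ _ (path_bpt X)).
- by move=> n a x aE; apply: path_eq => k b t /=; congr pv; apply: om_ext => i /=; rewrite aE.
- by move=> k m n a b c x cE; apply: path_eq => l d t /=; congr pv; apply: om_ext => i /=; rewrite cE.
- by move=> *; apply: path_eq.
Defined.

Definition cst1 (e : bool) n : ordmap n 1.
Proof. by apply: (@nom n 1 (fun _ => e : nat)); case: e. Defined.

Lemma cst1_comp e m n (a : ordmap m n) : om_comp (cst1 e n) a = cst1 e m.
Proof. exact: om_ext. Qed.

Lemma pv_comp (X : psset) n (H : path X n) k l (c : ordmap k l) (a : ordmap l n)
   (a' : ordmap k n) (t : ordmap l 1) t' :
  a' = om_comp a c -> t' = om_comp t c -> pv H a' t' = sact c (pv H a t).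
Proof. by move=> -> ->; apply: pv_act. Qed.

Definition ev (X : psset) (e : bool) : psmap (pathS X) X.
Proof.
apply: (@PsMap (pathS X) X (fun n H => pv H (om_id n) (cst1 e n))) => //.
by move=> m n a H /=; apply: pv_comp; apply: om_ext.
Defined.

Lemma pv_cst (X : psset) n (H : path X n) k (a : ordmap k n) e :
  pv H a (cst1 e k) = sact a (ev X e n H).
Proof. by apply: pv_comp; apply: om_ext. Qed.

Definition cpath (X : psset) : psmap X (pathS X).
Proof.
refine (@PsMap X (pathS X) (fun n x => @Path X n (fun k a t => sact a x) _) _ _).
- by move=> m n a x; apply: path_eq => k b t /=; rewrite sactA.
- by move=> n; apply: path_eq => k b t /=; rewrite act_bpt.
Unshelve. by move=> *; rewrite sactA.
Defined.

Lemma ev_cpath (X : psset) e n (x : X n) : ev X e n (cpath X n x) = x.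
Proof. exact: sact1. Qed.

Definition pathf (X Y : psset) (f : psmap X Y) : psmap (pathS X) (pathS Y).
Proof.
refine (@PsMap (pathS X) (pathS Y)
  (fun n H => @Path Y n (fun k a t => f k (pv H a t)) _) _ _).
- by move=> *; apply: path_eq.
- by move=> n; apply: path_eq => k a t /=; rewrite pf_pt.
Unshelve. by move=> *; rewrite pv_act pf_act.
Defined.

(** * Prisms

    The nondegenerate [n.+1]-simplices of [Delta^n * Delta^1] are
    [tau_i = (sg i, th i)], [i <= n]; the faces [i] and [i.+1] of [tau_i] are
    [rho_i] and [rho_(i.+1)], where [rho_j = (id, rh j)]. *)

Definition sg (n i : nat) : ordmap n.+1 n.
Proof.
apply: (@nom n.+1 n (fun j => minn n (j - (i < j)))); move=> *; lia.
Defined.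

Definition th (n i : nat) : ordmap n.+1 1.
Proof. by apply: (@nom n.+1 1 (fun j => nat_of_bool (i < j))); move=> *; lia. Defined.

Definition rh (n i : nat) : ordmap n 1.
Proof. by apply: (@nom n 1 (fun j => nat_of_bool (i <= j))); move=> *; lia. Defined.

(** The two coordinates of the vertex [l] of [tau_i] add up to [l]. So the sum recovers a simplex of
    [tau_i] from its coordinates, by a formula that does not depend on [i]. *)
Definition om_add k n (a : ordmap k n) (t : ordmap k 1) : ordmap k n.+1.
Proof.
apply: (@OrdMap k n.+1 (fun l => exist (fun j => j <= n.+1)
  (minn n.+1 (sval (a l) + sval (t l))) (geq_minl _ _))).
by move=> i j ij /=; have := om_mono a ij; have := om_mono t ij; lia.
Defined.

Definition valid k n (i : nat) (a : ordmap k n) (t : ordmap k 1) : Prop :=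
  forall l, (sval (t l) = 0 -> sval (a l) <= i) /\
            (sval (t l) = 1 -> i <= sval (a l)).

Lemma valid_comp k l n i (a : ordmap k n) t (c : ordmap l k) :
  valid i a t -> valid i (om_comp a c) (om_comp t c).
Proof. by move=> H j; apply: H. Qed.

Lemma om_addK k n i (a : ordmap k n) t : i <= n -> valid i a t ->
  om_comp (sg n i) (om_add a t) = a /\ om_comp (th n i) (om_add a t) = t.
Proof.
move=> i_n V; split; apply: om_ext => l /=; have := V l;
  case: (a l) (t l) => [x Hx] [y Hy] /=; lia.
Qed.

Lemma valid_tau k n i (b : ordmap k n.+1) : i <= n ->
  valid i (om_comp (sg n i) b) (om_comp (th n i) b).
Proof. by move=> i_n l /=; case: (b l) => x Hx /=; lia. Qed.

Lemma om_add_tau k n i (b : ordmap k n.+1) : i <= n ->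
  om_add (om_comp (sg n i) b) (om_comp (th n i) b) = b.
Proof. by move=> i_n; apply: om_ext => l /=; case: (b l) => x Hx /=; lia. Qed.

Lemma sg_face n i f : i <= n -> f = i \/ f = i.+1 ->
  om_comp (sg n i) (coface n f) = om_id n.
Proof.
move=> i_n [|] ->; apply: om_ext => -[l Hl] /=; rewrite /bump; lia.
Qed.

Lemma th_face n i f : i <= n -> f = i \/ f = i.+1 ->
  om_comp (th n i) (coface n f) = rh n f.
Proof.
move=> i_n [|] ->; apply: om_ext => -[l Hl] /=; rewrite /bump; lia.
Qed.

(** The [tau_i] cover the prism: [i] is the largest lower bound of [a] on the vertices with [t = 1],
    capped by [n]. Maximality and the monotonicity of [a] and [t] then bound [a] by [i] where
    [t = 0]. *)
Lemma valid_ex k n (a : ordmap k n) t : exists2 i, i <= n & valid i a t.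
Proof.
pose P i := (i <= n) && `[< forall l, sval (t l) = 1 -> i <= sval (a l) >].
have P0 : exists i, P i by exists 0; apply/andP; split=> //; apply/asboolP.
have Pn i : P i -> i <= n by case/andP.
case: (ex_maxnP P0 Pn) => i /andP[i_n /asboolP Hi] im; exists i => // l.
split=> [t0|]; last exact: Hi.
case: (ltnP i n) => [lt|]; last by case: (a l) => /=; lia.
apply: contrapT => al; have /negP[] : ~~ P i.+1 by apply/negP=> /im; rewrite ltnn.
apply/andP; split=> //; apply/asboolP => l' t1.
have [ll|/ltnW ll] := leqP (sval l) (sval l').
  by have := om_mono a ll; lia.
by have := om_mono t ll; lia.
Qed.

Lemma path_glue (X : psset) n (x : nat -> X n.+1) :
  (forall i, i < n -> sact (coface n i.+1) (x i) = sact (coface n i.+1) (x i.+1)) ->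
  exists K : path X n, forall k (a : ordmap k n) t i, i <= n -> valid i a t ->
    pv K a t = sact (om_add a t) (x i).
Proof.
move=> xE.
(* A simplex in [tau_i] and [tau_(i + d)] lies in all the [tau_j] in between. Being in two
   consecutive ones, it misses the vertex that is not on their common face, so the two values agree
   by [xE]. *)
have indep k (a : ordmap k n) t i d : i + d <= n -> valid i a t -> valid (i + d) a t ->
    sact (om_add a t) (x i) = sact (om_add a t) (x (i + d)).
  elim: d => [|d IH] idn Vi Vd; first by rewrite addn0.
  have Vd' : valid (i + d) a t.
    by move=> l; have := Vi l; have := Vd l; lia.
  rewrite IH ?addnS //; last lia.
  have am : misses (om_add a t) (i + d).+1.
    by move=> l /=; have := Vd l; have := Vd' l; case: (a l) (t l) => [u Hu] [v Hv] /=; lia.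
  by rewrite -(om_unK _ am) -?sactA ?xE //; lia.
pose i0 k (a : ordmap k n) t := s2val (cid2 (valid_ex a t)).
have i0P k (a : ordmap k n) t i : i <= n -> valid i a t ->
    sact (om_add a t) (x (i0 k a t)) = sact (om_add a t) (x i).
  rewrite /i0; case: (cid2 _) => j jn Vj /= i_n Vi.
  have [ij|/ltnW ij] := leqP i j.
    by rewrite -(subnKC ij); symmetry; apply: indep; rewrite ?subnKC.
  by rewrite -(subnKC ij); apply: indep; rewrite ?subnKC.
have nat k l (c : ordmap k l) a t :
    sact (om_add (om_comp a c) (om_comp t c)) (x (i0 k (om_comp a c) (om_comp t c))) =
    sact c (sact (om_add a t) (x (i0 l a t))).
  case: (valid_ex a t) => i i_n V.
  rewrite (i0P _ a t i) // (i0P _ _ _ i i_n (valid_comp c V)) sactA.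
  by congr sact; apply: om_ext.
by exists (Path nat) => k a t i i_n V /=; apply: i0P.
Qed.

Section Prism.
Variables (X Y : psset) (p : psmap X Y) (n : nat) (H : path Y n).
Variable h : forall k, ordmap k n -> pathS X k.
Hypotheses (hn_ : pmapn (@bd n) h)
  (hH : forall k (a : ordmap k n), bd a -> pathf p k (h a) = sact a (H : pathS Y n)).

(** The candidates for the restriction of the sought path to [rho_i]: the image in [Y] is prescribed
    by [H] and the boundary by [h]. *)
Definition over_rho i (y : X n) : Prop :=
  p n y = pv H (om_id n) (rh n i) /\
  forall k (b : ordmap k n), bd b ->
    sact b y = pv (h b) (om_id k) (om_comp (rh n i) b).

Definition over_tau i (x : X n.+1) : Prop :=
  p n.+1 x = pv H (sg n i) (th n i) /\
  forall k (b : ordmap k n.+1), bd (om_comp (sg n i) b) ->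
    sact b x = pv (h (om_comp (sg n i) b)) (om_id k) (om_comp (th n i) b).

Lemma pv_h k l (a : ordmap k n) (b : ordmap l k) t : bd a ->
  pv (h (om_comp a b)) (om_id l) (om_comp t b) = sact b (pv (h a) (om_id k) t).
Proof.
by move=> aS; rewrite hn_ //= -pv_act; congr pv; apply: om_ext.
Qed.

Lemma over_face i f x : i <= n -> f = i \/ f = i.+1 -> over_tau i x ->
  over_rho f (sact (coface n f) x).
Proof.
move=> i_n fi [x1 x2]; split.
  rewrite pf_act x1 -pv_act sg_face ?th_face //.
move=> k b bB; rewrite sactA x2 -?om_compA ?sg_face ?th_face ?om_comp1f //.
Qed.

(** [F] tells which of the faces [i] and [i.+1] of [tau_i] are already filled. With one of them the
    extension problem is a horn, with both it is a boundary; this serves Kan fibrations and trivial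
    fibrations alike. *)
Lemma tau_ext i (F : nat -> Prop) (ys : nat -> X n) : i <= n ->
  (forall f, F f -> (f = i \/ f = i.+1) /\ over_rho f (ys f)) ->
  ext p (fun k (b : ordmap k n.+1) =>
    bd (om_comp (sg n i) b) \/ exists2 f, F f & misses b f) ->
  exists2 x, over_tau i x & forall f, F f -> sact (coface n f) x = ys f.
Proof.
move=> i_n FP E.
(* A simplex that misses both [i] and [i.+1] lies over the boundary of [Delta^n]; so off that
   boundary at most one of the two faces contains it. *)
pose f0 k (b : ordmap k n.+1) := if `[< misses b i >] then i else i.+1.
have f0P k (b : ordmap k n.+1) f : f = i \/ f = i.+1 -> misses b f ->
    ~ bd (om_comp (sg n i) b) -> f0 k b = f.
  move=> fi bf nb; rewrite /f0; case: asboolP => bi; case: fi => fE //; last by subst f.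
  subst f; case: nb; exists i => // l /=.
  by have := bi l; have := bf l; case: (b l) => u Hu /=; lia.
pose x' k (b : ordmap k n.+1) :=
  if `[< bd (om_comp (sg n i) b) >] then
    pv (h (om_comp (sg n i) b)) (om_id k) (om_comp (th n i) b)
  else sact (om_un (f0 k b) b) (ys (f0 k b)).
have x'b k (b : ordmap k n.+1) : bd (om_comp (sg n i) b) ->
    x' k b = pv (h (om_comp (sg n i) b)) (om_id k) (om_comp (th n i) b).
  by rewrite /x' => bb; case: asboolP.
have x'f k (b : ordmap k n) f : F f -> x' k (om_comp (coface n f) b) = sact b (ys f).
  move=> Ff; have [fi [_ yb]] := FP f Ff; rewrite /x'; case: asboolP => bb.
    move: bb; rewrite -!om_compA sg_face // th_face // om_comp1f => bb.
    by rewrite yb.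
  rewrite (@f0P _ _ f) //; last by apply/misses_comp/misses_coface.
  by rewrite om_un_comp om_un_coface ?om_comp1f //; case: fi; lia.
have fac k (b : ordmap k n.+1) f : F f -> misses b f ->
    exists c, b = om_comp (coface n f) c.
  move=> /FP [fi _] bf; exists (om_un f b); rewrite om_unK //.
  by case: fi; lia.
case: (E x' (pv H (sg n i) (th n i))).
- move=> k l a b [aB|[f Ff af]].
    have aB' : bd (om_comp (sg n i) (om_comp a b)) by rewrite -om_compA; apply: bd_comp.
    by rewrite !x'b // -!om_compA pv_h.
  by have [c ->] := fac _ _ _ Ff af; rewrite om_compA !x'f // sactA.
- move=> k a [aB|[f Ff af]].
    rewrite x'b // -pv_act.
    have := congr1 (fun u => pv u (om_id k) (om_comp (th n i) a)) (hH aB).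
    by rewrite /= om_compf1.
  have [c ->] := fac _ _ _ Ff af; rewrite x'f // pf_act.
  have [fi [-> _]] := FP f Ff; rewrite -!pv_act; congr pv.
    by rewrite -om_compA sg_face.
  by rewrite -om_compA th_face.
move=> x [xp xb]; exists x.
  split=> // k b bB; rewrite xb ?x'b //; by left.
move=> f Ff; rewrite xb; last first.
  by right; exists f => //; apply: misses_coface.
by rewrite -[coface n f]om_compf1 x'f // sact1.
Qed.

Lemma bd_sg k i (b : ordmap k n.+1) : i <= n -> bd (om_comp (sg n i) b) ->
  (exists2 j, j <= n.+1 & [/\ j <> i, j <> i.+1 & misses b j]) \/
  (misses b i /\ misses b i.+1).
Proof.
move=> i_n [j jn bj]; case: (ltngtP j i) => ji.
- left; exists j; first lia.
  by split; [lia|lia|] => l bl; apply: (bj l); rewrite /= bl; lia.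
- left; exists j.+1; first lia.
  by split; [lia|lia|] => l bl; apply: (bj l); rewrite /= bl; lia.
- right; split=> l bl; apply: (bj l); rewrite /= bl; lia.
Qed.

Lemma misses_bd_sg k i j (b : ordmap k n.+1) : i <= n -> j <= n.+1 ->
  j <> i -> j <> i.+1 -> misses b j -> bd (om_comp (sg n i) b).
Proof.
move=> i_n jn ji ji1 bj; exists (j - (i < j)); first lia.
by move=> l /=; have := bj l; case: (b l) => u Hu /=; lia.
Qed.

Lemma tau_kf i f y : kf p -> i <= n -> f = i \/ f = i.+1 -> over_rho f y ->
  exists2 x, over_tau i x & sact (coface n f) x = y.
Proof.
move=> K i_n fi yo.
pose g := if f == i then i.+1 else i.
have [||x xo xf] := @tau_ext i (fun f' => f' = f) (fun _ => y) i_n.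
- by move=> f' ->.
- apply: ext_sub (@K n g _); last by rewrite /g; case: ifP; lia.
    move=> k a [j jn [jg aj]].
    case: (eqVneq j f) => [jf|/eqP jf]; first by right; exists f; rewrite -?jf.
    by left; apply: misses_bd_sg aj => //; move: jg; rewrite /g; case: eqP; case: fi; lia.
  move=> k a [/(bd_sg i_n)[[j jn [ji ji1 aj]]|[ai ai1]]|[f' -> af]].
  - by exists j => //; split=> //; rewrite /g; case: ifP.
  - exists f; first by case: fi; lia.
    by split; [rewrite /g; case: eqP; case: fi; lia | case: fi => ->].
  exists f; first by case: fi; lia.
  by split=> //; rewrite /g; case: eqP; case: fi; lia.
by exists x => //; apply: xf.
Qed.

Lemma tau_tf i (y y' : X n) : tf p -> i <= n -> over_rho i y -> over_rho i.+1 y' ->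
  exists x, [/\ over_tau i x, sact (coface n i) x = y & sact (coface n i.+1) x = y'].
Proof.
move=> T i_n yo yo'.
have [||x xo xf] := @tau_ext i (fun f => f = i \/ f = i.+1)
    (fun f => if f == i then y else y') i_n.
- move=> f fi; split=> //; case: eqP => [->//|]; by case: fi => ->.
- apply: ext_sub (@T n.+1).
    move=> k a [j jn aj].
    case: (eqVneq j i) => [ji|/eqP ji]; first by right; exists i; rewrite -?ji //; left.
    case: (eqVneq j i.+1) => [ji1|/eqP ji1]; first by right; exists i.+1; rewrite -?ji1 //; right.
    by left; apply: misses_bd_sg aj.
  move=> k a [/(bd_sg i_n)[[j jn [ji ji1 aj]]|[ai ai1]]|[f fi af]].
  - by exists j.
  - by exists i => //; lia.
  by exists f => //; case: fi; lia.
exists x; split=> //; first by rewrite xf ?eqxx //; left.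
by rewrite xf; [case: eqP => // ?; lia|right].
Qed.

Lemma rho_tf i : tf p -> exists y, over_rho i y.
Proof.
move=> T; case: (T n (fun k b => pv (h b) (om_id k) (om_comp (rh n i) b))
   (pv H (om_id n) (rh n i))).
- by move=> k l a b aB; rewrite -om_compA pv_h.
- move=> k a aB; rewrite -pv_act om_comp1f.
  have := congr1 (fun u => pv u (om_id k) (om_comp (rh n i) a)) (hH aB).
  by rewrite /= om_compf1.
by move=> y [y1 y2]; exists y.
Qed.

Lemma rh0 : rh n 0 = cst1 true n. Proof. exact: om_ext. Qed.
Lemma rhn : rh n n.+1 = cst1 false n.
Proof. by apply: om_ext => -[l Hl] /=; lia. Qed.

Lemma path_of_taus (x : nat -> X n.+1) :
  (forall i, i <= n -> over_tau i (x i)) ->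
  (forall i, i < n -> sact (coface n i.+1) (x i) = sact (coface n i.+1) (x i.+1)) ->
  exists K : pathS X n, [/\ pathf p n K = H, forall k (a : ordmap k n), bd a ->
      sact a K = h a, ev X true n K = sact (coface n 0) (x 0) &
      ev X false n K = sact (coface n n.+1) (x n)].
Proof.
move=> xo xE; have [K KE] := path_glue xE; exists K; split.
- apply: path_eq => k a t /=; have [i i_n V] := valid_ex a t.
  rewrite (KE _ _ _ i) // pf_act (xo i i_n).1 -pv_act.
  by have [-> ->] := om_addK i_n V.
- move=> k a aB; apply: path_eq => l b t /=.
  have [i i_n V] := valid_ex (om_comp a b) t.
  have [E1 E2] := om_addK i_n V.
  rewrite (KE _ _ _ i) // (xo i i_n).2; last by rewrite E1; apply: bd_comp.
  by rewrite E1 E2 hn_ //= om_compf1.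
- rewrite /= (KE _ _ _ 0) //.
  by congr sact; apply: om_ext => -[l Hl] /=; rewrite /bump; lia.
have V : valid n (om_id n) (cst1 false n) by move=> -[l Hl]; split=> /=; lia.
rewrite /= (KE _ _ _ n) //.
by congr sact; apply: om_ext => -[l Hl] /=; rewrite /bump; lia.
Qed.

Lemma prism_kf e (y : X n) : kf p -> p n y = ev Y e n H ->
  (forall k (a : ordmap k n), bd a -> ev X e k (h a) = sact a y) ->
  exists K : pathS X n, [/\ pathf p n K = H, forall k (a : ordmap k n), bd a ->
      sact a K = h a & ev X e n K = y].
Proof.
move=> Kp py hy.
(* [rho_0] is the end [true] and [rho_(n.+1)] the end [false]. The [tau_i] are filled one after
   another from the end [e], upwards or downwards. *)
have yo : over_rho (if e then 0 else n.+1) y.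
  split=> [|k b bB]; first by clear hy; move: py; case: e; rewrite ?rh0 ?rhn.
  by rewrite -hy //=; clear hy py; case: e; rewrite ?rh0 ?rhn cst1_comp.
pose f i := if e then i else i.+1.
have fP i : f i = i \/ f i = i.+1 by rewrite /f; case: ifP; [left|right].
have /choice[xx xxP] (iy : nat * X n) : exists x, iy.1 <= n -> over_rho (f iy.1) iy.2 ->
    over_tau iy.1 x /\ sact (coface n (f iy.1)) x = iy.2.
  case: (pselect (iy.1 <= n /\ over_rho (f iy.1) iy.2)) => [[i_n yi]|N].
    by have [x x1 x2] := tau_kf Kp i_n (fP _) yi; exists x.
  by exists (bpt _) => ? ?; case: N.
pose g i := if e then i.+1 else i.
have gP i : g i = i \/ g i = i.+1 by rewrite /g; case: ifP; [right|left].
(* [nx m] is the index filled in step [m]: its simplex is entered through the face [f] and left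
   through the face [g]. *)
pose nx m := if e then m else n - m.
pose ys := fix ys m := if m is m'.+1 then
   sact (coface n (g (nx m'))) (xx (nx m', ys m')) else y.
have nxn m : m <= n -> nx m <= n by rewrite /nx; case: ifP => // _; lia.
have nxS m : m <= n -> f (nx m.+1) = g (nx m) \/ m = n.
  by rewrite /f /g /nx; case: (e); lia.
have yso m : m <= n -> over_rho (f (nx m)) (ys m).
  elim: m => [|m IH] mn; first by rewrite /f /nx; move: yo; case: ifP => // _; rewrite subn0.
  have mn' := ltnW mn.
  have [-> /=|] := nxS m mn'; last lia.
  apply: over_face (gP _) _; first exact: nxn.
  by case: (xxP (nx m, ys m)) => //=; [apply: nxn|apply: IH].
have xxo m : m <= n -> over_tau (nx m) (xx (nx m, ys m)) /\
   sact (coface n (f (nx m))) (xx (nx m, ys m)) = ys m.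
  by move=> mn; apply: (xxP (nx m, ys m)); [apply: nxn|apply: yso].
have nxK m : m <= n -> nx (nx m) = m by rewrite /nx; case: (e); lia.
pose x i := xx (i, ys (nx i)).
have xo i : i <= n -> over_tau i (x i) /\ sact (coface n (f i)) (x i) = ys (nx i).
  by move=> i_n; have := xxo (nx i) (nxn _ i_n); rewrite nxK.
have [i i_n|i i_n|K [K1 K2 K3 K4]] := @path_of_taus x.
- by case: (xo i i_n).
- have [_ xi] := xo i (ltnW i_n); have [_ xi1] := xo i.+1 i_n.
  move: xi xi1; rewrite /f /x; case Ee: e => xi xi1.
    by rewrite xi1 /nx Ee /= /g /nx Ee.
  rewrite xi /nx Ee (_ : n - i = (n - i.+1).+1); last lia.
  by rewrite /= /g /nx Ee (_ : n - (n - i.+1) = i.+1) //; lia.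
exists K; split=> //.
have [_ x0] := xo 0 isT; have [_ xn] := xo n (leqnn n).
move: x0 xn K3 K4; rewrite /f /nx; case: (e) => [-> _ -> //|_ -> _ ->].
by rewrite subnn.
Qed.

Lemma prism_tf (y0 y1 : X n) : tf p -> p n y0 = ev Y false n H ->
  p n y1 = ev Y true n H ->
  (forall k (a : ordmap k n), bd a -> ev X false k (h a) = sact a y0) ->
  (forall k (a : ordmap k n), bd a -> ev X true k (h a) = sact a y1) ->
  exists K : pathS X n, [/\ pathf p n K = H, forall k (a : ordmap k n), bd a ->
      sact a K = h a, ev X false n K = y0 & ev X true n K = y1].
Proof.
move=> T py0 py1 hy0 hy1.
(* Both ends are prescribed, so the inner walls [rho_i] are lifted first; each [tau_i] is then a
   boundary problem. *)
have /choice[z zP] i := rho_tf i T.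
pose ys i := if i == 0 then y1 else if i == n.+1 then y0 else z i.
have yso i : over_rho i (ys i).
  rewrite /ys; case: eqP => [->|_].
    by split=> [|k b bB]; rewrite rh0 // -hy1 //= cst1_comp.
  case: eqP => [->|_]; last exact: zP.
  by split=> [|k b bB]; rewrite rhn // -hy0 //= cst1_comp.
have /choice[x xP] i : exists x, i <= n ->
  [/\ over_tau i x, sact (coface n i) x = ys i & sact (coface n i.+1) x = ys i.+1].
  case: (leqP i n) => i_n; last by exists (bpt _).
  by have [x Hx] := tau_tf T i_n (yso i) (yso i.+1); exists x.
have [i i_n|i i_n|K [K1 K2 K3 K4]] := @path_of_taus x.
- by case: (xP i i_n).
- by have [_ _ ->] := xP i (ltnW i_n); have [_ -> _] := xP i.+1 i_n.
exists K; split=> //.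
  by have [_ _] := xP n (leqnn n); rewrite K4 => ->; rewrite /ys eqxx.
by have [_ + _] := xP 0 isT; rewrite K3 => ->; rewrite /ys eqxx.
Qed.

End Prism.

(** * Pullbacks and the gap maps of path spaces *)

Lemma sval_eq (T : Type) (P : T -> Prop) (u v : {x | P x}) :
  sval u = sval v -> u = v.
Proof.
case: u v => [x Hx] [y Hy] /= E; case: y / E Hy => Hy.
by congr exist; apply: Prop_irrelevance.
Qed.

Section Pullback.
Variables (A B E : psset) (f : psmap A B) (p : psmap E B).

Definition pbS : psset.
Proof.
refine (@PSSet (fun n => {u : A n * E n | f n u.1 = p n u.2})
  (fun m n a u => exist _ (sact a (sval u).1, sact a (sval u).2) _) _ _
  (fun n => exist _ (bpt n, bpt n) _) _).
- by move=> n a u aE; apply: sval_eq => /=; rewrite !act_id //; case: (sval u).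
- by move=> k m n a b c u cE; apply: sval_eq; rewrite /= !(act_comp _ cE).
- by move=> m n a; apply: sval_eq; rewrite /= !act_bpt.
Unshelve.
- by rewrite /= !pf_act (svalP u).
- by rewrite /= !pf_pt.
Defined.

Definition pb1 : psmap pbS A.
Proof. by refine (@PsMap pbS A (fun n u => (sval u).1) _ _). Defined.

Definition pb2 : psmap pbS E.
Proof. by refine (@PsMap pbS E (fun n u => (sval u).2) _ _). Defined.

Definition pbpair (Z : psset) (g : psmap Z A) (h : psmap Z E)
  (gh : forall n z, f n (g n z) = p n (h n z)) : psmap Z pbS.
Proof.
refine (@PsMap Z pbS (fun n z => exist _ (g n z, h n z) (gh n z)) _ _).
- by move=> *; apply: sval_eq; rewrite /= !pf_act.
- by move=> *; apply: sval_eq; rewrite /= !pf_pt.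
Defined.

End Pullback.

Section Matching.
Variables (X Y : psset) (q : psmap X Y).

Lemma mtch_act e m n (a : ordmap m n) x H :
  q n x = ev Y e n H -> q m (sact a x) = ev Y e m (sact a H).
Proof. by move=> E; rewrite !pf_act E. Qed.

(** The pullback [(X * X) *_(Y * Y) Y^(Delta^1)]: a path in [Y] with lifts of both its ends. *)
Definition mtch : psset.
Proof.
refine (@PSSet (fun n => {u : X n * X n * pathS Y n |
    q n u.1.1 = ev Y false n u.2 /\ q n u.1.2 = ev Y true n u.2})
  (fun m n a u => exist _ (sact a (sval u).1.1, sact a (sval u).1.2, sact a (sval u).2) _) _ _
  (fun n => exist _ (bpt n, bpt n, bpt n) _) _).
- by move=> n a [[[x0 x1] H] Hu] aE; apply: sval_eq; congr (_, _, _); apply: act_id.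
- by move=> k m n a b c u cE; apply: sval_eq; congr (_, _, _); apply: act_comp.
- by move=> m n a; apply: sval_eq; congr (_, _, _); apply: act_bpt.
Unshelve.
- by split; apply: mtch_act; case: (svalP u).
- by split; rewrite !pf_pt.
Defined.

Definition gap2 : psmap (pathS X) mtch.
Proof.
refine (@PsMap (pathS X) mtch (fun n H => exist _
   (ev X false n H, ev X true n H, pathf q n H) _) _ _).
- by move=> m n a H; apply: sval_eq; congr (_, _, _); apply: pf_act.
- by move=> n; apply: sval_eq; congr (_, _, _); apply: pf_pt.
Unshelve. by [].
Defined.

Definition gap1 e : psmap (pathS X) (pbS q (ev Y e)).
Proof. by apply: (@pbpair _ _ _ _ _ (pathS X) (ev X e) (pathf q)). Defined.

End Matching.

Lemma gap1_tf X Y (p : psmap X Y) e : kf p -> tf (gap1 p e).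
Proof.
move=> Kp n h [[y H] /= yH] hnat hy.
have [k a aB|k a aB|K [K1 K2 K3]] := prism_kf (h := h) (H := H) (e := e) hnat _ Kp yH.
- by have := congr1 (fun u => (sval u).2) (hy k a aB).
- by have := congr1 (fun u => (sval u).1) (hy k a aB).
by exists K; split=> //; apply: sval_eq; rewrite /= -K1 -K3.
Qed.

Lemma gap2_tf X Y (q : psmap X Y) : tf q -> tf (gap2 q).
Proof.
move=> T n h [[[y0 y1] H] /= [yH0 yH1]] hnat hy.
have [k a aB|k a aB|k a aB|K [K1 K2 K3 K4]] :=
  prism_tf (h := h) (H := H) hnat _ T yH0 yH1.
- by have := congr1 (fun u => (sval u).2) (hy k a aB).
- by have := congr1 (fun u => (sval u).1.1) (hy k a aB).
- by have := congr1 (fun u => (sval u).1.2) (hy k a aB).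
by exists K; split=> //; apply: sval_eq; rewrite /= -K1 -K3 -K4.
Qed.

(** The horn [k] of [Delta^n] is a retract of the part of [Delta^n * Delta^1]
    consisting of the end [e] and of the horn times [Delta^1]. *)
Section Retraction.
Variables (n k : nat) (e : bool).

Hypothesis kn : k <= n.

Lemma rr_proof m (c : ordmap m n) (s : ordmap m 1) l :
  (if sval (s l) == e :> nat then
    (if e then maxn (sval (c l)) k else minn (sval (c l)) k) else sval (c l)) <= n.
Proof. by case: (c l) => u Hu /=; case: ifP => _ //; case: (e); lia. Qed.

Lemma rr_mono m (c : ordmap m n) (s : ordmap m 1) (i j : simp m) : sval i <= sval j ->
  sval (exist (fun l => l <= n) _ (rr_proof c s i)) <=
  sval (exist (fun l => l <= n) _ (rr_proof c s j)).
Proof.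
move=> ij /=; have := om_mono c ij; have := om_mono s ij.
by case: (s i) (s j) (c i) (c j) => [u Hu] [v Hv] [w Hw] [x Hx] /=; case: (e);
  case: eqP; case: eqP; lia.
Qed.

Definition rr m (c : ordmap m n) (s : ordmap m 1) : ordmap m n :=
  OrdMap (@rr_mono m c s).

Lemma rr_comp m l (c : ordmap m n) s (b : ordmap l m) :
  rr (om_comp c b) (om_comp s b) = om_comp (rr c s) b.
Proof. exact: om_ext. Qed.

Lemma rr_end m (c : ordmap m n) : rr c (cst1 (~~ e) m) = c.
Proof. by apply: om_ext => l /=; case: (e). Qed.

Lemma rr_hn m (c : ordmap m n) s : hn k c -> hn k (rr c s).
Proof.
case=> j jn [jk cj]; exists j => //; split=> // l /=; have := cj l.
by case: eqP; case: (e); lia.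
Qed.

Lemma rr_hn_end m (c : ordmap m n) : 0 < n -> e = (k == n) -> hn k (rr c (cst1 e m)).
Proof.
move=> n0 ek; exists (if e then 0 else n); first by case: ifP.
split; first by move: ek; case: (e); lia.
by move=> l /=; rewrite eqxx; move: ek; case: (c l) => u Hu /=; case: (e); lia.
Qed.

End Retraction.

(** Along the retraction [rr] a horn problem for [gap2 p] becomes one for [gap2 (gap1 p e)], which
    is a trivial fibration because [gap1 p e] is one. At the end opposite to [e], where [rr] is the
    identity, its solution solves the given problem. *)
Lemma gap2_kf X Y (p : psmap X Y) : kf p -> kf (gap2 p).
Proof.
move=> Kp n k kn h [[[x0 x1] H] [xH0 xH1]] hnat hu.
change (p n.+1 x0 = ev Y false n.+1 H) in xH0.
change (p n.+1 x1 = ev Y true n.+1 H) in xH1.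
(* At the end [e] the retraction must land in the horn. For [k = n.+1] it collapses everything to
   the last vertex; otherwise it moves everything to vertices up to [k], so that the last vertex is
   missed. *)
pose e := k == n.+1; pose r m c s := @rr n.+1 k e kn m c s.
have rc m l c s (b : ordmap l m) : r l (om_comp c b) (om_comp s b) = om_comp (r m c s) b.
  exact: rr_comp.
have re m c : hn k (r m c (cst1 e m)) by apply: rr_hn_end.
have rs m c s : hn k c -> hn k (r m c s) by apply: rr_hn.
have hp m (a : ordmap m n.+1) t : hn k a -> p m (pv (h m a) (om_id m) t) = pv H a t.
  move=> /hu /(congr1 (fun u => pv (sval u).2 (om_id m) t)) /=.
  by rewrite om_compf1.
have h0 m (a : ordmap m n.+1) : hn k a -> ev X false m (h m a) = sact a x0.
  by move=> /hu /(congr1 (fun u => (sval u).1.1)).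
have h1 m (a : ordmap m n.+1) : hn k a -> ev X true m (h m a) = sact a x1.
  by move=> /hu /(congr1 (fun u => (sval u).1.2)).
have hv m l (a : ordmap m n.+1) (b : ordmap l m) t : hn k a ->
    pv (h l (om_comp a b)) (om_id l) t = pv (h m a) b t.
  by move=> aS; rewrite hnat //= om_compf1.
have @inn m (a : ordmap m n.+1) (S : hn k a) l (b : ordmap l m) (t : ordmap l 1) : path X l.
  apply: (@Path X l (fun l' b' s =>
    pv (h l' (r l' (om_comp (om_comp a b) b') s)) (om_id l') (om_comp t b'))).
  move=> l' l'' c b' s; rewrite -[om_comp _ (om_comp b' c)]om_compA rc hv; last first.
    by apply: (rs); do 2 apply: hn_comp.
  by rewrite -pv_act om_comp1f om_compA.
have @h' m (a : ordmap m n.+1) : pathS (pathS X) m.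
  refine (match pselect (hn k a) with
  | right _ => bpt m
  | left aS => @Path (pathS X) m (inn m a aS) _
  end).
  by move=> l l' c b t; apply: path_eq => i b' s /=; rewrite -!om_compA.
have h'E m (a : ordmap m n.+1) l (b : ordmap l m) t l' b' s : hn k a ->
    pv (pv (h' m a) b t) b' s =
    pv (h l' (r l' (om_comp (om_comp a b) b') s)) (om_id l') (om_comp t b').
  by move=> aS; rewrite /h'; case: pselect.
have @w (x : X n.+1) : pathS X n.+1.
  refine (@Path X n.+1 (fun l b s => sact (r l b s) x) _).
  by move=> l l' c b s; rewrite rc sactA.
pose Z := pbS p (ev Y e).
have @snd l (b : ordmap l n.+1) (t : ordmap l 1) : pathS Y l.
  refine (@Path Y l (fun l' b' s => pv H (r l' (om_comp b b') s) (om_comp t b')) _).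
  by move=> l' l'' c b' s; rewrite -!om_compA rc pv_act.
pose fst l (b : ordmap l n.+1) (t : ordmap l 1) : X l :=
  pv (h l (r l b (cst1 e l))) (om_id l) t.
have fs l (b : ordmap l n.+1) (t : ordmap l 1) : p l (fst l b t) = ev Y e l (snd l b t).
  by rewrite /= hp ?om_compf1.
have @Hz : path Z n.+1.
  apply: (@Path Z n.+1 (fun l b t => exist _ (fst l b t, snd l b t) (fs l b t))).
  move=> l l' c b t; apply: sval_eq; congr pair.
    by rewrite /= /fst -(cst1_comp e c) rc hv // -pv_act om_comp1f.
  by apply: path_eq => j b' s /=; rewrite !om_compA.
have wz0 : gap1 p e n.+1 (w x0) = ev Z false n.+1 Hz.
  apply: sval_eq; congr pair; first by rewrite /= -h0.
  by apply: path_eq => j b' s; rewrite /= pf_act xH0 /= om_comp1f -pv_act; congr pv; apply: om_ext.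
have wz1 : gap1 p e n.+1 (w x1) = ev Z true n.+1 Hz.
  apply: sval_eq; congr pair; first by rewrite /= -h1.
  by apply: path_eq => j b' s; rewrite /= pf_act xH1 /= om_comp1f -pv_act; congr pv; apply: om_ext.
have KG := tf_kf (gap2_tf (gap1_tf (e := e) Kp)).
case: (KG n k kn h' (exist _ (w x0, w x1, Hz) (conj wz0 wz1))).
- move=> m l a b aS; apply: path_eq => l' b' t; apply: path_eq => l'' c s.
  rewrite [RHS]h'E // h'E; last exact: hn_comp.
  by rewrite !om_compA.
- move=> m a aS; apply: sval_eq; congr (_, _, _).
  + by apply: path_eq => l b s; rewrite /= h'E //= !om_compf1 cst1_comp -[cst1 _ _]/(cst1 false l)
      -[pv _ _ _]/(ev X false _ _) h0 //; apply: (rs); apply: hn_comp.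
  + by apply: path_eq => l b s; rewrite /= h'E //= !om_compf1 cst1_comp -[cst1 _ _]/(cst1 true l)
      -[pv _ _ _]/(ev X true _ _) h1 //; apply: (rs); apply: hn_comp.
  apply: path_eq => l b t; apply: sval_eq; congr pair.
    by rewrite /= h'E // !om_compf1.
  apply: path_eq => l' b' s; rewrite /= h'E // hp //.
  by apply: (rs); do 2 apply: hn_comp.
move=> W [WE Wh]; exists (pathf (ev X (~~ e)) n.+1 W); split.
  apply: sval_eq; congr (_, _, _).
  - have /(congr1 (fun u => ev X (~~ e) _ (sval u).1.1)) /= := WE.
    by rewrite /r rr_end sact1.
  - have /(congr1 (fun u => ev X (~~ e) _ (sval u).1.2)) /= := WE.
    by rewrite /r rr_end sact1.
  apply: path_eq => l b t.
  have /(congr1 (fun u : mtch (gap1 p e) n.+1 =>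
    pv (sval (pv (sval u).2 b t : Z l)).2 (om_id l) (cst1 (~~ e) l))) /= := WE.
  by rewrite /r rr_end !om_compf1.
move=> m a aS; apply: path_eq => l b t.
have /(congr1 (fun u : pathS (pathS X) m =>
    pv (pv u b t : pathS X l) (om_id l) (cst1 (~~ e) l))) /= -> := Wh m a aS.
by rewrite h'E // /r rr_end !om_compf1 hv.
Qed.

(** * Kan complexes and the filling of boxes *)

Definition ptS : psset.
Proof. by apply: (@PSSet (fun _ => unit) (fun _ _ _ _ => tt) _ _ (fun _ => tt)) => // ? ? []. Defined.

Definition to_pt (X : psset) : psmap X ptS.
Proof. by apply: (@PsMap X ptS (fun _ _ => tt)). Defined.

Definition kan (X : psset) : Prop := kf (to_pt X).

Lemma ptS_eq n (u v : ptS n) : u = v.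
Proof. by case: u v => [] []. Qed.

Lemma kanP (X : psset) : kan_complex X <-> kan X.
Proof.
rewrite /kan -kfP; split=> K n k x.
  by move=> y kn xh _; case: (K n k x kn xh) => z zx; exists z; split=> //; apply: ptS_eq.
move=> kn xh; case: (K n k x (bpt _) kn xh) => // z [zx _]; by exists z.
Qed.

Lemma kan_kf_pt (X Y : psset) (f : psmap X Y) : kf f -> kan Y -> kan X.
Proof.
move=> Kf KY n k kn x y xn xy.
case: (KY n k kn (fun m a => f m (x m a)) y).
- by move=> m l a b aS; rewrite xn // pf_act.
- by move=> *; apply: ptS_eq.
move=> z [_ zx]; case: (Kf n k kn x z xn) => [m a aS|w [_ wx]]; first by rewrite zx.
by exists w; split=> //; apply: ptS_eq.
Qed.

Lemma prism_kan (X : psset) n e (y : X n) (h : forall k, ordmap k n -> pathS X k) :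
  kan X -> pmapn (@bd n) h ->
  (forall k (a : ordmap k n), bd a -> ev X e k (h k a) = sact a y) ->
  exists K : pathS X n,
    (forall k (a : ordmap k n), bd a -> sact a K = h k a) /\ ev X e n K = y.
Proof.
move=> KX hnat hy.
have [||K [_ K1 K2]] := @prism_kf X ptS (to_pt X) n (path_bpt ptS n) h hnat _ e y KX _ hy.
- by move=> *; apply: path_eq => *; apply: ptS_eq.
- exact: ptS_eq.
by exists K.
Qed.

(** Fills an open box: [K] is prescribed at the end [e], [G0] and [G1] on the
    two sides, and [h] over the boundary. *)
Lemma box (X : psset) n e (K G0 G1 : pathS X n)
    (h : forall k, ordmap k n -> pathS (pathS X) k) :
  kan X -> pmapn (@bd n) h ->
  ev X false n K = ev X e n G0 -> ev X true n K = ev X e n G1 ->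
  (forall k (a : ordmap k n), bd a -> ev (pathS X) e k (h k a) = sact a K) ->
  (forall k (a : ordmap k n), bd a -> pathf (ev X false) k (h k a) = sact a G0) ->
  (forall k (a : ordmap k n), bd a -> pathf (ev X true) k (h k a) = sact a G1) ->
  exists K' : pathS X n, [/\ ev X false n K' = ev X (~~ e) n G0,
    ev X true n K' = ev X (~~ e) n G1 &
    forall k (a : ordmap k n), bd a -> sact a K' = ev (pathS X) (~~ e) k (h k a)].
Proof.
move=> KX hnat K0 K1 he h0 h1.
have KG := gap2_kf KX.
have mP l (b : ordmap l n) s : to_pt X l (pv G0 b s) = ev ptS false l (path_bpt ptS l) /\
    to_pt X l (pv G1 b s) = ev ptS true l (path_bpt ptS l) by [].
pose M l b s : mtch (to_pt X) l := exist _ (pv G0 b s, pv G1 b s, path_bpt ptS l) (mP l b s).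
have Mn l l' (c : ordmap l l') b s : M l (om_comp b c) (om_comp s c) = sact c (M l' b s).
  by apply: sval_eq; congr (_, _, _); [apply: pv_act|apply: pv_act|apply: path_eq].
have [k a aB||S [S1 S2 S3]] := @prism_kf _ _ (gap2 (to_pt X)) n (Path Mn) h hnat _ e K KG _ he.
- apply: path_eq => l b s; apply: sval_eq; congr (_, _, _).
  + by have /(congr1 (fun u : pathS X k => pv u b s)) := h0 k a aB.
  + by have /(congr1 (fun u : pathS X k => pv u b s)) := h1 k a aB.
  by apply: path_eq => *; apply: ptS_eq.
- apply: sval_eq; congr (_, _, _) => //.
  by apply: path_eq => *; apply: ptS_eq.
have SG l b s : gap2 (to_pt X) l (pv S b s) = M l b s by rewrite -[M _ _ _]/(pv (Path Mn) b s) -S1.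
exists (ev (pathS X) (~~ e) n S); split.
- by have /(congr1 (fun u : mtch (to_pt X) n => (sval u).1.1)) := SG n (om_id n) (cst1 (~~ e) n).
- by have /(congr1 (fun u : mtch (to_pt X) n => (sval u).1.2)) := SG n (om_id n) (cst1 (~~ e) n).
by move=> k a aB; rewrite -pf_act S2.
Qed.

Lemma pmapn_act (X : psset) n (S : sieve n) (x : X n) :
  pmapn S (fun k a => sact a x).
Proof. by move=> k l a b _; rewrite sactA. Qed.

Lemma pmapn_map (X Y : psset) (f : psmap X Y) n (S : sieve n) x :
  pmapn S x -> pmapn S (fun k a => f k (x k a)).
Proof. by move=> xn k l a b /xn ->; rewrite pf_act. Qed.

Lemma pathf_cpath (X Y : psset) (f : psmap X Y) n (x : X n) :
  pathf f n (cpath X n x) = cpath Y n (f n x).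
Proof. by apply: path_eq => k a t /=; rewrite pf_act. Qed.

(** * Homotopies relative to the boundary *)

Definition relh (X : psset) n (y0 y1 : X n) : Prop :=
  exists H : pathS X n, [/\ ev X false n H = y0, ev X true n H = y1 &
    forall k (a : ordmap k n), bd a -> sact a H = cpath X k (sact a y0)].

Lemma relh_refl (X : psset) n (y : X n) : relh y y.
Proof. by exists (cpath X n y); rewrite !ev_cpath; split=> // k a _; rewrite pf_act. Qed.

Lemma relh_bd (X : psset) n (y0 y1 : X n) : relh y0 y1 ->
  forall k (a : ordmap k n), bd a -> sact a y0 = sact a y1.
Proof.
by case=> H [<- <- Hb] k a aB; rewrite -!pf_act Hb // !ev_cpath.
Qed.

Lemma relh_map (X Y : psset) (f : psmap X Y) n (y0 y1 : X n) :
  relh y0 y1 -> relh (f n y0) (f n y1).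
Proof.
case=> H [H0 H1 Hb]; exists (pathf f n H); split.
- by rewrite -H0.
- by rewrite -H1.
by move=> k a aB; rewrite -pf_act Hb // pathf_cpath pf_act.
Qed.

(** The two homotopies are the sides of a box with [b] as its bottom; over the boundary everything
    is constant in the vertical direction. *)
Lemma path_adjust (X : psset) n (b : pathS X n) (z0 z1 w0 w1 : X n) : kan X ->
  ev X false n b = z0 -> ev X true n b = z1 -> relh z0 w0 -> relh z1 w1 ->
  exists b' : pathS X n, [/\ ev X false n b' = w0, ev X true n b' = w1 &
    forall k (a : ordmap k n), bd a -> sact a b' = sact a b].
Proof.
move=> KX b0 b1 [G0 [G00 G01 G0b]] [G1 [G10 G11 G1b]].
have [|||k a aB|k a aB|k a aB|b' [b'0 b'1 b'b]] := @box X n false b G0 G1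
   (fun k a => cpath (pathS X) k (sact a b)) KX _ _ _ _ _ _.
- exact: (pmapn_map _ (pmapn_act _)).
- by rewrite G00.
- by rewrite G10.
- by rewrite ev_cpath.
- by rewrite G0b // -b0 -pf_act pathf_cpath.
- by rewrite G1b // -b1 -pf_act pathf_cpath.
exists b'; split; first by rewrite b'0.
  by rewrite b'1.
by move=> k a aB; rewrite b'b // ev_cpath.
Qed.

Lemma relh_sym (X : psset) n (y0 y1 : X n) : kan X -> relh y0 y1 -> relh y1 y0.
Proof.
move=> KX H; have [||b [b0 b1 bb]] := @path_adjust X n (cpath X n y0) y0 y0 y1 y0 KX _ _ H (relh_refl y0).
- exact: ev_cpath.
- exact: ev_cpath.
by exists b; split=> // k a aB; rewrite bb // -pf_act (relh_bd H).
Qed.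

Lemma relh_trans (X : psset) n (y0 y1 y2 : X n) : kan X ->
  relh y0 y1 -> relh y1 y2 -> relh y0 y2.
Proof.
move=> KX H01 [b [b0 b1 bb]].
have [b' [b'0 b'1 b'b]] := path_adjust KX b0 b1 (relh_sym KX H01) (relh_refl y2).
by exists b'; split=> // k a aB; rewrite b'b // bb // (relh_bd H01).
Qed.

(** A homotopy at one end, with [G0] and [G1] as sides, is an open box; its lid is a homotopy at the
    other end. *)
Lemma relh_transport (X : psset) n e (G0 G1 : pathS X n) : kan X ->
  (forall k (a : ordmap k n), bd a -> sact a G0 = sact a G1) ->
  relh (ev X e n G0) (ev X e n G1) -> relh (ev X (~~ e) n G0) (ev X (~~ e) n G1).
Proof.
move=> KX GG [K [K0 K1 Kb]].
have [|k a aB|k a aB|k a aB|b' [b'0 b'1 b'b]] := @box X n e K G0 G1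
   (fun k a => pathf (cpath X) k (sact a G0)) KX _ K0 K1 _ _ _.
- exact: (pmapn_map _ (pmapn_act _)).
- rewrite Kb // -pf_act; exact: path_eq.
- by apply: path_eq => l b s; rewrite -[LHS]/(ev X _ _ _) /= sact1.
- by rewrite -GG //; apply: path_eq => l b s; rewrite -[LHS]/(ev X _ _ _) /= sact1.
exists b'; split=> // k a aB; rewrite b'b // -pf_act; exact: path_eq.
Qed.

(** * Weak equivalences of Kan complexes

    [weq] is the relative homotopy lifting property against boundaries. *)

Definition weq (X Y : psset) (f : psmap X Y) : Prop :=
  forall n (x : forall k, ordmap k n -> X k) (y : Y n), pmapn (@bd n) x ->
    (forall k (a : ordmap k n), bd a -> f k (x k a) = sact a y) ->
    exists z : X n, (forall k (a : ordmap k n), bd a -> sact a z = x k a) /\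
      relh (f n z) y.

Lemma tf_weq (X Y : psset) (f : psmap X Y) : tf f -> weq f.
Proof.
move=> T n x y xn xy; have [z [zy zx]] := T n x y xn xy.
by exists z; split=> //; rewrite zy; apply: relh_refl.
Qed.

Lemma weq_kf_tf (X Y : psset) (f : psmap X Y) : kf f -> weq f -> tf f.
Proof.
move=> K W n x y xn xy; have [z [zx [H [H0 H1 Hb]]]] := W n x y xn xy.
have [|k a aB||k a aB|G [G1 G2 G3]] := @prism_kf X Y f n H (fun k a => cpath X k (x k a)) _ _ false z K _ _.
- exact: pmapn_map.
- by rewrite pathf_cpath Hb // -pf_act zx.
- by rewrite H0.
- by rewrite ev_cpath zx.
exists (ev X true n G); split; first by rewrite -H1 -G1.
by move=> k a aB; rewrite -pf_act G2 // ev_cpath.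
Qed.

Lemma weq_comp (X Y Z : psset) (g : psmap Y Z) (f : psmap X Y) : kan Z ->
  weq f -> weq g -> weq (ps_comp g f).
Proof.
move=> KZ Wf Wg n x z xn xz.
have [y [yx yz]] := Wg n _ z (pmapn_map f xn) xz.
have [w [wx wy]] := Wf n x y xn (fun k a aB => esym (yx k a aB)).
by exists w; split=> //; apply: relh_trans (relh_map g wy) yz.
Qed.

(** The mapping path space [X *_Y Y^(Delta^1)]; between Kan complexes [cyl_ev] is the fibration that
    replaces [f]. *)
Definition cyl (X Y : psset) (f : psmap X Y) : psset := pbS f (ev Y false).

Definition cyl_ev (X Y : psset) (f : psmap X Y) : psmap (cyl f) Y :=
  ps_comp (ev Y true) (pb2 f (ev Y false)).

Definition cyl_c (X Y : psset) (f : psmap X Y) : psmap X (cyl f) :=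
  @pbpair _ _ _ f (ev Y false) X (ps_id X) (ps_comp (cpath Y) f)
    (fun n x => esym (ev_cpath false (f n x))).

(** The given paths over the boundary are extended to a path [b] ending at [z]. A lift of the start
    of [b] exists up to a relative homotopy, and this homotopy is absorbed into [b]. *)
Lemma weq_cyl (X Y : psset) (f : psmap X Y) : kan Y -> weq f -> tf (cyl_ev f).
Proof.
move=> KY W n c z cn cz.
have [||b [bb bz]] := @prism_kan Y n true z (fun k a => (sval (c k a)).2) KY _ _.
- exact: (pmapn_map (pb2 _ _) cn).
- exact: cz.
have [||x [xx xb]] := W n (fun k a => (sval (c k a)).1) (ev Y false n b) _ _.
- exact: (pmapn_map (pb1 _ _) cn).
- by move=> k a aB; rewrite (svalP (c k a)) -pf_act bb.
have [b' [b'0 b'1 b'b]] := path_adjust KY erefl bz (relh_sym KY xb) (relh_refl z).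
exists (exist _ (x, b') (esym b'0)); split=> // k a aB.
apply: sval_eq; rewrite -[LHS]/(sact a x, sact a b') xx // b'b // bb //.
by case: (sval _).
Qed.

(** The relative homotopy is lifted along the trivial fibration [cyl_ev f], with constant paths
    prescribed at both ends; the first component of the lift is the homotopy sought. *)
Lemma weq_inj (X Y : psset) (f : psmap X Y) n (y0 y1 : X n) : kan Y -> weq f ->
  (forall k (a : ordmap k n), bd a -> sact a y0 = sact a y1) ->
  relh (f n y0) (f n y1) -> relh y0 y1.
Proof.
move=> KY W y01 [H [H0 H1 Hb]].
pose c i := cyl_c f n i.
have [|k a aB|||k a aB|k a aB|K [_ K2 K3 K4]] :=
  @prism_tf _ _ (cyl_ev f) n H (fun k a => cpath _ k (sact a (c y0))) _ _ (c y0) (c y1) (weq_cyl KY W) _ _ _ _.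
- exact: (pmapn_map _ (pmapn_act _)).
- by rewrite pathf_cpath Hb // pf_act; congr (cpath Y k (sact a _)); apply: ev_cpath.
- by rewrite [LHS]ev_cpath.
- by rewrite [LHS]ev_cpath.
- by rewrite ev_cpath.
- by rewrite ev_cpath /c -!pf_act y01.
exists (pathf (pb1 _ _) n K); split.
- by have /(congr1 (fun u : cyl f n => (sval u).1)) := K3.
- by have /(congr1 (fun u : cyl f n => (sval u).1)) := K4.
by move=> k a aB; rewrite -pf_act K2 // pathf_cpath.
Qed.

Lemma weq_cancel (X Y Z : psset) (g : psmap Y Z) (f : psmap X Y) : kan Z ->
  weq (ps_comp g f) -> weq g -> weq f.
Proof.
move=> KZ Wgf Wg n x y xn xy.
have [k a aB|z [zx zy]] := Wgf n x (g n y) xn _; first by rewrite /= xy // pf_act.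
exists z; split=> //; apply: (weq_inj KZ Wg) zy => k a aB.
by rewrite -pf_act zx // xy.
Qed.

Lemma weq_ext (X Y : psset) (f g : psmap X Y) :
  (forall n x, f n x = g n x) -> weq f -> weq g.
Proof.
move=> fg W n x y xn xy.
have [k a aB|z [zx zy]] := W n x y xn _; first by rewrite fg xy.
by exists z; rewrite -fg.
Qed.

Lemma weq_bij (X Y : psset) (f : psmap X Y) (g : forall n, Y n -> X n) :
  (forall n x, g n (f n x) = x) -> (forall n y, f n (g n y) = y) -> tf f.
Proof.
move=> gf fg n x y xn xy; exists (g n y); split=> // k a aB.
by rewrite -[LHS]gf pf_act fg -xy.
Qed.

Lemma ev_tf (X : psset) e : kan X -> tf (ev X e).
Proof.
move=> KX n h y hnat hy.
by have [K [K1 K2]] := prism_kan KX hnat hy; exists K.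
Qed.

(** * Pullbacks and the cogluing lemma *)

Section Spb.
Variables (A B E Z : psset) (f : psmap A B) (p : psmap E B)
  (q1 : psmap Z A) (q2 : psmap Z E).

(** Being a pullback is expressed by elements, so that the lemmas apply to [pbS], to path and loop
    spaces of pullbacks, and to pullbacks known by a universal property. *)
Record spb : Prop := Spb {
  spb_eq : forall n z, f n (q1 n z) = p n (q2 n z);
  spb_inj : forall n z z', q1 n z = q1 n z' -> q2 n z = q2 n z' -> z = z';
  spb_ex : forall n a e, f n a = p n e -> exists z, q1 n z = a /\ q2 n z = e }.

Lemma spb_ext n (S : sieve n) : spb -> ext p S -> ext q1 S.
Proof.
move=> [qe qi qx] K x y xn xy.
have [||e [ep ex]] := K (fun k a => q2 k (x k a)) (f n y) _ _.
- exact: pmapn_map.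
- by move=> k a aS; rewrite -qe xy // pf_act.
have [z [z1 z2]] := qx n y e (esym ep).
exists z; split=> // k a aS; apply: qi; first by rewrite pf_act z1 xy.
by rewrite pf_act z2 ex.
Qed.

Lemma spb_kf : spb -> kf p -> kf q1.
Proof. by move=> S K n k kn; apply: (spb_ext S); apply: K. Qed.

Lemma spb_tf : spb -> tf p -> tf q1.
Proof. by move=> S K n; apply: (spb_ext S); apply: K. Qed.

End Spb.

Lemma pbS_spb (A B E : psset) (f : psmap A B) (p : psmap E B) :
  spb f p (pb1 f p) (pb2 f p).
Proof.
split=> [n u|n u v E1 E2|n a e ae]; first exact: (svalP u).
  by apply: sval_eq; move: E1 E2 => /=; case: (sval u) (sval v) => ? ? [? ?] /= -> ->.
by exists (exist _ (a, e) ae).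
Qed.

Lemma spb_path (A B E Z : psset) (f : psmap A B) (p : psmap E B)
    (q1 : psmap Z A) (q2 : psmap Z E) :
  spb f p q1 q2 -> spb (pathf f) (pathf p) (pathf q1) (pathf q2).
Proof.
case=> qe qi qx; split=> [n z|n z z' E1 E2|n a e ae].
- by apply: path_eq => k b t /=.
- apply: path_eq => k b t; apply: qi.
    by have /(congr1 (fun u : pathS A n => pv u b t)) := E1.
  by have /(congr1 (fun u : pathS E n => pv u b t)) := E2.
have /(_ _ _ _)/cid F k b t : exists z, q1 k z = pv a b t /\ q2 k z = pv e b t.
  by apply: qx; have /(congr1 (fun u : pathS B n => pv u b t)) := ae.
have nat k l (c : ordmap k l) b t :
    sval (F k (om_comp b c) (om_comp t c)) = sact c (sval (F l b t)).
  case: (F _ _ _) (F _ _ _) => z [z1 z2] [w [w1 w2]] /=.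
  by apply: qi; rewrite pf_act ?z1 ?z2 ?w1 ?w2 pv_act.
by exists (Path nat); split; apply: path_eq => k b t /=; case: (F _ _ _) => z [].
Qed.

(** [phi] is the base change of [w] along [p]. The relative homotopy found in [A1] is pushed to [B]
    and lifted to [E] by the fibration; the start of the lift is the second component of the
    preimage. *)
Lemma base_change_weq (A A1 B E Z Z1 : psset) (w : psmap A A1) (f : psmap A B)
    (g : psmap A1 B) (p : psmap E B) (q1 : psmap Z A) (q2 : psmap Z E)
    (r1 : psmap Z1 A1) (r2 : psmap Z1 E) (phi : psmap Z Z1) :
  kf p -> weq w -> (forall n a, g n (w n a) = f n a) ->
  spb f p q1 q2 -> spb g p r1 r2 ->
  (forall n z, r1 n (phi n z) = w n (q1 n z)) ->
  (forall n z, r2 n (phi n z) = q2 n z) -> weq phi.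
Proof.
move=> Kp W gw [qe qi qx] rS phi1 phi2 n x y xn xy; have [re ri rx] := rS.
have [||a [ax [H [H0 H1 Hb]]]] := W n (fun k a => q1 k (x k a)) (r1 n y) _ _.
- exact: pmapn_map.
- by move=> k a aB; rewrite -phi1 xy // pf_act.
have [|k b bB||k b bB|G [G1 G2 G3]] := @prism_kf E B p n (pathf g n H)
   (fun k b => cpath E k (q2 k (x k b))) _ _ true (r2 n y) Kp _ _.
- exact: (pmapn_map _ (pmapn_map _ xn)).
- rewrite pathf_cpath -qe -pf_act Hb // pathf_cpath; congr (cpath B k).
  by rewrite -pf_act ax // gw.
- by rewrite -re -H1.
- by rewrite ev_cpath -phi2 xy // pf_act.
have [z [z1 z2]] : exists z, q1 n z = a /\ q2 n z = ev E false n G.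
  by apply: qx; rewrite -gw -H0 -[RHS]/(ev B false n (pathf p n G)) G1.
exists z; split.
  move=> k b bB; apply: qi; first by rewrite pf_act z1 ax.
  by rewrite pf_act z2 -pf_act G2 // ev_cpath.
have [_ pi px] := spb_path rS.
have [L [L1 L2]] := px n H G (esym G1).
exists L; split.
- apply: ri; first by rewrite phi1 z1 -H0 -L1.
  by rewrite phi2 z2 -L2.
- by apply: ri; [rewrite -H1 -L1|rewrite -G3 -L2].
move=> k b bB; apply: pi.
  rewrite (pf_act (pathf r1)) L1 Hb // pathf_cpath; congr (cpath A1 k _).
  by rewrite (pf_act r1) phi1 z1.
rewrite (pf_act (pathf r2)) L2 G2 // pathf_cpath; congr (cpath E k _).
by rewrite (pf_act r2) phi2 z2 -(pf_act (ev E false)) G2 // ev_cpath.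
Qed.

Lemma cyl_kf (X Y : psset) (f : psmap X Y) : kan X -> kan Y -> kf (cyl_ev f).
Proof.
move=> KX KY n k kn c y cn cy.
have [||x [_ xx]] := KX n k kn (fun m a => (sval (c m a)).1) tt _ _.
- exact: (pmapn_map (pb1 _ _) cn).
- by move=> *; apply: ptS_eq.
have mP : to_pt Y n.+1 (f n.+1 x) = ev ptS false n.+1 (path_bpt ptS n.+1) /\
  to_pt Y n.+1 y = ev ptS true n.+1 (path_bpt ptS n.+1) by [].
have [||b [bE bb]] := gap2_kf KY kn (x := fun m a => (sval (c m a)).2)
   (y := exist _ (f n.+1 x, y, path_bpt ptS n.+1) mP) _ _.
- exact: (pmapn_map (pb2 _ _) cn).
- move=> m a aS; apply: sval_eq; congr (_, _, _).
  + by rewrite -[LHS](svalP (c m a)) -xx // pf_act.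
  + exact: cy.
  by apply: path_eq => *; apply: ptS_eq.
have b0 : f n.+1 x = ev Y false n.+1 b.
  by have /(congr1 (fun u : mtch (to_pt Y) n.+1 => (sval u).1.1)) := bE.
exists (exist _ (x, b) b0); split.
  by have /(congr1 (fun u : mtch (to_pt Y) n.+1 => (sval u).1.2)) := bE.
move=> m a aS; apply: sval_eq; rewrite -[LHS]/(sact a x, sact a b) xx // bb //.
by case: (sval _).
Qed.

Lemma cyl_c_weq (X Y : psset) (f : psmap X Y) : kan X -> kan Y -> weq (cyl_c f).
Proof.
move=> KX KY; apply: (@weq_cancel _ _ _ (pb1 f (ev Y false))) => //.
  exact: (tf_weq (@weq_bij X X _ (fun _ x => x) _ _)).
exact: (tf_weq (spb_tf (pbS_spb _ _) (ev_tf (e := false) KY))).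
Qed.

Lemma spb_swap (A B E Z : psset) (f : psmap A B) (p : psmap E B)
    (q1 : psmap Z A) (q2 : psmap Z E) : spb f p q1 q2 -> spb p f q2 q1.
Proof.
case=> qe qi qx; split=> [n z|n z z' E1 E2|n a e ae]; first by rewrite qe.
  exact: qi.
by have [z [z1 z2]] := qx n e a (esym ae); exists z.
Qed.

Lemma cogluing (A B E Z A' B' E' Z' : psset)
    (f : psmap A B) (p : psmap E B) (q1 : psmap Z A) (q2 : psmap Z E)
    (f' : psmap A' B') (p' : psmap E' B') (r1 : psmap Z' A') (r2 : psmap Z' E')
    (al : psmap A A') (be : psmap B B') (ep : psmap E E') (phi : psmap Z Z') :
  kan A -> kan B -> kan B' -> kan E' -> kan Z' -> kf p -> kf p' ->
  weq al -> weq be -> weq ep ->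
  spb f p q1 q2 -> spb f' p' r1 r2 ->
  (forall n a, be n (f n a) = f' n (al n a)) ->
  (forall n e, be n (p n e) = p' n (ep n e)) ->
  (forall n z, r1 n (phi n z) = al n (q1 n z)) ->
  (forall n z, r2 n (phi n z) = ep n (q2 n z)) -> weq phi.
Proof.
move=> KA KB KB' KE' KZ' Kp Kp' Wa Wb We qS rS bf bp phi1 phi2.
have [qe qi qx] := qS; have [re ri rx] := rS.
(* [phi] factors through the pullback of [E1 = B *_B' E'] along [f]. The second factor is a base
   change of [al]; the first one only exchanges [E] for [E1] over [B]. *)
pose E1 := pbS be p'.
pose p1 : psmap E1 B := pb1 be p'.
have Kp1 : kf p1 by apply: spb_kf (pbS_spb _ _) Kp'.
pose j : psmap E E1 := pbpair (g := p) (h := ep) bp.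
have Wj : weq j.
  apply: (@weq_cancel _ _ _ (pb2 be p')) => //.
  apply: (@base_change_weq _ _ _ _ _ _ be be (ps_id B') p' p1 (pb2 be p') p' (ps_id E')) => //.
  - exact: pbS_spb.
  - by split=> // n a e ae; exists e.
  - by move=> n z; rewrite /= -(svalP z).
pose Z1 := pbS f p1.
have fp n z : f n (q1 n z) = p1 n (j n (q2 n z)) by rewrite qe.
pose psi : psmap Z Z1 := @pbpair _ _ _ _ _ Z q1 (ps_comp j q2) fp.
have ch n (z : Z1 n) : f' n (al n (sval z).1) = p' n (sval (sval z).2).2.
  by rewrite -bf (svalP z) /= (svalP (sval z).2).
pose F n z := cid (rx n _ _ (ch n z)).
have @chi : psmap Z1 Z'.
  refine (@PsMap Z1 Z' (fun n z => sval (F n z)) _ _).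
    move=> m n a z; case: (F _ _) (F _ _) => u [u1 u2] [v [v1 v2]] /=.
    by apply: ri; rewrite pf_act ?u1 ?u2 ?v1 ?v2 /= ?pf_act.
  move=> n; case: (F _ _) => u [u1 u2] /=.
  by apply: ri; rewrite ?u1 ?u2 !pf_pt.
have chiP n z : r1 n (chi n z) = al n (sval z).1 /\ r2 n (chi n z) = (sval (sval z).2).2.
  exact: (svalP (F n z)).
have Wchi : weq chi.
  apply: (@base_change_weq A A' B' E' Z1 Z' al (ps_comp be f) f' p'
     (pb1 f p1) (ps_comp (pb2 be p') (pb2 f p1)) r1 r2) => //.
  - by move=> n z; rewrite /= bf.
  - split=> [n z|n z z' E1_ E2_|n a e ae].
    + by rewrite /= (svalP z) /= (svalP (sval z).2).
    + apply: (spb_inj (pbS_spb f p1)) => //; apply: (spb_inj (pbS_spb be p')) => //.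
      by rewrite -(spb_eq (pbS_spb f p1)) -(spb_eq (pbS_spb f p1)); congr (f n _).
    have [w [w1 w2]] := spb_ex (pbS_spb be p') ae.
    have [z [z1 z2]] := spb_ex (pbS_spb f p1) (esym w1).
    by exists z; split=> //; rewrite -w2 -z2.
  - by move=> n z; case: (chiP n z).
  - by move=> n z; case: (chiP n z).
suff Wpsi : weq psi.
  apply: (weq_ext (f := ps_comp chi psi)); last exact: weq_comp.
  by move=> n z; have [h1 h2] := chiP n (psi n z); apply: (ri); [rewrite phi1 [LHS]h1|rewrite phi2 [LHS]h2].
(* Base change of [j] along [f] would need [f] to be a fibration, so [f] is replaced by [g]; the
   maps [u] and [u1] compare the old pullbacks with the new ones. *)
pose g : psmap (cyl f) B := cyl_ev f.
have Kg : kf g by apply: cyl_kf.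
pose Zg := pbS g p; pose Zg1 := pbS g p1.
have KZg1 : kan Zg1.
  apply: (kan_kf_pt (spb_kf (pbS_spb g p1) Kp1)).
  exact: (kan_kf_pt (spb_kf (pbS_spb f (ev B false)) (tf_kf (ev_tf (e := false) KB))) KA).
have Wc : weq (cyl_c f) by apply: cyl_c_weq.
have gc n a : g n (cyl_c f n a) = f n a by apply: ev_cpath.
have cp n z : g n (cyl_c f n (q1 n z)) = p n (q2 n z) by rewrite gc qe.
pose u : psmap Z Zg := @pbpair _ _ _ g p Z (ps_comp (cyl_c f) q1) q2 cp.
have Wu : weq u.
  apply: (@base_change_weq _ _ _ _ _ _ (cyl_c f) f g p q1 q2 (pb1 g p) (pb2 g p)) => //.
  exact: pbS_spb.
have gj n (z : Zg n) : g n (sval z).1 = p1 n (j n (sval z).2) by apply: (svalP z).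
pose v : psmap Zg Zg1 := @pbpair _ _ _ g p1 Zg (pb1 g p) (ps_comp j (pb2 g p)) gj.
have Wv : weq v.
  apply: (@base_change_weq E E1 B (cyl f) Zg Zg1 j p p1 g (pb2 g p) (pb1 g p) (pb2 g p1) (pb1 g p1)) => //.
  - exact: spb_swap (pbS_spb _ _).
  - exact: spb_swap (pbS_spb _ _).
have cp1 n (z : Z1 n) : g n (cyl_c f n (sval z).1) = p1 n (sval z).2.
  by rewrite gc (svalP z).
pose u1 : psmap Z1 Zg1 := @pbpair _ _ _ g p1 Z1 (ps_comp (cyl_c f) (pb1 f p1)) (pb2 f p1) cp1.
have Wu1 : weq u1.
  apply: (@base_change_weq _ _ _ _ _ _ (cyl_c f) f g p1 (pb1 f p1) (pb2 f p1) (pb1 g p1) (pb2 g p1)) => //.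
  - exact: pbS_spb.
  - exact: pbS_spb.
apply: (weq_cancel KZg1 _ Wu1).
apply: (weq_ext (f := ps_comp v u)); last exact: weq_comp.
by move=> n z; apply: sval_eq.
Qed.

(** * Comparison with isomorphisms on homotopy groups *)

Lemma bd_surj k n (a : ordmap k n) :
  bd a <-> ~ (forall j : simp n, exists i, a i = j).
Proof.
split=> [[j jn aj] H|H].
  by have [i ai] := H (exist _ j jn); apply: (aj i); rewrite ai.
apply: contrapT => N; apply: H => -[j jn]; apply: contrapT => E; apply: N.
exists j => // l al; apply: E; exists l; exact: simp_eq.
Qed.

Lemma sphereP (X : psset) n v (s : X n) :
  sphere v s <-> forall k (a : ordmap k n), bd a -> sact a s = sact (to0 k) v.
Proof. by split=> S k a /bd_surj; apply: S. Qed.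

Lemma to0_comp k m (a : ordmap k m) : om_comp (to0 m) a = to0 k.
Proof. exact: om_ext. Qed.

(** The two simplices [s] and [s'] placed on the faces [n] and [n.+1] of
    [Delta^(n.+1)], the other faces being degenerate. *)
Section TwoFaces.
Variables (X : psset) (n : nat) (s s' : X n).

Definition two_faces k (a : ordmap k n.+1) : X k :=
  if `[< misses a n.+1 >] then sact (om_un n.+1 a) s' else sact (om_comp (sg n n) a) s.

Lemma two_faces1 k (a : ordmap k n.+1) : misses a n.+1 -> two_faces a = sact (om_un n.+1 a) s'.
Proof. by rewrite /two_faces => am; case: asboolP. Qed.

Hypothesis ss' : forall k (a : ordmap k n), bd a -> sact a s = sact a s'.

Lemma un_bd k (a : ordmap k n.+1) j : j <= n -> misses a j -> misses a n.+1 -> bd (om_un n.+1 a).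
Proof.
move=> jn aj an; exists j => // l /=; have := aj l; have := an l.
by case: (a l) => u Hu /=; lia.
Qed.

Lemma sg_un k (a : ordmap k n.+1) : misses a n.+1 -> om_comp (sg n n) a = om_un n.+1 a.
Proof. by move=> an; apply: om_ext => l /=; have := an l; case: (a l) => u Hu /=; lia. Qed.

Lemma two_faces2 k (a : ordmap k n.+1) j : j <= n -> misses a j ->
  two_faces a = sact (om_comp (sg n n) a) s.
Proof.
rewrite /two_faces; case: asboolP => // an jn aj.
by rewrite sg_un // ss' //; apply: un_bd aj an.
Qed.

Lemma two_faces_pmapn : pmapn (@bd n.+1) two_faces.
Proof.
move=> k l a b [j jn aj]; case: (eqVneq j n.+1) => [jE|jE].
  rewrite {}jE in aj; rewrite !two_faces1 ?om_un_comp ?sactA //; exact: misses_comp.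
have {}jn : j <= n by lia.
rewrite !(two_faces2 (j := j)) // ?sactA -?om_compA //; exact: misses_comp.
Qed.

End TwoFaces.

(** A degenerate [n.+1]-simplex on [s] is deformed: its last face moves along the homotopy and the
    other faces stay fixed. *)
Lemma relh_homotopic (X : psset) n v (s t : X n) : kan X -> sphere v s ->
  relh s t -> homotopic v s t.
Proof.
move=> KX /sphereP sv [H [H0 H1 Hb]].
have sH k (a : ordmap k n) : bd a -> sact a (cpath X n s) = sact a H.
  by move=> aB; rewrite -pf_act Hb.
have [||K [Kb K0]] := @prism_kan X n.+1 false (sact (sg n n) s) (two_faces (X := pathS X) (cpath X n s) H) KX _ _.
- exact: two_faces_pmapn.
- move=> k a [j jn aj]; case: (eqVneq j n.+1) => [jE|jE].
    rewrite {}jE in aj; rewrite two_faces1 // pf_act H0 sactA; congr (sact _ s).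
    by rewrite sg_un.
  rewrite (two_faces2 sH (j := j)) //; last lia.
  by rewrite pf_act ev_cpath sactA.
have mc i := @misses_coface n i.
exists (ev X true n.+1 K); split.
- move=> i i_n; rewrite -pf_act Kb; last by exists i => //; lia.
  rewrite (two_faces2 sH (j := i)) //; last lia.
  rewrite pf_act ev_cpath sv //; exists i; first lia.
  by move=> [l Hl] /=; rewrite /bump; lia.
- rewrite -pf_act Kb; last by exists n.
  by rewrite (two_faces2 sH (j := n)) // sg_face //; [rewrite sact1 ev_cpath|left].
rewrite -pf_act Kb; last by exists n.+1.
by rewrite two_faces1 // om_un_coface // sact1.
Qed.

(** The map [Delta^n * Delta^1 -> Delta^(n.+1)] that sends the vertex [(n, 1)] to [n.+1] and
    projects the other vertices. At the times 0 and 1 it is the coface [n.+1] and [n], hence the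
    order of [t] and [s] in [homotopic_relh]. *)
Definition om_tip k n (a : ordmap k n) (t : ordmap k 1) : ordmap k n.+1.
Proof.
apply: (@OrdMap k n.+1 (fun l => exist (fun j => j <= n.+1)
  (minn n.+1 (sval (a l) + ((sval (a l) == n) && (sval (t l) == 1)))) (geq_minl _ _))).
move=> i j ij /=; have := om_mono a ij; have := om_mono t ij.
by case: (a i) (a j) (t i) (t j) => [u Hu] [v Hv] [x Hx] [y Hy] /=; lia.
Defined.

Lemma homotopic_relh (X : psset) n v (s t : X n) : sphere v t ->
  homotopic v s t -> relh t s.
Proof.
move=> /sphereP tv [z [zi zs zt]].
have nat k l (c : ordmap k l) (a : ordmap l n) u :
    sact (om_tip (om_comp a c) (om_comp u c)) z = sact c (sact (om_tip a u) z).
  by rewrite sactA; congr (sact _ z); apply: om_ext.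
exists (Path nat); split.
- rewrite -zt /=; congr (sact _ z); apply: om_ext => -[l Hl] /=.
  by rewrite /bump; lia.
- rewrite -zs /=; congr (sact _ z); apply: om_ext => -[l Hl] /=.
  by rewrite /bump; lia.
move=> k a [j jn aj]; apply: path_eq => m b u /=.
rewrite !sactA tv; last by exists j => //; do 1 apply: misses_comp.
case: (eqVneq j n) => [jE|jE].
  have -> : om_tip (om_comp a b) u = om_comp (coface n n.+1) (om_comp a b).
    apply: om_ext => l /=; have := aj (b l); rewrite /bump.
    by case: (a (b l)) => w Hw /=; lia.
  by rewrite -sactA zt tv //; exists j => // l; apply: aj.
have tj : misses (om_tip (om_comp a b) u) j.
  by move=> l /=; have := aj (b l); case: (a (b l)) => w Hw /=; lia.
by rewrite -(om_unK _ tj) -?sactA ?zi ?sactA ?to0_comp //; lia.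
Qed.

(** The contraction of [Delta^n] to its last vertex; maps being monotone, time moves the vertices
    upwards. *)
Definition om_con k n (a : ordmap k n) (t : ordmap k 1) : ordmap k n.
Proof.
apply: (@OrdMap k n (fun l => exist (fun j => j <= n)
  (minn n (if sval (t l) == 0 then sval (a l) else n)) (geq_minl _ _))).
move=> i j ij /=; have := om_mono a ij; have := om_mono t ij.
by case: (a i) (a j) (t i) (t j) => [u Hu] [v Hv] [x Hx] [y Hy] /=; case: eqP; case: eqP; lia.
Defined.

Lemma contraction (X : psset) n (y : X n) :
  exists v (G : pathS X n), ev X false n G = y /\ ev X true n G = sact (to0 n) v.
Proof.
have nat k l (c : ordmap k l) (a : ordmap l n) u :
    sact (om_con (om_comp a c) (om_comp u c)) y = sact c (sact (om_con a u) y).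
  by rewrite sactA; congr (sact _ y); apply: om_ext.
pose tip : ordmap 0 n := @OrdMap 0 n (fun _ => exist _ n (leqnn n)) (fun _ _ _ => leqnn n).
exists (sact tip y), (Path nat); split; rewrite /=.
  by rewrite -[RHS]sact1; congr (sact _ y); apply: om_ext => -[l Hl] /=; lia.
by rewrite sactA; congr (sact _ y); apply: om_ext => -[l Hl] /=; lia.
Qed.

Lemma move_path (X : psset) n e (y' : X n) (G : pathS X n) : kan X ->
  (forall k (a : ordmap k n), bd a -> sact a (ev X e n G) = sact a y') ->
  exists G' : pathS X n, ev X e n G' = y' /\
    forall k (a : ordmap k n), bd a -> sact a G' = sact a G.
Proof.
move=> KX Gy; have [||K [K1 K2]] := @prism_kan X n e y' (fun k a => sact a G) KX _ _.
- exact: pmapn_act.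
- by move=> k a aB; rewrite pf_act Gy.
by exists K.
Qed.

Section WeakEquiv.
Variables (X Y : psset) (f : psmap X Y).
Hypotheses (KX : kan X) (KY : kan Y).

Lemma f_const k v : f k (sact (to0 k) v) = sact (to0 k) (f 0 v).
Proof. exact: pf_act. Qed.

Lemma weq_weak_equiv : weq f -> weak_equiv f.
Proof.
move=> W n v; split=> [t /sphereP tv|s s' /sphereP sv /sphereP s'v [z [zi zn zn1]]].
  have [||s [sb st]] := W n (fun k a => sact (to0 k) v) t _ _.
  - by move=> *; rewrite sactA to0_comp.
  - by move=> k a aB; rewrite tv // f_const.
  have sv : sphere v s by apply/sphereP.
  exists s; split=> //; apply: relh_homotopic => //.
  by apply/sphereP => k a aB; rewrite -pf_act sb // f_const.
have ss' k (a : ordmap k n) : bd a -> sact a s = sact a s'.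
  by move=> aB; rewrite sv // s'v.
have [||w [wb _]] := W n.+1 (two_faces s s') z _ _.
- exact: two_faces_pmapn.
- move=> k a [j jn aj]; case: (eqVneq j n.+1) => [jE|jE].
    rewrite {}jE in aj; rewrite two_faces1 // pf_act -zn1 sactA; congr (sact _ z).
    by rewrite om_unK.
  have {}jn : j <= n by lia.
  rewrite (two_faces2 ss' jn aj).
  case: (eqVneq j n) => [{}jE|{}jE].
    rewrite {}jE in aj; rewrite pf_act -zn sactA; congr (sact _ z); apply: om_ext => l /=.
    by have := aj l; case: (a l) => u Hu /=; rewrite /bump; lia.
  rewrite sv; last first.
    by exists j => // l /=; have := aj l; case: (a l) => u Hu /=; lia.
  by rewrite f_const -(om_unK _ aj) -?sactA ?zi ?sactA ?to0_comp //; lia.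
exists w; split.
- move=> i i_n; rewrite wb; last by exists i; [lia|apply: misses_coface].
  rewrite (two_faces2 ss' (j := i)); [|lia|exact: misses_coface].
  by rewrite sv //; exists i => [|[l Hl] /=]; rewrite /bump; lia.
- rewrite wb; last by exists n; [lia|apply: misses_coface].
  rewrite (two_faces2 ss' (j := n)) ?sg_face ?sact1 //; last exact: misses_coface.
  by left.
rewrite wb; last by exists n.+1; [lia|apply: misses_coface].
by rewrite two_faces1 ?om_un_coface ?sact1 //; apply: misses_coface.
Qed.

Hypothesis We : weak_equiv f.

(** Only simplices with constant boundary are controlled by [weak_equiv]. So [y0] is contracted to a
    vertex and [y1] is carried along a path with the same boundary. *)
Lemma weak_equiv_inj n (y0 y1 : X n) :
  (forall k (a : ordmap k n), bd a -> sact a y0 = sact a y1) ->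
  relh (f n y0) (f n y1) -> relh y0 y1.
Proof.
move=> y01 R; have [v [G [G0 G1]]] := contraction y0.
have [|G' [G'0 G'b]] := @move_path X n false y1 G KX _; first by rewrite G0.
have S0 : sphere v (ev X true n G).
  by apply/sphereP => k a _; rewrite G1 sactA to0_comp.
have S1 : sphere v (ev X true n G').
  by apply/sphereP => k a aB; rewrite -pf_act G'b // pf_act G1 sactA to0_comp.
have R1 : relh (f n (ev X true n G)) (f n (ev X true n G')).
  apply: (@relh_transport Y n false (pathf f n G) (pathf f n G') KY).
    by move=> k a aB; rewrite -!pf_act G'b.
  change (relh (f n (ev X false n G)) (f n (ev X false n G'))); by rewrite G0 G'0.
have {}R1 : homotopic (f 0 v) (f n (ev X true n G)) (f n (ev X true n G')).
  apply: relh_homotopic R1 => //; apply/sphereP => k a aB.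
  by rewrite -pf_act G1 sactA to0_comp f_const.
have {R1}/(homotopic_relh S1) R1 := (We n v).2 _ _ S0 S1 R1.
rewrite -G0 -G'0; apply: (@relh_transport X n true G G' KX); last exact: relh_sym.
by move=> k a aB; rewrite G'b.
Qed.

(** The horn without the last face is filled by [z]. The last face of [z] is homotopic to the
    prescribed one, because their images are, by a path from [f z] to [y]; this homotopy is then
    used to correct [z]. *)
Lemma weak_equiv_fill n (x : forall k, ordmap k n -> X k) (y : Y n) :
  pmapn (@bd n) x -> (forall k (a : ordmap k n), bd a -> f k (x k a) = sact a y) ->
  exists z : X n, forall k (a : ordmap k n), bd a -> sact a z = x k a.
Proof.
case: n x y => [|n] x y xn xy.
  exists (bpt 0) => k a [j jn aj]; case: (aj (vertex0 k)).
  by case: (a _) => /= l Hl; lia.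
have xh : pmapn (@hn n.+1 n.+1) x by move=> k l a b /hn_bd; apply: xn.
have [|z [_ zx]] := (KX : kf (to_pt X)) n n.+1 (leqnn n.+1) x tt xh _.
  by move=> *; apply: ptS_eq.
have cB : bd (coface n n.+1) by exists n.+1 => //; apply: misses_coface.
have hc m (b : ordmap m n) : bd b -> hn n.+1 (om_comp (coface n n.+1) b).
  exact: hn_coface.
have R : relh (sact (coface n n.+1) z) (x n (coface n n.+1)).
  apply: weak_equiv_inj.
    by move=> k a /hc aB; rewrite sactA zx // xn.
  have mP : to_pt Y n.+1 (f n.+1 z) = ev ptS false n.+1 (path_bpt ptS n.+1) /\
      to_pt Y n.+1 y = ev ptS true n.+1 (path_bpt ptS n.+1) by [].
  have [||H [HE Hh]] := gap2_kf KY (leqnn n.+1) (x := fun m a => cpath Y m (f m (x m a)))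
     (y := exist _ (f n.+1 z, y, path_bpt ptS n.+1) mP) _ _.
  - exact: (pmapn_map _ (pmapn_map _ xh)).
  - move=> m a aS; apply: sval_eq; congr (_, _, _).
    + by rewrite ev_cpath -zx // pf_act.
    + by rewrite ev_cpath xy //; apply: hn_bd aS.
    by apply: path_eq => *; apply: ptS_eq.
  have E0 : ev Y false n.+1 H = f n.+1 z.
    exact: (congr1 (fun u : mtch (to_pt Y) n.+1 => (sval u).1.1) HE).
  have E1 : ev Y true n.+1 H = y.
    exact: (congr1 (fun u : mtch (to_pt Y) n.+1 => (sval u).1.2) HE).
  exists (sact (coface n n.+1) H); split.
  - by rewrite pf_act E0 pf_act.
  - by rewrite pf_act E1 xy.
  by move=> k a /hc aB; rewrite sactA Hh // -pf_act sactA zx.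
case: R => L [L0 L1 Lb].
have [||h [hn_ h1 h2]] := @horn_glue (pathS X) n n.+1 (fun k a => cpath X k (x k a)) L (leqnn _) _ _.
- exact: pmapn_map.
- move=> m b bB; rewrite Lb // sactA zx //; exact: hc.
have [|K [Kb K0]] := @prism_kan X n.+1 false z h KX hn_ _.
  move=> k a /(bd_hnE (leqnn _))[aS|[b ->]].
    by rewrite h1 // ev_cpath zx.
  by rewrite h2 pf_act L0 sactA.
exists (ev X true n.+1 K) => k a aB; rewrite -pf_act Kb //.
case: (bd_hnE (leqnn _) aB) => [aS|[b aE]]; first by rewrite h1 // ev_cpath.
by rewrite aE h2 pf_act L1 xn.
Qed.

(** The filler [z] has the right boundary but an arbitrary image. Along a contraction of [z], [y] is
    carried to a sphere; this sphere lifts up to homotopy, and the lift is carried back. *)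
Lemma weak_equiv_weq : weq f.
Proof.
move=> n x y xn xy; have [z zx] := weak_equiv_fill xn xy.
have [v [G [G0 G1]]] := contraction z.
have [|G' [G'0 G'b]] := @move_path Y n false y (pathf f n G) KY _.
  by move=> k a aB; rewrite [ev _ _ _ _](_ : _ = f n (ev X false n G)) // G0 -pf_act zx // xy.
have S' : sphere (f 0 v) (ev Y true n G').
  apply/sphereP => k a aB; rewrite -pf_act G'b // pf_act.
  by rewrite [ev _ _ _ _](_ : _ = f n (ev X true n G)) // G1 f_const sactA to0_comp.
have [s [/sphereP sv /(homotopic_relh S') R]] := (We n v).1 _ S'.
have [|G'' [G''1 G''b]] := @move_path X n true s G KX _.
  by move=> k a aB; rewrite G1 sv // sactA to0_comp.
exists (ev X false n G''); split.
  by move=> k a aB; rewrite -pf_act G''b // pf_act G0 zx.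
rewrite -G'0; apply: relh_sym => //.
apply: (@relh_transport Y n true G' (pathf f n G'') KY).
  by move=> k a aB; rewrite G'b // -!pf_act G''b.
change (relh (ev Y true n G') (f n (ev X true n G''))); by rewrite G''1.
Qed.

End WeakEquiv.

Lemma weak_equivP (X Y : psset) (f : psmap X Y) : kan X -> kan Y ->
  weak_equiv f <-> weq f.
Proof. by move=> KX KY; split; [apply: weak_equiv_weq|apply: weq_weak_equiv]. Qed.

(** * Abstract categories of fibrant objects *)

Definition is_pullback (C : category) (A B E P : C) (f : mor A B) (p : mor E B)
    (q1 : mor P A) (q2 : mor P E) : Prop :=
  f \oc q1 = p \oc q2 /\
  forall (Z : C) (u : mor Z A) (v : mor Z E), f \oc u = p \oc v ->
    exists w : mor Z P, [/\ q1 \oc w = u, q2 \oc w = v &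
      forall w', q1 \oc w' = u -> q2 \oc w' = v -> w' = w].

(** Pointed categories of fibrant objects in the sense of K. Brown. *)
Record fibcat := FibCat {
  fc :> category;
  weak : forall A B : fc, mor A B -> Prop;
  fib : forall A B : fc, mor A B -> Prop;
  weak_iso : forall A B (f : mor A B), is_iso f -> weak f;
  weak_comp : forall A B X (g : mor B X) (f : mor A B),
    weak f -> weak g -> weak (g \oc f);
  weak_cancel : forall A B X (g : mor B X) (f : mor A B),
    weak (g \oc f) -> weak g -> weak f;
  fib_comp : forall A B X (g : mor B X) (f : mor A B),
    fib f -> fib g -> fib (g \oc f);
  fib_iso : forall A B (f : mor A B), is_iso f -> fib f;
  pt : fc;
  zto : forall A, mor A pt;
  zfrom : forall A, mor pt A;
  ztoE : forall A (f : mor A pt), f = zto A;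
  zfromE : forall A (f : mor pt A), f = zfrom A;
  fib_zto : forall A, fib (zto A);
  pullback_ex : forall A B E (f : mor A B) (p : mor E B), fib p ->
    exists P (q1 : mor P A) (q2 : mor P E), is_pullback f p q1 q2;
  pullback_fib : forall A B E P (f : mor A B) (p : mor E B) (q1 : mor P A)
    (q2 : mor P E), is_pullback f p q1 q2 -> fib p -> fib q1;
  pullback_weak : forall A B E P (f : mor A B) (p : mor E B) (q1 : mor P A)
    (q2 : mor P E), is_pullback f p q1 q2 -> fib p -> weak p -> weak q1;
  base_change : forall A B E P (f : mor A B) (p : mor E B) (q1 : mor P A)
    (q2 : mor P E), is_pullback f p q1 q2 -> fib p -> weak f -> weak q2;
  PI : fc -> fc;
  dl : forall X, mor (PI X) X;
  dr : forall X, mor (PI X) X;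
  dc : forall X, mor X (PI X);
  PImap : forall X Y, mor X Y -> mor (PI X) (PI Y);
  dl_nat : forall X Y (f : mor X Y), dl Y \oc PImap f = f \oc dl X;
  dr_nat : forall X Y (f : mor X Y), dr Y \oc PImap f = f \oc dr X;
  dl_dc : forall X, dl X \oc dc X = idc X;
  dr_dc : forall X, dr X \oc dc X = idc X;
  weak_dl : forall X, weak (dl X);
  weak_dr : forall X, weak (dr X);
  fib_dl : forall X, fib (dl X);
  fib_dr : forall X, fib (dr X);
  path_pullback : forall X Z (u v : mor Z X), exists P (q1 : mor P Z) (q2 : mor P (PI X)),
    [/\ fib q1, dl X \oc q2 = u \oc q1, dr X \oc q2 = v \oc q1 &
      forall A (a : mor A Z) (h : mor A (PI X)), dl X \oc h = u \oc a -> dr X \oc h = v \oc a ->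
        exists w : mor A P, q1 \oc w = a /\ q2 \oc w = h];
  path_factor : forall X Y (f : mor X Y), exists Q (r : mor Q X) (e : mor Q Y) (h : mor Q (PI Y)),
    [/\ fib r, weak r, fib e, dl Y \oc h = f \oc r /\ dr Y \oc h = e &
      forall A (a : mor A X) (k : mor A (PI Y)), dl Y \oc k = f \oc a ->
        exists w : mor A Q, r \oc w = a /\ h \oc w = k] }.

Definition is_ker (C : fibcat) (F E B : C) (i : mor F E) (p : mor E B) : Prop :=
  is_pullback (zfrom B) p (zto F) i.

(** A pointed category of fibrant objects with a based path fibration
    [Om X -> Pt X -> X] and a shift functor inverse to [Om] up to weak
    equivalence. *)
Record stable := Stable {
  sf :> fibcat;
  Pt : sf -> sf;
  Ptm : forall X Y, mor X Y -> mor (Pt X) (Pt Y);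
  ep : forall X, mor (Pt X) X;
  Om : functor sf sf;
  io : forall X, mor (Om X) (Pt X);
  ep_nat : forall X Y (f : mor X Y), ep Y \oc Ptm f = f \oc ep X;
  io_nat : forall X Y (f : mor X Y), io Y \oc fmap Om f = Ptm f \oc io X;
  ep_fib : forall X, fib (ep X);
  Pt_weak : forall X, weak (zto (Pt X));
  io_ker : forall X, is_ker (io X) (ep X);
  null_path : forall A X (h : mor A (PI X)), dr X \oc h = zfrom X \oc zto A ->
    exists k : mor A (Pt X), ep X \oc k = dl X \oc h;
  Om_weak : forall X Y (f : mor X Y), weak f -> weak (fmap Om f);
  Om_fib : forall X Y (f : mor X Y), fib f -> fib (fmap Om f);
  Om_ker : forall X Y Z (f : mor X Y) (g : mor Y Z), fib g -> is_ker f g ->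
    is_ker (fmap Om f) (fmap Om g);
  Sh : functor sf sf;
  Sh_weak : forall X Y (f : mor X Y), weak f -> weak (fmap Sh f);
  Sh_fib : forall X Y (f : mor X Y), fib f -> fib (fmap Sh f);
  Sh_ker : forall X Y Z (f : mor X Y) (g : mor Y Z), fib g -> is_ker f g ->
    is_ker (fmap Sh f) (fmap Sh g);
  eta : forall X, mor X (Om (Sh X));
  eta_nat : forall X Y (f : mor X Y), eta Y \oc f = fmap Om (fmap Sh f) \oc eta X;
  eta_weak : forall X, weak (eta X);
  kap : forall X, mor (Sh (Om X)) (Om (Sh X));
  kap_nat : forall X Y (f : mor X Y),
    kap Y \oc fmap Sh (fmap Om f) = fmap Om (fmap Sh f) \oc kap X;
  kap_weak : forall X, weak (kap X) }.

(** * Homotopies and fractions in a category of fibrant objects *)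

Section Brown.
Variable C : fibcat.
Implicit Types A B X Y Z : C.

Lemma comp_assoc A B X Y (h : mor X Y) (g : mor B X) (f : mor A B) :
  h \oc g \oc f = h \oc (g \oc f).
Proof. by rewrite compA. Qed.

Lemma idc_iso A : is_iso (idc A).
Proof. by exists (idc A); rewrite comp1f. Qed.

Lemma weak_id A : weak (idc A).
Proof. exact/weak_iso/idc_iso. Qed.

Definition tfib A B (f : mor A B) := fib f /\ weak f.

Lemma tfib_id A : tfib (idc A).
Proof. by split; [apply/fib_iso/idc_iso|apply: weak_id]. Qed.

Lemma tfib_comp A B X (g : mor B X) (f : mor A B) : tfib f -> tfib g -> tfib (g \oc f).
Proof. by case=> f1 f2 [g1 g2]; split; [apply: fib_comp|apply: weak_comp]. Qed.

Lemma tfib_pull A B E (f : mor A B) (p : mor E B) : tfib p ->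
  exists P (q1 : mor P A) (q2 : mor P E), is_pullback f p q1 q2 /\ tfib q1.
Proof.
case=> p1 p2; have [P [q1 [q2 H]]] := pullback_ex f p1.
exists P, q1, q2; split=> //; split; first exact: pullback_fib H p1.
exact: pullback_weak H p1 p2.
Qed.

Lemma pullback_sym A B E P (f : mor A B) (p : mor E B) (q1 : mor P A) (q2 : mor P E) :
  is_pullback f p q1 q2 -> is_pullback p f q2 q1.
Proof.
case=> E1 U; split=> // Z u v uv; have [w [w1 w2 w3]] := U Z v u (esym uv).
by exists w; split=> // w' H1 H2; apply: w3.
Qed.

Lemma tfib_pull2 A B E (f : mor A B) (p : mor E B) : tfib f -> tfib p ->
  exists P (q1 : mor P A) (q2 : mor P E), [/\ f \oc q1 = p \oc q2, tfib q1 & tfib q2].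
Proof.
move=> [f1 f2] Tp; have [P [q1 [q2 [H T1]]]] := tfib_pull f Tp.
exists P, q1, q2; split=> //; first by case: H.
have H' := pullback_sym H.
by split; [apply: pullback_fib H' f1|apply: pullback_weak H' f1 f2].
Qed.

Lemma weak_homotopic A X (h : mor A (PI X)) :
  weak (dl X \oc h) -> weak (dr X \oc h).
Proof.
by move=> W; apply: weak_comp (weak_dr X); apply: weak_cancel W (weak_dl X).
Qed.

(** The refinement by a trivial fibration [s] stands in for cofibrancy of [A]: without it homotopies
    could not be composed. *)
Definition lhtp A X (f g : mor A X) : Prop :=
  exists A' (s : mor A' A) (h : mor A' (PI X)),
    [/\ tfib s, dl X \oc h = f \oc s & dr X \oc h = g \oc s].

Lemma lhtp_path A X (h : mor A (PI X)) : lhtp (dl X \oc h) (dr X \oc h).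
Proof. by exists A, (idc A), h; rewrite !compf1; split=> //; apply: tfib_id. Qed.

Lemma lhtp_refl A X (f : mor A X) : lhtp f f.
Proof.
by have := lhtp_path (dc X \oc f); rewrite !compA dl_dc dr_dc comp1f.
Qed.

Lemma lhtp_pre A B X (f g : mor A X) (u : mor B A) : lhtp f g -> lhtp (f \oc u) (g \oc u).
Proof.
case=> A' [s [h [Ts h0 h1]]]; have [P [q1 [q2 [[E _] T1]]]] := tfib_pull u Ts.
exists P, q1, (h \oc q2); split=> //.
  by rewrite compA h0 comp_assoc -E compA.
by rewrite compA h1 comp_assoc -E compA.
Qed.

Lemma lhtp_post A X Y (f g : mor A X) (u : mor X Y) : lhtp f g -> lhtp (u \oc f) (u \oc g).
Proof.
case=> A' [s [h [Ts h0 h1]]]; exists A', s, (PImap u \oc h); split=> //.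
  by rewrite compA dl_nat comp_assoc h0 compA.
by rewrite compA dr_nat comp_assoc h1 compA.
Qed.

Lemma lhtp_tfib A B X (f g : mor A X) (s : mor B A) : tfib s ->
  lhtp (f \oc s) (g \oc s) -> lhtp f g.
Proof.
move=> Ts [A' [t [h [Tt h0 h1]]]]; exists A', (s \oc t), h.
by split; [apply: tfib_comp|rewrite compA|rewrite compA].
Qed.

(** The criterion behind symmetry, transitivity and cancellation of weak maps: a common section [k]
    makes [P] behave like a path object. It lifts to the object of homotopies between [d0] and [d1],
    and the mapping path object of this lift carries the homotopy. *)
Lemma lhtp_ends X P (d0 d1 : mor P X) (k : mor X P) :
  d0 \oc k = idc X -> d1 \oc k = idc X -> weak d0 -> lhtp d0 d1.
Proof.
move=> k0 k1 W0; have [S [a [b [Fa b0 b1 U]]]] := path_pullback d0 d1.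
have [||kR [ak bk]] := U X k (dc X).
- by rewrite dl_dc k0.
- by rewrite dr_dc k1.
have [Q [r [e [h [Fr Wr Fe [h0 h1] _]]]]] := path_factor kR.
exists Q, (a \oc e), (b \oc e); split.
- split; first exact: fib_comp.
  (* Through [h], the map [d0 a e] is homotopic to [d0 a kR r = d0 k r = r], which is weak. *)
  apply: weak_cancel (W0); rewrite compA -h1 compA -dr_nat -compA.
  by apply: weak_homotopic; rewrite compA dl_nat -compA h0 (comp_assoc d0) (compA a) ak compA k0 comp1f.
- by rewrite compA b0 -compA.
by rewrite compA b1 -compA.
Qed.

Lemma lhtp_sym A X (f g : mor A X) : lhtp f g -> lhtp g f.
Proof.
case=> A' [s [h [Ts h0 h1]]]; apply: (lhtp_tfib Ts); rewrite -h0 -h1.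
apply: lhtp_pre; apply: (lhtp_ends (k := dc X)) (weak_dr X).
  exact: dr_dc.
exact: dl_dc.
Qed.

(** A pair of composable homotopies is a map to [PI X *_X PI X], whose outer ends have the pair of
    constant paths as a common section. *)
Lemma lhtp_trans A X (f g k : mor A X) : lhtp f g -> lhtp g k -> lhtp f k.
Proof.
case=> A1 [s1 [h1 [T1 h10 h11]]] [A2 [s2 [h2 [T2 h20 h21]]]].
have [A' [t1 [t2 [tE Tt1 Tt2]]]] := tfib_pull2 T1 T2.
have [P [q1 [q2 [[qE qU] [Fq Wq]]]]] := tfib_pull (dr X) (conj (fib_dl X) (weak_dl X)).
have [|c [c1 c2 _]] := qU X (dc X) (dc X); first by rewrite dr_dc dl_dc.
have [|w [w1 w2 _]] := qU A' (h1 \oc t1) (h2 \oc t2).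
  by rewrite compA h11 comp_assoc tE compA -h20 -compA.
apply: (lhtp_tfib (tfib_comp Tt1 T1)).
have -> : f \oc (s1 \oc t1) = dl X \oc q1 \oc w by rewrite comp_assoc w1 compA -h10 -compA.
have -> : k \oc (s1 \oc t1) = dr X \oc q2 \oc w by rewrite comp_assoc w2 tE compA -h21 -compA.
apply: lhtp_pre; apply: (lhtp_ends (k := c)).
- by rewrite comp_assoc c1 dl_dc.
- by rewrite comp_assoc c2 dr_dc.
exact: weak_comp Wq (weak_dl X).
Qed.

(** * Spans *)

Record span A X := Span {
  sp_obj : C;
  sp_t : mor sp_obj A;
  sp_f : mor sp_obj X;
  sp_tfib : tfib sp_t }.

Definition span_eq A X (u v : span A X) : Prop :=
  exists A' (s : mor A' (sp_obj u)) (s' : mor A' (sp_obj v)),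
    [/\ tfib s, tfib s', sp_t u \oc s = sp_t v \oc s' & lhtp (sp_f u \oc s) (sp_f v \oc s')].

Lemma span_refl A X (u : span A X) : span_eq u u.
Proof.
exists (sp_obj u), (idc _), (idc _); split=> //; try exact: tfib_id.
exact: lhtp_refl.
Qed.

Lemma span_sym A X (u v : span A X) : span_eq u v -> span_eq v u.
Proof.
by case=> A' [s [s' [T T' E L]]]; exists A', s', s; split=> //; apply: lhtp_sym.
Qed.

Lemma span_trans A X (u v w : span A X) : span_eq u v -> span_eq v w -> span_eq u w.
Proof.
case=> A1 [s [s' [T T' E L]]] [A2 [r [r' [S S' F M]]]].
have [A' [t1 [t2 [tE Tt1 Tt2]]]] := tfib_pull2 T' S.
exists A', (s \oc t1), (r' \oc t2); split; try exact: tfib_comp.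
  by rewrite compA E comp_assoc tE compA F compA.
rewrite !compA; apply: lhtp_trans (lhtp_pre t1 L) _.
by rewrite comp_assoc tE compA; apply: lhtp_pre.
Qed.

Definition span_post A X Y (f : mor X Y) (u : span A X) : span A Y :=
  Span (f \oc sp_f u) (sp_tfib u).

Lemma span_post_eq A X Y (f : mor X Y) (u v : span A X) :
  span_eq u v -> span_eq (span_post f u) (span_post f v).
Proof.
case=> A' [s [s' [T T' E L]]]; exists A', s, s'; split=> //=.
by rewrite -!compA; apply: lhtp_post.
Qed.

Lemma span_weak_surj A X Y (w : mor X Y) (v : span A Y) : weak w ->
  exists u : span A X, span_eq (span_post w u) v.
Proof.
move=> Ww; have [Q [r [e [h [Fr Wr Fe [h0 h1] _]]]]] := path_factor w.
have Te : tfib e.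
  by split=> //; rewrite -h1; apply: weak_homotopic; rewrite h0; apply: weak_comp.
have [A' [s [k [[E _] Ts]]]] := tfib_pull (sp_f v) Te.
exists (Span (r \oc k) (tfib_comp Ts (sp_tfib v))).
exists A', (idc _), s; split=> //=; try exact: tfib_id.
  by rewrite compf1.
rewrite compf1 E compA -h0 -h1 -!compA; exact: lhtp_path.
Qed.

(** [P] consists of two points of [X] with a path between their images. One projection is a base
    change of the trivial fibration [e] and the diagonal is a common section, so [lhtp_ends] makes
    the two projections homotopic. *)
Lemma lhtp_weak_inj A X Y (w : mor X Y) (f g : mor A X) : weak w ->
  lhtp (w \oc f) (w \oc g) -> lhtp f g.
Proof.
move=> Ww [A' [s [k [Ts k0 k1]]]]; apply: (lhtp_tfib Ts).
have [Q [r [e [h [Fr Wr Fe [h0 h1] U]]]]] := path_factor w.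
have Te : tfib e.
  by split=> //; rewrite -h1; apply: weak_homotopic; rewrite h0; apply: weak_comp.
have [P [q1 [q2 [[qE qU] [Fq Wq]]]]] := tfib_pull w Te.
have [|c [c1 c2]] := U X (idc X) (dc Y \oc w).
  by rewrite compA dl_dc comp1f compf1.
have [|d [d1 d2 _]] := qU X (idc X) c.
  by rewrite -h1 comp_assoc c2 compA dr_dc compf1 comp1f.
have [|l [l1 l2]] := U A' (f \oc s) k; first by rewrite k0 compA.
have [|m [m1 m2 _]] := qU A' (g \oc s) l.
  by rewrite -h1 comp_assoc l2 k1 compA.
have -> : f \oc s = r \oc q2 \oc m by rewrite comp_assoc m2.
rewrite -m1; apply: lhtp_pre; apply: lhtp_sym; apply: (lhtp_ends (k := d)) Wq => //.
by rewrite comp_assoc d2.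
Qed.

Lemma span_weak_inj A X Y (w : mor X Y) (u v : span A X) : weak w ->
  span_eq (span_post w u) (span_post w v) -> span_eq u v.
Proof.
move=> Ww [A' [s [s' [T T' E /= L]]]]; exists A', s, s'; split=> //.
by apply: (lhtp_weak_inj Ww); rewrite !compA.
Qed.

(** Zigzags act covariantly on spans: weak equivalences act bijectively. *)
Fixpoint zact A X Y (z : zigzag (@weak C) X Y) : span A X -> span A Y -> Prop :=
  match z with
  | znil _ => fun u v => span_eq u v
  | zfwd _ _ _ f z' => fun u v => zact z' (span_post f u) v
  | zbwd _ _ _ w _ z' => fun u v => exists u', span_eq (span_post w u') u /\ zact z' u' v
  end.

Lemma zact_eq A X Y (z : zigzag (@weak C) X Y) (u u' : span A X) v :
  span_eq u u' -> zact z u v -> zact z u' v.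
Proof.
elim: z u u' v => [B|B D X' f z IH|B D X' w Ww z IH] u u' v uu' /=.
- by apply: span_trans; apply: span_sym.
- by apply: IH; apply: span_post_eq.
by case=> x [xu xv]; exists x; split=> //; apply: span_trans uu'.
Qed.

(** Thus the action descends to the localization. The two cancellation rules are the injectivity and
    surjectivity of weak maps on spans. *)
Lemma zact_zeq A X Y (y z : zigzag (@weak C) X Y) : zeq y z ->
  forall (u : span A X) v, zact y u v <-> zact z u v.
Proof.
elim=> {X Y y z} //=.
- by move=> X Y y z _ IH u v; rewrite IH.
- by move=> X Y x y z _ IH1 _ IH2 u v; rewrite IH1.
- by move=> X1 Y1 Z1 w Ww y z _ IH u v; split=> -[u' [? ?]]; exists u'; split=> //; apply/IH.
- move=> B X z u v; split; apply: zact_eq.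
    exists (sp_obj u), (idc _), (idc _); split=> //; try exact: tfib_id.
    by rewrite /= comp1f; apply: lhtp_refl.
  exists (sp_obj u), (idc _), (idc _); split=> //; try exact: tfib_id.
  by rewrite /= comp1f; apply: lhtp_refl.
- move=> B D X Y f g z u v; split; apply: zact_eq.
    exists (sp_obj u), (idc _), (idc _); split=> //; try exact: tfib_id.
    by rewrite /= compA; apply: lhtp_refl.
  exists (sp_obj u), (idc _), (idc _); split=> //; try exact: tfib_id.
  by rewrite /= compA; apply: lhtp_refl.
- move=> B D X w Ww z u v; split=> [[u' [E Z]]|Z].
    by apply: zact_eq Z; apply: (span_weak_inj Ww).
  by exists u; split=> //; apply: span_refl.
move=> B D X w Ww z u v; split=> [[u' [E Z]]|Z].
  exact: zact_eq Z.
by have [u' u'E] := span_weak_surj u Ww; exists u'; split=> //; apply: zact_eq Z; apply: span_sym.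
Qed.

(** * The homotopy category *)

Definition hoc : category := localization (@weak C).
Definition ho A B (f : mor A B) : @mor hoc A B := loc_hom (@weak C) f.

Lemma ho_id A : ho (idc A) = @idc hoc A.
Proof. by apply/clsP; apply: zeq_id. Qed.

Lemma ho_comp A B X (g : mor B X) (f : mor A B) : ho (g \oc f) = ho g \oc ho f.
Proof. by rewrite [RHS]lcompE; apply/clsP; apply: zeq_sym; apply: zeq_comp. Qed.

Definition hoV A B (w : mor A B) (Ww : weak w) : @mor hoc B A :=
  lcls (zbwd Ww (znil _ A)).

Lemma hoVK A B (w : mor A B) (Ww : weak w) : hoV Ww \oc ho w = @idc hoc A.
Proof. by rewrite [LHS]lcompE; apply/clsP; apply: zeq_fwd_bwd. Qed.

Lemma hoKV A B (w : mor A B) (Ww : weak w) : ho w \oc hoV Ww = @idc hoc B.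
Proof. by rewrite [LHS]lcompE; apply/clsP; apply: zeq_bwd_fwd. Qed.

Lemma ho_weak_iso A B (w : mor A B) : weak w -> is_iso (ho w).
Proof. by move=> Ww; exists (hoV Ww); rewrite hoVK hoKV. Qed.

Lemma iso_epi (D : category) (A B X : D) (s : mor A B) (f g : mor B X) :
  is_iso s -> f \oc s = g \oc s -> f = g.
Proof.
case=> s' [_ ss'] /(congr1 (fun k => k \oc s')).
by rewrite -!Defs.compA ss' !compf1.
Qed.

Lemma iso_mono (D : category) (A B X : D) (s : mor A B) (f g : mor X A) :
  is_iso s -> s \oc f = s \oc g -> f = g.
Proof.
case=> s' [s's _] /(congr1 (fun k => s' \oc k)).
by rewrite !compA s's !comp1f.
Qed.

Lemma iso_comp (D : category) (A B X : D) (g : mor B X) (f : mor A B) :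
  is_iso f -> is_iso g -> is_iso (g \oc f).
Proof.
case=> f' [f1 f2] [g' [g1 g2]]; exists (f' \oc g'); split.
  by rewrite -compA (compA g') g1 comp1f.
by rewrite -compA (compA f) f2 comp1f.
Qed.

Lemma weak_dc X : weak (dc X).
Proof. by apply: weak_cancel (weak_dl X); rewrite dl_dc; apply: weak_id. Qed.

Lemma ho_ends X : ho (dl X) = ho (dr X).
Proof.
by apply: (iso_epi (ho_weak_iso (weak_dc X))); rewrite -!ho_comp dl_dc dr_dc.
Qed.

Lemma lhtp_ho A X (f g : mor A X) : lhtp f g -> ho f = ho g.
Proof.
case=> A' [s [h [[_ Ts] h0 h1]]]; apply: (iso_epi (ho_weak_iso Ts)).
by rewrite -!ho_comp -h0 -h1 !ho_comp ho_ends.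
Qed.

Lemma ho_lhtp A X (f g : mor A X) : ho f = ho g -> lhtp f g.
Proof.
move=> /clsP Z; pose u : span A A := Span (idc A) (tfib_id A).
(* Equal zigzags act equally on the identity span of [A], which they send to the spans of [f] and
   [g]. *)
have [_ H] := zact_zeq Z u (span_post g u).
have {H} [|A' [s [s' [T _]]]] := H _; first exact: span_refl.
rewrite /= !comp1f !compf1 => <-; exact: lhtp_tfib.
Qed.

Definition span_val A X (v : span A X) : @mor hoc A X :=
  ho (sp_f v) \oc hoV (sp_tfib v).2.

Lemma span_valE A X (v : span A X) : span_val v \oc ho (sp_t v) = ho (sp_f v).
Proof. by rewrite -compA hoVK compf1. Qed.

Lemma span_val_post A X Y (f : mor X Y) (u : span A X) :
  span_val (span_post f u) = ho f \oc span_val u.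
Proof. by rewrite /span_val ho_comp -(@compA hoc). Qed.

Lemma span_eq_val A X (u v : span A X) : span_eq u v -> span_val u = span_val v.
Proof.
case=> A' [s [s' [T T' E /lhtp_ho L]]].
apply: (iso_epi (ho_weak_iso (sp_tfib u).2)); apply: (iso_epi (ho_weak_iso T.2)).
have E2 : ho (sp_t u) \oc ho s = ho (sp_t v) \oc ho s' by rewrite -!ho_comp E.
by rewrite span_valE -(@compA hoc) E2 (@compA hoc) span_valE -!ho_comp.
Qed.

(** Along the zigzag the span is composed with the forward maps, while the backward maps are
    inverted by [span_weak_surj]. *)
Lemma span_of A X (u : @mor hoc A X) : exists v : span A X, u = span_val v.
Proof.
suff H B (z : zigzag (@weak C) A X) (v : span B A) :
    exists v' : span B X, (lcls z : @mor hoc _ _) \oc span_val v = span_val v'.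
  have [v' E] := H A (rep u) (Span (idc A) (tfib_id A)); exists v'; rewrite -E.
  rewrite -[lcls _]/(cls _ (rep u)) repK -[LHS](@compf1 hoc); congr (_ \oc _).
  apply: (iso_epi (ho_weak_iso (weak_id A))).
  by rewrite comp1f; symmetry; exact: (span_valE (Span (idc A) (tfib_id A))).
elim: z B v => {u} [D|D D' Y f z IH|D D' Y w Ww z IH] B v.
- by exists v; apply: (@comp1f hoc).
- have [v' E] := IH B (span_post f v); exists v'; rewrite -E.
  have -> : lcls (zfwd f z) = (lcls z : @mor hoc _ _) \oc ho f by rewrite [RHS]lcompE.
  by rewrite span_val_post (@compA hoc).
have [v0 /span_eq_val E] := span_weak_surj v Ww.
have [v' E'] := IH B v0; exists v'; rewrite -E'.
have -> : lcls (zbwd Ww z) = (lcls z : @mor hoc _ _) \oc hoV Ww by rewrite [RHS]lcompE.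
by rewrite -(@compA hoc) -E span_val_post (@compA hoc _ _ _ _ (hoV Ww)) hoVK comp1f.
Qed.

Lemma ho_rep A X (u : @mor hoc A X) : exists A' (t : mor A' A) (f : mor A' X),
  tfib t /\ u \oc ho t = ho f.
Proof.
have [[A' t f T] ->] := span_of u; exists A', t, f; split=> //.
exact: (span_valE (Span f T)).
Qed.

End Brown.

(** * Loop spaces *)

Definition loopf (X Y : psset) (f : psmap X Y) : psmap (loop_space X) (loop_space Y).
Proof.
refine (@PsMap (loop_space X) (loop_space Y)
  (fun n l => @Loop Y n (fun k a t => f k (lp l a t)) _ _) _ _).
- by move=> *; apply: loop_eq.
- by move=> n; apply: loop_eq => k a t /=; rewrite pf_pt.
Unshelve.
- by move=> k l' c a t a' t' aE tE; rewrite (lp_act l aE tE) pf_act.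
- by move=> k a t tc; rewrite lp_end // pf_pt.
Defined.

Definition loop_path (X : psset) : psmap (loop_space X) (pathS X).
Proof.
refine (@PsMap (loop_space X) (pathS X) (fun n l => @Path X n (lp l) _) _ _).
- by move=> *; apply: path_eq.
- by move=> n; apply: path_eq.
Unshelve. by move=> *; apply: lp_act.
Defined.

Lemma const_cst1 k (t : ordmap k 1) : (forall i j, t i = t j) -> exists e, t = cst1 e k.
Proof.
move=> tc; exists (sval (t (vertex0 k)) == 1); apply: om_ext => i /=.
by rewrite (tc i (vertex0 k)); case: (t _) => u Hu /=; lia.
Qed.

Lemma path_loop (X : psset) n (H : pathS X n) :
  ev X false n H = bpt n -> ev X true n H = bpt n ->
  exists l : loop_space X n, loop_path X n l = H.
Proof.
move=> H0 H1.
have h1 k l (c : ordmap k l) (a : ordmap l n) (t : ordmap l 1) (a' : ordmap k n) (t' : ordmap k 1) :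
    (forall i, a' i = a (c i)) -> (forall i, t' i = t (c i)) -> pv H a' t' = sact c (pv H a t).
  by move=> aE tE; apply: pv_comp; apply: om_ext => i; rewrite /= ?aE ?tE.
have h2 k (a : ordmap k n) (t : ordmap k 1) : (forall i j, t i = t j) -> pv H a t = bpt k.
  by move=> /const_cst1[e ->]; rewrite pv_cst; case: e; rewrite ?H0 ?H1 act_bpt.
by exists (Loop h1 h2); apply: path_eq.
Qed.

Lemma loop_path_inj (X : psset) n (l l' : loop_space X n) :
  loop_path X n l = loop_path X n l' -> l = l'.
Proof.
move=> E; apply: loop_eq => k a t.
exact: (congr1 (fun u : pathS X n => pv u a t) E).
Qed.

Lemma loop_path_ev (X : psset) n (l : loop_space X n) e : ev X e n (loop_path X n l) = bpt n.
Proof. by rewrite /= lp_end // => i j; apply: simp_eq. Qed.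

(** A lifting problem for loops is one for paths over paths in which both ends are prescribed to be
    the base point. *)
Lemma loopf_ext (X Y : psset) (q : psmap X Y) n (S : sieve n) :
  ext (gap2 q) S -> ext (loopf q) S.
Proof.
move=> K x y xn xy.
have mP : q n (bpt n) = ev Y false n (loop_path Y n y) /\
  q n (bpt n) = ev Y true n (loop_path Y n y) by rewrite !loop_path_ev pf_pt.
have [||H [HE Hx]] := K (fun k a => loop_path X k (x k a)) (exist _ (bpt n, bpt n, loop_path Y n y) mP) _ _.
- exact: pmapn_map.
- move=> k a aS; apply: sval_eq; congr (_, _, _).
  + by rewrite loop_path_ev act_bpt.
  + by rewrite loop_path_ev act_bpt.
  by rewrite -pf_act -xy //; apply: path_eq.
have E0 : ev X false n H = bpt n := congr1 (fun u : mtch q n => (sval u).1.1) HE.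
have E1 : ev X true n H = bpt n := congr1 (fun u : mtch q n => (sval u).1.2) HE.
have EH : pathf q n H = loop_path Y n y := congr1 (fun u : mtch q n => (sval u).2) HE.
have [l lH] := path_loop E0 E1; exists l; split.
  by apply: loop_path_inj; rewrite -EH -lH; apply: path_eq.
by move=> k a aS; apply: loop_path_inj; rewrite pf_act lH Hx.
Qed.

Lemma loopf_kf (X Y : psset) (q : psmap X Y) : kf q -> kf (loopf q).
Proof. by move=> K n k kn; apply/loopf_ext/gap2_kf. Qed.

Lemma loopf_tf (X Y : psset) (q : psmap X Y) : tf q -> tf (loopf q).
Proof. by move=> K n; apply/loopf_ext/gap2_tf. Qed.

Lemma kan_loop (X : psset) : kan X -> kan (loop_space X).
Proof.
move=> KX; apply: (kan_kf_pt (loopf_kf KX)); apply: tf_kf => n x y _ _.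
by exists (bpt n); split=> *; [apply: ptS_eq|apply: loop_eq => *; apply: ptS_eq].
Qed.

Lemma spb_loop (A B E Z : psset) (f : psmap A B) (p : psmap E B)
    (q1 : psmap Z A) (q2 : psmap Z E) :
  spb f p q1 q2 -> spb (loopf f) (loopf p) (loopf q1) (loopf q2).
Proof.
move=> S; have [qe qi qx] := S; have [pe pi px] := spb_path S; split.
- by move=> n z; apply: loop_eq => k a t /=.
- move=> n z z' E1 E2; apply: loop_eq => k a t; apply: qi.
    exact: (congr1 (fun u : loop_space A n => lp u a t) E1).
  exact: (congr1 (fun u : loop_space E n => lp u a t) E2).
move=> n a e ae; have [|z [z1 z2]] := px n (loop_path A n a) (loop_path E n e).
  apply: path_eq => k b t.
  exact: (congr1 (fun u : loop_space B n => lp u b t) ae).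
have zE i : ev Z i n z = bpt n.
  apply: qi; rewrite pf_pt.
    by have := loop_path_ev a i; rewrite -z1.
  by have := loop_path_ev e i; rewrite -z2.
have [l lz] := path_loop (zE false) (zE true); exists l.
by split; apply: loop_path_inj; [rewrite -z1|rewrite -z2]; rewrite -lz; apply: path_eq.
Qed.

(** * Constructions on modules, level by level *)

Section Modules.
Variable R : symmetric_ring_spectrum.
Implicit Types M N L : module R.

Definition lvl M N (f : module_map M N) (A : finite_set) : psmap (M A) (N A) :=
  PsMap (mm_act f (A := A)) (mm_bpt f A).

Lemma kan_lvl M A : kan (M A).
Proof. by apply/kanP; apply: fib_kan (mfib M) A. Qed.

Lemma kan_loop_lvl M A : kan (loop_space (M A)).
Proof. exact/kan_loop/kan_lvl. Qed.

Definition adjS (M : premodule R) B C (e : bij (fs_sum fs_unit B) C) :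
  psmap (M B) (loop_space (M C)).
Proof.
refine (@PsMap (M B) (loop_space (M C)) (@adjoint R M B C e) _ _).
- by move=> m n a x; apply: loop_eq => k b t /=; rewrite sactA.
- by move=> n; apply: loop_eq => k b t /=; rewrite act_bpt smul_bptr tr_bpt.
Defined.

Lemma adjS_weq M B C (e : bij (fs_sum fs_unit B) C) : weq (adjS M e).
Proof.
by apply/weak_equivP; [apply: kan_lvl|apply: kan_loop_lvl|apply: fib_omega (mfib M) _ _ _].
Qed.

Definition weakm M N (f : module_map M N) := forall A, weq (lvl f A).
Definition fibm M N (f : module_map M N) := forall A, kf (lvl f A).

Lemma weakmP M N (f : module_map M N) : level_equiv f <-> weakm f.
Proof.
by split=> W A; have := W A; rewrite -(weak_equivP (lvl f A) (@kan_lvl M A) (@kan_lvl N A)).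
Qed.

(** ** The zero module *)

Definition pt_seq : symseq.
Proof.
by apply: (@SymSeq (fun _ => ptS) (fun _ _ _ _ _ => tt)) => // *; apply: ptS_eq.
Defined.

Definition pt_pre : premodule R.
Proof.
by apply: (@PreModule R pt_seq (fun _ _ _ _ _ => tt)) => // *; apply: ptS_eq.
Defined.

Lemma kan_ptS : kan ptS.
Proof.
by apply: tf_kf => n x y _ _; exists (bpt n); split=> *; apply: ptS_eq.
Qed.

Lemma pt_fibrant : fibrant pt_pre.
Proof.
split=> [A|B C e]; first by apply/kanP/kan_ptS.
apply/(weak_equivP (adjS pt_pre e) kan_ptS (kan_loop kan_ptS)).
apply: tf_weq => n x y _ _; exists tt.
by split=> *; [apply: loop_eq => *; apply: ptS_eq|apply: ptS_eq].
Qed.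

Definition pt_mod : module R := Module pt_fibrant.

Definition zto_mod M : module_map M pt_mod.
Proof. by refine (@ModuleMap R M pt_mod (fun _ _ _ => tt) _ _ _ _). Defined.

Definition zfrom_mod M : module_map pt_mod M.
Proof.
refine (@ModuleMap R pt_mod M (fun A n _ => bpt n) _ _ _ _) => //.
- by move=> *; rewrite act_bpt.
- by move=> *; rewrite tr_bpt.
- by move=> *; rewrite smul_bptr.
Defined.

(** ** Pullbacks *)

Section PullbackModule.
Variables (M N L : module R) (f : module_map M N) (p : module_map L N).

Definition pb_seq : symseq.
Proof.
refine (@SymSeq (fun A => pbS (lvl f A) (lvl p A))
  (fun A B g n u => exist _ (tr g (sval u).1, tr g (sval u).2) _) _ _ _ _).
- by move=> *; apply: sval_eq; congr (_, _); apply: tr_act.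
- by move=> *; apply: sval_eq; congr (_, _); apply: tr_bpt.
- by move=> A g n [[x y] H] gE; apply: sval_eq; congr (_, _); apply: tr_id.
- by move=> A B D g h k n u kE; apply: sval_eq; congr (_, _); apply: tr_comp.
Unshelve. by rewrite /= !mm_tr; congr (tr g _); apply: (svalP u).
Defined.

Definition pb_pre : premodule R.
Proof.
refine (@PreModule R pb_seq
  (fun A B n r u => exist _ (smul r (sval u).1, smul r (sval u).2) _) _ _ _ _ _ _).
- by move=> *; apply: sval_eq; congr (_, _); apply: smul_act.
- by move=> *; apply: sval_eq; congr (_, _); apply: smul_tr.
- by move=> *; apply: sval_eq; congr (_, _); apply: smul_bptl.
- by move=> *; apply: sval_eq; congr (_, _); apply: smul_bptr.
- by move=> *; apply: sval_eq; congr (_, _); apply: smulA.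
- by move=> A n [[x y] H]; apply: sval_eq; congr (_, _); apply: smul1.
Unshelve. by rewrite /= !mm_smul; congr (smul r _); apply: (svalP u).
Defined.

Hypothesis pF : fibm p.

Lemma pb_kan A : kan (pb_pre A).
Proof.
exact: (@kan_kf_pt (pbS (lvl f A) (lvl p A)) (M A) (pb1 _ _)
  (spb_kf (pbS_spb (lvl f A) (lvl p A)) (@pF A)) (@kan_lvl M A)).
Qed.

Lemma adjS_nat M1 M2 (g : module_map M1 M2) B C (e : bij (fs_sum fs_unit B) C) n x :
  adjS M2 e n (lvl g B n x) = loopf (lvl g C) n (adjS M1 e n x).
Proof. by apply: loop_eq => k a t /=; rewrite mm_tr mm_smul mm_act. Qed.

(** The adjoint structure map of the pullback is induced by those of [M], [N] and [L], which are
    weak equivalences; so the Omega condition is an instance of the cogluing lemma. *)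
Lemma pb_fibrant : fibrant pb_pre.
Proof.
split=> [A|B C e]; first exact/kanP/pb_kan.
apply/(weak_equivP (adjS pb_pre e) (@pb_kan B) (kan_loop (@pb_kan C))).
apply: (@cogluing _ _ _ _ _ _ _ _ (lvl f B) (lvl p B) (pb1 _ _) (pb2 _ _)
  (loopf (lvl f C)) (loopf (lvl p C)) (loopf (pb1 _ _)) (loopf (pb2 _ _))
  (adjS M e) (adjS N e) (adjS L e)); try exact: kan_lvl; try exact: kan_loop_lvl;
  try exact: adjS_weq.
- exact/kan_loop/pb_kan.
- exact: pF.
- exact/loopf_kf/pF.
- exact: pbS_spb.
- exact/spb_loop/pbS_spb.
- by move=> n a; apply: adjS_nat.
- by move=> n a; apply: adjS_nat.
- by move=> n z; apply: loop_eq.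
- by move=> n z; apply: loop_eq.
Qed.

Definition pb_mod : module R := Module pb_fibrant.

Definition pbm1 : module_map pb_mod M.
Proof. by refine (@ModuleMap R pb_mod M (fun A n u => (sval u).1) _ _ _ _). Defined.

Definition pbm2 : module_map pb_mod L.
Proof. by refine (@ModuleMap R pb_mod L (fun A n u => (sval u).2) _ _ _ _). Defined.

Definition pbm_pair Z (g : module_map Z M) (h : module_map Z L)
  (gh : forall A n z, f A n (g A n z) = p A n (h A n z)) : module_map Z pb_mod.
Proof.
refine (@ModuleMap R Z pb_mod (fun A n z => exist _ (g A n z, h A n z) (gh A n z)) _ _ _ _).
- by move=> *; apply: sval_eq; congr (_, _); apply: mm_act.
- by move=> *; apply: sval_eq; congr (_, _); apply: mm_bpt.
- by move=> *; apply: sval_eq; congr (_, _); apply: mm_tr.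
- by move=> *; apply: sval_eq; congr (_, _); apply: mm_smul.
Defined.

End PullbackModule.

(** ** Path objects *)

Section PathModule.
Variable M : module R.

Definition path_seq : symseq.
Proof.
refine (@SymSeq (fun A => pathS (M A))
  (fun A B g n H => @Path (M B) n (fun k a t => tr g (pv H a t)) _) _ _ _ _).
- by move=> *; apply: path_eq.
- by move=> *; apply: path_eq => *; apply: tr_bpt.
- by move=> *; apply: path_eq => *; apply: tr_id.
- by move=> *; apply: path_eq => *; apply: tr_comp.
Unshelve. by move=> *; rewrite pv_act tr_act.
Defined.

Definition path_pre : premodule R.
Proof.
refine (@PreModule R path_seq
  (fun A B n r H => @Path (M (fs_sum A B)) n (fun k a t => smul (sact a r) (pv H a t)) _) _ _ _ _ _ _).
- by move=> *; apply: path_eq => *; rewrite /= sactA.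
- by move=> *; apply: path_eq => *; rewrite /= -tr_act smul_tr.
- by move=> *; apply: path_eq => *; rewrite /= act_bpt smul_bptl.
- by move=> *; apply: path_eq => *; rewrite /= smul_bptr.
- by move=> *; apply: path_eq => *; rewrite /= -rmul_act smulA.
- by move=> *; apply: path_eq => *; rewrite /= sactA to0_comp smul1.
Unshelve. by move=> *; rewrite pv_act -sactA smul_act.
Defined.

Lemma path_kan A : kan (path_pre A).
Proof. exact: kan_kf_pt (tf_kf (ev_tf (e := false) (@kan_lvl M A))) (@kan_lvl M A). Qed.

(** Evaluation at an end is a weak equivalence on levels and on their loop spaces, so the Omega
    condition of [M] passes to the path object by cancellation. *)
Lemma path_fibrant : fibrant path_pre.
Proof.
split=> [A|B C e]; first exact/kanP/path_kan.
apply/(weak_equivP (adjS path_pre e) (@path_kan B) (kan_loop (@path_kan C))).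
apply: (@weq_cancel _ _ _ (loopf (ev (M C) false))).
- exact: kan_loop_lvl.
- apply: (weq_ext (f := ps_comp (adjS M e) (ev (M B) false))).
    by move=> n H; apply: loop_eq => k a t /=; rewrite ?sact1 ?om_compf1 ?pv_cst ?sact1.
  apply: weq_comp; [exact: kan_loop_lvl| |exact: adjS_weq].
  exact/tf_weq/ev_tf/kan_lvl.
exact/tf_weq/loopf_tf/ev_tf/kan_lvl.
Qed.

Definition path_mod : module R := Module path_fibrant.

Definition evm (e : bool) : module_map path_mod M.
Proof.
refine (@ModuleMap R path_mod M (fun A n H => ev (M A) e n H) _ _ _ _) => //.
- by move=> A m n a H; apply: pf_act.
- by move=> A B n r H; rewrite /= sact1.
Defined.

Definition cpathm : module_map M path_mod.
Proof.
refine (@ModuleMap R M path_mod (fun A n x => cpath (M A) n x) _ _ _ _).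
- by move=> *; apply: pf_act.
- by move=> *; apply: pf_pt.
- by move=> *; apply: path_eq => *; rewrite /= tr_act.
- by move=> *; apply: path_eq => *; rewrite /= smul_act.
Defined.

End PathModule.

Definition pathm M N (f : module_map M N) : module_map (path_mod M) (path_mod N).
Proof.
refine (@ModuleMap R (path_mod M) (path_mod N) (fun A n H => pathf (lvl f A) n H) _ _ _ _).
- by move=> *; apply: pf_act.
- by move=> *; apply: pf_pt.
- by move=> *; apply: path_eq => *; rewrite /= mm_tr.
- by move=> *; apply: path_eq => *; rewrite /= mm_smul.
Defined.

End Modules.

(** * Modules form a category of fibrant objects *)

Section ModuleFibcat.
Variable R : symmetric_ring_spectrum.
Notation mc := (module_cat R).
Implicit Types M N L Z : mc.

Lemma mm_congr M N (f g : mor M N) A n (x : (M : module R) A n) : f = g -> f A n x = g A n x.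
Proof. by move=> ->. Qed.

Lemma weakm_iso M N (f : mor M N) : is_iso f -> weakm f.
Proof.
case=> g [gf fg] A; apply: (tf_weq (@weq_bij _ _ (lvl f A) (fun n y => g A n y) _ _)).
  by move=> n x; exact: (mm_congr x gf).
by move=> n x; exact: (mm_congr x fg).
Qed.

Lemma weakm_comp M N L (g : mor N L) (f : mor M N) : weakm f -> weakm g -> weakm (g \oc f).
Proof.
move=> Wf Wg A; apply: (weq_ext (f := ps_comp (lvl g A) (lvl f A))) => //.
exact: weq_comp (@kan_lvl R L A) (Wf A) (Wg A).
Qed.

Lemma weakm_cancel M N L (g : mor N L) (f : mor M N) : weakm (g \oc f) -> weakm g -> weakm f.
Proof.
move=> W Wg A; apply: weq_cancel (@kan_lvl R L A) _ (Wg A).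
by apply: weq_ext (W A).
Qed.

Lemma kf_comp (X Y Z : psset) (g : psmap Y Z) (f : psmap X Y) :
  kf f -> kf g -> kf (ps_comp g f).
Proof.
move=> Kf Kg n k kn x y xn xy.
have [||z [zy zx]] := Kg n k kn (fun m a => f m (x m a)) y _ _.
- exact: pmapn_map.
- exact: xy.
have [m a aS|w [wz wx]] := Kf n k kn x z xn _; first by rewrite zx.
by exists w; split=> //=; rewrite wz.
Qed.

Lemma fibm_comp M N L (g : mor N L) (f : mor M N) : fibm f -> fibm g -> fibm (g \oc f).
Proof. by move=> Ff Fg A; apply: kf_comp (Ff A) (Fg A). Qed.

Lemma fibm_iso M N (f : mor M N) : is_iso f -> fibm f.
Proof.
case=> g [gf fg] A; apply: (tf_kf (@weq_bij _ _ (lvl f A) (fun n y => g A n y) _ _)).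
  by move=> n x; exact: (mm_congr x gf).
by move=> n x; exact: (mm_congr x fg).
Qed.

Lemma zto_modE M (f : mor M (pt_mod R : mc)) : f = zto_mod M.
Proof. by apply: module_map_eq => *; apply: ptS_eq. Qed.

Lemma zfrom_modE M (f : mor (pt_mod R : mc) M) : f = zfrom_mod M.
Proof. by apply: module_map_eq => A n [] /=; rewrite -(mm_bpt f). Qed.

Lemma fibm_zto M : fibm (zto_mod M).
Proof. by move=> A; apply: kan_lvl. Qed.

Section Pb.
Variables (M N L : mc) (f : mor M N) (p : mor L N) (pF : fibm p).

Lemma pb_is_pullback : @is_pullback mc _ _ _ _ f p (pbm1 f pF) (pbm2 f pF).
Proof.
split; first by apply: module_map_eq => A n [u uE]; exact: uE.
move=> Z u v uv; exists (pbm_pair pF (fun A n z => mm_congr z uv)).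
split; try by apply: module_map_eq.
move=> w' w1 w2; apply: module_map_eq => A n z; apply: sval_eq.
by rewrite /= -w1 -w2 /=; case: (sval _).
Qed.

Variables (P : mc) (q1 : mor P M) (q2 : mor P L).

(** The universal property makes [P] isomorphic to the constructed pullback, so it is computed by
    elements at each level. *)
Lemma is_pullback_spb : is_pullback f p q1 q2 ->
  forall A, spb (lvl f A) (lvl p A) (lvl q1 A) (lvl q2 A).
Proof.
move=> [E U] A; have [E' U'] := pb_is_pullback.
have [w [w1 w2 _]] := U' P q1 q2 E.
have [v [v1 v2 _]] := U _ _ _ E'.
have vw : v \oc w = idc P.
  have [i [_ _ iU]] := U P q1 q2 E; rewrite [RHS]iU ?compf1 //; apply: iU.
    by rewrite compA v1 w1.
  by rewrite compA v2 w2.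
split.
- by move=> n z; exact: (mm_congr z E).
- move=> n z z' E1 E2; rewrite -[z](mm_congr z vw) -[z'](mm_congr z' vw) /=.
  congr (v A n _); apply: sval_eq.
  move: (mm_congr z w1) (mm_congr z w2) (mm_congr z' w1) (mm_congr z' w2) E1 E2.
  rewrite /=; case: (sval (w A n z)) (sval (w A n z')) => a b [a' b'] /= -> -> -> ->.
  by move=> -> ->.
move=> n a e ae; exists (v A n (exist _ (a, e) ae)); split.
  exact: (mm_congr (exist _ (a, e) ae : (pb_mod f pF : module R) A n) v1).
exact: (mm_congr (exist _ (a, e) ae : (pb_mod f pF : module R) A n) v2).
Qed.

End Pb.

Lemma spb_weq_tf (A B E P : psset) (f : psmap A B) (p : psmap E B) (q1 : psmap P A)
  (q2 : psmap P E) : spb f p q1 q2 -> kf p -> weq p -> tf q1.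
Proof. by move=> S Kp Wp; apply: spb_tf S (weq_kf_tf Kp Wp). Qed.

Lemma spb_id (B E : psset) (p : psmap E B) : spb (ps_id B) p p (ps_id E).
Proof. by split=> // n a e ae; exists e. Qed.

Definition prod_mod M N : mc := pb_mod (zto_mod M) (@fibm_zto N).

Definition ends_mod M : mor (path_mod M : mc) (prod_mod M M) :=
  @pbm_pair R M (pt_mod R) M (zto_mod M) (zto_mod M) (@fibm_zto M) (path_mod M) (evm M false) (evm M true)
    (fun _ _ _ => erefl).

Lemma path_ends_ext (X : psset) n k (x : forall m, ordmap m n.+1 -> pathS X m) (y0 y1 : X n.+1) :
  kan X -> k <= n.+1 -> pmapn (@hn n.+1 k) x ->
  (forall m (a : ordmap m n.+1), hn k a -> ev X false m (x m a) = sact a y0) ->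
  (forall m (a : ordmap m n.+1), hn k a -> ev X true m (x m a) = sact a y1) ->
  exists H : pathS X n.+1, [/\ ev X false _ H = y0, ev X true _ H = y1 &
    forall m (a : ordmap m n.+1), hn k a -> sact a H = x m a].
Proof.
move=> KX kn xn x0 x1.
have mP : to_pt X n.+1 y0 = ev ptS false n.+1 (path_bpt ptS n.+1) /\
  to_pt X n.+1 y1 = ev ptS true n.+1 (path_bpt ptS n.+1) by [].
have [|H [HE Hh]] := gap2_kf KX kn (x := x)
   (y := exist _ (y0, y1, path_bpt ptS n.+1) mP) xn _.
  move=> m a aS; apply: sval_eq; congr (_, _, _); [exact: x0|exact: x1|].
  by apply: path_eq => *; apply: ptS_eq.
exists H; split=> //.
  exact: (congr1 (fun u : mtch (to_pt X) n.+1 => (sval u).1.1) HE).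
exact: (congr1 (fun u : mtch (to_pt X) n.+1 => (sval u).1.2) HE).
Qed.

Lemma ends_fib M : fibm (ends_mod M).
Proof.
move=> A n k kn x y xn xy.
have [||H [H0 H1 Hh]] := @path_ends_ext (M A) n k x (sval y).1 (sval y).2 (@kan_lvl R M A) kn xn _ _.
- move=> m a aS; exact: (congr1 (fun u : prod_mod M M A m => (sval u).1) (xy m a aS)).
- move=> m a aS; exact: (congr1 (fun u : prod_mod M M A m => (sval u).2) (xy m a aS)).
by exists H; split=> //; apply: sval_eq; rewrite [RHS]surjective_pairing -H0 -H1.
Qed.

Definition module_fibcat : fibcat.
Proof.
refine (@FibCat mc (@level_equiv R) (@fibm R) _ _ _ fibm_comp fibm_iso (pt_mod R)
  (@zto_mod R) (@zfrom_mod R) zto_modE zfrom_modE fibm_zto _ _ _ _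
  (@path_mod R : mc -> mc) (fun M => evm M false) (fun M => evm M true) (@cpathm R)
  (@pathm R) _ _ _ _ _ _ _ _ _ _).
- by move=> M N f /weakm_iso/weakmP.
- by move=> M N L g f /weakmP Wf /weakmP Wg; apply/weakmP/weakm_comp.
- by move=> M N L g f /weakmP Wf /weakmP Wg; apply/weakmP; apply: weakm_cancel Wf Wg.
- move=> M N L f p pF; exists (pb_mod f pF), (pbm1 f pF), (pbm2 f pF).
  exact: pb_is_pullback.
- by move=> M N L P f p q1 q2 pb pF A; apply: spb_kf (is_pullback_spb pF pb A) (@pF A).
- move=> M N L P f p q1 q2 pb pF /weakmP pW; apply/weakmP => A.
  exact: tf_weq (spb_weq_tf (is_pullback_spb pF pb A) (@pF A) (pW A)).
- move=> M N L P f p q1 q2 pb pF /weakmP fW; apply/weakmP => A.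
  by apply: (base_change_weq (phi := lvl q2 A) (@pF A) (fW A) _ (is_pullback_spb pF pb A) (spb_id (lvl p A))) => // n z;
    rewrite /= -[LHS](spb_eq (is_pullback_spb pF pb A)).
- by move=> M N f; apply: module_map_eq.
- by move=> M N f; apply: module_map_eq.
- by move=> M; apply: module_map_eq => A n x; apply: ev_cpath.
- by move=> M; apply: module_map_eq => A n x; apply: ev_cpath.
- by move=> M; apply/weakmP => A; apply/tf_weq/(@ev_tf (M A) false)/kan_lvl.
- by move=> M; apply/weakmP => A; apply/tf_weq/(@ev_tf (M A) true)/kan_lvl.
- by move=> M A; apply/tf_kf/(@ev_tf (M A) false)/kan_lvl.
- by move=> M A; apply/tf_kf/(@ev_tf (M A) true)/kan_lvl.
- move=> M Z u v.
  (* Homotopies from [u] to [v] are the pullback along [(u, v)] of the fibration of both ends. *)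
  pose uv : mor Z (prod_mod M M) := @pbm_pair R M (pt_mod R) M (zto_mod M) (zto_mod M) (@fibm_zto M) Z u v (fun _ _ _ => erefl).
  have [E U] := pb_is_pullback uv (ends_fib (M := M)).
  exists (pb_mod uv (ends_fib (M := M))), (pbm1 uv (ends_fib (M := M))), (pbm2 uv (ends_fib (M := M))).
  split.
  + move=> A; apply: spb_kf (pbS_spb (lvl uv A) (lvl (ends_mod M) A)) _; exact: ends_fib.
  + apply: module_map_eq => A n z.
    by have /(congr1 (fun u : prod_mod M M A n => (sval u).1)) := mm_congr z E.
  + apply: module_map_eq => A n z.
    by have /(congr1 (fun u : prod_mod M M A n => (sval u).2)) := mm_congr z E.
  move=> A a h h0 h1; have [|w [w1 w2 _]] := U A a h; last by exists w.
  apply: module_map_eq => B n z; apply: sval_eq.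
  by rewrite -[LHS]/(_, _) -[RHS]/(_, _); congr (_, _); [exact: (esym (mm_congr z h0))|exact: (esym (mm_congr z h1))].
(* The factorization is through the mapping path object: the pullback along [f] of the start of a
   path. *)
move=> M N f; pose dF : fibm (evm N false) := fun A => tf_kf (@ev_tf (N A) false (@kan_lvl R N A)).
have [E U] := pb_is_pullback f dF.
exists (pb_mod f dF), (pbm1 f dF), (@compm mc (pb_mod f dF) (path_mod N) N (evm N true) (pbm2 f dF)), (pbm2 f dF).
have dT A : tf (lvl (evm N false) A) by apply/(@ev_tf (N A) false)/kan_lvl.
split.
- by move=> A; apply/tf_kf; apply: spb_tf (pbS_spb _ _) (dT A).
- by apply/weakmP => A; apply/tf_weq; apply: spb_tf (pbS_spb _ _) (dT A).
- by move=> A; apply: cyl_kf (@kan_lvl R M A) (@kan_lvl R N A).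
- by split=> //; rewrite -E.
by move=> A a k k0; have [|w [w1 w2 _]] := U A a k; [|exists w].
Defined.

End ModuleFibcat.

Lemma rel_path_ends_ext (X Y : psset) (p : psmap X Y) n k
    (x : forall m, ordmap m n.+1 -> pathS X m) (y0 y1 : X n.+1) (H : pathS Y n.+1) :
  kf p -> k <= n.+1 -> pmapn (@hn n.+1 k) x ->
  (forall m (a : ordmap m n.+1), hn k a -> ev X false m (x m a) = sact a y0) ->
  (forall m (a : ordmap m n.+1), hn k a -> ev X true m (x m a) = sact a y1) ->
  (forall m (a : ordmap m n.+1), hn k a -> pathf p m (x m a) = sact a H) ->
  p _ y0 = ev Y false _ H -> p _ y1 = ev Y true _ H ->
  exists K : pathS X n.+1, [/\ ev X false _ K = y0, ev X true _ K = y1, pathf p _ K = H &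
    forall m (a : ordmap m n.+1), hn k a -> sact a K = x m a].
Proof.
move=> Kp kn xn x0 x1 xH H0 H1.
have [|K [KE Kh]] := gap2_kf Kp kn (x := x) (y := exist _ (y0, y1, H) (conj H0 H1)) xn _.
  by move=> m a aS; apply: sval_eq; congr (_, _, _); [exact: x0|exact: x1|exact: xH].
exists K; split=> //.
- exact: (congr1 (fun u : mtch p n.+1 => (sval u).1.1) KE).
- exact: (congr1 (fun u : mtch p n.+1 => (sval u).1.2) KE).
exact: (congr1 (fun u : mtch p n.+1 => (sval u).2) KE).
Qed.

(** * Based paths, loops and the shift of modules *)

Section ModuleStable.
Variable R : symmetric_ring_spectrum.
Notation mc := (module_cat R).
Implicit Types M N L Z : mc.

Lemma dr_fib M : fibm (evm M true).
Proof. by move=> A; apply/tf_kf/(@ev_tf (M A) true)/kan_lvl. Qed.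

Definition pt_mod_path M : mc := pb_mod (zfrom_mod M) (@dr_fib M).
Notation PM := pt_mod_path.

Definition pt_in M : mor (PM M) (path_mod M : mc) := pbm2 (zfrom_mod M) (@dr_fib M).

Definition pt_pair M Z (h : mor Z (path_mod M : mc))
    (hE : forall A n z, bpt n = ev (M A) true n (h A n z)) : mor Z (PM M) :=
  @pbm_pair R _ _ _ (zfrom_mod M) (evm M true) (@dr_fib M) Z (zto_mod Z) h hE.

Definition epm M : mor (PM M) M := @compm mc _ _ _ (evm M false) (pt_in M).

Lemma pt_in_end M A n (z : PM M A n) : bpt n = ev (M A) true n (pt_in M A n z).
Proof. exact: (svalP z). Qed.

Lemma pb_inj M N L (f : mor M N) (p : mor L N) (pF : fibm p) A n
  (z z' : (pb_mod f pF : module R) A n) :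
  pbm1 f pF A n z = pbm1 f pF A n z' -> pbm2 f pF A n z = pbm2 f pF A n z' -> z = z'.
Proof. exact: (spb_inj (pbS_spb (lvl f A) (lvl p A))). Qed.

Lemma pt_in_inj M A n (z z' : PM M A n) : pt_in M A n z = pt_in M A n z' -> z = z'.
Proof. by apply: pb_inj; apply: ptS_eq. Qed.

Definition Ptmm M N (f : mor M N) : mor (PM M) (PM N).
Proof.
refine (@pt_pair N (PM M) (@compm mc _ _ _ (pathm f) (pt_in M)) _).
by move=> A n z; rewrite -(mm_bpt f) (pt_in_end z).
Defined.

Lemma epm_fib M : fibm (epm M).
Proof.
move=> A n k kn x y xn xy.
have [|m a aS|m a aS|H [H0 H1 Hh]] := @path_ends_ext (M A) n k (fun m a => pt_in M A m (x m a)) y (bpt _) (@kan_lvl R M A) kn _ _ _.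
- exact: (pmapn_map (lvl (pt_in M) A) xn).
- exact: xy.
- by rewrite act_bpt -(pt_in_end (x m a)).
exists (exist _ (tt, H) (esym H1)); split=> // m a aS; apply: pt_in_inj.
exact: Hh.
Qed.

(** Loops are the kernel of [epm], hence a pullback inside a pullback, so fibrancy and the kernel
    property come for free. The [loop_space] of the Omega condition is reached by [loop_path]. *)
Definition Omo M : mc := pb_mod (zfrom_mod M) (@epm_fib M).

Definition iom M : mor (Omo M) (PM M) := pbm2 (zfrom_mod M) (@epm_fib M).

Definition omp M : mor (Omo M) (path_mod M : mc) := @compm mc _ _ _ (pt_in M) (iom M).

Lemma omp_l M A n (z : Omo M A n) : bpt n = ev (M A) false n (omp M A n z).
Proof. exact: (svalP z). Qed.

Lemma omp_r M A n (z : Omo M A n) : bpt n = ev (M A) true n (omp M A n z).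
Proof. exact: pt_in_end. Qed.

Lemma omp_inj M A n (z z' : Omo M A n) : omp M A n z = omp M A n z' -> z = z'.
Proof. by move=> /pt_in_inj; apply: pb_inj; apply: ptS_eq. Qed.

Lemma pt_pairE M Z (h : mor Z (path_mod M : mc))
    (h1 : forall A n z, bpt n = ev (M A) true n (h A n z)) A n z :
  epm M A n (pt_pair h1 A n z) = ev (M A) false n (h A n z).
Proof. by []. Qed.

Lemma om_pair_proof M Z (h : mor Z (path_mod M : mc))
    (h0 : forall A n z, bpt n = ev (M A) false n (h A n z))
    (h1 : forall A n z, bpt n = ev (M A) true n (h A n z)) A n z :
  zfrom_mod M A n (zto_mod Z A n z) = epm M A n (pt_pair h1 A n z).
Proof. by rewrite pt_pairE -h0. Qed.

Definition om_pair M Z (h : mor Z (path_mod M : mc))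
    (h0 : forall A n z, bpt n = ev (M A) false n (h A n z))
    (h1 : forall A n z, bpt n = ev (M A) true n (h A n z)) : mor Z (Omo M) :=
  @pbm_pair R (pt_mod R) M (PM M) (zfrom_mod M) (epm M) (@epm_fib M) Z (zto_mod Z)
    (pt_pair h1) (om_pair_proof h0 h1).

Definition Omm M N (f : mor M N) : mor (Omo M) (Omo N).
Proof.
refine (@om_pair N (Omo M) (@compm mc _ _ _ (pathm f) (omp M)) _ _).
  by move=> A n z; rewrite -(mm_bpt f) (omp_l z).
by move=> A n z; rewrite -(mm_bpt f) (omp_r z).
Defined.

Definition Omf : functor mc mc.
Proof.
apply: (@Functor mc mc Omo Omm).
- by move=> M; apply: module_map_eq => A n z; apply: omp_inj; apply: path_eq.
- by move=> M N L g f; apply: module_map_eq => A n z; apply: omp_inj; apply: path_eq.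
Defined.

Lemma pb_ex M N L (f : mor M N) (p : mor L N) (pF : fibm p) A n
  (x : (M : module R) A n) (y : (L : module R) A n) : f A n x = p A n y ->
  exists z : (pb_mod f pF : module R) A n, pbm1 f pF A n z = x /\ pbm2 f pF A n z = y.
Proof. exact: (spb_ex (pbS_spb (lvl f A) (lvl p A))). Qed.

Lemma om_ex M A n (H : pathS ((M : module R) A) n) : ev _ false n H = bpt n ->
  ev _ true n H = bpt n -> exists z : (Omo M : module R) A n, omp M A n z = H.
Proof.
move=> H0 H1.
have [|u [_ u2]] := @pb_ex _ _ _ (zfrom_mod M) (evm M true) (@dr_fib M) A n tt H _.
  by rewrite [RHS]H1.
have [|z [_ z2]] := @pb_ex _ _ _ (zfrom_mod M) (epm M) (@epm_fib M) A n tt u _.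
  by rewrite -[RHS]/(evm M false A n (pt_in M A n u)) [pt_in _ _ _ _]u2 [RHS]H0.
exists z; rewrite -u2 -z2; exact: erefl.
Qed.

Lemma omp_nat M N (f : mor M N) A n z :
  omp N A n (Omm f A n z) = pathf (lvl f A) n (omp M A n z).
Proof. exact: erefl. Qed.

Lemma Omm_fib M N (f : mor M N) : fibm f -> fibm (Omm f).
Proof.
move=> fF A n k kn x y xn xy.
have [|m a aS|m a aS|m a aS|||H [E0 E1 EH Hh]] := @rel_path_ends_ext _ _ (lvl f A) n k
  (fun m a => omp M A m (x m a)) (bpt _) (bpt _) (omp N A _ y) (@fF A) kn _ _ _ _ _ _.
- exact: (pmapn_map (lvl (omp M) A) xn).
- by rewrite act_bpt -(omp_l (x m a)).
- by rewrite act_bpt -(omp_r (x m a)).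
- by rewrite -omp_nat -(mm_act (omp N)) -xy.
- by rewrite pf_pt -(omp_l y).
- by rewrite pf_pt -(omp_r y).
have [z zH] := om_ex E0 E1; exists z; split.
  by apply: omp_inj; rewrite -EH -zH.
by move=> m a aS; apply: omp_inj; rewrite mm_act zH Hh.
Qed.

Lemma is_kerP (F E B : module_fibcat R) (i : mor F E) (p : mor E B) : fibm p ->
  is_ker i p <-> strict_fibre i p.
Proof.
move=> pF; split=> [K A n|S].
  have [qe qi qx] := is_pullback_spb pF K A; split.
    by move=> z z' E1; apply: qi => //; apply: ptS_eq.
  move=> y; split=> [py|[x <-]]; last by rewrite -[LHS](qe n x).
  by have [z [_ z2]] := qx n tt y (esym py); exists z.
split.
  apply: module_map_eq => A n z; symmetry; apply/(S A n).2; by exists z.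
move=> Z u v uv.
have vE A n z : exists x, i A n x = v A n z.
  by apply/(S A n).2; rewrite -[LHS](mm_congr z uv).
pose w A n z := sval (cid (vE A n z)).
have wE A n z : i A n (w A n z) = v A n z by exact: (svalP (cid (vE A n z))).
have iI A n x x' : i A n x = i A n x' -> x = x' by apply: (S A n).1.
have @W : module_map (Z : module R) F.
  apply: (@ModuleMap R Z F w).
  - by move=> *; apply: iI; rewrite mm_act !wE mm_act.
  - by move=> *; apply: iI; rewrite mm_bpt !wE mm_bpt.
  - by move=> *; apply: iI; rewrite mm_tr !wE mm_tr.
  - by move=> *; apply: iI; rewrite mm_smul !wE mm_smul.
exists W; split.
- by apply: module_map_eq => *; apply: ptS_eq.
- by apply: module_map_eq => A n z; apply: wE.
move=> w' _ w'2; apply: module_map_eq => A n z; apply: (iI).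
by rewrite [RHS]wE -w'2.
Qed.

Lemma Omm_strict (F E B : mc) (i : mor F E) (p : mor E B) :
  strict_fibre i p -> strict_fibre (Omm i) (Omm p).
Proof.
move=> S A n.
have iI k x x' : i A k x = i A k x' -> x = x' by apply: (S A k).1.
split.
  move=> z z' E1; apply: omp_inj; apply: path_eq => k a t; apply: iI.
  have := congr1 (omp E A n) E1; rewrite !omp_nat.
  exact: (congr1 (fun u : pathS (E A) n => pv u a t)).
have bE k (a : ordmap k n) (t : ordmap k 1) : pv (omp B A n (bpt n)) a t = bpt k.
  by rewrite (mm_bpt (omp B)).
move=> y; split=> [py|[x <-]]; last first.
  apply: omp_inj; apply: path_eq => k a t; rewrite bE !omp_nat; apply/(S A k).2.
  by exists (pv (omp F A n x) a t).
have yE k (a : ordmap k n) (t : ordmap k 1) : exists x, i A k x = pv (omp E A n y) a t.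
  apply/(S A k).2; have := congr1 (omp B A n) py; rewrite omp_nat.
  by move=> /(congr1 (fun u : pathS (B A) n => pv u a t)); rewrite bE.
pose w k a t := sval (cid (yE k a t)).
have wE k a t : i A k (w k a t) = pv (omp E A n y) a t by exact: (svalP (cid (yE k a t))).
have nat k l (c : ordmap k l) a t : w k (om_comp a c) (om_comp t c) = sact c (w l a t).
  by apply: iI; rewrite mm_act !wE pv_act.
have H0 : bpt n = ev (F A) false n (Path nat).
  by apply: iI; rewrite mm_bpt [RHS]wE -[RHS]/(ev (E A) false n (omp E A n y)) -omp_l.
have H1 : bpt n = ev (F A) true n (Path nat).
  by apply: iI; rewrite mm_bpt [RHS]wE -[RHS]/(ev (E A) true n (omp E A n y)) -omp_r.
have [z zE] := om_ex (esym H0) (esym H1).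
by exists z; apply: omp_inj; rewrite omp_nat zE; apply: path_eq => k a t; apply: wE.
Qed.

Lemma PM_tf M A : tf (lvl (zto_mod (PM M)) A).
Proof.
have T := spb_tf (pbS_spb (lvl (zfrom_mod M) A) (lvl (evm M true) A))
  (@ev_tf (M A) true (@kan_lvl R M A)).
move=> n x y xn _; have [|z [_ zx]] := T n x y xn _; first by move=> *; apply: ptS_eq.
by exists z; split=> //; apply: ptS_eq.
Qed.

(** Loops are the pullback of the contractible [PM M] over [M] along the zero map, so the cogluing
    lemma applies. *)
Lemma Omm_weak M N (f : mor M N) : weakm f -> weakm (Omm f).
Proof.
move=> fW A.
have PW : weq (lvl (Ptmm f) A).
  apply: (weq_cancel (kan_ptS) _ (tf_weq (@PM_tf N A))).
  exact: (weq_ext _ (tf_weq (@PM_tf M A))).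
apply: (@cogluing _ _ _ _ _ _ _ _ (lvl (zfrom_mod M) A) (lvl (epm M) A) (pb1 _ _) (pb2 _ _)
  (lvl (zfrom_mod N) A) (lvl (epm N) A) (pb1 _ _) (pb2 _ _) (ps_id ptS) (lvl f A)
  (lvl (Ptmm f) A)); try exact: kan_lvl; try exact: pbS_spb; try exact: epm_fib.
- exact: (@kan_lvl R (Omo N) A).
- exact: (tf_weq (@weq_bij ptS ptS (ps_id ptS) (fun _ x => x) (fun _ _ => erefl) (fun _ _ => erefl))).
- exact: fW.
- exact: PW.
- by move=> n a; rewrite /= mm_bpt.
- by [].
- by move=> *; apply: ptS_eq.
- by move=> n z; apply: sval_eq; congr (_, _); apply: path_eq.
Qed.

(** ** The shift *)

(** The suspension class has to be moved past [r]; this is where its centrality enters. *)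
Lemma sh_lin M A B n k (t : ordmap k 1) (r : R A n) (b : ordmap k n) (x : (M : module R) B k) :
  tr (bij_sumC fs_unit (fs_sum A B)) (smul (sact t (rsusp R)) (smul (sact b r) x)) =
  smul (p := sh_pre (M : module R)) (sact b r)
    (tr (bij_sumC fs_unit B) (smul (sact t (rsusp R)) x)).
Proof.
rewrite /= /sh_smul -smulA tr_tr.
rewrite -[X in smul X (tr _ _)](@tr_id R A (bij_id A)) // smul_tr -smulA.
rewrite -(rsusp_central t (sact b r)).
rewrite -[X in smul (tr _ _) X](@tr_id (M : module R) B (bij_id B)) // smul_tr !tr_tr.
by apply: tr_ext; case=> [[]|].
Qed.

Definition eta_path M : mor M (path_mod (sh_obj M) : mc).
Proof.
refine (@ModuleMap R M (path_mod (sh_obj M)) (fun B n x =>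
  loop_path _ n (adjS M (bij_sumC fs_unit B) n x)) _ _ _ _).
- by move=> B m n a x; rewrite !pf_act.
- by move=> B n; rewrite !pf_pt.
- move=> A B f n x; apply: path_eq => k a t /=.
  rewrite -tr_act -[X in smul X (tr f _)](@tr_id R fs_unit (bij_id fs_unit)) // smul_tr !tr_tr.
  by apply: tr_ext; case.
move=> A B n r x; apply: path_eq => k a t.
by rewrite -[RHS](@sh_lin M A B n k t r a (sact a x)) /= smul_act.
Defined.

Definition eta_mod M : mor M (Omo (sh_obj M)).
Proof.
by refine (@om_pair (sh_obj M) M (eta_path M) _ _) => A n z; rewrite -[RHS]/(ev _ _ _ (loop_path _ _ _)) loop_path_ev.
Defined.

Lemma omp_eta M A n z : omp _ A n (eta_mod M A n z) = eta_path M A n z.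
Proof. exact: erefl. Qed.

Lemma eta_mod_nat M N (f : mor M N) :
  @compm mc _ _ _ (eta_mod N) f = @compm mc _ _ _ (Omm (sh_mm f)) (eta_mod M).
Proof.
apply: module_map_eq => A n z; apply: omp_inj.
rewrite -[LHS]/(omp _ A n (eta_mod N A n (f A n z))) omp_eta.
rewrite -[RHS]/(omp _ A n (Omm (sh_mm f) A n (eta_mod M A n z))) omp_nat omp_eta.
by apply: path_eq => k a t /=; rewrite mm_tr mm_smul mm_act.
Qed.

(** [G] translates loops in the sense of [Omo] to [loop_space], where [eta_mod] becomes the adjoint
    structure map for the bijection of [1 + A] with [A + 1]. *)
Lemma eta_mod_weak M : weakm (eta_mod M).
Proof.
move=> A.
have omp_loop n (z : Omo (sh_obj M) A n) : exists l, loop_path _ n l = omp _ A n z.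
  by have [l El] := path_loop (esym (omp_l z)) (esym (omp_r z)); exists l.
pose g n z := sval (cid (@omp_loop n z)).
have gE n z : loop_path _ n (g n z) = omp _ A n z := svalP (cid (@omp_loop n z)).
have @G : psmap (Omo (sh_obj M) A) (loop_space ((M : module R) (fs_sum A fs_unit))).
  apply: (@PsMap _ _ g).
    by move=> m n a z; apply: loop_path_inj; rewrite pf_act !gE mm_act.
  by move=> n; apply: loop_path_inj; rewrite pf_pt gE mm_bpt.
apply: (weq_cancel (g := G)); first exact: kan_loop_lvl.
  apply: (weq_ext (f := adjS (M : module R) (bij_sumC fs_unit A))); last exact: adjS_weq.
  by move=> n x; apply: loop_path_inj; exact: (esym (gE n (eta_mod M A n x))).
move=> n x y xn xy.
have [z zE] := om_ex (M := sh_obj M) (A := A) (loop_path_ev y false) (loop_path_ev y true).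
exists z; split.
  by move=> k a aB; apply: omp_inj; rewrite mm_act zE -pf_act -xy.
have -> : G n z = y by apply: loop_path_inj; rewrite -zE; exact: (gE n z).
exact: relh_refl.
Qed.

Lemma kap_smul M A B n (r : R A n) (x : (sh_obj (Omo M) : module R) B n) :
  omp M (fs_sum (fs_sum A B) fs_unit) n (smul r x) =
  smul r (omp M (fs_sum B fs_unit) n x : (path_mod (sh_obj M) : module R) B n).
Proof. by apply: path_eq => k a t; rewrite /= /sh_smul. Qed.

Lemma kap_tr M A B (f : bij A B) n (x : (sh_obj (Omo M) : module R) A n) :
  omp M (fs_sum B fs_unit) n (tr f x) =
  tr f (omp M (fs_sum A fs_unit) n x : (path_mod (sh_obj M) : module R) A n).
Proof. by apply: path_eq => k a t /=. Qed.

Definition kap_mod M : mor (sh_obj (Omo M) : mc) (Omo (sh_obj M)).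
Proof.
refine (@om_pair (sh_obj M) (sh_obj (Omo M)) (@ModuleMap R (sh_obj (Omo M)) (path_mod (sh_obj M))
  (fun A n z => omp M (fs_sum A fs_unit) n z) _ _ _ _) _ _).
- by move=> A n z; exact: (omp_l z).
- by move=> A n z; exact: (omp_r z).
Unshelve.
- by move=> *; apply: (mm_act (omp M)).
- by move=> *; apply: (mm_bpt (omp M)).
- exact: kap_tr.
- exact: kap_smul.
Defined.

Lemma omp_kap M A n z : omp _ A n (kap_mod M A n z) = omp M (fs_sum A fs_unit) n z.
Proof. exact: erefl. Qed.

Lemma kap_mod_nat M N (f : mor M N) :
  @compm mc _ _ _ (kap_mod N) (sh_mm (Omm f)) = @compm mc _ _ _ (Omm (sh_mm f)) (kap_mod M).
Proof.
apply: module_map_eq => A n z; apply: omp_inj.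
rewrite -[LHS]/(omp _ A n (kap_mod N A n (Omm f (fs_sum A fs_unit) n z))) omp_kap omp_nat.
rewrite -[RHS]/(omp _ A n (Omm (sh_mm f) A n (kap_mod M A n z))) omp_nat omp_kap; exact: path_eq.
Qed.

Lemma kap_mod_weak M : weakm (kap_mod M).
Proof.
move=> A; apply: tf_weq => n x y xn xy.
have [z zE] := om_ex (M := M) (A := fs_sum A fs_unit) (esym (omp_l y)) (esym (omp_r y)).
exists z; split; first by apply: omp_inj; exact: zE.
move=> k a aB; apply: omp_inj; rewrite (mm_act (omp M)) zE.
have E := congr1 (omp (sh_obj M) A k) (xy k a aB).
by rewrite (mm_act (omp (sh_obj M))) in E; exact: (esym E).
Qed.

Lemma iom_ker M : @is_ker (module_fibcat R) _ _ _ (iom M) (epm M).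
Proof.
have H := @pb_is_pullback R (pt_mod R) M (PM M) (zfrom_mod M) (epm M) (@epm_fib M).
by rewrite (zto_modE (pbm1 _ _)) in H.
Qed.

Lemma null_pathm A M (h : mor A (path_mod M : mc)) :
  @compm mc _ _ _ (evm M true) h = @compm mc _ _ _ (zfrom_mod M) (zto_mod A) ->
  exists k : mor A (PM M), @compm mc _ _ _ (epm M) k = @compm mc _ _ _ (evm M false) h.
Proof.
move=> h1; have hE B n z : bpt n = ev ((M : module R) B) true n (h B n z).
  by rewrite -[RHS](mm_congr z (esym h1)).
by exists (pt_pair hE); apply: module_map_eq => B n z; rewrite -[RHS]pt_pairE.
Qed.

Lemma epm_nat M N (f : mor M N) :
  @compm mc _ _ _ (epm N) (Ptmm f) = @compm mc _ _ _ f (epm M).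
Proof. by apply: module_map_eq => A n z; exact: erefl. Qed.

Lemma iom_nat M N (f : mor M N) :
  @compm mc _ _ _ (iom N) (Omm f) = @compm mc _ _ _ (Ptmm f) (iom M).
Proof.
apply: module_map_eq => A n z; apply: pt_in_inj.
rewrite -[LHS]/(omp N A n (Omm f A n z)) omp_nat; exact: erefl.
Qed.

Lemma Omm_is_ker (F E B : mc) (i : mor F E) (p : mor E B) : fibm p ->
  @is_ker (module_fibcat R) _ _ _ i p -> @is_ker (module_fibcat R) _ _ _ (Omm i) (Omm p).
Proof.
by move=> pF /(is_kerP _ pF) S; apply/(is_kerP _ (Omm_fib pF))/Omm_strict.
Qed.

Lemma sh_is_ker (F E B : mc) (i : mor F E) (p : mor E B) : fibm p ->
  @is_ker (module_fibcat R) _ _ _ i p ->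
  @is_ker (module_fibcat R) _ _ _ (fmap (sh_functor R) i) (fmap (sh_functor R) p).
Proof.
move=> pF /(is_kerP _ pF) S; apply/is_kerP; last by move=> A n; apply: S.
by move=> A; apply: pF.
Qed.

Definition module_stable : stable.
Proof.
refine (@Stable (module_fibcat R) PM Ptmm epm Omf iom epm_nat iom_nat epm_fib _ iom_ker null_pathm _ Omm_fib Omm_is_ker
  (sh_functor R) (@sh_level_equiv R) _ sh_is_ker eta_mod eta_mod_nat _ kap_mod kap_mod_nat _).
- by move=> M; apply/weakmP => A; apply/tf_weq/PM_tf.
- by move=> M N f /weakmP W; apply/weakmP/Omm_weak.
- by move=> M N f fF A; apply: fF.
- by move=> M; apply/weakmP/eta_mod_weak.
by move=> M; apply/weakmP/kap_mod_weak.
Defined.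

End ModuleStable.

(** * The homotopy category with its products, loops and shift *)

Section Stable.
Variable S : stable.
Implicit Types A B X Y Z : S.
Notation T := (hoc S).

Lemma compAr (D : category) (A B X Y : D) (h : mor X Y) (g : mor B X) (f : mor A B) :
  h \oc g \oc f = h \oc (g \oc f).
Proof. by rewrite compA. Qed.

(** ** Zero maps *)

Definition tzero A B : @mor T A B := ho (zfrom B \oc zto A).

Lemma to_ptE A (u v : @mor T A (pt S)) : u = v.
Proof.
suff H w : w = ho (zto A) by rewrite (H u) (H v).
have [A' [t [f [[_ Tt] E]]]] := ho_rep w; apply: (iso_epi (ho_weak_iso Tt)).
by rewrite E -ho_comp; congr ho; rewrite (ztoE f) (ztoE (_ \oc t)).
Qed.

Lemma from_ptE A (u v : @mor T (pt S) A) : u = v.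
Proof.
suff H w : w = ho (zfrom A) by rewrite (H u) (H v).
have [A' [t [f [Tt E]]]] := ho_rep w.
have ts : t \oc zfrom A' = idc _ by rewrite (zfromE (t \oc _)) (zfromE (idc _)).
rewrite -[LHS]compf1 -[@idc T _]ho_id -ts ho_comp compA E -ho_comp.
by congr ho; apply: zfromE.
Qed.

Lemma tzeroE A B (u : @mor T A (pt S)) (v : @mor T (pt S) B) : v \oc u = tzero A B.
Proof. by rewrite /tzero ho_comp (to_ptE u (ho (zto A))) (from_ptE v (ho (zfrom B))). Qed.

Lemma tzero_r A B X (u : @mor T A B) : tzero B X \oc u = tzero A X.
Proof. by rewrite /tzero ho_comp -compA tzeroE /tzero ho_comp. Qed.

Lemma tzero_l A B X (u : @mor T B X) : u \oc tzero A B = tzero A X.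
Proof. by rewrite {1}/tzero ho_comp compA tzeroE. Qed.

Lemma ho_zero A B (f : mor A (pt S)) (g : mor (pt S) B) : ho (g \oc f) = tzero A B.
Proof. by rewrite ho_comp tzeroE. Qed.

Lemma is_zero_pt : @is_zero_obj T (pt S).
Proof.
move=> A; split; [exists (ho (zto A))|exists (ho (zfrom A))]; split=> // *.
  exact: to_ptE.
exact: from_ptE.
Qed.

Lemma weak_pt A : weak (zto A) -> weak (zfrom A).
Proof.
move=> W; apply: (weak_cancel (g := zto A)) => //.
by rewrite (zfromE (_ \oc _)) -(zfromE (idc _)); apply: weak_id.
Qed.

(** ** Chosen pullbacks *)

Section PbData.
Variables (A B E : S) (f : mor A B) (p : mor E B) (Fp : fib p).

Record pbdata := PbData {
  pbo_ : S; pbo1_ : mor pbo_ A; pbo2_ : mor pbo_ E; pboP_ : is_pullback f p pbo1_ pbo2_ }.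

Lemma pbd_ex : exists d : pbdata, True.
Proof. by have [P [q1 [q2 H]]] := pullback_ex f Fp; exists (PbData H). Qed.

Definition pbd : pbdata := sval (cid pbd_ex).
End PbData.

Section ChosenPullback.
Variables (A B E : S) (f : mor A B) (p : mor E B) (Fp : fib p).
Definition pbo : S := pbo_ (pbd f Fp).
Definition pbo1 : mor pbo A := pbo1_ (pbd f Fp).
Definition pbo2 : mor pbo E := pbo2_ (pbd f Fp).

Lemma pboP : is_pullback f p pbo1 pbo2.
Proof. exact: pboP_. Qed.

Lemma pboE : f \oc pbo1 = p \oc pbo2.
Proof. by case: pboP. Qed.

Lemma pbo_eq Z (u v : mor Z pbo) : pbo1 \oc u = pbo1 \oc v -> pbo2 \oc u = pbo2 \oc v -> u = v.
Proof.
move=> E1 E2; have [_ U] := pboP.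
have [|w [_ _ wU]] := U Z (pbo1 \oc v) (pbo2 \oc v); first by rewrite !compA pboE.
by transitivity w; [apply: wU|symmetry; apply: wU].
Qed.

Variables (Z : S) (u : mor Z A) (v : mor Z E) (uv : f \oc u = p \oc v).

Lemma pbo_lift_ex : exists w : mor Z pbo, pbo1 \oc w = u /\ pbo2 \oc w = v.
Proof. by have [_ U] := pboP; have [w [w1 w2 _]] := U Z u v uv; exists w. Qed.

Definition pbo_lift : mor Z pbo := sval (cid pbo_lift_ex).
Lemma pbo_lift1 : pbo1 \oc pbo_lift = u.
Proof. by case: (svalP (cid pbo_lift_ex)). Qed.
Lemma pbo_lift2 : pbo2 \oc pbo_lift = v.
Proof. by case: (svalP (cid pbo_lift_ex)). Qed.

End ChosenPullback.

Lemma pt_uniq A (f g : mor A (pt S)) : f = g.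
Proof. by rewrite (ztoE f) (ztoE g). Qed.

Lemma pt_uniq' A (f g : mor (pt S) A) : f = g.
Proof. by rewrite (zfromE f) (zfromE g). Qed.

Lemma zero_comp A B X (f : mor A B) : zfrom X \oc zto B \oc f = zfrom X \oc zto A.
Proof. by rewrite -compA (ztoE (_ \oc f)). Qed.

Lemma comp_zero A B X (f : mor B X) : f \oc (zfrom B \oc zto A) = zfrom X \oc zto A.
Proof. by rewrite compA (zfromE (f \oc _)). Qed.

(** ** Products *)

Definition prd X Y : S := pbo (zto X) (fib_zto Y).
Definition pr1 X Y : mor (prd X Y) X := pbo1 (zto X) (fib_zto Y).
Definition pr2 X Y : mor (prd X Y) Y := pbo2 (zto X) (fib_zto Y).
Definition pair X Y Z (u : mor Z X) (v : mor Z Y) : mor Z (prd X Y) :=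
  pbo_lift (fib_zto Y) (pt_uniq (zto X \oc u) (zto Y \oc v)).

Lemma pair1 X Y Z (u : mor Z X) (v : mor Z Y) : pr1 X Y \oc pair u v = u.
Proof. exact: pbo_lift1. Qed.
Lemma pair2 X Y Z (u : mor Z X) (v : mor Z Y) : pr2 X Y \oc pair u v = v.
Proof. exact: pbo_lift2. Qed.
Lemma prd_eq X Y Z (u v : mor Z (prd X Y)) :
  pr1 X Y \oc u = pr1 X Y \oc v -> pr2 X Y \oc u = pr2 X Y \oc v -> u = v.
Proof. exact: pbo_eq. Qed.

Lemma common_span A X Y (u : @mor T A X) (v : @mor T A Y) :
  exists A' (t : mor A' A) (f : mor A' X) (g : mor A' Y),
    [/\ tfib t, u \oc ho t = ho f & v \oc ho t = ho g].
Proof.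
have [A1 [t1 [f [T1 E1]]]] := ho_rep u; have [A2 [t2 [g [T2 E2]]]] := ho_rep v.
have [A' [s1 [s2 [sE Ts1 Ts2]]]] := tfib_pull2 T1 T2.
exists A', (t1 \oc s1), (f \oc s1), (g \oc s2); split; first exact: tfib_comp.
  by rewrite ho_comp compA E1 -ho_comp.
by rewrite sE ho_comp compA E2 -ho_comp.
Qed.

Lemma tpair_ex A X Y (u : @mor T A X) (v : @mor T A Y) :
  exists w : @mor T A (prd X Y), ho (pr1 X Y) \oc w = u /\ ho (pr2 X Y) \oc w = v.
Proof.
have [A' [t [f [g [[_ Wt] E1 E2]]]]] := common_span u v.
exists (ho (pair f g) \oc hoV Wt); split; apply: (iso_epi (ho_weak_iso Wt)).
  by rewrite !compAr hoVK compf1 -ho_comp pair1 E1.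
by rewrite !compAr hoVK compf1 -ho_comp pair2 E2.
Qed.

(** [P2] is the object of points of the product with a path in each factor starting there. The
    constant paths are a common section of its two ends, so [lhtp_ends] applies and the two
    homotopies define a map to [P2]. *)
Lemma prd_lhtp A X Y (u v : mor A (prd X Y)) : ho (pr1 X Y \oc u) = ho (pr1 X Y \oc v) ->
  ho (pr2 X Y \oc u) = ho (pr2 X Y \oc v) -> ho u = ho v.
Proof.
move=> /ho_lhtp[A1 [t1 [h1 [T1 h10 h11]]]] /ho_lhtp[A2 [t2 [h2 [T2 h20 h21]]]].
have [A' [s1 [s2 [sE Ts1 Ts2]]]] := tfib_pull2 T1 T2.
pose P1 := pbo (pr1 X Y) (fib_dl X).
pose a1 : mor P1 _ := pbo1 (pr1 X Y) (fib_dl X); pose b1 : mor P1 _ := pbo2 (pr1 X Y) (fib_dl X).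
pose P2 := pbo (pr2 X Y \oc a1) (fib_dl Y).
pose a2 : mor P2 _ := pbo1 (pr2 X Y \oc a1) (fib_dl Y).
pose b2 : mor P2 _ := pbo2 (pr2 X Y \oc a1) (fib_dl Y).
have E1 : pr1 X Y \oc a1 = dl X \oc b1 by apply: pboE.
have E2 : pr2 X Y \oc a1 \oc a2 = dl Y \oc b2 by apply: pboE.
pose D1 := pair (dr X \oc b1 \oc a2) (dr Y \oc b2).
have WD0 : weak (a1 \oc a2).
  apply: weak_comp; first exact: pullback_weak (pboP _ _) (fib_dl _) (weak_dl Y).
  exact: pullback_weak (pboP _ _) (fib_dl _) (weak_dl X).
have L Z (k : mor Z (prd X Y)) (x : mor Z (PI X)) (y : mor Z (PI Y)) :
    pr1 X Y \oc k = dl X \oc x -> pr2 X Y \oc k = dl Y \oc y ->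
    exists w : mor Z P2, [/\ a1 \oc a2 \oc w = k, b1 \oc a2 \oc w = x & b2 \oc w = y].
  move=> kx ky; have [w1 [w1a w1b]] := pbo_lift_ex (fib_dl X) kx.
  have [|w [wa wb]] := @pbo_lift_ex _ _ _ (pr2 X Y \oc a1) _ (fib_dl Y) _ w1 y.
    by rewrite -compA w1a.
  by exists w; rewrite -!compA wa.
have [||c [c1 c2 c3]] := L _ (idc _) (dc X \oc pr1 X Y) (dc Y \oc pr2 X Y).
- by rewrite compA dl_dc comp1f compf1.
- by rewrite compA dl_dc comp1f compf1.
have HD : ho (a1 \oc a2) = ho D1.
  apply/lhtp_ho/(lhtp_ends (k := c)) => //; apply: prd_eq.
    by rewrite compA pair1 compf1 !compAr (compA b1) c2 compA dr_dc comp1f.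
  by rewrite compA pair2 compf1 -compA c3 compA dr_dc comp1f.
have [||w [w1 w2 w3]] := L A' (u \oc t1 \oc s1) (h1 \oc s1) (h2 \oc s2).
- by rewrite !compA h10 !compAr.
- by rewrite !compA h20 !compAr sE !compA.
have WT : weak (t1 \oc s1) := (tfib_comp Ts1 T1).2.
apply: (iso_epi (ho_weak_iso WT)); rewrite -!ho_comp.
have -> : u \oc (t1 \oc s1) = a1 \oc a2 \oc w by rewrite w1 compA.
have -> : v \oc (t1 \oc s1) = D1 \oc w.
  apply: prd_eq; rewrite !compA ?pair1 ?pair2.
    by rewrite -h11 -(compA _ h1 s1) -w2 !compA.
  by rewrite -(compA _ b2 w) w3 -(compA _ t1 s1) sE (compA _ t2 s2) -h21 compA.
by rewrite !(ho_comp _ w) HD.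
Qed.

Lemma tpair_uniq A X Y (u v : @mor T A (prd X Y)) :
  ho (pr1 X Y) \oc u = ho (pr1 X Y) \oc v -> ho (pr2 X Y) \oc u = ho (pr2 X Y) \oc v -> u = v.
Proof.
have [A' [t [f [g [[_ Wt] E1 E2]]]]] := common_span u v.
move=> H1 H2; apply: (iso_epi (ho_weak_iso Wt)); rewrite E1 E2.
by apply: prd_lhtp; rewrite !ho_comp -E1 -E2 !compA ?H1 ?H2.
Qed.

Definition tpair A X Y (u : @mor T A X) (v : @mor T A Y) : @mor T A (prd X Y) :=
  sval (cid (tpair_ex u v)).
Lemma tpair1 A X Y (u : @mor T A X) (v : @mor T A Y) : ho (pr1 X Y) \oc tpair u v = u.
Proof. by case: (svalP (cid (tpair_ex u v))). Qed.
Lemma tpair2 A X Y (u : @mor T A X) (v : @mor T A Y) : ho (pr2 X Y) \oc tpair u v = v.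
Proof. by case: (svalP (cid (tpair_ex u v))). Qed.

Lemma tpair_pre A B X Y (u : @mor T A X) (v : @mor T A Y) (w : @mor T B A) :
  tpair u v \oc w = tpair (u \oc w) (v \oc w).
Proof. by apply: tpair_uniq; rewrite compA ?tpair1 ?tpair2. Qed.

(** ** Functors on the homotopy category *)

Definition OmT : functor T T := loc_functor (@Om_weak S).
Definition ShT : functor T T := loc_functor (@Sh_weak S).

Lemma OmT_ho X Y (f : mor X Y) : fmap OmT (ho f) = ho (fmap (Om S) f).
Proof. exact: lmapE. Qed.

Lemma ShT_ho X Y (f : mor X Y) : fmap ShT (ho f) = ho (fmap (Sh S) f).
Proof. exact: lmapE. Qed.

Lemma fmap_iso (C D : category) (F : functor C D) (X Y : C) (f : mor X Y) :
  is_iso f -> is_iso (fmap F f).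
Proof.
by case=> g [gf fg]; exists (fmap F g); rewrite -!fmapM gf fg !fmap1.
Qed.

(** Every map is a fraction of strict maps, and naturality passes to inverses of isomorphisms. *)
Lemma nat_ho (F G : functor T T) (al : forall X, @mor T (F X) (G X)) :
  (forall X Y (f : mor X Y), al Y \oc fmap F (ho f) = fmap G (ho f) \oc al X) ->
  forall X Y (u : @mor T X Y), al Y \oc fmap F u = fmap G u \oc al X.
Proof.
move=> N X Y u; have [X' [t [f [[_ Wt] E]]]] := ho_rep u.
apply: (iso_epi (fmap_iso F (ho_weak_iso Wt))).
by rewrite !compAr N -fmapM E N compA -fmapM E.
Qed.

Definition etaT X : @mor T X (OmT (ShT X)) := ho (eta X).
Definition kapT X : @mor T (ShT (OmT X)) (OmT (ShT X)) := ho (kap X).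

Definition id_functor (C : category) : functor C C :=
  @Functor C C (fun x => x) (fun _ _ f => f) (fun _ => erefl) (fun _ _ _ _ _ => erefl).
Definition comp_functor (C D E : category) (G : functor D E) (F : functor C D) : functor C E.
Proof.
apply: (@Functor C E (fun x => G (F x)) (fun _ _ f => fmap G (fmap F f))).
  by move=> x; rewrite !fmap1.
by move=> *; rewrite !fmapM.
Defined.

Lemma etaT_nat X Y (u : @mor T X Y) : etaT Y \oc u = fmap OmT (fmap ShT u) \oc etaT X.
Proof.
apply: (@nat_ho (id_functor T) (comp_functor OmT ShT) etaT) => {X Y u} X Y f.
change (etaT Y \oc ho f = fmap OmT (fmap ShT (ho f)) \oc etaT X).
by rewrite (ShT_ho f) (OmT_ho (fmap (Sh S) f)) -!ho_comp eta_nat.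
Qed.

Lemma kapT_nat X Y (u : @mor T X Y) :
  kapT Y \oc fmap ShT (fmap OmT u) = fmap OmT (fmap ShT u) \oc kapT X.
Proof.
apply: (@nat_ho (comp_functor ShT OmT) (comp_functor OmT ShT) kapT) => {X Y u} X Y f.
change (kapT Y \oc fmap ShT (fmap OmT (ho f)) = fmap OmT (fmap ShT (ho f)) \oc kapT X).
by rewrite (OmT_ho f) (ShT_ho f) (ShT_ho (fmap (Om S) f)) (OmT_ho (fmap (Sh S) f)) -!ho_comp kap_nat.
Qed.

Lemma etaT_iso X : is_iso (etaT X).
Proof. exact/ho_weak_iso/eta_weak. Qed.

Lemma kapT_iso X : is_iso (kapT X).
Proof. exact/ho_weak_iso/kap_weak. Qed.

Lemma ShT_faithful X Y (u v : @mor T X Y) : fmap ShT u = fmap ShT v -> u = v.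
Proof.
by move=> E; apply: (iso_mono (etaT_iso Y)); rewrite !etaT_nat E.
Qed.

Lemma OmT_faithful X Y (u v : @mor T X Y) : fmap OmT u = fmap OmT v -> u = v.
Proof.
move=> E; apply: (iso_mono (etaT_iso Y)); rewrite !etaT_nat; congr (_ \oc _).
by apply: (iso_epi (kapT_iso X)); rewrite -!kapT_nat E.
Qed.

(** The candidate is [fmap OmT w] conjugated by [etaT]. That its shift is [w] is checked after
    applying [OmT], which is already known to be faithful. *)
Lemma ShT_full X Y (w : @mor T (ShT X) (ShT Y)) : exists u : @mor T X Y, fmap ShT u = w.
Proof.
have [e [e1 e2]] := etaT_iso Y.
exists (e \oc fmap OmT w \oc etaT X); apply: OmT_faithful.
apply: (iso_epi (etaT_iso X)).
by rewrite -etaT_nat !compA e2 comp1f.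
Qed.

Lemma OmT_full X Y (w : @mor T (OmT X) (OmT Y)) : exists u : @mor T X Y, fmap OmT u = w.
Proof.
have [e [e1 e2]] := etaT_iso Y; have [k [k1 k2]] := kapT_iso X.
pose w' := kapT Y \oc fmap ShT w \oc k.
exists (e \oc w' \oc etaT X); set u := _ \oc etaT X.
have E : fmap OmT (fmap ShT u) = w'.
  by apply: (iso_epi (etaT_iso X)); rewrite -etaT_nat !compA e2 comp1f.
apply: ShT_faithful; apply: (iso_mono (kapT_iso Y)).
by rewrite kapT_nat E /w' -compA k1 compf1.
Qed.

End Stable.

(** ** Filtered colimits *)

Lemma path_tau (X : psset) n (K : path X n) k (a : ordmap k n) t i : i <= n -> valid i a t ->
  pv K a t = sact (om_add a t) (pv K (sg n i) (th n i)).
Proof. by move=> i_n V; have [e1 e2] := om_addK i_n V; rewrite -pv_act e1 e2. Qed.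

Lemma path_tau_eq (X : psset) n (K K' : path X n) :
  (forall i, i < n.+1 -> pv K (sg n i) (th n i) = pv K' (sg n i) (th n i)) -> K = K'.
Proof.
move=> E; apply: path_eq => k a t; have [i i_n V] := valid_ex a t.
by rewrite (path_tau _ i_n V) E // -path_tau.
Qed.

Lemma path_tau_face (X : psset) n (K : path X n) i : i < n ->
  sact (coface n i.+1) (pv K (sg n i) (th n i)) =
  sact (coface n i.+1) (pv K (sg n i.+1) (th n i.+1)).
Proof.
by move=> i_n; rewrite -!pv_act !sg_face ?th_face; auto; lia.
Qed.

Section Colimits.
Variable R : symmetric_ring_spectrum.
Notation mc := (module_cat R).
Variables (J : category) (D : functor J mc) (L : mc) (lam : forall j, mor (D j) L).
Hypothesis colim : levelwise_filtered_colimit lam.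

Lemma colim_fil : filtered J. Proof. by case: colim. Qed.

Lemma colim_nat j k (h : mor j k) : lam k \oc fmap D h = lam j.
Proof. by have [_ H _ _] := colim; apply: H. Qed.

Lemma colim_natE j k (h : mor j k) A n (x : (D j : module R) A n) :
  lam k A n (fmap D h A n x) = lam j A n x.
Proof. exact: (mm_congr x (colim_nat h)). Qed.

Lemma colimM j k l (h : mor j k) (g : mor k l) A n (x : (D j : module R) A n) :
  fmap D (g \oc h) A n x = fmap D g A n (fmap D h A n x).
Proof. exact: (mm_congr x (fmapM D g h)). Qed.

Lemma colim_lift A n N (x : nat -> (L : module R) A n) :
  exists j (y : nat -> (D j : module R) A n), forall i, i < N -> lam j A n (y i) = x i.
Proof.
have [[[j0 _] join _] _ sur _] := colim.
elim: N => [|N [j [y yE]]]; first by exists j0, (fun=> bpt n).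
have [k [z zE]] := sur A n (x N); have [l [g [h _]]] := join j k.
exists l, (fun i => if i == N then fmap D h A n z else fmap D g A n (y i)) => i.
by case: eqP => [-> _|iN iN1]; rewrite colim_natE // yE //; lia.
Qed.

Lemma colim_eq1 A n j (x y : (D j : module R) A n) : lam j A n x = lam j A n y ->
  exists k (g : mor j k), fmap D g A n x = fmap D g A n y.
Proof.
have [[_ _ coeq] _ _ inj] := colim.
move=> /inj[l [g [h E]]]; have [k [m mE]] := coeq _ _ g h.
by exists k, (m \oc g); rewrite {2}mE !colimM E.
Qed.

Lemma colim_eq A n j N (x y : nat -> (D j : module R) A n) :
  (forall i, i < N -> lam j A n (x i) = lam j A n (y i)) ->
  exists k (g : mor j k), forall i, i < N -> fmap D g A n (x i) = fmap D g A n (y i).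
Proof.
elim: N => [|N IH] E; first by exists j, (idc j).
have [|k [g gE]] := IH; first by move=> i iN; apply: E; lia.
have [|l [h hE]] := @colim_eq1 A n k (fmap D g A n (x N)) (fmap D g A n (y N)).
  by rewrite !colim_natE; apply: E.
exists l, (h \oc g) => i iN; rewrite !colimM.
by have [->//|ne] := eqVneq i N; rewrite gE //; lia.
Qed.

Lemma colim_sh : levelwise_filtered_colimit
  (D := comp_functor (sh_functor R) D) (fun j => fmap (sh_functor R) (lam j)).
Proof.
have [fil nat sur inj] := colim; split=> //.
- by move=> j k h; rewrite -(nat j k h) fmapM.
- by move=> A n y; apply: sur.
by move=> A n j k x y; apply: inj.
Qed.

(** A loop is given by the simplices on the [n.+1] pieces of the prism, subject to finitely many
    equations: for the common faces and for the two ends. All of them hold at some stage of a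
    filtered diagram. *)
Lemma colim_Om_lift A n (z : (Omo L : module R) A n) :
  exists j (x : (Omo (D j) : module R) A n), Omm (lam j) A n x = z.
Proof.
pose K := omp L A n z.
have [j [y yE]] := @colim_lift A n.+1 n.+1 (fun i => pv K (sg n i) (th n i)).
have [|k [g gE]] := @colim_eq A n j n (fun i => sact (coface n i.+1) (y i))
    (fun i => sact (coface n i.+1) (y i.+1)).
  by move=> i i_n; rewrite !mm_act !yE ?path_tau_face //; lia.
have [|K' K'E] := @path_glue ((D k : module R) A) n (fun i => fmap D g A n.+1 (y i)).
  by move=> i i_n; rewrite -!mm_act gE.
have lK : pathf (lvl (lam k) A) n K' = K.
  apply: path_tau_eq => i i_n; rewrite /= (K'E _ _ _ i) //; last exact: (valid_tau (om_id _)).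
  rewrite mm_act colim_natE yE // -pv_act.
  have := @om_add_tau n.+1 n i (om_id _) i_n; rewrite !om_compf1 => ->.
  by rewrite !om_compf1.
(* The indices 0 and 1 stand for the ends [false] and [true], so that both equations are treated by
   one use of [colim_eq]. *)
have ends : forall i, i < 2 -> lam k A n (ev _ (i == 1) n K') = lam k A n (bpt n).
  move=> i _; rewrite mm_bpt -[LHS]/(ev _ (i == 1) n (pathf (lvl (lam k) A) n K')) lK.
  by case: (i == 1); [rewrite -(omp_r z)|rewrite -(omp_l z)].
have [l [h hE]] := @colim_eq A n k 2 (fun i => ev _ (i == 1) n K') (fun=> bpt n) ends.
have [||x xE] := @om_ex R (D l) A n (pathf (lvl (fmap D h) A) n K').
- by rewrite -[LHS]/(fmap D h A n (ev _ (0 == 1) n K')) hE // mm_bpt.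
- by rewrite -[LHS]/(fmap D h A n (ev _ (1 == 1) n K')) hE // mm_bpt.
exists l, x; apply: omp_inj; rewrite omp_nat xE -/K -lK.
by apply: path_eq => m a t /=; rewrite colim_natE.
Qed.

End Colimits.

Lemma colim_Om R J D L lam : @levelwise_filtered_colimit R J D L lam ->
  levelwise_filtered_colimit (D := comp_functor (Omf R) D) (fun j => fmap (Omf R) (lam j)).
Proof.
move=> H; have [fil nat sur inj] := H; split=> //.
- by move=> j k h; rewrite -(nat j k h) fmapM.
- by move=> A n y; apply: colim_Om_lift.
move=> A n j k x y xy; have [_ join _] := fil; have [l [g [h _]]] := join j k.
have E : forall i, i < n.+1 -> lam l A n.+1 (pv (omp (D l) A n (Omm (fmap D g) A n x)) (sg n i) (th n i)) =
    lam l A n.+1 (pv (omp (D l) A n (Omm (fmap D h) A n y)) (sg n i) (th n i)).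
  move=> i _; rewrite !omp_nat /= !(colim_natE H).
  have xy' : Omm (lam j) A n x = Omm (lam k) A n y by exact: xy.
  have := congr1 (fun z => pv (omp L A n z) (sg n i) (th n i)) xy'.
  by rewrite !omp_nat.
have [m [u uE]] := @colim_eq _ _ _ _ _ H A n.+1 l n.+1 (fun i => pv _ (sg n i) (th n i))
  (fun i => pv _ (sg n i) (th n i)) E.
exists m, (u \oc g), (u \oc h).
suff E' : Omm (fmap D (u \oc g)) A n x = Omm (fmap D (u \oc h)) A n y by exact: E'.
apply: omp_inj; apply: path_tau_eq => i i_n.
have := uE i i_n; rewrite !omp_nat /= => E'.
by rewrite !colimM.
Qed.

(** ** Maps out of the unit module *)

Section Unit.
Variable R : e1_ring.
Notation mc := (module_cat R).
Notation S := (module_stable R).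
Notation T := (hoc S).
Notation ov := fs_void.

(** Multiplication of ring elements with [x]: as a module, [R] is free on one vertex of level
    [ov]. *)
Definition unit_map_fun (M : mc) (x : (M : module R) ov 0) A n
    (r : (unit_module R : module R) A n) : (M : module R) A n :=
  tr (bij_sum0r A) (smul (r : R A n) (sact (to0 n) x)).

Lemma to0_om m n (a : ordmap m n) : om_comp (to0 n) a = to0 m.
Proof. exact: om_ext. Qed.

Definition unit_map (M : mc) (x : (M : module R) ov 0) : @mor mc (unit_module R) M.
Proof.
apply: (@ModuleMap R (unit_module R) M (@unit_map_fun M x)).
- by move=> A m n a r; rewrite /unit_map_fun -tr_act -smul_act sactA to0_om.
- by move=> A n; rewrite /unit_map_fun smul_bptl tr_bpt.
- move=> A B f n r; rewrite /unit_map_fun.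
  rewrite -[X in smul (tr f r) X](@tr_id (M : module R) ov (bij_id ov)) // smul_tr !tr_tr.
  by apply: tr_ext; case=> // -[].
move=> A B n r s; rewrite /unit_map_fun.
rewrite -[X in smul X (tr _ _)](@tr_id R A (bij_id A)) // smul_tr -smulA !tr_tr.
by apply: tr_ext; case=> [[]|[]].
Defined.

Lemma unit_mapE (M : mc) (x : (M : module R) ov 0) : @unit_map_fun M x ov 0 (rone R) = x.
Proof.
rewrite -[RHS]smul1 /unit_map_fun !(act_id (a := to0 0)) //; try by move=> i; apply: simp_eq; case: i => -[].
by apply: tr_ext; case.
Qed.

Lemma unit_map_nat (M N : mc) (f : mor M N) (x : (M : module R) ov 0) :
  f \oc unit_map x = unit_map (f ov 0 x).
Proof.
by apply: module_map_eq => A n r; rewrite /= /unit_map_fun mm_tr mm_smul mm_act.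
Qed.

Lemma unit_map_one : unit_map (M := unit_module R) (rone R) = idc _.
Proof. by apply: module_map_eq => A n r; apply: rmul1r. Qed.

Lemma unit_map_bpt (M : mc) : unit_map (M := M) (bpt 0) = zfrom (M : S) \oc zto (unit_module R : S).
Proof.
by apply: module_map_eq => A n r; rewrite /= /unit_map_fun act_bpt smul_bptr tr_bpt.
Qed.

(** A trivial fibration onto a free module splits by lifting the generator. Hence maps out of [R]
    are represented without fractions. *)
Lemma unit_lift (A : S) (t : @mor S A (unit_module R)) : tfib t ->
  exists a, t ov 0 a = rone R /\ t \oc unit_map (M := A) a = idc _.
Proof.
case=> tF /weakmP tW; have := weq_kf_tf (tF ov) (tW ov).
have bd0 k (a : ordmap k 0) : ~ bd a.
  by case=> j j0 /(_ (vertex0 k)); case: (a _) => i /=; lia.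
move=> /(_ 0 (fun k _ => bpt k) (rone R))[|k a /bd0 //|a [tE _]]; first by move=> k l a b /bd0.
by exists a; split=> //; rewrite -unit_map_one unit_map_nat; congr unit_map.
Qed.

Lemma unit_rep (M : S) (u : @mor T (unit_module R) M) :
  exists x, u = ho (unit_map (M := M) x : @mor S _ _).
Proof.
have [A [t [f [Tt E]]]] := ho_rep u; have [a [_ aE]] := unit_lift Tt.
exists (f ov 0 a); rewrite -unit_map_nat ho_comp -E compAr -ho_comp.
by rewrite [t \oc _]aE ho_id compf1.
Qed.

Lemma unit_htp (M : S) (x y : (M : module R) ov 0) :
  ho (unit_map (M := M) x : @mor S _ _) = ho (unit_map (M := M) y : @mor S _ _) <->
  exists z : (M : module R) ov 1, sact (cst1 false 0) z = x /\ sact (cst1 true 0) z = y.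
Proof.
split=> [/ho_lhtp[A [t [h [Tt h0 h1]]]]|[z [<- <-]]].
  have [a [aE _]] := unit_lift Tt; exists (pv (h ov 0 a) (to0 1) (om_id 1)); rewrite -!pv_act.
  have E (e : bool) (w : (M : module R) ov 0) : @compm mc _ _ _ (evm M e) h = @compm mc _ _ _ (unit_map (M := M) w) t ->
     pv (h ov 0 a) (om_comp (to0 1) (cst1 e 0)) (om_comp (om_id 1) (cst1 e 0)) = w.
    move=> /(mm_congr a) E; rewrite -[RHS]unit_mapE -aE -[RHS]E.
    by congr pv; apply: om_ext => -[[|i] ?].
  by split; apply: E.
have pvE k l (c : ordmap k l) (a : ordmap l 0) (t : ordmap l 1) :
  sact (om_comp t c) z = sact c (sact t z) by rewrite sactA.
pose K : (path_mod M : module R) ov 0 := @Path ((M : module R) ov) 0 (fun k a t => sact t z) pvE.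
have e (b : bool) : @compm mc _ _ _ (evm M b) (unit_map (M := path_mod M) K) = unit_map (M := M) (sact (cst1 b 0) z).
  by rewrite (unit_map_nat (M := path_mod M)).
rewrite -!e.
have := @lhtp_path S _ _ (unit_map (M := path_mod M) K) => /lhtp_ho; exact.
Qed.

End Unit.

Import GRing.Theory Num.Theory.
Local Open Scope ring_scope.

(** A unital cancelling operation satisfying the interchange law is the
    subtraction of an abelian group. *)
Section Subtraction.
Variables (G : Type) (z : G) (s : G -> G -> G).
Hypotheses (s0 : forall a, s a z = a) (ss : forall a, s a a = z)
  (sI : forall a b c d, s (s a b) (s c d) = s (s a c) (s b d)).
Definition sub_add a b := s a (s z b).

Lemma sub_add0 : left_id z sub_add.
Proof. by move=> b; rewrite /sub_add -{1}(ss b) sI s0 ss s0. Qed.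

Lemma sub_add0r a : sub_add a z = a.
Proof. by rewrite /sub_add ss s0. Qed.

Lemma sub_addN : left_inverse z (s z) sub_add.
Proof. by move=> a; rewrite /sub_add ss. Qed.

Lemma sub_addC : commutative sub_add.
Proof.
have H a b : sub_add a b = s z (s (s z a) b).
  by rewrite /sub_add -{1}[a]sub_add0 /sub_add sI ss.
move=> a b; rewrite !H; congr (s z _).
by rewrite -{1}[b]s0 sI s0.
Qed.

Lemma sub_addI a b c d : sub_add (sub_add a b) (sub_add c d) =
  sub_add (sub_add a c) (sub_add b d).
Proof.
have H x y : s z (sub_add x y) = s (s z x) (s z (s z y)).
  by rewrite /sub_add -{1}(ss z) sI.
by rewrite {1}/sub_add H {1}/sub_add sI -/(sub_add a c) -H.
Qed.

Lemma sub_addA : associative sub_add.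
Proof. by move=> a b c; rewrite -{1}[a]sub_add0r sub_addI sub_add0. Qed.

Lemma sub_addB a b : sub_add a (s z b) = s a b.
Proof. by rewrite /sub_add -[s z (s z b)]/(sub_add z b) sub_add0. Qed.

End Subtraction.

(** * The additive structure of the homotopy category *)

Section Additive.
Variable S : stable.
Implicit Types A B X Y Z : S.
Notation T := (hoc S).

(** ** Homotopy fibres *)

Section HomotopyFibre.
Variables (E B : S) (p : mor E B).

Definition hf : S := pbo p (ep_fib B).
Definition hf1 : mor hf E := pbo1 p (ep_fib B).
Definition hf2 : mor hf (Pt B) := pbo2 p (ep_fib B).

Lemma hfE : p \oc hf1 = ep B \oc hf2.
Proof. exact: pboE. Qed.

Lemma hf1_fib : fib hf1.
Proof. exact: pullback_fib (pboP _ _) (ep_fib B). Qed.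

Lemma hf2_fib : fib p -> fib hf2.
Proof. exact: pullback_fib (pullback_sym (pboP _ _)). Qed.

Lemma io0 X : ep X \oc io X = zfrom X \oc zto (Om S X).
Proof. by have [<- _] := io_ker X. Qed.

Lemma hfk_proof : p \oc (zfrom E \oc zto (Om S B)) = ep B \oc io B.
Proof. by rewrite comp_zero io0. Qed.

Definition hfk : mor (Om S B) hf := pbo_lift (ep_fib B) hfk_proof.
Lemma hfk1 : hf1 \oc hfk = zfrom E \oc zto (Om S B). Proof. exact: pbo_lift1. Qed.
Lemma hfk2 : hf2 \oc hfk = io B. Proof. exact: pbo_lift2. Qed.

Lemma hf_eq Z (u v : mor Z hf) : hf1 \oc u = hf1 \oc v -> hf2 \oc u = hf2 \oc v -> u = v.
Proof. exact: pbo_eq. Qed.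

Lemma hfk_ker : is_ker hfk hf1.
Proof.
split; first by rewrite hfk1.
move=> Z u v uv; have [_ U] := io_ker B.
have [|w [w1 w2 w3]] := U Z u (hf2 \oc v).
  by rewrite compA -hfE -compA -uv (ztoE u) compA (zfromE (p \oc _)).
exists w; split=> //.
  apply: hf_eq; first by rewrite compA hfk1 zero_comp -uv (ztoE u).
  by rewrite compA hfk2.
move=> w' _ w'2; apply: w3; first exact: pt_uniq.
by rewrite -w'2 compA hfk2.
Qed.

Section Fibre.
Variables (F : S) (i : mor F E).
Hypothesis iK : is_ker i p.

Lemma ker0 : p \oc i = zfrom B \oc zto F.
Proof. by case: iK => <-. Qed.

Lemma hfj_proof : p \oc i = ep B \oc (zfrom (Pt B) \oc zto F).
Proof. by rewrite comp_zero ker0. Qed.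

Definition hfj : mor F hf := pbo_lift (ep_fib B) hfj_proof.
Lemma hfj1 : hf1 \oc hfj = i. Proof. exact: pbo_lift1. Qed.
Lemma hfj2 : hf2 \oc hfj = zfrom _ \oc zto F. Proof. exact: pbo_lift2. Qed.

Lemma hfj_ker : is_ker hfj hf2.
Proof.
split; first by rewrite hfj2.
move=> Z u v uv; have [_ U] := iK.
have [|w [w1 w2 w3]] := U Z u (hf1 \oc v).
  by rewrite compA hfE -compA -uv (ztoE u) compA (zfromE (ep B \oc _)).
exists w; split=> //.
  apply: hf_eq; first by rewrite compA hfj1.
  by rewrite compA hfj2 zero_comp -uv (ztoE u).
move=> w' _ w'2; apply: w3; first exact: pt_uniq.
by rewrite -w'2 compA hfj1.
Qed.

Lemma hfj_weak : fib p -> weak hfj.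
Proof.
by move=> pF; apply: base_change hfj_ker (hf2_fib pF) (weak_pt (Pt_weak B)).
Qed.

End Fibre.

End HomotopyFibre.

Section FibreMap.
Variables (E B E' B' : S) (p : mor E B) (p' : mor E' B') (u : mor E E') (v : mor B B').
Hypothesis sq : p' \oc u = v \oc p.

Lemma hfm_proof : p' \oc (u \oc hf1 p) = ep B' \oc (Ptm v \oc hf2 p).
Proof. by rewrite !compA sq ep_nat !compAr hfE. Qed.

Definition hfm : mor (hf p) (hf p') := pbo_lift (ep_fib B') hfm_proof.
Lemma hfm1 : hf1 p' \oc hfm = u \oc hf1 p. Proof. exact: pbo_lift1. Qed.
Lemma hfm2 : hf2 p' \oc hfm = Ptm v \oc hf2 p. Proof. exact: pbo_lift2. Qed.

Lemma hfm_hfk : hfm \oc hfk p = hfk p' \oc fmap (Om S) v.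
Proof.
apply: hf_eq; rewrite !compA.
  by rewrite hfm1 hfk1 zero_comp compAr hfk1 comp_zero.
by rewrite hfm2 hfk2 compAr hfk2 io_nat.
Qed.

Lemma hfm_hfj F F' (i : mor F E) (i' : mor F' E') (iK : is_ker i p) (iK' : is_ker i' p')
  (w : mor F F') : i' \oc w = u \oc i -> hfm \oc hfj iK = hfj iK' \oc w.
Proof.
move=> sq'; apply: hf_eq; rewrite !compA.
  by rewrite hfm1 hfj1 compAr hfj1.
by rewrite hfm2 hfj2 zero_comp compAr hfj2 comp_zero.
Qed.

End FibreMap.

(** ** Subtraction on maps into a loop object *)

(** [wo X] is the space of pairs of based paths with a common end point; both
    inclusions of [Om X] are weak equivalences, and the class of a pair of loops
    is their difference. *)
Definition wo X : S := hf (ep X).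
Definition inc1 X : mor (Om S X) (wo X) := hfj (io_ker X).
Definition inc2 X : mor (Om S X) (wo X) := hfk (ep X).

Lemma inc1_weak X : weak (inc1 X).
Proof. exact/hfj_weak/ep_fib. Qed.

Lemma inc2_weak X : weak (inc2 X).
Proof. exact: base_change (hfk_ker (ep X)) (hf1_fib _) (weak_pt (Pt_weak X)). Qed.

Lemma incs_proof X : ep X \oc (io X \oc pr1 (Om S X) (Om S X)) = ep X \oc (io X \oc pr2 (Om S X) (Om S X)).
Proof. by rewrite !compA io0 -!compA; congr (_ \oc _); apply: pt_uniq. Qed.

Definition incs X : mor (prd (Om S X) (Om S X)) (wo X) := pbo_lift (ep_fib X) (incs_proof X).
Lemma incs1 X : hf1 (ep X) \oc incs X = io X \oc pr1 _ _. Proof. exact: pbo_lift1. Qed.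
Lemma incs2 X : hf2 (ep X) \oc incs X = io X \oc pr2 _ _. Proof. exact: pbo_lift2. Qed.

Definition wom X Y (f : mor X Y) : mor (wo X) (wo Y) := hfm (ep_nat f).

Lemma wom1 X Y (f : mor X Y) : hf1 (ep Y) \oc wom f = Ptm f \oc hf1 (ep X).
Proof. exact: hfm1. Qed.

Lemma wom2 X Y (f : mor X Y) : hf2 (ep Y) \oc wom f = Ptm f \oc hf2 (ep X).
Proof. exact: hfm2. Qed.

Lemma wom_inc1 X Y (f : mor X Y) : wom f \oc inc1 X = inc1 Y \oc fmap (Om S) f.
Proof. exact/hfm_hfj/io_nat. Qed.

Definition lsub A X (a b : @mor T A (Om S X)) : @mor T A (Om S X) :=
  hoV (inc1_weak X) \oc ho (incs X) \oc tpair a b.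

Lemma lsubE A X (a b : @mor T A (Om S X)) (A' : S) (t : mor A' A) (f g : mor A' (Om S X)) h :
  tfib t -> a \oc ho t = ho f -> b \oc ho t = ho g ->
  inc1 X \oc h = incs X \oc pair f g -> lsub a b \oc ho t = ho h.
Proof.
move=> Tt af bg E; apply: (iso_mono (ho_weak_iso (inc1_weak X))).
rewrite /lsub !compA hoKV comp1f -ho_comp E ho_comp compAr; congr (_ \oc _).
by rewrite tpair_pre af bg; apply: tpair_uniq; rewrite ?tpair1 ?tpair2 -ho_comp ?pair1 ?pair2.
Qed.

Lemma ho_io X : ho (io X) = tzero (Om S X) (Pt X).
Proof.
by apply: (iso_mono (ho_weak_iso (Pt_weak X))); apply: to_ptE.
Qed.

Lemma lsub0 A X (a : @mor T A (Om S X)) : lsub a (tzero A (Om S X)) = a.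
Proof.
have [A' [t [f [Tt E]]]] := ho_rep a; apply: (iso_epi (ho_weak_iso Tt.2)).
rewrite E; apply: (lsubE (g := zfrom _ \oc zto A') Tt E); first by rewrite tzero_r.
apply: hf_eq; rewrite !compA ?incs1 ?incs2 -?(compA (io X)) ?pair1 ?pair2.
  by rewrite hfj1.
by rewrite hfj2 comp_zero zero_comp.
Qed.

(** The pair [(f, f)] factors through the diagonal of [Pt X], which is contractible. *)
Lemma lsub_self A X (a : @mor T A (Om S X)) : lsub a a = tzero A (Om S X).
Proof.
have D : ep X \oc idc (Pt X) = ep X \oc idc (Pt X) by [].
pose d := pbo_lift (ep_fib X) D.
apply: (iso_mono (ho_weak_iso (inc1_weak X))).
rewrite /lsub !compA hoKV comp1f tzero_l.
have [A' [t [f [Tt E]]]] := ho_rep a; apply: (iso_epi (ho_weak_iso Tt.2)).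
rewrite compAr tpair_pre E tzero_r.
have -> : tpair (ho f) (ho f) = ho (pair f f).
  by apply: tpair_uniq; rewrite ?tpair1 ?tpair2 -ho_comp ?pair1 ?pair2.
rewrite -ho_comp.
have -> : incs X \oc pair f f = d \oc (io X \oc f).
  apply: hf_eq; rewrite !compA ?incs1 ?incs2 -?(compA (io X)) ?pair1 ?pair2.
    by rewrite (pbo_lift1 _ D) comp1f.
  by rewrite (pbo_lift2 _ D) comp1f.
by rewrite !ho_comp ho_io tzero_r tzero_l.
Qed.

Lemma lsub_pre A B X (a b : @mor T A (Om S X)) (w : @mor T B A) :
  lsub a b \oc w = lsub (a \oc w) (b \oc w).
Proof. by rewrite /lsub compAr tpair_pre. Qed.

Lemma lsub_post A X Y (a b : @mor T A (Om S X)) (f : mor X Y) :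
  ho (fmap (Om S) f) \oc lsub a b =
  lsub (ho (fmap (Om S) f) \oc a) (ho (fmap (Om S) f) \oc b).
Proof.
apply: (iso_mono (ho_weak_iso (inc1_weak Y))).
rewrite /lsub !compA hoKV comp1f -ho_comp -wom_inc1 ho_comp.
rewrite (compAr (ho (wom f))) hoKV compf1.
have -> : tpair (ho (fmap (Om S) f) \oc a) (ho (fmap (Om S) f) \oc b) =
    ho (pair (fmap (Om S) f \oc pr1 _ _) (fmap (Om S) f \oc pr2 _ _)) \oc tpair a b.
  by apply: tpair_uniq; rewrite ?tpair1 ?tpair2 compA -ho_comp ?pair1 ?pair2 ho_comp compAr ?tpair1 ?tpair2.
rewrite compA -!ho_comp; congr (ho _ \oc _).
apply: hf_eq; rewrite !compA ?wom1 ?wom2 ?incs1 ?incs2 -?compA.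
  by rewrite pair1 incs1 !compA io_nat.
by rewrite pair2 incs2 !compA io_nat.
Qed.

(** By [etaT] every object is a loop object up to isomorphism, so the difference of loops gives a
    difference of arbitrary maps. *)
Definition tsub A Y (a b : @mor T A Y) : @mor T A Y :=
  hoV (eta_weak Y) \oc lsub (etaT Y \oc a) (etaT Y \oc b).

Lemma etaV_eta A Y (a : @mor T A Y) : hoV (eta_weak Y) \oc (etaT Y \oc a) = a.
Proof. by rewrite compA hoVK comp1f. Qed.

Lemma tsub0 A Y (a : @mor T A Y) : tsub a (tzero A Y) = a.
Proof. by rewrite /tsub tzero_l lsub0 etaV_eta. Qed.

Lemma tsub_self A Y (a : @mor T A Y) : tsub a a = tzero A Y.
Proof. by rewrite /tsub lsub_self tzero_l. Qed.

Lemma tsub_pre A B Y (a b : @mor T A Y) (w : @mor T B A) :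
  tsub a b \oc w = tsub (a \oc w) (b \oc w).
Proof. by rewrite /tsub compAr lsub_pre !compAr. Qed.

Lemma eta_tsub A Y (a b : @mor T A Y) :
  etaT Y \oc tsub a b = lsub (etaT Y \oc a) (etaT Y \oc b).
Proof. by rewrite /tsub (compA (etaT Y)) hoKV comp1f. Qed.

Lemma etaT_ho X Y (f : mor X Y) : etaT Y \oc ho f = ho (fmap (Om S) (fmap (Sh S) f)) \oc etaT X.
Proof. by rewrite -!ho_comp eta_nat. Qed.

Lemma tsub_post_ho A X Y (a b : @mor T A X) (f : mor X Y) :
  ho f \oc tsub a b = tsub (ho f \oc a) (ho f \oc b).
Proof.
apply: (iso_mono (etaT_iso Y)).
rewrite (compA _ (ho f)) etaT_nat -(compA _ (etaT X)) !eta_tsub.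
rewrite (ShT_ho f) (OmT_ho (fmap (Sh S) f)) lsub_post.
congr (lsub _ _); rewrite !compA; congr (_ \oc _); exact: (esym (etaT_ho f)).
Qed.

Lemma tsub_post A X Y (a b : @mor T A X) (u : @mor T X Y) :
  u \oc tsub a b = tsub (u \oc a) (u \oc b).
Proof.
have [X' [t [f [[_ Wt] E]]]] := ho_rep u.
have H (c : @mor T A X) : c = ho t \oc (hoV Wt \oc c) by rewrite compA hoKV comp1f.
by rewrite (H a) (H b) -tsub_post_ho !(compA u) E -tsub_post_ho.
Qed.

Lemma tsub_pair A X Y (a c : @mor T A X) (b d : @mor T A Y) :
  tsub (tpair a b) (tpair c d) = tpair (tsub a c) (tsub b d).
Proof. by apply: tpair_uniq; rewrite tsub_post ?tpair1 ?tpair2. Qed.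

(** Subtraction is composition with a fixed map [m] out of the product, and composition preserves
    subtraction. *)
Lemma tsubI A Y (a b c d : @mor T A Y) :
  tsub (tsub a b) (tsub c d) = tsub (tsub a c) (tsub b d).
Proof.
pose m := tsub (ho (pr1 Y Y)) (ho (pr2 Y Y)).
have H (x y : @mor T A Y) : tsub x y = m \oc tpair x y by rewrite tsub_pre tpair1 tpair2.
by rewrite (H a b) (H c d) -tsub_post tsub_pair -H.
Qed.

Definition thom A Y : Type := @mor T A Y.

Section Zmod.
Variables A Y : S.
HB.instance Definition _ := gen_eqMixin (thom A Y).
HB.instance Definition _ := gen_choiceMixin (thom A Y).
HB.instance Definition _ := GRing.isZmodule.Build (thom A Y)
  (sub_addA (@tsub0 A Y) (@tsub_self A Y) (@tsubI A Y))
  (sub_addC (@tsub0 A Y) (@tsub_self A Y) (@tsubI A Y))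
  (sub_add0 (@tsub0 A Y) (@tsub_self A Y) (@tsubI A Y))
  (sub_addN (@tsub_self A Y)).
End Zmod.

Lemma thomB A Y (a b : thom A Y) : a - b = tsub a b :> thom A Y.
Proof. exact: (sub_addB (@tsub0 A Y) (@tsub_self A Y) (@tsubI A Y)). Qed.

Definition tcomp A X Y (u : thom X Y) (a : thom A X) : thom A Y := @compm T A X Y u a.

Lemma tcompBr A X Y (u : thom X Y) (a b : thom A X) : tcomp u (a - b) = tcomp u a - tcomp u b.
Proof. by rewrite !thomB; apply: tsub_post. Qed.

Lemma tcompBl A X Y (u v : thom X Y) (a : thom A X) : tcomp (u - v) a = tcomp u a - tcomp v a.
Proof. by rewrite !thomB; apply: tsub_pre. Qed.

Lemma tcomp0r A X Y (u : thom X Y) : tcomp u (0 : thom A X) = 0.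
Proof. exact: tzero_l. Qed.

Lemma tcomp0l A X Y (a : thom A X) : tcomp (0 : thom X Y) a = 0.
Proof. exact: tzero_r. Qed.

Lemma tcompNr A X Y (u : thom X Y) (a : thom A X) : tcomp u (- a) = - tcomp u a.
Proof. by rewrite -[- a]sub0r tcompBr tcomp0r sub0r. Qed.

Lemma tcompNl A X Y (u : thom X Y) (a : thom A X) : tcomp (- u) a = - tcomp u a.
Proof. by rewrite -[- u]sub0r tcompBl tcomp0l sub0r. Qed.

Lemma tcompDr A X Y (u : thom X Y) (a b : thom A X) : tcomp u (a + b) = tcomp u a + tcomp u b.
Proof. by rewrite -{1}[b]opprK tcompBr tcompNr opprK. Qed.

Lemma tcompDl A X Y (u v : thom X Y) (a : thom A X) : tcomp (u + v) a = tcomp u a + tcomp v a.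
Proof. by rewrite -{1}[v]opprK tcompBl tcompNl opprK. Qed.

Lemma tcompA A B X Y (h : thom X Y) (g : thom B X) (f : thom A B) :
  tcomp h (tcomp g f) = tcomp (tcomp h g) f.
Proof. exact: compA. Qed.

End Additive.

(** * Connecting maps of fibre sequences *)

Section Triangles.
Variable S : stable.
Implicit Types A B X Y Z : S.
Notation T := (hoc S).
Notation OM := (OmT S).
Notation SH := (ShT S).

Lemma tcancel (D : category) (A B X : D) (u : mor A B) (v : mor B A) (w : mor X B) :
  u \oc v = idc B -> u \oc (v \oc w) = w.
Proof. by rewrite compA => ->; rewrite comp1f. Qed.

Lemma tcancelr (D : category) (A B X : D) (u : mor A B) (v : mor B A) (w : mor B X) :
  u \oc v = idc B -> w \oc u \oc v = w.
Proof. by rewrite compAr => ->; rewrite compf1. Qed.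

Section Boundary.
Variables (F E B : S) (i : mor F E) (p : mor E B) (pF : fib p) (iK : is_ker i p).

(** The connecting map: loops of the base include into the homotopy fibre, which is weakly
    equivalent to the fibre [F]. *)
Definition bdm : @mor T (Om S B) F := hoV (hfj_weak iK pF) \oc ho (hfk p).

Lemma hfj_bd : ho (hfj iK) \oc bdm = ho (hfk p).
Proof. by rewrite /bdm (tcancel _ (hoKV _)). Qed.

Lemma hfj_hoV : ho i \oc hoV (hfj_weak iK pF) = ho (hf1 p).
Proof.
apply: (iso_epi (ho_weak_iso (hfj_weak iK pF))).
by rewrite compAr hoVK compf1 -ho_comp hfj1.
Qed.

End Boundary.

Lemma bd_nat (F E B F' E' B' : S) (i : mor F E) (p : mor E B) (pF : fib p) (iK : is_ker i p)
  (i' : mor F' E') (p' : mor E' B') (pF' : fib p') (iK' : is_ker i' p')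
  (w : mor F F') (u : mor E E') (v : mor B B') :
  p' \oc u = v \oc p -> i' \oc w = u \oc i ->
  ho w \oc bdm pF iK = bdm pF' iK' \oc fmap OM (ho v).
Proof.
move=> sq sq'; apply: (iso_mono (ho_weak_iso (hfj_weak iK' pF'))).
rewrite (compA _ (bdm pF' iK')) hfj_bd (OmT_ho v) -(ho_comp _ (fmap (Om S) v)) -(hfm_hfk sq) compA.
by rewrite -(ho_comp _ w) -(hfm_hfj sq iK iK' sq') !ho_comp compAr hfj_bd.
Qed.

(** The sign in the rotation of fibre sequences. *)
Definition nu X : @mor T (OM X) (OM X) := bdm (ep_fib X) (io_ker X).

Lemma nu_iso X : is_iso (nu X).
Proof.
apply: iso_comp; first exact: (ho_weak_iso (inc2_weak X)).
by exists (ho (hfj (io_ker X))); rewrite hoKV hoVK.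
Qed.

Lemma nu_nat X Y (u : @mor T X Y) : nu Y \oc fmap OM u = fmap OM u \oc nu X.
Proof.
apply: (@nat_ho _ OM OM nu) => {X Y u} X Y f.
by rewrite (OmT_ho f); symmetry; rewrite /nu (bd_nat _ _ (ep_fib Y) (io_ker Y) (ep_nat f) (io_nat f)) OmT_ho.
Qed.

(** ** Fibre sequences *)

Record model X Y Z (f : @mor T X Y) (g : @mor T Y Z) := Model {
  mF : S; mE : S; mB : S; mi : mor mF mE; mp : mor mE mB;
  mfib : fib mp; mker : is_ker mi mp;
  ma : @mor T X mF; mb : @mor T Y mE; mc : @mor T Z mB;
  ma_iso : is_iso ma; mb_iso : is_iso mb; mc_iso : is_iso mc;
  mi_eq : ho mi \oc ma = mb \oc f; mp_eq : ho mp \oc mb = mc \oc g }.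

Definition fs X Y Z (f : @mor T X Y) (g : @mor T Y Z) : Prop := exists m : model f g, True.

(** A connecting map is read off from a strict model, which is not unique; so it is kept as a
    relation. *)
Definition bdry X Y Z (f : @mor T X Y) (g : @mor T Y Z) (d : @mor T (OM Z) X) : Prop :=
  exists m : model f g, ma m \oc d = bdm (mfib m) (mker m) \oc fmap OM (mc m).

Lemma bdry_ex X Y Z (f : @mor T X Y) (g : @mor T Y Z) : fs f g -> exists d, bdry f g d.
Proof.
case=> m _; have [a' [a1 a2]] := ma_iso m.
by exists (a' \oc (bdm (mfib m) (mker m) \oc fmap OM (mc m))), m; rewrite tcancel.
Qed.

Lemma idT_iso A : is_iso (@idc T A).
Proof. by exists (@idc T A); rewrite comp1f. Qed.

Section Rotate.
Variables (X Y Z : S) (f : @mor T X Y) (g : @mor T Y Z) (d : @mor T (OM Z) X).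

(** The kernel of [hf1] is the loop object of the base, so the homotopy fibre of a model provides a
    model of the rotated sequence. Its connecting map is compared with [nu] by the map [hf2] to the
    path fibration. *)
Lemma bdry_rot : bdry f g d -> bdry d f (nu Z \oc fmap OM g).
Proof.
case=> m dE; have iE : is_iso (ho (hfj (mker m)) \oc ma m).
  exact: iso_comp (ma_iso m) (ho_weak_iso (hfj_weak _ (mfib m))).
have e1 : ho (hfk (mp m)) \oc fmap OM (mc m) = ho (hfj (mker m)) \oc ma m \oc d.
  by rewrite compAr dE compA hfj_bd.
have e2 : ho (hf1 (mp m)) \oc (ho (hfj (mker m)) \oc ma m) = mb m \oc f.
  by rewrite compA -ho_comp hfj1 mi_eq.
exists (Model (hf1_fib (mp m)) (hfk_ker (mp m)) (fmap_iso OM (mc_iso m)) iE (mb_iso m) e1 e2).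
suff H : fmap OM (mc m) \oc (nu Z \oc fmap OM g) =
    bdm (hf1_fib (mp m)) (hfk_ker (mp m)) \oc fmap OM (mb m) by exact: H.
rewrite compA -nu_nat compAr -fmapM -(mp_eq m) fmapM compA; congr (_ \oc _).
have := bd_nat (hf1_fib (mp m)) (hfk_ker (mp m)) (ep_fib _) (io_ker _) (esym (hfE (mp m))) (w := idc _).
by rewrite compf1 hfk2 ho_id comp1f => -> //.
Qed.

Lemma bdry_fs : bdry f g d -> fs f g.
Proof. by case=> m _; exists m. Qed.

Lemma fs_comp0 : fs f g -> g \oc f = tzero X Z.
Proof.
case=> m _; apply: (iso_mono (mc_iso m)); rewrite tzero_l compA -mp_eq compAr -mi_eq compA.
by rewrite -ho_comp (ker0 (mker m)) ho_zero tzero_r.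
Qed.

(** A null-homotopy of [g u], available after refining [A], is the same as a lift of [u] to the
    homotopy fibre. *)
Lemma fs_exact A (u : @mor T A Y) : fs f g -> g \oc u = tzero A Z ->
  exists x : @mor T A X, f \oc x = u.
Proof.
case=> m _ gu; have [A' [t [v [Tt vE]]]] := ho_rep (mb m \oc u).
have /ho_lhtp[A'' [s [h [Ts h0 h1]]]] : ho (mp m \oc v) = ho (zfrom (mB m) \oc zto A').
  by rewrite ho_comp -vE !compA mp_eq (compAr (mc m)) gu tzero_l tzero_r.
have [|k kE] := @null_path S _ _ h; first by rewrite h1 zero_comp.
have lE : mp m \oc (v \oc s) = ep (mB m) \oc k by rewrite kE h0 compA.
have W : is_iso (ho (t \oc s)) := ho_weak_iso (tfib_comp Ts Tt).2.
have [r [r1 r2]] := W; have [a' [a1 a2]] := ma_iso m.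
exists (a' \oc (hoV (hfj_weak (mker m) (mfib m)) \oc (ho (pbo_lift (ep_fib _) lE) \oc r))).
apply: (iso_mono (mb_iso m)); rewrite compA -mi_eq compAr (tcancel _ a2).
rewrite (compA _ (hoV _)) hfj_hoV compA -ho_comp.
apply: (iso_epi W); rewrite (tcancelr _ r1) /hf1 pbo_lift1 !ho_comp -vE.
by rewrite !compAr.
Qed.

End Rotate.

Lemma bdry_fs_rot X Y Z (f : @mor T X Y) (g : @mor T Y Z) (d : @mor T (OM Z) X) :
  bdry f g d -> fs d f.
Proof. by move=> /bdry_rot/bdry_fs. Qed.

(** ** Kernels of strict maps *)

Lemma ker_ex E B (p : mor E B) : fib p -> exists F (i : mor F E), is_ker i p.
Proof.
move=> pF; have [F [q [i H]]] := pullback_ex (zfrom B) pF.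
by exists F, i; rewrite /is_ker -(ztoE q).
Qed.

Lemma ker_lift F E B (i : mor F E) (p : mor E B) A (u : mor A E) : is_ker i p ->
  p \oc u = zfrom B \oc zto A -> exists v, i \oc v = u.
Proof.
case=> _ U E0; have [|v [_ v2 _]] := U A (zto A) u; first by rewrite E0.
by exists v.
Qed.

Lemma ker_inj F E B (i : mor F E) (p : mor E B) A (u v : mor A F) : is_ker i p ->
  i \oc u = i \oc v -> u = v.
Proof.
move=> iK uv; have [_ U] := iK.
have [|w [_ _ wU]] := U A (zto A) (i \oc v).
  by rewrite (compA p) (ker0 iK) zero_comp.
by transitivity w; [apply: wU => //|symmetry; apply: wU => //]; apply: pt_uniq.
Qed.

Lemma is_kerI F E B (i : mor F E) (p : mor E B) : p \oc i = zfrom B \oc zto F ->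
  (forall A (u : mor A E), p \oc u = zfrom B \oc zto A -> exists v, i \oc v = u) ->
  (forall A (u v : mor A F), i \oc u = i \oc v -> u = v) -> is_ker i p.
Proof.
move=> p0 ex un; split=> // A u v; rewrite (ztoE u) => E0.
have [w wE] := ex A v (esym E0); exists w; split=> //; first exact: pt_uniq.
by move=> w' _ w'E; apply: un; rewrite w'E.
Qed.

Lemma pb_uniq A B E P (f : mor A B) (p : mor E B) (q1 : mor P A) (q2 : mor P E) Z
  (u v : mor Z P) : is_pullback f p q1 q2 -> q1 \oc u = q1 \oc v -> q2 \oc u = q2 \oc v -> u = v.
Proof.
case=> sq U E1 E2; have [|w [_ _ wU]] := U Z (q1 \oc v) (q2 \oc v).
  by rewrite !compA sq.
by transitivity w; [apply: wU|symmetry; apply: wU].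
Qed.

Lemma pb_ker F E B W Q (i : mor F E) (p : mor E B) (u : mor W B) (q1 : mor Q W) (q2 : mor Q E) :
  is_ker i p -> is_pullback u p q1 q2 -> exists i1 : mor F Q, q2 \oc i1 = i /\ is_ker i1 q1.
Proof.
move=> iK Q2; have [sq U] := Q2.
have [|i1 [i1a i1b _]] := U F (zfrom W \oc zto F) i; first by rewrite (ker0 iK) comp_zero.
exists i1; split=> //; apply: is_kerI => // [A v v0|A v w vw]; last first.
  by apply: (ker_inj iK); rewrite -i1b -!compA vw.
have [|x xE] := @ker_lift _ _ _ _ _ A (q2 \oc v) iK.
  by rewrite compA -sq compAr v0 comp_zero.
exists x; apply: (pb_uniq Q2); rewrite compA; last by rewrite i1b.
by rewrite i1a zero_comp v0.
Qed.

Lemma comp_ker F E B E2 F2 (i : mor F E) (p : mor E B) (s : mor E2 E) (i2 : mor F2 E2) (r : mor F2 F) :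
  is_ker i p -> is_pullback i s r i2 -> is_ker i2 (p \oc s).
Proof.
move=> iK P2; have [sq U] := P2; apply: is_kerI => [|A v v0|A v w vw].
- by rewrite compAr -sq compA (ker0 iK) zero_comp.
- have [|x xE] := @ker_lift _ _ _ _ _ A (s \oc v) iK; first by rewrite compA.
  by have [w [_ w2 _]] := U A x v xE; exists w.
apply: (pb_uniq P2) => //; apply: (ker_inj iK).
by rewrite !compA sq !compAr vw.
Qed.

(** A null-homotopy of [b p] is a map from the fibre sequence to the path fibration of [L], and the
    equation is naturality of the connecting map. First [B] is refined to make [b] strict, then the
    total object to make the null-homotopy strict. *)
Lemma bd_null F E B (i : mor F E) (p : mor E B) (pF : fib p) (iK : is_ker i p) L
  (b : @mor T B L) : b \oc ho p = tzero E L ->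
  exists v : @mor T F (OM L), v \oc bdm pF iK = nu L \oc fmap OM b.
Proof.
move=> bp; have [B' [t [b' [Tt bE]]]] := ho_rep b.
have [E' [q1 [q2 Q]]] := pullback_ex t pF.
have q1F : fib q1 := pullback_fib Q pF.
have [i1 [i1E i1K]] := pb_ker iK Q; have sq : t \oc q1 = p \oc q2 by case: Q.
have /ho_lhtp[E2 [s [h [Ts h0 h1]]]] : ho (b' \oc q1) = ho (zfrom L \oc zto E').
  by rewrite ho_comp -bE compAr -ho_comp sq ho_comp compA bp tzero_r.
have [|k kE] := @null_path S _ _ h; first by rewrite h1 zero_comp.
have [F2 [r [i2 P]]] := pullback_ex i1 Ts.1.
have rW : weak r := pullback_weak P Ts.1 Ts.2.
have i2K := comp_ker i1K P; have p2F : fib (q1 \oc s) := fib_comp Ts.1 q1F.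
have [|w wE] := @ker_lift _ _ _ _ _ F2 (k \oc i2) (io_ker L).
  by rewrite compA kE h0 !compAr (compA q1) (ker0 i2K) comp_zero.
have N1 : ho r \oc bdm p2F i2K = bdm pF iK \oc fmap OM (ho t).
  apply: (bd_nat _ _ _ _ (u := q2 \oc s)); first by rewrite !compA -sq.
  by have [pE _] := P; rewrite compAr -pE compA i1E.
have N2 : ho w \oc bdm p2F i2K = nu L \oc fmap OM (ho b').
  by apply: (bd_nat _ _ _ _ (u := k)) => //; rewrite kE h0 compA.
exists (ho w \oc hoV rW); apply: (iso_epi (fmap_iso OM (ho_weak_iso Tt.2))).
rewrite -(compA _ (bdm pF iK)) -N1 -(compA (ho w)) (tcancel _ (hoVK _)) N2 -bE fmapM.
exact: compA.
Qed.

End Triangles.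

(** * Exactness in the first variable, rotation and the octahedral axiom *)

Section Exactness.
Variable S : stable.
Implicit Types A B X Y Z : S.
Notation T := (hoc S).
Notation OM := (OmT S).
Notation SH := (ShT S).

Lemma fs_iso X Y Z X' Y' Z' (f : @mor T X Y) (g : @mor T Y Z) (f' : @mor T X' Y')
  (g' : @mor T Y' Z') (a : @mor T X' X) (b : @mor T Y' Y) (c : @mor T Z' Z) :
  is_iso a -> is_iso b -> is_iso c -> f \oc a = b \oc f' -> g \oc b = c \oc g' ->
  fs f g -> fs f' g'.
Proof.
move=> ai bi ci fa gb [m _].
have e1 : ho (mi m) \oc (ma m \oc a) = mb m \oc b \oc f' by rewrite compA mi_eq compAr fa compA.
have e2 : ho (mp m) \oc (mb m \oc b) = mc m \oc c \oc g' by rewrite compA mp_eq compAr gb compA.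
by exists (Model (mfib m) (mker m) (iso_comp ai (ma_iso m)) (iso_comp bi (mb_iso m))
  (iso_comp ci (mc_iso m)) e1 e2).
Qed.

Lemma fs_Om X Y Z (f : @mor T X Y) (g : @mor T Y Z) : fs f g -> fs (fmap OM f) (fmap OM g).
Proof.
case=> m _.
have e1 : ho (fmap (Om S) (mi m)) \oc fmap OM (ma m) = fmap OM (mb m) \oc fmap OM f.
  by rewrite -(OmT_ho (mi m)) -!fmapM mi_eq.
have e2 : ho (fmap (Om S) (mp m)) \oc fmap OM (mb m) = fmap OM (mc m) \oc fmap OM g.
  by rewrite -(OmT_ho (mp m)) -!fmapM mp_eq.
by exists (Model (Om_fib (mfib m)) (Om_ker (mfib m) (mker m)) (fmap_iso OM (ma_iso m))
  (fmap_iso OM (mb_iso m)) (fmap_iso OM (mc_iso m)) e1 e2).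
Qed.

Lemma fs_Sh X Y Z (f : @mor T X Y) (g : @mor T Y Z) : fs f g -> fs (fmap SH f) (fmap SH g).
Proof.
case=> m _.
have e1 : ho (fmap (Sh S) (mi m)) \oc fmap SH (ma m) = fmap SH (mb m) \oc fmap SH f.
  by rewrite -(ShT_ho (mi m)) -!fmapM mi_eq.
have e2 : ho (fmap (Sh S) (mp m)) \oc fmap SH (mb m) = fmap SH (mc m) \oc fmap SH g.
  by rewrite -(ShT_ho (mp m)) -!fmapM mp_eq.
by exists (Model (Sh_fib (mfib m)) (Sh_ker (mfib m) (mker m)) (fmap_iso SH (ma_iso m))
  (fmap_iso SH (mb_iso m)) (fmap_iso SH (mc_iso m)) e1 e2).
Qed.

Lemma fs_strict F E B (i : mor F E) (p : mor E B) : fib p -> is_ker i p -> fs (ho i) (ho p).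
Proof.
move=> pF iK; have e C D (u : mor C D) : ho u \oc @idc T C = @idc T D \oc ho u.
  by rewrite compf1 comp1f.
by exists (Model pF iK (idT_iso F) (idT_iso E) (idT_iso B) (e _ _ i) (e _ _ p)).
Qed.

Lemma bdry_null X Y Z (f : @mor T X Y) (g : @mor T Y Z) (d : @mor T (OM Z) X) L
  (b : @mor T Z L) : bdry f g d -> b \oc g = tzero Y L ->
  exists v : @mor T X (OM L), v \oc d = fmap OM b.
Proof.
case=> m dE bg; have [c' [c1 c2]] := mc_iso m; have [n [n1 n2]] := nu_iso L.
have [|v vE] := @bd_null S _ _ _ _ _ (mfib m) (mker m) L (b \oc c').
  apply: (iso_epi (mb_iso m)); rewrite tzero_r -(compA _ (ho (mp m))) mp_eq.
  by rewrite -(compA b) (tcancel _ c1).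
exists (n \oc (v \oc ma m)); rewrite -!compA dE.
by rewrite (compA v) vE -(compA (nu L)) (tcancel _ n1) -fmapM -compA c1 compf1.
Qed.

(** For the rotated sequence [bdry_null] gives the factorization after looping once; as [OmT] is
    full and faithful, the loops can be removed. *)
Lemma fs_contra X Y Z (f : @mor T X Y) (g : @mor T Y Z) L (u : @mor T Y L) :
  fs f g -> u \oc f = tzero X L -> exists v : @mor T Z L, v \oc g = u.
Proof.
move=> /bdry_ex[d /bdry_rot D] uf; have [v vE] := bdry_null D uf.
have [v' v'E] := OmT_full (v \oc nu Z); exists v'; apply: OmT_faithful.
by rewrite fmapM v'E compAr vE.
Qed.

Lemma fs_rotl X Y Z (f : @mor T X Y) (g : @mor T Y Z) : fs f g ->
  exists d : @mor T (OM Z) X, fs d f /\ fs (nu Z \oc fmap OM g) d.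
Proof.
move=> /bdry_ex[d D]; exists d; split; first exact: bdry_fs_rot D.
exact: bdry_fs_rot (bdry_rot D).
Qed.

(** This is rotation to the left of the shifted sequence, with [OM (SH Z)] replaced by [Z]. The sign
    [nu] is absorbed into the isomorphism that does so. *)
Lemma fs_rotr X Y Z (f : @mor T X Y) (g : @mor T Y Z) : fs f g ->
  exists d : @mor T Z (SH X), fs g d /\ fs d (fmap SH f).
Proof.
move=> /fs_Sh/fs_rotl[d [D1 D2]]; exists (d \oc (nu (SH Z) \oc etaT Z)).
have I : is_iso (nu (SH Z) \oc etaT Z) := iso_comp (etaT_iso Z) (nu_iso (SH Z)).
split.
  apply: (fs_iso (etaT_iso Y) I (idT_iso _)) D2; last by rewrite comp1f.
  by rewrite -(compA _ (fmap OM _)) -etaT_nat compA.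
by apply: (fs_iso I (idT_iso _) (idT_iso _)) D1; rewrite ?comp1f ?compf1.
Qed.

Lemma bdry_strict F E B (i : mor F E) (p : mor E B) (pF : fib p) (iK : is_ker i p) :
  bdry (ho i) (ho p) (bdm pF iK).
Proof.
have e C D (u : mor C D) : ho u \oc @idc T C = @idc T D \oc ho u.
  by rewrite compf1 comp1f.
exists (Model pF iK (idT_iso F) (idT_iso E) (idT_iso B) (e _ _ i) (e _ _ p)).
by rewrite [LHS]comp1f fmap1 [RHS]compf1.
Qed.

(** ** Constructions *)

Lemma fibration_rep Y Z (g : @mor T Y Z) :
  exists Q (p : mor Q Z) (b : @mor T Y Q), [/\ fib p, is_iso b & ho p \oc b = g].
Proof.
have [Y' [t [f [[_ Wt] E]]]] := ho_rep g.
have [Q [r [e [h [Fr Wr Fe [h0 h1] U]]]]] := path_factor f.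
have he : ho e = ho f \oc ho r by rewrite -h1 -ho_comp -h0 !ho_comp ho_ends.
exists Q, e, (hoV Wr \oc hoV Wt); split=> //.
  by apply: iso_comp; [exists (ho t)|exists (ho r)]; rewrite hoVK hoKV.
by rewrite he -(compA (ho f)) (tcancel _ (hoKV _)) -E (tcancelr _ (hoKV _)).
Qed.

Lemma fibre_ex Y Z (g : @mor T Y Z) : exists X (f : @mor T X Y), fs f g.
Proof.
have [Q [p [b [pF bi gE]]]] := fibration_rep g; have [F [i iK]] := ker_ex pF.
have [b' [b1 b2]] := bi; exists F, (b' \oc ho i).
apply: (fs_iso (idT_iso _) bi (idT_iso _)) (fs_strict pF iK); last by rewrite comp1f.
by rewrite compf1 (tcancel _ b2).
Qed.

Lemma fs_pull X Y Z W (f : @mor T X Y) (g : @mor T Y Z) (u : @mor T W Z) : fs f g ->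
  exists Q (f' : @mor T X Q) (g' : @mor T Q W) (v : @mor T Q Y),
    [/\ fs f' g', g \oc v = u \oc g' & v \oc f' = f].
Proof.
case=> m _; have [W' [t [u' [[_ Wt] uE]]]] := ho_rep (mc m \oc u).
have [Q [q1 [q2 P]]] := pullback_ex u' (mfib m).
have [i1 [i1E i1K]] := pb_ker (mker m) P; have q1F := pullback_fib P (mfib m).
have [b' [b1 b2]] := mb_iso m.
exists Q, (ho i1 \oc ma m), (ho t \oc ho q1), (b' \oc ho q2); split.
- apply: (fs_iso (ma_iso m) (idT_iso _) _ _ _ (fs_strict q1F i1K)); last first.
  + by rewrite compf1; symmetry; apply: (tcancel _ (hoVK Wt)).
  + by rewrite comp1f.
  by exists (ho t); rewrite hoVK hoKV.
- apply: (iso_mono (mc_iso m)); rewrite !compA uE -mp_eq (tcancelr _ b2).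
  by rewrite -!ho_comp; case: P => ->.
by rewrite -(compA b') (compA (ho q2)) -ho_comp i1E mi_eq (tcancel _ b1).
Qed.

Lemma fs_id A : fs (ho (zfrom A)) (@idc T A).
Proof.
rewrite -ho_id; apply: fs_strict; first exact/fib_iso/idc_iso.
apply: is_kerI => [|B u|B u v _]; last exact: pt_uniq.
  by rewrite comp1f; apply: pt_uniq'.
by rewrite comp1f => ->; exists (zto B).
Qed.

Lemma fs_prd X Y : exists f : @mor T Y (prd X Y), fs f (ho (pr1 X Y)).
Proof.
have pF : fib (pr1 X Y) := pullback_fib (pboP _ _) (fib_zto Y).
exists (ho (pair (zfrom X \oc zto Y) (idc Y))); apply: fs_strict => //.
apply: is_kerI => [|B u u0|B u v uv]; first by rewrite pair1.
  exists (pr2 X Y \oc u); apply: prd_eq; rewrite !compA ?pair1 ?pair2 ?comp1f //.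
  by rewrite zero_comp zero_comp u0.
by have := congr1 (fun w => pr2 X Y \oc w) uv; rewrite !compA pair2 !comp1f.
Qed.

Lemma fs_compl X Y Z (f : @mor T X Y) (g : @mor T Y Z) (L : S) (u v : thom L Y) : fs f g ->
  tcomp g u = tcomp g v -> exists x : thom L X, v = u + tcomp f x.
Proof.
move=> D gu; have [|x xE] := @fs_exact S _ _ _ _ _ L (v - u) D.
  by rewrite -[LHS]/(tcomp g (v - u)) tcompBr gu subrr.
by exists x; rewrite /tcomp xE addrC subrK.
Qed.

(** The five lemma for sequences with the same fibre: [q2] annihilates no nonzero map, and a section
    of it is constructed after looping. *)
Lemma fs_map_iso F E B Q W (i : mor F E) (p : mor E B) (i1 : mor F Q) (q1 : mor Q W)
  (q2 : mor Q E) (k : mor W B) : fib p -> is_ker i p -> fib q1 -> is_ker i1 q1 ->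
  p \oc q2 = k \oc q1 -> q2 \oc i1 = i -> is_iso (ho k) -> is_iso (ho q2).
Proof.
move=> pF iK q1F i1K sq sqi kI.
have N : bdm q1F i1K = bdm pF iK \oc fmap OM (ho k).
  rewrite -(bd_nat q1F i1K pF iK (w := idc F) sq) ?compf1 //.
  by rewrite ho_id comp1f.
have [k' [k1 k2]] := fmap_iso OM kI.
have D1 := bdry_strict q1F i1K; have D := bdry_strict pF iK.
have inj A (u : @mor T A Q) : ho q2 \oc u = tzero A E -> u = tzero A Q.
  move=> u0; have [|y yE] := @fs_exact S _ _ _ _ _ A u (bdry_fs D1).
    by apply: (iso_mono kI); rewrite tzero_l compA -ho_comp -sq ho_comp compAr u0 tzero_l.
  have [|z zE] := @fs_exact S _ _ _ _ _ A y (bdry_fs_rot D).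
    by rewrite -sqi ho_comp compAr yE.
  rewrite -yE -zE -(compf1 (bdm pF iK)) -k2 (compA (bdm pF iK)) -N.
  by rewrite -(compA (bdm q1F i1K)) (compA (ho i1)) (fs_comp0 (bdry_fs_rot D1)) tzero_r.
have sq' : fmap OM (ho p) \oc fmap OM (ho q2) = fmap OM (ho k) \oc fmap OM (ho q1).
  by rewrite -!fmapM -!ho_comp sq.
(* The component of the identity of [OM E] in [OM B] is lifted through [OM Q]; the remaining
   difference comes from the looped fibre and is added in [s]. *)
have [|y yE] := @fs_exact S _ _ _ _ _ _ (k' \oc fmap OM (ho p)) (bdry_fs_rot (bdry_rot D1)).
  rewrite N -(compA (bdm pF iK)) (tcancel _ k2); have [n [n1 n2]] := nu_iso E.
  have := fs_comp0 (bdry_fs_rot (bdry_rot D)); rewrite nu_nat => /(congr1 (fun w => w \oc n)).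
  by rewrite tzero_r (compA (bdm pF iK)) (tcancelr _ n2).
have [|z zE] := @fs_compl _ _ _ _ _ _ (fmap OM (ho q2) \oc (nu Q \oc y)) (@idc T _) (fs_Om (bdry_fs D)).
  rewrite /tcomp compf1 compA sq' -(compA (fmap OM (ho k))) (compA (fmap OM (ho q1))) -nu_nat yE.
  by rewrite (tcancel _ k2).
pose s : thom _ _ := (nu Q \oc y : thom (OM E) (OM Q)) + tcomp (fmap OM (ho i1)) z.
have sE : fmap OM (ho q2) \oc s = @idc T _.
  rewrite zE -[LHS]/(tcomp (fmap OM (ho q2)) s) tcompDr tcompA.
  by rewrite [tcomp _ (fmap _ _)](esym (fmapM OM (ho q2) (ho i1))) -ho_comp sqi.
have [s' s'E] := OmT_full s; exists s'.
have q2s : ho q2 \oc s' = @idc T E by apply: OmT_faithful; rewrite fmapM s'E fmap1.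
split=> //; have H := inj Q ((s' \oc ho q2 : thom Q Q) - (@idc T Q : thom Q Q)).
apply: (subr0_eq (V := thom Q Q)); apply: H.
rewrite -[LHS]/(tcomp (ho q2) _) tcompBr /tcomp (tcancel _ q2s) compf1. exact: (@subrr (thom Q E) (ho q2)).
Qed.

(** A part of the octahedral axiom: the fibre of a composite is an extension of the two fibres. It
    makes composites of even epimorphisms even epimorphisms. *)
Lemma fs_comp X C B X' A (f : @mor T X C) (g : @mor T C B) (f' : @mor T X' B) (g' : @mor T B A) :
  fs f g -> fs f' g' -> exists K (h : @mor T K C) (k : @mor T X K) (l : @mor T K X'),
    fs h (g' \oc g) /\ fs k l.
Proof.
case=> m _ [m' _]; have [b [b1 b2]] := mb_iso m'.
(* The base of one model and the total object of the other are isomorphic in the homotopy category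
   only; [W] with [t] and [k] is a strict span between them. *)
have [W [t [k [Tt kE]]]] := ho_rep (mc m \oc b).
have kI : is_iso (ho k).
  rewrite -kE; apply: iso_comp (ho_weak_iso Tt.2) _; apply: iso_comp (mc_iso m).
  by exists (mb m').
have [Q [q1 [q2 P]]] := pullback_ex k (mfib m).
have [i1 [i1E i1K]] := pb_ker (mker m) P; have q1F := pullback_fib P (mfib m).
have [sq _] := P.
have q2I := fs_map_iso (mfib m) (mker m) q1F i1K (esym sq) i1E kI.
have [V [r [j PV]]] := pullback_ex (mi m') Tt.1.
have rI : is_iso (ho r) := ho_weak_iso (pullback_weak PV Tt.1 Tt.2).
have jK := comp_ker (mker m') PV; have ptF := fib_comp Tt.1 (mfib m').
have [K [k1 [k2 PK]]] := pullback_ex j q1F.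
have k2K := comp_ker jK PK; have [i3 [i3E i3K]] := pb_ker i1K (PK).
have k1F := pullback_fib PK q1F.
have [q2' [q2a q2b]] := q2I; have [b' [b'1 b'2]] := mb_iso m.
have [a [a1 a2]] := ma_iso m'.
exists K, (b' \oc (ho q2 \oc ho k2)), (ho i3 \oc ma m), (a \oc (ho r \oc ho k1)); split.
  apply: (fs_iso (idT_iso _) _ (mc_iso m') _ _ (fs_strict (fib_comp q1F ptF) k2K)).
  - exact: (iso_comp (mb_iso m) (ex_intro _ (ho q2) (conj q2b q2a))).
  - by rewrite compf1 -(compA q2') (tcancel _ b'2) (tcancel _ q2a).
  have H : ho t \oc (ho q1 \oc (q2' \oc mb m)) = mb m' \oc g.
    apply: (iso_mono (iso_comp (ex_intro _ (mb m') (conj b2 b1)) (mc_iso m))).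
    rewrite (compA (mc m \oc b)) kE (compA (ho k)) -ho_comp sq ho_comp.
    rewrite -(compA (ho (mp m))) (tcancel _ q2b) mp_eq.
    by rewrite -(compA (mc m)) (tcancel _ b1).
  by rewrite !ho_comp !compAr H compA mp_eq compAr.
have rV := pullback_weak PV Tt.1 Tt.2.
apply: (fs_iso (ma_iso m) (idT_iso _) _ _ _ (fs_strict k1F i3K)).
- apply: (iso_comp (ma_iso m') (g := hoV rV)); by exists (ho r); rewrite hoKV hoVK.
- by rewrite comp1f.
by rewrite compf1 -(compA (hoV rV)) (tcancel _ a2) (tcancel _ (hoVK rV)).
Qed.

End Exactness.

(** * The presented hom groups and additivity of functors *)

Section AddHoms.
Variable S : stable.
Implicit Types A B X Y Z : S.
Notation T := (hoc S).
Notation OM := (OmT S).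
Notation SH := (ShT S).

Lemma zero_hom0 A B (f : thom A B) : @is_zero_hom T A B f -> f = 0.
Proof.
case=> Z [Z0 [g [h ->]]]; have [[z [_ zU]] _] := Z0 Z.
have E : @idc T Z = tzero Z Z by rewrite -(zU (@idc T Z) I) -(zU (tzero Z Z) I).
by rewrite -[h](@comp1f T) E tzero_r tzero_l.
Qed.

Lemma tsum_inj X Y P (p1 : thom P X) (p2 : thom P Y) A (u v : thom A P) :
  (forall (f : thom A X) (g : thom A Y), exists! u : @mor T A P, p1 \oc u = f /\ p2 \oc u = g) ->
  tcomp p1 u = tcomp p1 v -> tcomp p2 u = tcomp p2 v -> u = v.
Proof.
move=> U e1 e2; have [w [_ wU]] := U (tcomp p1 v) (tcomp p2 v).
by rewrite -(wU u) // -(wU v).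
Qed.

Lemma biprod_sum X Y P i1 i2 p1 p2 : @biproduct T X Y P i1 i2 p1 p2 ->
  tcomp (i1 : thom X P) (p1 : thom P X) + tcomp (i2 : thom Y P) (p2 : thom P Y) =
  (@idc T P : thom P P).
Proof.
case=> e11 e22 /zero_hom0 e12 /zero_hom0 e21 U _.
apply: (tsum_inj (U P)); rewrite tcompDr !tcompA /tcomp ?e11 ?e22 ?e12 ?e21 compf1.
  by rewrite comp1f [tzero _ _ \oc _]tcomp0l addr0.
by rewrite comp1f [tzero _ _ \oc _]tcomp0l add0r.
Qed.

Lemma biprod_comp X Y P i1 i2 p1 p2 A B (u : thom A P) (v : thom P B) :
  @biproduct T X Y P i1 i2 p1 p2 ->
  tcomp v u = (v \oc i1 \oc p1 \oc u : thom A B) + (v \oc i2 \oc p2 \oc u : thom A B).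
Proof.
move=> /biprod_sum H.
have -> : tcomp v u = tcomp v (tcomp (tcomp (i1 : thom X P) (p1 : thom P X) +
    tcomp (i2 : thom Y P) (p2 : thom P Y)) u) by rewrite H /tcomp comp1f.
by rewrite tcompDl tcompDr !tcompA.
Qed.

Definition prd1 X Y : @mor T X (prd X Y) := tpair (@idc T X) (tzero X Y).
Definition prd2 X Y : @mor T Y (prd X Y) := tpair (tzero Y X) (@idc T Y).

Lemma tzero_hom A B : @is_zero_hom T A B (tzero A B).
Proof.
exists (pt S); split; first exact: is_zero_pt.
by exists (ho (zfrom B)), (ho (zto A)); rewrite -ho_comp.
Qed.

Lemma prd_biproduct X Y :
  @biproduct T X Y (prd X Y) (prd1 X Y) (prd2 X Y) (ho (pr1 X Y)) (ho (pr2 X Y)).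
Proof.
have e1 : tcomp (prd1 X Y : thom _ _) (ho (pr1 X Y) : thom _ _) +
    tcomp (prd2 X Y : thom _ _) (ho (pr2 X Y) : thom _ _) = (@idc T _ : thom _ _).
  apply: tpair_uniq; rewrite -[LHS]/(tcomp (_ : thom _ _) _) tcompDr !tcompA /tcomp /prd1 /prd2 ?tpair1 ?tpair2.
    by rewrite comp1f compf1 [tzero _ _ \oc _]tcomp0l addr0.
  by rewrite comp1f compf1 [tzero _ _ \oc _]tcomp0l add0r.
split; rewrite /prd1 /prd2 ?tpair1 ?tpair2 //; try exact: tzero_hom.
  move=> A f g; exists (tpair f g); split; first by rewrite tpair1 tpair2.
  move=> w [<- <-].
  by apply: tpair_uniq; rewrite ?tpair1 ?tpair2.
move=> A f g; pose v : thom (prd X Y) A := tcomp (f : thom X A) (ho (pr1 X Y) : thom _ _) + tcomp (g : thom Y A) (ho (pr2 X Y) : thom _ _).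
exists v; split.
  split; rewrite -[LHS]/(tcomp v _) tcompDl -!tcompA /tcomp /prd1 /prd2 ?tpair1 ?tpair2 compf1.
    by rewrite [_ \oc tzero _ _]tcomp0r addr0.
  by rewrite [_ \oc tzero _ _]tcomp0r add0r.
move=> w [w1 w2]; rewrite /v -w1 -w2 -[RHS](@compf1 T) -e1 -[RHS]/(tcomp (w : thom _ _) _).
by rewrite tcompDr !tcompA.
Qed.

(** ** Addition of maps agrees with the presented group of maps *)

Fixpoint hev A B (x : @hterm T A B) : thom A B :=
  match x with
  | hgen f => f
  | hzero => 0
  | hopp y => - hev y
  | hadd y z => hev y + hev z
  end.

Lemma hev_eq A B (x y : @hterm T A B) : heq x y -> hev x = hev y.
Proof.
elim=> {x y} //=.
- by move=> x y z _ -> _ ->.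
- by move=> x x' _ ->.
- by move=> x x' y y' _ -> _ ->.
- by move=> x y z; rewrite addrA.
- by move=> x y; rewrite addrC.
- by move=> x; rewrite add0r.
- by move=> x; rewrite addNr.
by move=> X Y P i1 i2 p1 p2 u v H; exact: (biprod_comp u v H).
Qed.

Definition ungen A B (x : @add_hom T A B) : thom A B := hev (qrep x).

Lemma ungen_cls A B (x : @hterm T A B) : @ungen A B (@qcls (@hterm_pregroup T A B) x) = hev x.
Proof. by apply: hev_eq; apply: (@qrep_cls (@hterm_pregroup T A B)). Qed.

Lemma genK A B (f : thom A B) : ungen (@gen T A B f) = f.
Proof. exact: ungen_cls. Qed.

Lemma ungenB A B (x y : @add_hom T A B) : ungen (x - y) = ungen x - ungen y.
Proof. by rewrite -(qrepK x) -(qrepK y) -qclsN -qclsD !ungen_cls. Qed.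

Lemma genD A B (f g : thom A B) : @gen T A B (f + g : thom A B) = @gen T A B f + @gen T A B g.
Proof.
pose v : thom (prd B B) B := (ho (pr1 B B) : thom _ _) + (ho (pr2 B B) : thom _ _).
rewrite -qclsD; apply/qclsP.
have := @heq_biprod T A B _ _ _ _ _ _ _ (tpair f g) v (prd_biproduct B B).
have v1 : v \oc prd1 B B = @idc T B.
  rewrite -[LHS]/(tcomp v _) tcompDl /tcomp /prd1 tpair1 tpair2; exact: (@addr0 (thom B B)).
have v2 : v \oc prd2 B B = @idc T B.
  rewrite -[LHS]/(tcomp v _) tcompDl /tcomp /prd2 tpair1 tpair2; exact: (@add0r (thom B B)).
have -> : v \oc tpair f g = f + g.
  by rewrite -[LHS]/(tcomp v _) tcompDl /tcomp tpair1 tpair2.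
by rewrite v1 v2 !(@comp1f T) tpair1 tpair2.
Qed.

Lemma ungenK A B (x : @add_hom T A B) : gen (ungen x) = x.
Proof.
rewrite -(qrepK x); move: (qrep x) => h; rewrite ungen_cls.
have g0 : @gen T A B (0 : thom A B) = 0.
  by apply: (@addrI _ (@gen T A B (0 : thom A B))); rewrite -genD !addr0.
elim: h => [f||y IH|y IHy z IHz].
- by [].
- exact: g0.
- have -> : gen (hev (hopp y) : thom A B) = - @gen T A B (hev y).
    by apply: (@addrI _ (@gen T A B (hev y))); rewrite -genD !subrr.
  by rewrite IH -(@qclsN (@hterm_pregroup T A B)).
have -> : gen (hev (hadd y z) : thom A B) = @gen T A B (hev y) + @gen T A B (hev z) by exact: genD.
by rewrite IHy IHz -(@qclsD (@hterm_pregroup T A B)).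
Qed.

Lemma ungen_inj A B (x y : @add_hom T A B) : ungen x = ungen y -> x = y.
Proof. by move=> xy; rewrite -(ungenK x) xy ungenK. Qed.

Lemma ungen_map A B A' B' (g : @mor T B B') (f : @mor T A' A) (x : @add_hom T A B) :
  ungen (add_hom_map g f x) = g \oc ungen x \oc f.
Proof. by rewrite -[in LHS](ungenK x) add_hom_mapE genK. Qed.

(** ** Additive functors *)

Section FullyFaithful.
Variable F : functor T T.
Hypothesis F_faithful : forall X Y (u v : @mor T X Y), fmap F u = fmap F v -> u = v.
Hypothesis F_full : forall X Y (w : @mor T (F X) (F Y)), exists u : @mor T X Y, fmap F u = w.

Lemma fmap0 X Y : fmap F (tzero X Y) = tzero (F X) (F Y).
Proof.
have E : @idc T (F (pt S)) = tzero (F (pt S)) (F (pt S)).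
  have [u uE] := F_full (tzero (F (pt S)) (F (pt S))).
  by rewrite -uE (to_ptE u (@idc T _)) fmap1.
have -> : tzero X Y = ho (zfrom Y) \oc (@idc T (pt S) \oc ho (zto X)).
  by rewrite comp1f -ho_comp.
by rewrite !fmapM fmap1 E tzero_r tzero_l.
Qed.

(** The sum [s] of the images of the two projectors is [fmap F w] by fullness, and [w] is the
    identity because its components are, by faithfulness. So [F] preserves the decomposition of the
    product, hence sums. *)
Lemma fmapD X Y (u v : thom X Y) :
  fmap F (u + v : thom X Y) = (fmap F u : thom (F X) (F Y)) + (fmap F v : thom (F X) (F Y)).
Proof.
pose p1 : thom _ _ := ho (pr1 Y Y); pose p2 : thom _ _ := ho (pr2 Y Y).
pose s : thom (F (prd Y Y)) (F (prd Y Y)) := tcomp (fmap F (prd1 Y Y) : thom _ _) (fmap F p1 : thom _ _) +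
  tcomp (fmap F (prd2 Y Y) : thom _ _) (fmap F p2 : thom _ _).
have [w wE] := F_full s.
have s1 : s = @idc T _.
  rewrite -wE -fmap1; congr (fmap F _); apply: tpair_uniq; apply: F_faithful; rewrite !fmapM wE fmap1 compf1.
    rewrite -[LHS]/(tcomp (fmap F p1 : thom _ _) s) tcompDr !tcompA /tcomp -!fmapM /p1 /p2 /prd1 /prd2 !tpair1 comp1f tzero_r fmap0.
    exact: (@addr0 (thom _ _)).
  rewrite -[LHS]/(tcomp (fmap F p2 : thom _ _) s) tcompDr !tcompA /tcomp -!fmapM /p1 /p2 /prd1 /prd2 !tpair2 comp1f tzero_r fmap0.
  exact: (@add0r (thom _ _)).
pose d : thom _ _ := (p1 + p2 : thom (prd Y Y) Y).
have d1 : d \oc prd1 Y Y = @idc T Y.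
  rewrite -[LHS]/(tcomp d _) tcompDl /tcomp /prd1 tpair1 tpair2; exact: (@addr0 (thom Y Y)).
have d2 : d \oc prd2 Y Y = @idc T Y.
  rewrite -[LHS]/(tcomp d _) tcompDl /tcomp /prd2 tpair1 tpair2; exact: (@add0r (thom Y Y)).
have -> : u + v = d \oc tpair u v.
  by rewrite -[RHS]/(tcomp d _) tcompDl /tcomp tpair1 tpair2.
rewrite fmapM -[fmap F d]compf1 -s1 -[LHS]/(tcomp (tcomp (fmap F d : thom _ _) s) (fmap F (tpair u v) : thom _ _)).
rewrite tcompDr tcompDl !tcompA /tcomp -!fmapM d1 d2 !comp1f.
by rewrite tpair1 tpair2.
Qed.

End FullyFaithful.

End AddHoms.

(** * Shifts as representing functors *)

Section Weights.
Variable S : stable.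
Implicit Types A B X Y Z M : S.
Notation T := (hoc S).
Notation OM := (OmT S).
Notation SH := (ShT S).

Definition adj A M (u : thom (SH A) M) : thom A (OM M) := fmap OM u \oc etaT A.

Lemma adj_inj A M (u v : thom (SH A) M) : adj u = adj v -> u = v.
Proof. by move=> /(iso_epi (etaT_iso A))/OmT_faithful. Qed.

Lemma adj_surj A M (w : thom A (OM M)) : exists u : thom (SH A) M, adj u = w.
Proof.
have [e [e1 e2]] := etaT_iso A; have [u uE] := OmT_full (w \oc e).
by exists u; rewrite /adj uE (tcancelr _ e1).
Qed.

Lemma adjD A M (u v : thom (SH A) M) : adj (u + v) = adj u + adj v.
Proof.
by rewrite /adj (fmapD (@OmT_faithful S) (@OmT_full S)) -[LHS]/(tcomp (_ + _) (etaT A)) tcompDl.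
Qed.

Lemma adj_nat A A' M M' (f : @mor T A' A) (g : @mor T M M') (u : thom (SH A) M) :
  adj (g \oc u \oc fmap SH f) = fmap OM g \oc adj u \oc f.
Proof. by rewrite /adj !fmapM !compAr -etaT_nat. Qed.

(** The loops next to [M] are taken first, so that [adjn] can move one shift at a time from the
    source to [M] by recursion. *)
Fixpoint omn k : functor T T :=
  if k is k'.+1 then comp_functor (omn k') OM else id_functor T.

Fixpoint adjn k A : forall M, thom (iter k SH A) M -> thom A (omn k M) :=
  match k with
  | 0 => fun M u => u
  | k'.+1 => fun M u => @adjn k' A (OM M) (adj u)
  end.

Lemma adjn_inj k A M (u v : thom (iter k SH A) M) : adjn u = adjn v -> u = v.
Proof. by elim: k M u v => [|k IH] M u v //= /IH/adj_inj. Qed.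

Lemma adjn_surj k A M (w : thom A (omn k M)) : exists u : thom (iter k SH A) M, adjn u = w.
Proof.
elim: k M w => [|k IH] M w; first by exists w.
by have [v <-] := IH (OM M) w; have [u <-] := adj_surj v; exists u.
Qed.

Lemma adjnD k A M (u v : thom (iter k SH A) M) : adjn (u + v) = adjn u + adjn v.
Proof. by elim: k M u v => [|k IH] M u v //=; rewrite adjD IH. Qed.

Lemma adjn_nat k A A' M M' (f : @mor T A' A) (g : @mor T M M') (u : thom (iter k SH A) M) :
  adjn (g \oc u \oc iter_fmap SH k f : thom (iter k SH A') M') = fmap (omn k) g \oc adjn u \oc f.
Proof. by elim: k M M' g u => [|k IH] M M' g u //=; rewrite adj_nat IH. Qed.

Definition shn k : functor T T :=
  @Functor T T (iter k SH) (iter_fmap SH k) (iter_fmap1 SH k) (iter_fmapM SH k).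

(** The functor representing [pi_n map]: [pi_n map (A, M)] is [[A, SN n M]]. *)
Definition SN (n : int) : functor T T :=
  match n with Posz k => omn k | Negz k => shn k.+1 end.

Lemma fs_SN n X Y Z (f : @mor T X Y) (g : @mor T Y Z) :
  fs f g -> fs (fmap (SN n) f) (fmap (SN n) g).
Proof.
case: n => k; first by elim: k X Y Z f g => //= k IH X Y Z f g H; apply/IH/fs_Om.
by move=> H; rewrite /=; apply/fs_Sh; elim: k => //= k IH; apply: fs_Sh.
Qed.

Lemma isom_refl (D : category) (X : D) : isomorphic X X.
Proof. by exists (idc X), (idc X); rewrite comp1f. Qed.

Lemma isom_sym (D : category) (X Y : D) : isomorphic X Y -> isomorphic Y X.
Proof. by case=> f [g [e1 e2]]; exists g, f. Qed.

Lemma isom_trans (D : category) (X Y Z : D) :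
  isomorphic X Y -> isomorphic Y Z -> isomorphic X Z.
Proof. by case=> f fi [g gi]; exists (g \oc f); apply: iso_comp. Qed.

Lemma isom_fmap (C D : category) (F : functor C D) (X Y : C) :
  isomorphic X Y -> isomorphic (F X) (F Y).
Proof. by case=> f fi; exists (fmap F f); apply: fmap_iso. Qed.

Lemma OmSh_isom X : @isomorphic T (OM (SH X)) X.
Proof. by apply: isom_sym; exists (etaT X); apply: etaT_iso. Qed.

Lemma ShOm_isom X : @isomorphic T (SH (OM X)) X.
Proof. by apply: isom_trans (OmSh_isom X); exists (kapT X); apply: kapT_iso. Qed.

Lemma omnSr k M : omn k (OM M) = OM (omn k M).
Proof. by elim: k M => //= k IH M; rewrite IH. Qed.

Lemma SN_Om n M : @isomorphic T (OM (SN n M)) (SN (n + 1) M).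
Proof.
case: n => k.
  by rewrite -PoszD addn1 /= omnSr; apply: isom_refl.
case: k => [|k]; first by apply: OmSh_isom.
have -> : Negz k.+1 + 1 = Negz k by lia.
exact: OmSh_isom.
Qed.

Lemma SN_Sh n M : @isomorphic T (SH (SN n M)) (SN (n - 1) M).
Proof.
have H : @isomorphic T (SN n M) (OM (SN (n - 1) M)).
  by apply: isom_sym; move: (SN_Om (n - 1) M); rewrite subrK.
exact: isom_trans (isom_fmap SH H) (ShOm_isom _).
Qed.

Definition nul A X : Prop := forall u : @mor T A X, u = tzero A X.

Lemma nul_iso A X Y : @isomorphic T X Y -> nul A X -> nul A Y.
Proof.
by case=> f [g [gf fg]] H u; rewrite -[u](@comp1f T) -fg compAr (H (g \oc u)) tzero_l.
Qed.

Lemma nul_isol A B X : @isomorphic T A B -> nul A X -> nul B X.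
Proof.
by case=> f [g [gf fg]] H u; rewrite -[u](@compf1 T) -fg compA (H (u \oc f)) tzero_r.
Qed.

Lemma nul_Sh A X : nul A (OM X) -> nul (SH A) X.
Proof.
move=> H u; apply: adj_inj; rewrite (H (adj u)); symmetry; exact: H.
Qed.

Lemma nul_ShSh A X : nul (SH A) (SH X) -> nul A X.
Proof. by move=> H u; apply: (@ShT_faithful S); exact: etrans (H _) (esym (H _)). Qed.

End Weights.

(** * Perfect even modules *)

Section Perfect.
Variable R : e1_ring.
Notation md := (module_cat R).
Notation S := (module_stable R).
Notation T := (hoc S).
Notation OM := (OmT S).
Notation SH := (ShT S).
Notation unit := (unit_module R : S).
Notation PE := (@perfect_even R).
Implicit Types A B X Y Z : S.

Lemma fsP X Y Z (f : @mor T X Y) (g : @mor T Y Z) : @fibre_sequence R X Y Z f g <-> fs f g.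
Proof.
split=> [[F [E [B [i [p [a [b [c [pF iS [ai bi ci] e1 e2]]]]]]]]]|[m _]].
  have pF' : @fib S _ _ p by move=> A; apply/(kfP (lvl p A))/pF.
  have iK : @is_ker S _ _ _ i p by apply/is_kerP.
  by exists (@Model S _ _ _ f g F E B i p pF' iK a b c ai bi ci e1 e2).
exists (mF m), (mE m), (mB m), (mi m), (mp m), (ma m), (mb m), (mc m).
split; [|exact: (proj1 (is_kerP _ (mfib m)) (mker m))|exact: (And3 (ma_iso m) (mb_iso m) (mc_iso m))|exact: (mi_eq m)|exact: (mp_eq m)].
by move=> A; exact: (proj2 (kfP (lvl (mp m) A)) (mfib m A)).
Qed.

Lemma pe_ext X Y Z (f : @mor T X Y) (g : @mor T Y Z) : fs f g -> PE X -> PE Z -> PE Y.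
Proof. by move=> /fsP; apply: perfect_even_ext. Qed.

Lemma pe_iso X Y : @isomorphic T X Y -> PE X -> PE Y.
Proof. by case=> f [g [gf fg]]; apply: (@perfect_even_retract R Y X g f). Qed.

Lemma pe_pt : PE (pt S).
Proof.
apply: (@perfect_even_retract R (pt S) unit (ho (zfrom unit : @mor S _ _)) (ho (zto unit : @mor S _ _))).
  exact: (@to_ptE S).
exact: perfect_even_unit.
Qed.

Lemma pe_prd X Y : PE X -> PE Y -> PE (prd X Y).
Proof. by move=> pX pY; have [f H] := fs_prd X Y; apply: pe_ext H pY pX. Qed.

Lemma pe_Sh2 X : PE X -> PE (SH (SH X)).
Proof.
elim=> {X} [k X kX|X Y Z f g /fsP H _ pX _ pZ|X Y s r rs _ pY].
- case: k kX => k /= kX.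
    apply: (@perfect_even_shift R k.+1); exact: (isom_fmap SH (isom_fmap SH kX)).
  case: k kX => [|k] kX; first exact: (@perfect_even_shift R 0).
  apply: (@perfect_even_shift R (Negz k)) => /=.
  by rewrite -!(iterSr _ SH) /=.
- exact: pe_ext (fs_Sh (fs_Sh H)) pX pZ.
apply: (@perfect_even_retract R _ _ (fmap SH (fmap SH s)) (fmap SH (fmap SH r)) _ pY).
by rewrite -!fmapM rs !fmap1.
Qed.

Lemma pe_Om2 X : PE X -> PE (OM (OM X)).
Proof.
have SO Y : @isomorphic T (SH (SH (OM (OM Y)))) Y.
  exact: isom_trans (isom_fmap SH (ShOm_isom (OM Y))) (ShOm_isom Y).
have OS Y : @isomorphic T (OM (OM (SH (SH Y)))) Y.
  exact: isom_trans (isom_fmap OM (OmSh_isom (SH Y))) (OmSh_isom Y).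
elim=> {X} [k X kX|X Y Z f g /fsP H _ pX _ pZ|X Y s r rs _ pY].
- case: k kX => [[|k]|k] /= kX.
  + apply: (@perfect_even_shift R (Negz 0)) => /=; exact: isom_trans (SO X) kX.
  + apply: (@perfect_even_shift R k); apply: isom_trans (OS _).
    exact: (isom_fmap OM (isom_fmap OM kX)).
  apply: (@perfect_even_shift R (Negz k.+1)).
  have E n Y : iter n.+2 SH Y = iter n SH (SH (SH Y)) by rewrite -!iterSr.
  suff: @isomorphic T (iter k.+1.*2.+2 SH (OM (OM X))) unit by [].
  rewrite E; apply: isom_trans kX; exact: (isom_fmap (shn S k.+1.*2) (SO X)).
- exact: pe_ext (fs_Om (fs_Om H)) pX pZ.
apply: (@perfect_even_retract R _ _ (fmap OM (fmap OM s)) (fmap OM (fmap OM r)) _ pY).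
by rewrite -!fmapM rs !fmap1.
Qed.

(** ** Compactness *)

Definition compact A : Prop :=
  forall (J : category) (D : functor J md) (L : md) (lam : forall j, mor (D j) L),
  levelwise_filtered_colimit lam ->
  (forall u : @mor T A L, exists j (v : @mor T A (D j)), ho (lam j : @mor S _ _) \oc v = u) /\
  (forall j (u : @mor T A (D j)), ho (lam j : @mor S _ _) \oc u = tzero A (L : S) ->
     exists k (g : mor j k), ho (fmap D g : @mor S _ _) \oc u = tzero A (D k : S)).

Lemma compact_retract X Y (s : @mor T X Y) (r : @mor T Y X) : r \oc s = @idc T X ->
  compact Y -> compact X.
Proof.
move=> rs cY J D L lam H; have [sur inj] := cY J D L lam H; split=> [u|j u u0].
  have [j [v vE]] := sur (u \oc r); exists j, (v \oc s).
  by rewrite compA vE -compA rs compf1.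
have [|k [g gE]] := inj j (u \oc r); first by rewrite compA u0 tzero_r.
exists k, g; rewrite -[u](@compf1 T) -rs (compA u) compA gE; exact: tzero_r.
Qed.

Lemma compact_iso X Y : @isomorphic T X Y -> compact X -> compact Y.
Proof. by case=> f [g [gf fg]]; apply: compact_retract fg. Qed.

(** By adjunction maps from [SH A] to the colimit are maps from [A] to its loops, and loops commute
    with these colimits. *)
Lemma compact_Sh A : compact A -> compact (SH A).
Proof.
move=> cA J D L lam H; have [sur inj] := cA _ _ _ _ (colim_Om H); split=> [u|j u u0].
  have [j [v vE]] := sur (adj (u : thom (SH A) (L : S))); have [w wE] := @adj_surj S A (D j) v.
  exists j, w; apply: (@adj_inj S A L); rewrite -vE -wE /adj fmapM compAr.
  by rewrite (OmT_ho (lam j : @mor S _ _)).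
have [|k [g gE]] := inj j (adj (u : thom (SH A) (D j : S))).
  have := congr1 (@adj S A L) u0; rewrite /adj fmapM compAr (OmT_ho (lam j : @mor S _ _)).
  by rewrite (fmap0 (@OmT_full S)) tzero_r.
exists k, g; apply: (@adj_inj S A (D k)); rewrite /adj fmapM compAr (OmT_ho (fmap D g : @mor S _ _)).
by rewrite (fmap0 (@OmT_full S)) tzero_r -gE.
Qed.

Lemma compact_ShV A : compact (SH A) -> compact A.
Proof.
move=> cA J D L lam H; have [sur inj] := cA _ _ _ _ (colim_sh H); split=> [u|j u u0].
  have [j [v vE]] := sur (fmap SH u); have [w wE] := @ShT_full S A (D j) v.
  exists j, w; apply: (@ShT_faithful S); rewrite -vE -wE fmapM.
  by rewrite (ShT_ho (lam j : @mor S _ _)).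
have [|k [g gE]] := inj j (fmap SH u).
  have := congr1 (@fmap _ _ SH _ _) u0; rewrite fmapM (ShT_ho (lam j : @mor S _ _)).
  by rewrite (fmap0 (@ShT_full S)).
exists k, g; apply: (@ShT_faithful S); rewrite fmapM (ShT_ho (fmap D g : @mor S _ _)).
by rewrite (fmap0 (@ShT_full S)) -gE.
Qed.

Lemma compact_Om A : compact A -> compact (OM A).
Proof. by move=> cA; apply/compact_ShV/(compact_iso (isom_sym (ShOm_isom A))). Qed.

(** The five lemma for long exact sequences in the first variable; the neighbouring terms are maps
    out of [OM Z] and [SH X]. *)
Lemma compact_ext X Y Z (f : @mor T X Y) (g : @mor T Y Z) : fs f g ->
  compact X -> compact Z -> compact Y.
Proof.
move=> H cX cZ J D L lam HL.
have nat j k (h : mor j k) : ho (lam k : @mor S _ _) \oc ho (fmap D h : @mor S _ _) = ho (lam j : @mor S _ _).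
  by rewrite -ho_comp; congr ho; apply: (colim_nat HL).
have Dc j k l (h : mor j k) (h' : mor k l) :
    ho (fmap D (h' \oc h) : @mor S _ _) = ho (fmap D h' : @mor S _ _) \oc ho (fmap D h : @mor S _ _).
  by rewrite -ho_comp; congr ho; apply: fmapM.
have [surX injX] := cX _ _ _ _ HL; have [surZ injZ] := cZ _ _ _ _ HL.
have [_ injOZ] := compact_Om cZ HL; have [surSX _] := compact_Sh cX HL.
have [d [D1 D2]] := fs_rotl H; have [e [E1 E2]] := fs_rotr H.
split=> [u|j u u0].
  have [j [w wE]] := surX (u \oc f).
  have [|k [h hE]] := injOZ j (w \oc d).
    by rewrite compA wE -compA (fs_comp0 D1) tzero_l.
  have [|v vE] := @fs_contra S _ _ _ _ _ _ (ho (fmap D h : @mor S _ _) \oc w) D1; first by rewrite -compA.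
  (* [v] realizes the restriction of [u] to [X] at the stage [k], so the difference factors through
     [Z]. *)
  pose u' : thom Y (L : S) := (u : thom Y (L : S)) - tcomp (ho (lam k : @mor S _ _)) v.
  have [|t tE] := @fs_contra S _ _ _ _ _ _ u' H.
    rewrite -[LHS]/(tcomp u' f) tcompBl -tcompA /tcomp vE (compA (ho _)) nat wE.
    exact: (@subrr (thom X (L : S))).
  have [l [s sE]] := surZ t; have [[_ join _] _ _ _] := HL.
  have [m [p [q _]]] := join k l.
  exists m, (tcomp (ho (fmap D p : @mor S _ _)) (v : thom Y (D k : S)) + tcomp (ho (fmap D q : @mor S _ _)) (tcomp s g) : thom Y (D m : S)).
  rewrite -[LHS]/(tcomp (ho (lam m : @mor S _ _)) (_ : thom _ _)) tcompDr !tcompA /tcomp !nat.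
  by rewrite sE tE addrC subrK.
have [|k [h hE]] := injX j (u \oc f); first by rewrite compA u0 tzero_r.
have [|v vE] := @fs_contra S _ _ _ _ _ _ (ho (fmap D h : @mor S _ _) \oc u) H; first by rewrite -compA.
have [|s sE] := @fs_contra S _ _ _ _ _ _ (ho (lam k : @mor S _ _) \oc v) E1.
  by rewrite -compA vE compA nat.
have [l [s' s'E]] := surSX s; have [[_ join _] _ _ _] := HL.
have [m [p [q _]]] := join k l.
(* The image of [v] in the colimit comes from [SH X]. Subtracting a representative of this part
   makes it vanish there, without changing the restriction to [Y], since [e g = 0]. *)
pose w : thom Z (D m : S) := (ho (fmap D p : @mor S _ _) \oc v : thom Z (D m : S)) -
  (ho (fmap D q : @mor S _ _) \oc s' \oc e : thom Z (D m : S)).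
have [|n [r rE]] := injZ m w.
  rewrite -[LHS]/(tcomp (ho (lam m : @mor S _ _)) w) tcompBr /tcomp !compA !nat s'E sE.
  exact: (@subrr (thom Z (L : S))).
exists n, (r \oc (p \oc h)); rewrite !Dc -!compA -vE.
have wE : (ho (fmap D r : @mor S _ _) \oc (ho (fmap D p : @mor S _ _) \oc v) : thom Z (D n : S)) =
    ho (fmap D r : @mor S _ _) \oc (ho (fmap D q : @mor S _ _) \oc s' \oc e).
  apply: (@subr0_eq (thom Z (D n : S))); rewrite -[RHS]rE -[RHS]/(tcomp (ho (fmap D r : @mor S _ _)) w).
  by rewrite tcompBr.
by rewrite (compA (ho (fmap D p : @mor S _ _)) v) (compA (ho (fmap D r : @mor S _ _))) wE -!compA (fs_comp0 E1) !tzero_l.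
Qed.

(** A map out of the unit is a vertex and a null-homotopy is an edge at level [fs_void], and the
    colimit is computed simplexwise. *)
Lemma compact_unit : compact unit.
Proof.
move=> J D L lam H; split=> [u|j u].
  have [x ->] := unit_rep u; have [_ _ sur _] := H; have [j [y yE]] := sur _ _ x.
  exists j, (ho (unit_map (M := D j) y : @mor S _ _)); rewrite -ho_comp -yE; congr ho.
  exact: unit_map_nat.
have [x ->] := unit_rep u; rewrite -ho_comp (unit_map_nat (lam j)) -(ho_zero (zto _) (zfrom _)) -unit_map_bpt.
move=> /unit_htp[z [z0 z1]]; have [_ _ sur _] := H; have [k [y yE]] := sur _ _ z.
have [_ join _] := colim_fil H; have [l [p [q _]]] := join j k.
have [|m [r rE]] := @colim_eq _ _ _ _ _ H fs_void 0%N l 2%N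
  (fun i => sact (cst1 (i == 1%N) 0%N) (fmap D q _ _ y)) (fun i => if i == 1%N then bpt 0%N else fmap D p _ _ x).
  case=> [|[|i]] // _; rewrite /= mm_act (colim_natE H) yE ?z0 ?z1 ?mm_bpt //.
  by rewrite (colim_natE H).
exists m, (r \oc p); rewrite -ho_comp (unit_map_nat (fmap D (r \oc p))) -(ho_zero (zto _) (zfrom _)) -unit_map_bpt.
apply/unit_htp; exists (fmap D r _ _ (fmap D q _ _ y)); rewrite colimM.
have e0 : fmap D r _ _ (sact (cst1 false 0%N) (fmap D q _ _ y)) = fmap D r _ _ (fmap D p _ _ x) :=
  rE 0%N isT.
have e1 : fmap D r _ _ (sact (cst1 true 0%N) (fmap D q _ _ y)) = fmap D r _ _ (bpt 0%N) := rE 1%N isT.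
by split; rewrite -mm_act; [exact: e0|exact: etrans e1 (mm_bpt _ _ _)].
Qed.

Lemma compact_pe A : PE A -> compact A.
Proof.
elim=> {A} [k A kA|X Y Z f g /fsP H _ cX _ cZ|X Y s r rs _ cY].
- case: k kA => k /= kA.
    apply: (compact_iso (isom_sym kA)); elim: (k.*2) => [|m IH]; first exact: compact_unit.
    exact: (compact_Sh IH).
  have : compact (iter k.+1.*2 SH A) by apply: (compact_iso (isom_sym kA)); apply: compact_unit.
  by elim: (k.+1.*2) => //= m IH /compact_ShV.
- exact: compact_ext H cX cZ.
exact: (@compact_retract X Y s r).
Qed.

End Perfect.

(** * Vanishing, flatness and even epimorphisms *)

Section EvenSite.
Variable R : e1_ring.
Notation md := (module_cat R).
Notation S := (module_stable R).
Notation T := (hoc S).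
Notation OM := (OmT S).
Notation SH := (ShT S).
Notation unit := (unit_module R : S).
Notation PE := (@perfect_even R).
Implicit Types A B X Y Z : S.

(** ** Vanishing *)

Lemma nul_unit n X : (forall x : homotopy_group n X, x = 0) -> nul unit (SN S n X).
Proof.
case: n => k H u.
  have [w <-] := adjn_surj (u : thom unit (omn S k X)).
  have := congr1 (@ungen S _ _) (H (gen w)); rewrite genK => ->.
  have -> : @ungen S (iter k SH unit) X 0 = 0 by rewrite -(subrr 0) ungenB subrr.
  apply: (@addrI _ (adjn (0 : thom (iter k SH unit) X))); rewrite -adjnD addr0; symmetry; exact: addr0.
have := congr1 (@ungen S _ _) (H (gen (u : thom unit (iter k.+1 SH X)))); rewrite genK => ->.
by rewrite -(subrr 0) ungenB subrr.
Qed.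

Lemma nul_ext A X Y Z (f : @mor T X Y) (g : @mor T Y Z) : fs f g -> nul X A -> nul Z A -> nul Y A.
Proof.
move=> H nX nZ u; have [v <-] := fs_contra H (nX (u \oc f)).
by rewrite (nZ v) tzero_r.
Qed.

Lemma vanish E : pi_even E -> forall A k, PE A -> nul A (SN S (k * 2 + 1) E).
Proof.
move=> evE A k pA; elim: pA k => {A} [m A kA|X Y Z f g /fsP H _ nX _ nZ|X Y s r rs _ nY] k.
- have nU j : nul unit (SN S (j * 2 + 1) E) := nul_unit (evE j).
  case: m kA => m /= kA.
    apply: (nul_isol (@isom_sym T _ _ kA)) => {A kA}.
    elim: m k => [|m IH] k; first exact: nU.
    rewrite doubleS; apply: nul_Sh; apply: nul_Sh.
    apply: nul_iso (IH (k + 1)); apply: isom_sym.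
    apply: isom_trans (isom_fmap OM (SN_Om _ _)) _; apply: isom_trans (SN_Om _ _) _.
    have -> : k * 2 + 1 + 1 + 1 = (k + 1) * 2 + 1 by lia.
    exact: isom_refl.
  have {kA} H j : nul (iter m.+1.*2 SH A) (SN S (j * 2 + 1) E) := nul_isol (@isom_sym T _ _ kA) (nU j).
  elim: (m.+1) A H k => [|n IH] A H k; first exact: H.
  apply: nul_ShSh; apply: nul_ShSh.
  apply: (nul_iso (X := SN S ((k - 1) * 2 + 1) E)).
    apply: isom_sym; apply: isom_trans (isom_fmap SH (SN_Sh _ _)) _; apply: isom_trans (SN_Sh _ _) _.
    have -> : k * 2 + 1 - 1 - 1 = (k - 1) * 2 + 1 by lia.
    exact: isom_refl.
  apply: IH => j; have := H j; rewrite doubleS.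
  by rewrite (iterSr _ SH) (iterSr _ SH).
- exact: nul_ext H (nX k) (nZ k).
move=> u; rewrite -[u](@compf1 T) -rs (@compA T) (nY k (u \oc r)); exact: tzero_r.
Qed.

(** ** Flatness *)

(** [flat false] is even flatness; [flat true] is its shift by one. *)
Definition flat (b : bool) X : Prop :=
  exists (J : category) (D : functor J md) (L : md) (lam : forall j, mor (D j) L),
    [/\ levelwise_filtered_colimit lam,
        forall j, PE (if b then OM (D j) else D j) & @isomorphic T L X].

Lemma flat_Om b X : flat b X -> flat (~~ b) (OM X).
Proof.
case=> J [D [L [lam [H p LX]]]]; exists J, (comp_functor (Omf R) D), (Omo L), (fun j => fmap (Omf R) (lam j)).
split; first exact: (colim_Om H).
  by move=> j; have := p j; case: b {p} => //= pj; apply: (@pe_Om2 R).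
exact: (isom_fmap OM LX).
Qed.

Lemma flat_Sh b X : flat b X -> flat (~~ b) (SH X).
Proof.
case=> J [D [L [lam [H p LX]]]]; exists J, (comp_functor (sh_functor R) D), (sh_obj L), (fun j => fmap (sh_functor R) (lam j)).
split; first exact: (colim_sh H).
  move=> j; have := p j; case: b {p} => /= pj.
    apply: pe_iso (pe_Sh2 pj); exact: (isom_fmap SH (ShOm_isom (D j : S))).
  apply: pe_iso pj; exact: (isom_sym (OmSh_isom (D j : S))).
exact: (isom_fmap SH LX).
Qed.

Lemma flat_SN b n X : flat b X -> flat (b (+) odd `|n|) (SN S n X).
Proof.
have addbN' c d : c (+) ~~ d = ~~ (c (+) d) by case: c; case: d.
case: n => k H.
  have -> : odd (absz (Posz k)) = odd k by [].
  elim: k b X H => [|k IH] b X H; first by rewrite addbF.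
  have -> : b (+) odd k.+1 = ~~ b (+) odd k by rewrite /= addbN' addNb.
  exact: IH (flat_Om H).
suff HS m : flat (b (+) odd m) (iter m SH X) by exact: (HS k.+1).
elim: m => [|m IH]; first by rewrite addbF.
by rewrite [odd m.+1]/= addbN'; apply: (flat_Sh IH).
Qed.

Lemma flat_even X (q : int) : even_flat X -> flat false (SN S (q * 2) X).
Proof.
case=> J [D [L [lam H]]]; have -> : false = false (+) odd (absz (q * 2)) by lia.
by apply: flat_SN; exists J, D, L, lam.
Qed.

(** ** Covers *)

Definition cover B A (f : @mor T B A) : Prop :=
  PE B /\ exists X (i : @mor T X B), fs i f /\ PE X.

(** The fibre of [u] is an extension of [A] by [OM W], so it is perfect even and its map to [A] is a
    cover. *)
Lemma cover_kill A W (u : @mor T A W) : PE A -> PE (OM W) ->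
  exists B (f : @mor T B A), cover f /\ u \oc f = tzero B W.
Proof.
move=> pA pW; have [B [f H]] := fibre_ex u; have [d [D1 D2]] := fs_rotl H.
have pB : PE B := pe_ext D1 pW pA.
by exists B, f; split; [split=> //; exists (OM W), d|apply: fs_comp0 H].
Qed.

(** By compactness [u] factors through a stage of the colimit, where [cover_kill] applies. *)
Lemma cover_flat A X (u : @mor T A X) : PE A -> flat true X ->
  exists B (f : @mor T B A), cover f /\ u \oc f = tzero B X.
Proof.
move=> pA [J [D [L [lam [H p [w [w' [w1 w2]]]]]]]].
have [sur _] := compact_pe pA H; have [j [v vE]] := sur (w' \oc u).
have [B [f [fc vf]]] := cover_kill v pA (p j); exists B, f; split=> //.
by rewrite -[u](@comp1f T) -w2 -(compA w) -vE -!compA vf !tzero_l.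
Qed.

Lemma cover_id A : PE A -> cover (@idc T A).
Proof. by move=> pA; split=> //; exists (pt S), (ho (zfrom A : @mor S _ _)); split; [apply: fs_id|apply: pe_pt]. Qed.

Lemma cover_pull B A W (f : @mor T B A) (u : @mor T W A) : PE W -> cover f ->
  exists Q (g : @mor T Q W) (v : @mor T Q B), cover g /\ f \oc v = u \oc g.
Proof.
move=> pW [pB [X [i [H pX]]]]; have [Q [i' [g [v [H' e1 e2]]]]] := fs_pull u H.
exists Q, g, v; split=> //; split; last by exists X, i'.
exact: pe_ext H' pX pW.
Qed.

Lemma cover_comp B A W (f : @mor T B A) (g : @mor T W B) : cover f -> cover g -> cover (f \oc g).
Proof.
move=> [pB [X [i [H pX]]]] [pW [X' [i' [H' pX']]]]; split=> //.
have [K [h [k [l [D1 D2]]]]] := fs_comp H' H.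
by exists K, h; split=> //; apply: pe_ext D2 pX' pX.
Qed.

(** [x] comes from a map to [OM A]. As [OM (OM A)] is perfect even, [cover_kill] applies to this
    map. *)
Lemma cover_mono X B A (i : @mor T X B) (f : @mor T B A) W (x : @mor T W X) :
  fs i f -> PE W -> PE A -> i \oc x = tzero W B ->
  exists Q (g : @mor T Q W), cover g /\ x \oc g = tzero Q X.
Proof.
move=> H pW pA x0; have [d [D1 _]] := fs_rotl H; have [w wE] := fs_exact D1 x0.
have [|Q [g [gc gE]]] := cover_kill w pW (W := OM A); first exact: pe_Om2.
by exists Q, g; split=> //; rewrite -wE -compA gE tzero_l.
Qed.

End EvenSite.

(** * Characters of abelian groups *)

Section MaxClosed.
Variables (T : Type) (rule : T -> T -> T -> Prop) (bad : T -> Prop).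

Definition closed_good (X : T -> Prop) : Prop :=
  (forall a b c, X a -> X b -> rule a b c -> X c) /\ (forall a, X a -> ~ bad a).

(** The form of Zorn's lemma used for graphs of homomorphisms and for subpresheaves: [rule] encodes
    the closure operations and [bad] the elements to be avoided. *)
Lemma max_closed (X0 : T -> Prop) t0 : X0 t0 -> closed_good X0 ->
  exists X : T -> Prop, [/\ forall t, X0 t -> X t, closed_good X &
    forall Y : T -> Prop, (forall t, X t -> Y t) -> closed_good Y -> forall t, Y t -> X t].
Proof.
move=> Xt0 X0g.
pose P (X : set T) := X = set0 \/ ((forall t, X0 t -> X t) /\ closed_good X).
have [F FP tot|X [XP Xmax]] := @Zorn_bigcup T P.
  have [[Z FZ [z Zz]]|none] := pselect (exists2 Z, F Z & exists z, Z z); last first.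
    left; apply/seteqP; split=> // x [Z FZ Zx]; case: none; exists Z => //; by exists x.
  have good Y y : F Y -> Y y -> (forall t, X0 t -> Y t) /\ closed_good Y.
    by move=> FY Yy; case: (FP Y FY) => // Y0; rewrite Y0 in Yy.
  right; split=> [t X0t|].
    by exists Z => //; have [H _] := good Z z FZ Zz; apply: H.
  split=> [a b c [A FA Aa] [B FB Bb] r|a [A FA Aa]]; last first.
    by have [_ [_ H]] := good A a FA Aa; apply: H.
  have [AB|BA] := tot A B FA FB.
    by exists B => //; have [_ [H _]] := good B b FB Bb; apply: H r => //; apply: AB.
  by exists A => //; have [_ [H _]] := good A a FA Aa; apply: H r => //; apply: BA.
have [X00|[X0X Xg]] := XP.
  case: (Xmax X0); last by right.
  by rewrite X00; split=> [t []|/(_ t0 Xt0)].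
exists X; split=> // Y XY Yg t Yt; apply: contrapT => nXt.
case: (Xmax Y); first by split=> // /(_ t Yt).
by right; split=> // s /X0X/XY.
Qed.

End MaxClosed.

Definition qz_eq (x y : rat) : Prop := exists n : int, x - y = n%:~R.

Lemma qz_equivalence : equivalence qz_eq.
Proof.
split=> [x|x y [n E]|x y z [n E] [m F]].
- by exists 0; rewrite subrr.
- by exists (- n); rewrite -opprB E mulrNz.
by exists (n + m); rewrite mulrzDr -E -F addrA subrK.
Qed.

Definition qz_pregroup : pregroup.
Proof.
apply: (@PreGroup rat qz_eq qz_equivalence 0 -%R +%R).
- by move=> x x' [n E]; exists (- n); rewrite -opprD E mulrNz.
- by move=> x x' y y' [n E] [m F]; exists (n + m); rewrite opprD addrACA E F mulrzDr.
- by move=> x y z; exists 0; rewrite -[LHS]/(x + (y + z) - (x + y + z)) addrA subrr.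
- by move=> x y; exists 0; rewrite -[LHS]/(x + y - (y + x)) (addrC y) subrr.
- by move=> x; exists 0; rewrite add0r subrr.
by move=> x; exists 0; rewrite addNr subrr.
Defined.

Definition QZ : zmodType := qgroup qz_pregroup.

Lemma qz_mulrn (x : rat) n : qcls (x : qz_pregroup) *+ n = qcls (x *+ n : qz_pregroup) :> QZ.
Proof.
elim: n => [|n IH]; first by [].
by rewrite !mulrS IH -qclsD.
Qed.

Lemma qz_div (d : QZ) n : (0 < n)%N -> exists d' : QZ, d' *+ n = d.
Proof.
move=> n0; rewrite -(qrepK d); set x : rat := qrep d.
exists (qcls (x / n%:R : qz_pregroup)); rewrite qz_mulrn; congr qcls.
by rewrite -(mulr_natr (x / n%:R)) divfK // pnatr_eq0; lia.
Qed.

Lemma qz_torsion m : (1 < m)%N -> exists d : QZ, d != 0 /\ d *+ m = 0.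
Proof.
move=> m1; exists (qcls (1 / m%:R : qz_pregroup)); split; last first.
  rewrite qz_mulrn; apply/(qclsP (G := qz_pregroup)); exists 1.
  by rewrite -[LHS]/((1 / m%:R) *+ m - 0) -(mulr_natr (1 / m%:R)) divfK ?subr0 // pnatr_eq0; lia.
apply/eqP => /(qclsP (G := qz_pregroup))[n]; rewrite /= subr0 => E.
have m0 : (m%:R : rat) != 0 by rewrite pnatr_eq0; lia.
have : (1 : rat) = (n * m%:Z)%:~R by rewrite intrM -E divfK.
rewrite -[1]/(1%:~R) => /eqP; rewrite eqr_int => /eqP/(congr1 absz).
rewrite abszM => /esym/eqP; rewrite muln_eq1 => /andP[_ /eqP] /=; lia.
Qed.

Section Extension.
Variable V : zmodType.

(** The graphs of homomorphisms to [QZ] from subgroups of [V]. *)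
Definition functional_subgroup (X : V * QZ -> Prop) : Prop :=
  [/\ X 0, forall a b, X a -> X b -> X (a - b) & forall d, X (0, d) -> d = 0].

Section Subgroup.
Variable X : V * QZ -> Prop.
Hypothesis HX : functional_subgroup X.

Lemma fsubN a : X a -> X (- a).
Proof. by have [X0 XB _] := HX; move=> Xa; rewrite -sub0r; apply: XB. Qed.

Lemma fsubD a b : X a -> X b -> X (a + b).
Proof. by have [X0 XB _] := HX; move=> Xa Xb; rewrite -[b]opprK; apply: XB => //; apply: fsubN. Qed.

Lemma fsubMn a n : X a -> X (a *+ n).
Proof.
have [X0 _ _] := HX; move=> Xa; elim: n => [|n IH]; first by rewrite mulr0n.
by rewrite mulrS; apply: fsubD.
Qed.

Lemma fsub_uniq v d d' : X (v, d) -> X (v, d') -> d = d'.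
Proof.
have [_ XB Xf] := HX; move=> H H'; apply/eqP; rewrite -subr_eq0; apply/eqP/Xf.
by have := XB _ _ H H'; rewrite -[_ - _]/(v - v, d - d') subrr.
Qed.

Hypothesis Xmax : forall Y : V * QZ -> Prop, (forall t, X t -> Y t) -> functional_subgroup Y ->
  forall t, Y t -> X t.

(** If [d] is compatible with the values already fixed on multiples of [v], adjoining [(v, d)] keeps
    the subgroup functional; by maximality nothing was added. *)
Lemma fsub_adjoin v d : (forall n e, X (v *+ n, e) -> e = d *+ n) -> X (v, d).
Proof.
have [X0 XB Xf] := HX; move=> H.
have Hz (n : int) e : X (v *~ n, e) -> e = d *~ n.
  case: n => n; first by rewrite -!pmulrn; apply: H.
  rewrite !NegzE !mulrNz => /fsubN; rewrite -[- _]/(- - (v *+ n.+1), - e) opprK => /H E.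
  by apply: oppr_inj; rewrite E opprK.
pose Y (t : V * QZ) := exists a (n : int), X a /\ t = (a.1 + v *~ n, a.2 + d *~ n).
apply: (Xmax (Y := Y)); last by exists 0, 1; rewrite !mulr1z /= !add0r.
  by move=> [a1 a2] Xa; exists (a1, a2), 0; rewrite !mulr0z !addr0.
split; first by exists 0, 0; rewrite !mulr0z /= !addr0.
  move=> _ _ [a [n [Xa ->]]] [b [m [Xb ->]]]; exists (a - b), (n - m); split; first exact: XB.
  by congr (_, _); rewrite /= mulrzBr opprD addrACA.
move=> e [[a1 a2] [n [Xa /= [E ->]]]].
have vn : v *~ n = - a1 by apply/eqP; rewrite -addr_eq0 addrC -E.
have := fsubN Xa; rewrite -[- _]/(- a1, - a2) -vn => /Hz <-.
by rewrite subrr.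
Qed.

Lemma fsub_total v : exists d, X (v, d).
Proof.
have [X0 XB Xf] := HX.
have [[n [n0 [e Xe]]]|none] := pselect (exists n, (0 < n)%N /\ exists e, X (v *+ n, e)); last first.
  exists 0; apply: fsub_adjoin => n e Xe; rewrite mul0rn.
  case: n Xe => [|n] Xe; last by case: none; exists n.+1; split=> //; exists e.
  by apply: Xf; rewrite mulr0n in Xe.
(* The least positive [m] with [v *+ m] in the domain divides all others, so it is enough to divide
   the value there by [m], which [QZ] permits. *)
pose Q m := `[< (0 < m)%N /\ exists e, X (v *+ m, e) >].
have exQ : exists m, Q m by exists n; apply/asboolP; split=> //; exists e.
have [m /asboolP[m0 [e' Xe']] mmin] := ex_minnP exQ.
have [d dE] := qz_div e' m0; exists d; apply: fsub_adjoin => k f Xk.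
have r0 : (k %% m = 0)%N.
  apply: contrapT => /eqP; rewrite -lt0n => r0.
  have : Q (k %% m)%N.
    apply/asboolP; split=> //; exists (f - e' *+ (k %/ m)).
    have := XB _ _ Xk (fsubMn (k %/ m) Xe').
    have -> : (v *+ m, e') *+ (k %/ m) = (v *+ m *+ (k %/ m), e' *+ (k %/ m)).
      by elim: (k %/ m)%N => // j IH; rewrite !mulrS IH.
    rewrite -[_ - _]/(v *+ k - v *+ m *+ (k %/ m), f - e' *+ (k %/ m)).
    by rewrite {1}(divn_eq k m) mulrnDr mulnC mulrnA addrC addKr.
  by move=> /mmin; rewrite leqNgt ltn_mod m0.
have kE : k = (m * (k %/ m))%N by rewrite {1}(divn_eq k m) r0 addn0 mulnC.
move: Xk; rewrite kE !mulrnA dE => Xk; apply: fsub_uniq Xk _.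
have := fsubMn (k %/ m) Xe'.
suff -> : (v *+ m, e') *+ (k %/ m) = (v *+ m *+ (k %/ m), e' *+ (k %/ m)) by [].
by elim: (k %/ m)%N => // j IH; rewrite !mulrS IH.
Qed.

End Subgroup.

(** Baer's criterion for [Q / Z]. *)
Lemma graph_ext (X0 : V * QZ -> Prop) : functional_subgroup X0 ->
  exists psi : {additive V -> QZ}, forall v d, X0 (v, d) -> psi v = d.
Proof.
move=> X0f; pose rule (a b c : V * QZ) := c = a - b.
pose bad (a : V * QZ) := a.1 = 0 /\ a.2 <> 0.
have toF (X : V * QZ -> Prop) : (forall t, X0 t -> X t) -> closed_good rule bad X -> functional_subgroup X.
  move=> X0X [Xr Xb]; split; first by apply: X0X; case: X0f.
    by move=> a b Xa Xb'; apply: Xr Xa Xb' _.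
  by move=> d Xd; apply: contrapT => d0; apply: (Xb _ Xd).
have toC X : functional_subgroup X -> closed_good rule bad X.
  move=> [X00 XB Xf]; split=> [a b c Xa Xb ->|[a1 a2] Xa [/= a10 a20]]; first exact: XB.
  by apply: a20; apply: Xf; rewrite -a10.
have [X00 _ _] := X0f; have [X [X0X Xg Xm]] := max_closed X00 (toC _ X0f).
have Xf := toF X X0X Xg.
have tot := fsub_total Xf (fun Y XY Yf => Xm Y XY (toC Y Yf)).
pose f v := sval (cid (tot v)); have fP v : X (v, f v) := svalP (cid (tot v)).
have fB : zmod_morphism f.
  move=> a b; apply: (fsub_uniq Xf (fP (a - b))).
  by have [_ XB _] := Xf; apply: (XB _ _ (fP a) (fP b)).
pose psi : {additive V -> QZ} := HB.pack f (GRing.isZmodMorphism.Build _ _ f fB).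
exists psi => v d /X0X Xv.
exact: (fsub_uniq Xf (fP v) Xv).
Qed.

(** [x] is sent to a nonzero [d] killed by the order of [x] modulo [U], or to any nonzero element if
    that order is infinite; [graph_ext] does the rest. *)
Lemma char_separate (U : V -> Prop) x : U 0 -> (forall a b, U a -> U b -> U (a - b)) -> ~ U x ->
  exists psi : {additive V -> QZ}, (forall u, U u -> psi u = 0) /\ psi x != 0.
Proof.
move=> U0 UB Ux.
have UN a : U a -> U (- a) by move=> Ua; rewrite -sub0r; apply: UB.
have UD a b : U a -> U b -> U (a + b) by move=> Ua Ub; rewrite -[b]opprK; apply: UB => //; apply: UN.
have [d [d0 dU]] : exists d : QZ, d != 0 /\ forall n, U (x *+ n) -> d *+ n = 0.
  have [[n [n0 Un]]|none] := pselect (exists n, (0 < n)%N /\ U (x *+ n)); last first.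
    have [d [d0 _]] := qz_torsion (isT : (1 < 2)%N); exists d; split=> // -[|n] Un //.
    by case: none; exists n.+1.
  pose Q m := `[< (0 < m)%N /\ U (x *+ m) >].
  have exQ : exists m, Q m by exists n; apply/asboolP.
  have [m /asboolP[m0 Um] mmin] := ex_minnP exQ.
  have m1 : (1 < m)%N.
    by rewrite ltn_neqAle m0 andbT; apply/eqP => m1; apply: Ux; rewrite -m1 mulr1n in Um.
  have Umk k : U (x *+ m *+ k) by elim: k => [|k IH]; rewrite ?mulr0n ?mulrS //; apply: UD.
  have [d [d0 dm]] := qz_torsion m1; exists d; split=> // k Uk.
  have r0 : (k %% m = 0)%N.
    apply: contrapT => /eqP; rewrite -lt0n => r0.
    have : Q (k %% m)%N.
      apply/asboolP; split=> //; have := UB _ _ Uk (Umk (k %/ m)%N).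
      by rewrite {1}(divn_eq k m) mulrnDr mulnC mulrnA addrC addKr.
    by move=> /mmin; rewrite leqNgt ltn_mod m0.
  by rewrite (divn_eq k m) r0 addn0 mulnC mulrnA dm mul0rn.
have dUz (n : int) : U (x *~ n) -> d *~ n = 0.
  case: n => n; first by rewrite -!pmulrn; apply: dU.
  by rewrite !NegzE !mulrNz => /UN; rewrite opprK => /dU; rewrite -pmulrn => ->; rewrite oppr0.
pose X0 (t : V * QZ) := exists u (n : int), U u /\ t = (u + x *~ n, d *~ n).
have [|psi psiE] := @graph_ext X0.
  split; first by exists 0, 0; rewrite !mulr0z addr0.
    move=> _ _ [u [n [Uu ->]]] [v [m [Uv ->]]]; exists (u - v), (n - m); split; first exact: UB.
    by congr (_, _); rewrite /= mulrzBr // opprD addrACA.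
  move=> e [u [n [Uu [E ->]]]]; apply: dUz.
  have -> : x *~ n = - u by apply/eqP; rewrite -addr_eq0 addrC -E.
  exact: UN.
exists psi; split=> [u Uu|]; first by apply: psiE; exists u, 0; rewrite !mulr0z addr0.
by rewrite (psiE x d) //; exists 0, 1; rewrite !mulr1z add0r.
Qed.

End Extension.

(** * Additive presheaves *)

Record preadditive := Preadditive {
  paC :> category;
  hcls : forall A B : paC, GRing.Zmodule.axioms_ (mor A B) }.

Definition chom (C : preadditive) (A B : C) : zmodType := GRing.Zmodule.Pack (hcls A B).

Definition ccomp (C : preadditive) (A B X : C) (g : chom B X) (f : chom A B) : chom A X :=
  g \oc f.

(** An additive category with a topology of single covers; [csq i f] says that
    [f] is a cover with fibre [i]. *)
Record addsite := AddSite {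
  asC :> preadditive;
  ccompDl : forall (A B X : asC) (f g : chom B X) (h : chom A B),
    ccomp (f + g) h = ccomp f h + ccomp g h;
  ccompDr : forall (A B X : asC) (f g : chom A B) (h : chom B X),
    ccomp h (f + g) = ccomp h f + ccomp h g;
  zero_exists : exists Z : asC, is_zero_obj Z;
  biprod_exists : forall A : asC, exists (P : asC) i1 i2 p1 p2, @biproduct asC A A P i1 i2 p1 p2;
  cov : forall B A : asC, chom B A -> Prop;
  cov_id : forall A, cov (idc A : chom A A);
  cov_comp : forall (A B X : asC) (f : chom B A) (g : chom X B), cov f -> cov g -> cov (ccomp f g);
  cov_pull : forall (A B X : asC) (f : chom B A) (u : chom X A), cov f ->
    exists Q (g : chom Q X) (v : chom Q B), cov g /\ ccomp f v = ccomp u g;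
  csq : forall X B A : asC, chom X B -> chom B A -> Prop;
  cov_csq : forall (A B : asC) (f : chom B A), cov f -> exists X (i : chom X B), csq i f;
  csq_cov : forall (X B A : asC) (i : chom X B) (f : chom B A), csq i f -> cov f;
  csq_comp0 : forall (X B A : asC) (i : chom X B) (f : chom B A), csq i f -> ccomp f i = 0;
  csq_exact : forall (X B A : asC) (i : chom X B) (f : chom B A) W (g : chom W B), csq i f ->
    ccomp f g = 0 -> exists h : chom W X, ccomp i h = g;
  csq_mono : forall (X B A : asC) (i : chom X B) (f : chom B A) W (x : chom W X), csq i f ->
    ccomp i x = 0 -> exists Q (g : chom Q W), cov g /\ ccomp x g = 0 }.

Section Site.
Variable C : addsite.
Implicit Types (A B W X : C) (F G : presheaf C).

Lemma ccomp0l A B W (h : chom A B) : ccomp (0 : chom B W) h = 0.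
Proof. by apply: (@addrI _ (ccomp (0 : chom B W) h)); rewrite -ccompDl !addr0. Qed.

Lemma ccomp0r A B W (h : chom B W) : ccomp h (0 : chom A B) = 0.
Proof. by apply: (@addrI _ (ccomp h (0 : chom A B))); rewrite -ccompDr !addr0. Qed.

Lemma ccompNr A B W (h : chom B W) (f : chom A B) : ccomp h (- f) = - ccomp h f.
Proof. by apply: (@addrI _ (ccomp h f)); rewrite -ccompDr !subrr ccomp0r. Qed.

Lemma ccompBr A B W (h : chom B W) (f g : chom A B) : ccomp h (f - g) = ccomp h f - ccomp h g.
Proof. by rewrite ccompDr ccompNr. Qed.

Lemma ccompNl A B W (h : chom A B) (f : chom B W) : ccomp (- f) h = - ccomp f h.
Proof. by apply: (@addrI _ (ccomp f h)); rewrite -ccompDl !subrr ccomp0l. Qed.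

Lemma ccompA A B W X (h : chom W X) (g : chom B W) (f : chom A B) :
  ccomp h (ccomp g f) = ccomp (ccomp h g) f.
Proof. exact: compA. Qed.

Definition cid1 A : chom A A := idc A.
Lemma ccomp1l A B (f : chom A B) : ccomp (cid1 B) f = f. Proof. exact: comp1f. Qed.
Lemma ccomp1r A B (f : chom A B) : ccomp f (cid1 A) = f. Proof. exact: compf1. Qed.

(** [res] along a map regarded as an element of a hom group. *)
Definition rs F A B (f : chom B A) : {additive F A -> F B} := res F f.

Lemma rs1 F A (x : F A) : rs F (cid1 A) x = x. Proof. exact: res1. Qed.
Lemma rsM F A B W (f : chom B A) (g : chom W B) (x : F A) :
  rs F (ccomp f g) x = rs F g (rs F f x).
Proof. exact: resM. Qed.

Lemma pm_rs F G (phi : presheaf_map F G) A B (f : chom B A) x : phi B (rs F f x) = rs G f (phi A x).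
Proof. exact: pm_nat. Qed.

Definition addp F : Prop := forall A B (f g : chom B A) (x : F A),
  rs F (f + g) x = rs F f x + rs F g x.

Lemma addp0 F A B (x : F A) : addp F -> rs F (0 : chom B A) x = 0.
Proof.
by move=> HF; apply: (@addrI _ (rs F (0 : chom B A) x)); rewrite -HF !addr0.
Qed.

Lemma addpB F A B (f g : chom B A) (x : F A) : addp F ->
  rs F (f - g) x = rs F f x - rs F g x.
Proof.
move=> HF; rewrite HF; congr (_ + _); apply: (@addrI _ (rs F g x)).
by rewrite -HF !subrr addp0.
Qed.

Lemma zero_idC A : is_zero_obj A -> cid1 A = 0.
Proof. by move=> /(_ A)[[z [_ zU]] _]; rewrite -(zU (cid1 A) I) -(zU (0 : chom A A) I). Qed.

Lemma chom_zero A B : is_zero_hom (0 : chom A B).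
Proof.
have [Z Z0] := zero_exists C; exists Z; split=> //.
by exists (0 : chom Z B), (0 : chom A Z); rewrite -[RHS]/(ccomp (0 : chom Z B) (0 : chom A Z)) ccomp0l.
Qed.

Lemma zero_homC A B (f : chom A B) : is_zero_hom f -> f = 0.
Proof.
case=> Z [/zero_idC Z0 [g [h ->]]].
by rewrite -[LHS]/(ccomp (g : chom Z B) h) -[h]ccomp1l Z0 ccomp0l ccomp0r.
Qed.

(** [f + g] is the map [(f, g)] followed by the sum of the projections of the biproduct. For that
    sum the claim is checked on the two summands. *)
Lemma additive_addp F : is_additive F -> addp F.
Proof.
move=> [F0 Fb] A B f g x.
have r0 X Y (y : F X) : rs F (0 : chom Y X) y = 0.
  have [Z [Z0 [h [k E]]]] := chom_zero Y X.
  by rewrite /rs E resM (F0 Z Z0 (res F h y)) raddf0.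
have [P [i1 [i2 [p1 [p2 bP]]]]] := biprod_exists A.
have [e11 e22 /zero_homC e12 /zero_homC e21 U _] := bP.
pose q1 : chom P A := p1; pose q2 : chom P A := p2.
pose j1 : chom A P := i1; pose j2 : chom A P := i2.
have {}e11 : ccomp q1 j1 = cid1 A by []. have {}e22 : ccomp q2 j2 = cid1 A by [].
have {}e12 : ccomp q1 j2 = 0 by []. have {}e21 : ccomp q2 j1 = 0 by [].
have vE : rs F (q1 + q2) x = rs F q1 x + rs F q2 x.
  have [inv invK _] := Fb _ _ _ _ _ _ _ bP; apply: (can_inj invK).
  rewrite -[LHS]/(rs F j1 _, rs F j2 _) -[RHS]/(rs F j1 _, rs F j2 _).
  by rewrite !raddfD -!rsM !ccompDl e11 e22 e12 e21 r0 !addr0 !add0r.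
have [u [[u1 u2] _]] := U B f g.
have {}u1 : ccomp q1 (u : chom B P) = f by []. have {}u2 : ccomp q2 (u : chom B P) = g by [].
by rewrite -u1 -u2 -ccompDl rsM vE raddfD -!rsM.
Qed.

Lemma addp_additive F : addp F -> is_additive F.
Proof.
move=> HF; split=> [Z /zero_idC Z0 x|X Y P i1 i2 p1 p2 bP].
  by rewrite -(rs1 x) Z0 addp0.
have [e11 e22 /zero_homC e12 /zero_homC e21 U _] := bP.
pose q1 : chom P X := p1; pose q2 : chom P Y := p2.
pose j1 : chom X P := i1; pose j2 : chom Y P := i2.
have {}e11 : ccomp q1 j1 = cid1 X by []. have {}e22 : ccomp q2 j2 = cid1 Y by [].
have {}e12 : ccomp q1 j2 = 0 by []. have {}e21 : ccomp q2 j1 = 0 by [].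
have sumE : ccomp j1 q1 + ccomp j2 q2 = cid1 P.
  have [w [_ wU]] := U P q1 q2; transitivity w; last by apply: wU; split; apply: compf1.
  symmetry; apply: wU; split.
    by rewrite -[LHS]/(ccomp q1 _) ccompDr !ccompA e11 e12 ccomp1l ccomp0l addr0.
  by rewrite -[LHS]/(ccomp q2 _) ccompDr !ccompA e22 e21 ccomp1l ccomp0l add0r.
exists (fun t : F X * F Y => rs F q1 t.1 + rs F q2 t.2).
  move=> x; rewrite -[(_, _).1]/(rs F j1 x) -[(_, _).2]/(rs F j2 x).
  by rewrite -!rsM -HF sumE rs1.
move=> [a b]; rewrite -[LHS]/(rs F j1 _, rs F j2 _).
by rewrite !raddfD -!rsM e11 e22 e12 e21 !rs1 !addp0 // addr0 add0r.
Qed.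

(** ** Subpresheaves *)

Definition subp F (K : forall A, F A -> Prop) : Prop :=
  [/\ forall A, K A 0, forall A x y, K A x -> K A y -> K A (x - y) &
      forall A B (f : chom B A) x, K A x -> K B (rs F f x)].

Section SubPresheaf.
Variables (F : presheaf C) (K : forall A, F A -> Prop).
Hypothesis HK : subp K.

(** The closure proof is an argument of the carrier type, so that the group instance below can be
    inferred from the type. *)
Record subcar A (H : subp K) := SubCar { sbv : F A; sbvP : K sbv }.

Lemma subcar_eq A (x y : subcar A HK) : sbv x = sbv y -> x = y.
Proof.
case: x y => [x Kx] [y Ky] /= E; case: y / E Ky => Ky; congr SubCar; exact: Prop_irrelevance.
Qed.

Lemma subp0 A : K (0 : F A). Proof. by case: HK. Qed.
Lemma subpB A (x y : F A) : K x -> K y -> K (x - y).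
Proof. by case: HK => _ H _; apply: H. Qed.
Lemma subpN A (x : F A) : K x -> K (- x).
Proof. by move=> Kx; rewrite -sub0r; apply: subpB => //; apply: subp0. Qed.
Lemma subpD A (x y : F A) : K x -> K y -> K (x + y).
Proof. by move=> Kx Ky; rewrite -[y]opprK; apply: subpB => //; apply: subpN. Qed.
Lemma subpR A B (f : chom B A) (x : F A) : K x -> K (rs F f x).
Proof. by case: HK => _ _ H; apply: H. Qed.

Definition sub_zero A : subcar A HK := @SubCar A HK 0 (subp0 A).
Definition sub_opp A (x : subcar A HK) : subcar A HK := @SubCar A HK _ (subpN (sbvP x)).
Definition sub_addm A (x y : subcar A HK) : subcar A HK := @SubCar A HK _ (subpD (sbvP x) (sbvP y)).

Lemma sub_addmA A : associative (@sub_addm A).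
Proof. by move=> x y z; apply: subcar_eq; rewrite /= addrA. Qed.
Lemma sub_addmC A : commutative (@sub_addm A).
Proof. by move=> x y; apply: subcar_eq; rewrite /= addrC. Qed.
Lemma sub_addm0 A : left_id (sub_zero A) (@sub_addm A).
Proof. by move=> x; apply: subcar_eq; rewrite /= add0r. Qed.
Lemma sub_addmN A : left_inverse (sub_zero A) (@sub_opp A) (@sub_addm A).
Proof. by move=> x; apply: subcar_eq; rewrite /= addNr. Qed.

HB.instance Definition _ A := gen_eqMixin (subcar A HK).
HB.instance Definition _ A := gen_choiceMixin (subcar A HK).
HB.instance Definition _ A := GRing.isZmodule.Build (subcar A HK)
  (@sub_addmA A) (@sub_addmC A) (@sub_addm0 A) (@sub_addmN A).

Definition sub_res_fun A B (f : chom B A) (x : subcar A HK) : subcar B HK :=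
  @SubCar B HK _ (subpR f (sbvP x)).

Lemma sub_res_add A B (f : chom B A) : zmod_morphism (sub_res_fun f).
Proof. by move=> x y; apply: subcar_eq; rewrite /= raddfB. Qed.

Definition sub_res A B (f : mor B A) : {additive subcar A HK -> subcar B HK} :=
  HB.pack (sub_res_fun f) (GRing.isZmodMorphism.Build _ _ _ (@sub_res_add A B f)).

Definition subpsh : presheaf C.
Proof.
apply: (@Presheaf C (fun A => subcar A HK : zmodType) sub_res).
- by move=> A x; apply: subcar_eq; apply: rs1.
- by move=> A B D f g x; apply: subcar_eq; apply: rsM.
Defined.

Lemma sbvB A (x y : subpsh A) : sbv (x - y) = sbv x - sbv y.
Proof. by []. Qed.

Definition sub_inc_fun A : {additive subpsh A -> F A} :=
  HB.pack (fun x : subpsh A => sbv x) (GRing.isZmodMorphism.Build _ _ _ (@sbvB A)).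

Definition sub_inc : presheaf_map subpsh F :=
  @PresheafMap C subpsh F sub_inc_fun (fun A B f x => erefl).

Lemma sub_inc_inj A (x y : subpsh A) : sub_inc A x = sub_inc A y -> x = y.
Proof. exact: subcar_eq. Qed.

Lemma sub_inc_ex A (x : F A) : K x -> exists y, sub_inc A y = x.
Proof. by move=> Kx; exists (@SubCar A HK x Kx). Qed.

Lemma sub_addp : addp F -> addp subpsh.
Proof. by move=> HF A B f g x; apply: subcar_eq; apply: HF. Qed.

Section Corestrict.
Variables (G : presheaf C) (phi : presheaf_map G F).
Hypothesis phiK : forall A x, K (phi A x).

Definition cor_fun A (x : G A) : subpsh A := @SubCar A HK _ (phiK x).

Lemma cor_add A : zmod_morphism (@cor_fun A).
Proof. by move=> x y; apply: subcar_eq; rewrite /= raddfB. Qed.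

Definition corestr : presheaf_map G subpsh.
Proof.
refine (@PresheafMap C G subpsh (fun A => HB.pack (@cor_fun A) (GRing.isZmodMorphism.Build _ _ _ (@cor_add A))) _).
by move=> A B f x; apply: subcar_eq; apply: pm_nat.
Defined.

Lemma corestrE A x : sub_inc A (corestr A x) = phi A x. Proof. by []. Qed.
End Corestrict.

End SubPresheaf.

Definition mkpm F G (f : forall A, F A -> G A) (fB : forall A, zmod_morphism (f A))
  (fr : forall A B (u : chom B A) x, f B (rs F u x) = rs G u (f A x)) : presheaf_map F G :=
  @PresheafMap C F G (fun A => HB.pack (f A) (GRing.isZmodMorphism.Build _ _ _ (fB A))) fr.

Definition pm_comp F G (H : presheaf C) (psi : presheaf_map G H) (phi : presheaf_map F G) : presheaf_map F H.
Proof.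
apply: (@mkpm F H (fun A x => psi A (phi A x))).
  by move=> A x y; rewrite !raddfB.
by move=> A B u x; rewrite !pm_rs.
Defined.

Definition pm_sub F G (psi phi : presheaf_map F G) : presheaf_map F G.
Proof.
apply: (@mkpm F G (fun A x => psi A x - phi A x)).
  by move=> A x y; rewrite (raddfB (psi A)) (raddfB (phi A)) [in LHS]opprD [in LHS]addrACA -opprD.
by move=> A B u x; rewrite raddfB !pm_rs.
Defined.

Definition pm_id F : presheaf_map F F.
Proof. by apply: (@mkpm F F (fun A x => x)). Defined.

Section ProdPresheaf.
Variables F G : presheaf C.

Lemma prod_res_add A B (f : chom B A) :
  zmod_morphism (fun t : F A * G A => (rs F f t.1, rs G f t.2)).
Proof. by move=> [x y] [x' y'] /=; rewrite !raddfB. Qed.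

Definition prodpsh : presheaf C.
Proof.
apply: (@Presheaf C (fun A => (F A * G A)%type : zmodType) (fun A B f =>
  HB.pack (fun t : F A * G A => (rs F f t.1, rs G f t.2)) (GRing.isZmodMorphism.Build _ _ _ (@prod_res_add A B f)))).
- by move=> A [x y] /=; rewrite !rs1.
- by move=> A B D f g [x y]; rewrite /= /rs !resM.
Defined.

Lemma prod_addp : addp F -> addp G -> addp prodpsh.
Proof. by move=> HF HG A B f g [x y]; rewrite /rs /=; congr (_, _); [apply: HF|apply: HG]. Qed.

End ProdPresheaf.

End Site.

(** * Local properties, injective presheaves and coinduction *)

Section Hull.
Variable C : addsite.
Implicit Types (A B W X : C) (F G P J : presheaf C).
Notation covC := (@cov C).

(** ** Local membership *)

Definition loc F (K : forall A, F A -> Prop) A (x : F A) : Prop :=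
  exists B (f : chom B A), cov f /\ K B (rs F f x).

Definition zerop F A (x : F A) : Prop := x = 0.

Lemma zero_subp F : subp (@zerop F).
Proof.
split=> [A|A x y -> ->|A B f x ->]; rewrite /zerop ?subrr //.
exact: raddf0.
Qed.

Lemma loc_self F (K : forall A, F A -> Prop) A (x : F A) : K A x -> loc K x.
Proof. by move=> Kx; exists A, (cid1 A); split; [apply: cov_id|rewrite rs1]. Qed.

Lemma loc_subp F (K : forall A, F A -> Prop) : subp K -> subp (loc K).
Proof.
move=> HK; split=> [A|A x y [B [f [fc Kx]]] [D [g [gc Ky]]]|A B u x [D [f [fc Kx]]]].
- exact/loc_self/(subp0 HK).
- have [Q [h [v [hc E]]]] := cov_pull g fc.
  exists Q, (ccomp g h); split; first exact: cov_comp.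
  by rewrite raddfB -{1}E !rsM; apply: subpB => //; apply: subpR.
have [Q [h [v [hc E]]]] := cov_pull u fc.
by exists Q, h; split=> //; rewrite -rsM -E rsM; apply: subpR.
Qed.

Lemma loc_loc F (K : forall A, F A -> Prop) A (x : F A) : loc (loc K) x -> loc K x.
Proof.
case=> B [f [fc [D [g [gc Kx]]]]]; exists D, (ccomp f g); split; first exact: cov_comp.
by rewrite rsM.
Qed.

Lemma loc_mono F (K K' : forall A, F A -> Prop) A (x : F A) :
  (forall B (y : F B), K B y -> K' B y) -> loc K x -> loc K' x.
Proof. by move=> KK' [B [f [fc Kx]]]; exists B, f; split=> //; apply: KK'. Qed.

Lemma loc_map F G (phi : presheaf_map F G) (K : forall A, F A -> Prop) (K' : forall A, G A -> Prop)
  A (x : F A) : (forall B (y : F B), K B y -> K' B (phi B y)) -> loc K x -> loc K' (phi A x).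
Proof. by move=> KK' [B [f [fc Kx]]]; exists B, f; split=> //; rewrite -pm_rs; apply: KK'. Qed.

Definition separated F : Prop := forall A (x : F A), loc (@zerop F) x -> x = 0.

Lemma sheaf_separated F : is_sheaf covC F -> separated F.
Proof.
move=> HF A x [B [f [fc fx]]]; have [|y [_ yU]] := HF A B f fc (0 : F B).
  by move=> D g h _; rewrite !raddf0.
by rewrite -(yU x) // -(yU 0) // raddf0.
Qed.

(** ** Presheaves injective for maps with prescribed kernel *)

Definition inj_psh I : Prop :=
  forall F G (j : presheaf_map F G) (f : presheaf_map F I), addp F -> addp G ->
    (forall A x, j A x = 0 -> f A x = 0) ->
    exists g : presheaf_map G I, forall A x, g A (j A x) = f A x.

Lemma inj_psh_retract I J (s : presheaf_map I J) (r : presheaf_map J I) :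
  (forall A x, r A (s A x) = x) -> inj_psh J -> inj_psh I.
Proof.
move=> rs_ HJ F G j f aF aG H; have [|g gE] := HJ F G j (pm_comp s f) aF aG.
  by move=> A x /H fx; rewrite /= fx raddf0.
by exists (pm_comp r g) => A x; rewrite /= gE /= rs_.
Qed.

Definition yon A : presheaf C.
Proof.
refine (@Presheaf C (fun B => chom B A) (fun B D f => HB.pack (fun h : chom B A => ccomp h f)
  (GRing.isZmodMorphism.Build _ _ _ _)) _ _).
- by move=> B h; apply: ccomp1r.
- by move=> B D E f g h; apply: ccompA.
Unshelve. by move=> h k; rewrite ccompDl ccompNl.
Defined.

Lemma yon_addp A : addp (yon A).
Proof. by move=> B D f g h; apply: ccompDr. Qed.

Definition yon_map F A (x : F A) (aF : addp F) : presheaf_map (yon A) F.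
Proof.
apply: (@mkpm C (yon A) F (fun B h => rs F h x)).
  by move=> B h k; apply: addpB.
by move=> B D u h; apply: rsM.
Defined.

Definition yon_post A B (i : chom A B) : presheaf_map (yon A) (yon B).
Proof.
apply: (@mkpm C (yon A) (yon B) (fun D h => ccomp i h)).
  by move=> D h k; apply: ccompBr.
by move=> D E u h; apply: ccompA.
Defined.

(** Gluing along [f] is extension along [yon_post f]: the matching condition says that its kernel is
    annihilated. Uniqueness is separatedness. *)
Lemma inj_sep_sheaf I : addp I -> inj_psh I -> separated I -> is_sheaf covC I.
Proof.
move=> aI HI sI A B f fc x comp.
have [||D h fh|y yE] := HI _ _ (yon_post f) (yon_map x aI).
- exact: yon_addp.
- exact: yon_addp.
- rewrite -[LHS]/(rs I h x) -(addp0 D x aI); apply: comp.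
  by rewrite -[LHS]/(ccomp f h) -[RHS]/(ccomp f (0 : chom D B)) ccomp0r; exact: fh.
exists (y A (cid1 A)); split.
  have := yE B (cid1 B); rewrite -[RHS]/(rs I (cid1 B) x) rs1 => <-.
  rewrite -[LHS]/(rs I f _) -pm_rs; congr (y B _).
  by rewrite -[LHS]/(ccomp (cid1 A) f) ccomp1l -[RHS]/(ccomp f (cid1 B)) ccomp1r.
move=> z zx; apply/eqP; rewrite -subr_eq0; apply/eqP/sI; exists B, f; split=> //.
rewrite /zerop raddfB -[rs I f z]/(res I f z) zx -{1}[x]rs1 -[rs I (cid1 B) x]/(yon_map x aI B (cid1 B)) -yE.
rewrite -[rs I f _]pm_rs -raddfB.
have -> : yon_post f B (cid1 B) = rs (yon A) f (cid1 A).
  by rewrite -[LHS]/(ccomp f (cid1 B)) ccomp1r -[RHS]/(ccomp (cid1 A) f) ccomp1l.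
by rewrite subrr raddf0.
Qed.

Definition flasque F : Prop :=
  forall X B A (i : chom X B) (f : chom B A), csq i f ->
    forall x : F X, exists y : F B, rs F i y = x.

(** The extension is along [yon_post i]. This need not be injective, but by [csq_mono] its kernel is
    locally zero, hence annihilated in a separated presheaf. *)
Lemma inj_sep_flasque I : addp I -> inj_psh I -> separated I -> flasque I.
Proof.
move=> aI HI sI X B A i f H x.
have [||D h ih|y yE] := HI _ _ (yon_post i) (yon_map x aI).
- exact: yon_addp.
- exact: yon_addp.
- have [Q [g [gc hg]]] := csq_mono H (ih : ccomp i h = 0).
  apply: sI; exists Q, g; split=> //; rewrite /zerop -[yon_map _ _ _ _]/(rs I h x) -rsM hg.
  exact: addp0.
exists (y B (cid1 B)); rewrite -pm_rs.
have := yE X (cid1 X); rewrite -[RHS]/(rs I (cid1 X) x) rs1 => <-; congr (y X _).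
by rewrite -[LHS]/(ccomp (cid1 B) i) ccomp1l -[RHS]/(ccomp i (cid1 X)) ccomp1r.
Qed.

(** ** Coinduced presheaves *)

Section Coinduced.
Variables (I : Type) (dom : I -> C).

(** The sections over [B] of the product over [t] of the presheaves coinduced from [Q / Z] at
    [dom t], that is, characters of the maps [dom t -> B]. *)
Record jelt B := JElt {
  jf :> forall t, chom (dom t) B -> QZ;
  jfB : forall t h k, @jf t (h - k) = jf h - jf k }.

Lemma jelt_eq B (x y : jelt B) : (forall t h, x t h = y t h) -> x = y.
Proof.
case: x y => [x Hx] [y Hy] /= E.
have {}E : x = y by apply: functional_extensionality_dep => t; apply/funext => h; apply: E.
by case: y / E Hy => Hy; congr JElt; apply: Prop_irrelevance.
Qed.

Definition j_zero B : jelt B.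
Proof. by apply: (@JElt B (fun _ _ => 0)) => *; rewrite subrr. Defined.
Definition j_opp B (x : jelt B) : jelt B.
Proof. by apply: (@JElt B (fun t h => - x t h)) => t h k; rewrite jfB opprD. Defined.
Definition j_add B (x y : jelt B) : jelt B.
Proof. by apply: (@JElt B (fun t h => x t h + y t h)) => t h k; rewrite !jfB addrACA -opprD. Defined.

Lemma j_addA B : associative (@j_add B).
Proof. by move=> x y z; apply: jelt_eq => t h; rewrite /= addrA. Qed.
Lemma j_addC B : commutative (@j_add B).
Proof. by move=> x y; apply: jelt_eq => t h; rewrite /= addrC. Qed.
Lemma j_add0 B : left_id (j_zero B) (@j_add B).
Proof. by move=> x; apply: jelt_eq => t h; rewrite /= add0r. Qed.
Lemma j_addN B : left_inverse (j_zero B) (@j_opp B) (@j_add B).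
Proof. by move=> x; apply: jelt_eq => t h; rewrite /= addNr. Qed.

HB.instance Definition _ B := gen_eqMixin (jelt B).
HB.instance Definition _ B := gen_choiceMixin (jelt B).
HB.instance Definition _ B := GRing.isZmodule.Build (jelt B) (@j_addA B) (@j_addC B) (@j_add0 B) (@j_addN B).

Definition j_res_fun A B (f : chom B A) (x : jelt A) : jelt B.
Proof. by apply: (@JElt B (fun t h => x t (ccomp f h))) => t h k; rewrite ccompBr jfB. Defined.

Lemma j_res_add A B (f : chom B A) : zmod_morphism (j_res_fun f).
Proof. by move=> x y; apply: jelt_eq. Qed.

Definition coind : presheaf C.
Proof.
refine (@Presheaf C (fun B => jelt B : zmodType) (fun A B f => HB.pack (j_res_fun f)
  (GRing.isZmodMorphism.Build _ _ _ (@j_res_add A B f))) _ _).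
- by move=> A x; apply: jelt_eq => t h; rewrite -[LHS]/(x t (ccomp (cid1 A) h)) ccomp1l.
- by move=> A B D f g x; apply: jelt_eq => t h; rewrite -[LHS]/(x t (ccomp (ccomp f g) h)) -ccompA.
Defined.

Lemma coindE A B (f : chom B A) (x : coind A) t h : (rs coind f x : jelt B) t h = (x : jelt A) t (ccomp f h).
Proof. by []. Qed.

Lemma jelt_add B (x : jelt B) t h k : x t (h + k) = x t h + x t k.
Proof.
have x0 : x t 0 = 0 by rewrite -(subrr 0) jfB subrr.
by rewrite -{1}[k]opprK jfB -[- k]sub0r jfB x0 sub0r opprK.
Qed.

Lemma coind_addp : addp coind.
Proof.
move=> A B f g x; apply: jelt_eq => t h; rewrite -[RHS]/(x t (ccomp f h) + x t (ccomp g h)).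
by rewrite coindE ccompDl jelt_add.
Qed.

(** A map from [G] is a family of characters of the groups [G (dom t)], so this is the injectivity
    of [Q / Z]. The kernel condition makes the graph prescribed on the image of [j] functional. *)
Lemma coind_inj : inj_psh coind.
Proof.
move=> F G j f aF aG H.
have ex t : exists psi : {additive G (dom t) -> QZ}, forall x, psi (j _ x) = (f (dom t) x : jelt _) t (cid1 _).
  have [|psi psiE] := @graph_ext (G (dom t)) (fun p => exists x, p = (j _ x, (f (dom t) x : jelt _) t (cid1 _))).
    split; first by exists 0; rewrite !raddf0.
      by move=> _ _ [x ->] [y ->]; exists (x - y); rewrite !raddfB.
    by move=> d [x [jx ->]]; rewrite H.
  by exists psi => x; apply: psiE; exists x.
pose psi t := sval (cid (ex t)).
have psiE t x : psi t (j _ x) = (f (dom t) x : jelt _) t (cid1 _) := svalP (cid (ex t)) x.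
have gP B (y : G B) t (h k : chom (dom t) B) : psi t (rs G (h - k) y) = psi t (rs G h y) - psi t (rs G k y).
  by rewrite addpB // raddfB.
pose g B (y : G B) : coind B := @JElt B (fun t h => psi t (rs G h y)) (gP B y).
have gB B : zmod_morphism (g B).
  by move=> x y; apply: jelt_eq => t h; rewrite /= !raddfB.
have gr A B (u : chom B A) x : g B (rs G u x) = rs coind u (g A x).
  by apply: jelt_eq => t h; rewrite /= rsM.
exists (mkpm gB gr) => A x; apply: jelt_eq => t h.
rewrite -[LHS]/(psi t (rs G h (j A x))) -pm_rs psiE pm_rs coindE.
by rewrite ccomp1r.
Qed.

End Coinduced.

(** ** Complements of subpresheaves *)

Lemma complement J (F N0 : forall A, J A -> Prop) : subp N0 ->
  (forall A x, F A x -> N0 A x -> x = 0) ->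
  exists N : forall A, J A -> Prop, [/\ subp N, forall A x, N0 A x -> N A x,
    forall A x, F A x -> N A x -> x = 0 &
    forall M : forall A, J A -> Prop, subp M -> (forall A x, N A x -> M A x) ->
      (forall A x, F A x -> M A x -> x = 0) -> forall A x, M A x -> N A x].
Proof.
move=> HN FN; pose T := {A : C & J A}; pose mk A (x : J A) : T := existT (fun A => J A : Type) A x.
pose rule (a b c : T) := (exists A x y, [/\ a = mk A x, b = mk A y & c = mk A (x - y)]) \/
  (exists A B (f : chom B A) x, a = mk A x /\ c = mk B (rs J f x)).
pose bad (a : T) := exists A x, [/\ a = mk A x, F A x & x <> 0].
pose st (M : forall A, J A -> Prop) (a : T) := M (projT1 a) (projT2 a).
have stg M : subp M -> (forall A x, F A x -> M A x -> x = 0) -> closed_good rule bad (st M).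
  move=> HM FM; split=> [a b c Ma Mb|a Ma [A [x [aE Fx x0]]]].
    by case=> [[A [x [y [aE bE ->]]]]|[A [B [f [x [aE ->]]]]]]; rewrite ?aE ?bE in Ma Mb *;
      [apply: subpB|apply: subpR].
  by rewrite aE in Ma; apply: x0; apply: FM.
have [Z0 _] := zero_exists C.
have N00 : st N0 (mk Z0 0) by apply: (subp0 HN).
have [X [N0X [Xr Xb] Xm]] := max_closed N00 (stg N0 HN FN).
exists (fun A x => X (mk A x)); split.
- split=> [A|A x y Xx Xy|A B f x Xx].
  + by apply: N0X; apply: (subp0 HN).
  + by apply: (Xr _ _ _ Xx Xy); left; exists A, x, y.
  by apply: (Xr _ _ _ Xx Xx); right; exists A, B, f, x.
- by move=> A x N0x; apply: N0X.
- by move=> A x Fx Xx; apply: contrapT => x0; apply: (Xb _ Xx); exists A, x.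
move=> M HM XM FM A x Mx; apply: (Xm (st M)) => //; last exact: stg.
by case=> B y; apply: XM.
Qed.

End Hull.

(** * Injective hulls of presheaves modulo locally trivial sections *)

Section InjectiveHull.
Variable C : addsite.
Implicit Types (A B W X : C) (F G P J : presheaf C).
Notation covC := (@cov C).

(** The summand of [J] complementary to a maximal subpresheaf [N] with
    [N :&: F = 0]; as [N] is maximal it is the image of an idempotent of [J]. *)
Lemma injective_summand J (F : forall A, J A -> Prop) : addp J -> inj_psh J -> subp F ->
  (forall A x, F A x -> loc (@zerop C J) x -> x = 0) ->
  exists r : presheaf_map J J,
    [/\ forall A x, r A (r A x) = r A x, forall A x, F A x -> r A x = x -> x = 0 &
        forall A x, r A x = 0 -> loc (@zerop C J) x -> x = 0].
Proof.
move=> aJ HJ HF Fsep.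
(* [N] is maximal with [N :&: F = 0], and [K], containing [F], is maximal with [K :&: N = 0]. The
   projection of their sum to [N] extends to [r] by injectivity. *)
have [|N [HN _ FN Nmax]] := complement (F := F) (zero_subp J); first by move=> A x _ ->.
have [K [HK FK NK Kmax]] := complement HF (F := N) (fun A x Nx Fx => FN A x Fx Nx).
have @jf : presheaf_map (prodpsh (subpsh HN) (subpsh HK)) J.
  apply: (@mkpm C (prodpsh (subpsh HN) (subpsh HK)) J (fun A t => sub_inc HN A t.1 + sub_inc HK A t.2)).
    by move=> A [x y] [x' y'] /=; rewrite opprD addrACA.
  by move=> A B u [x y]; rewrite /= raddfD.
have @nf : presheaf_map (prodpsh (subpsh HN) (subpsh HK)) J.
  apply: (@mkpm C (prodpsh (subpsh HN) (subpsh HK)) J (fun A t => sub_inc HN A t.1)).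
    by move=> A [x y] [x' y'].
  by move=> A B u [x y].
have [|||r rE] := HJ _ _ jf nf.
- by apply: prod_addp; apply: sub_addp.
- exact: aJ.
- move=> A [x y] /= xy; have Nx := sbvP x; have Ky := sbvP y.
  apply: (NK A _ Nx); have -> : sbv x = - sbv y by apply/eqP; rewrite -addr_eq0 xy.
  exact: (subpN HK).
have rN A x : N A x -> r A x = x.
  move=> Nx; have [y yE] := sub_inc_ex HN Nx; have := rE A (y, 0).
  by rewrite /jf /nf /= addr0 -[sbv y]/(sub_inc HN A y) yE.
have rK A x : K A x -> r A x = 0.
  move=> Kx; have [y yE] := sub_inc_ex HK Kx; have := rE A (0, y).
  by rewrite /jf /nf /= add0r -[sbv y]/(sub_inc HK A y) yE.
(* The image of [r] contains [N], so it is enough that it meets [F] in zero. The elements sent into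
   [F] form a subpresheaf that contains [K] and meets [N] in zero; it is [K] by maximality, and [r]
   vanishes on [K]. *)
have rIN A x : N A (r A x).
  apply: (Nmax (fun A y => exists x, y = r A x)); last by exists x.
  - split=> [D|D _ _ [y ->] [z ->]|D B f _ [y ->]]; first by exists 0; rewrite raddf0.
      by exists (y - z); rewrite raddfB.
    by exists (rs J f y); rewrite pm_rs.
  - by move=> D y Ny; exists y; rewrite rN.
  move=> D z Fz [y zE]; rewrite zE in Fz *; apply: (rK); apply: (Kmax (fun B z => F B (r B z))) => //.
  - split=> [E|E a b Fa Fb|E B f a Fa]; first by rewrite raddf0; apply: (subp0 HF).
      by rewrite raddfB; apply: subpB.
    by rewrite pm_rs; apply: subpR.
  - by move=> E w Kw; rewrite rK //; apply: (subp0 HF).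
  by move=> E w Nw; rewrite rN // => Fw; apply: FN.
exists r; split=> [A x|A x Fx rx|A x rx lx]; first exact: rN.
  by apply: FN => //; rewrite -rx.
(* [N] enlarged by the locally zero elements of the kernel of [r] still meets [F] in zero: locally
   the added part disappears, and [F] has no locally zero elements besides 0. *)
suff Nx : N A x by rewrite -(rN A x Nx).
apply: (Nmax (fun A y => exists n e, [/\ N A n, r A e = 0, loc (@zerop C J) e & y = n + e])).
- have HL := loc_subp (zero_subp J).
  split=> [D|D _ _ [n [e [Nn re le ->]]] [n' [e' [Nn' re' le' ->]]]|D B f _ [n [e [Nn re le ->]]]].
  + by exists 0, 0; rewrite raddf0 addr0; split=> //; [apply: (subp0 HN)|apply: (subp0 HL)].
  + exists (n - n'), (e - e'); split; rewrite ?raddfB ?re ?re' ?subrr //; try exact: subpB.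
    by rewrite opprD addrACA.
  exists (rs J f n), (rs J f e); rewrite raddfD pm_rs re raddf0; split=> //; exact: subpR.
- by move=> D n Nn; exists n, 0; rewrite raddf0 addr0; split=> //; apply: (subp0 (loc_subp (zero_subp J))).
- move=> D y Fy [n [e [Nn re le E]]]; rewrite E in Fy *; apply: Fsep => //.
  have [B [f [fc fe]]] := le; exists B, f; split=> //; rewrite /zerop in fe *.
  have fE : rs J f (n + e) = rs J f n by rewrite raddfD fe addr0.
  apply: FN; first exact: (subpR HF).
  by rewrite fE; apply: (subpR HN).
by exists 0, x; rewrite add0r; split=> //; apply: (subp0 HN).
Qed.

Section Characters.
Variables (P : presheaf C) (K : forall A, P A -> Prop).
Hypotheses (aP : addp P) (HK : subp K).

Record char := Char {
  ch_dom : C; ch_fun : {additive P ch_dom -> QZ};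
  ch_loc : forall x, loc K x -> ch_fun x = 0 }.

Lemma ch_mapP B (x : P B) t (h k : chom (ch_dom t) B) :
  ch_fun t (rs P (h - k) x) = ch_fun t (rs P h x) - ch_fun t (rs P k x).
Proof. by rewrite addpB // raddfB. Qed.

Definition ch_map : presheaf_map P (coind ch_dom).
Proof.
apply: (@mkpm C P (coind ch_dom) (fun B x => JElt (@ch_mapP B x) : coind ch_dom B)).
  by move=> B x y; apply: jelt_eq => t h; rewrite /= !raddfB.
by move=> A B u x; apply: jelt_eq => t h; rewrite /= rsM.
Defined.

Lemma ch_map0 A (x : P A) : ch_map A x = 0 <-> loc K x.
Proof.
have HL := loc_subp HK; split=> [x0|lx]; last first.
  by apply: jelt_eq => t h; rewrite /=; apply: ch_loc; apply: (subpR HL).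
apply: contrapT => nx.
have [chi [chiL]] := char_separate (subp0 HL A) (fun a b => subpB HL (x := a) (y := b)) nx.
have := congr1 (fun y : jelt ch_dom A => y (Char chiL) (cid1 A)) x0.
by rewrite /= rs1 => -> /eqP.
Qed.

(** The characters that vanish locally on [K] map [P] to a coinduced presheaf with kernel [loc K].
    [E] is the kernel of [r] there; [d] stays injective modulo [loc K] since [r] fixes no nonzero
    element of the image. *)
Lemma hull : exists E (d : presheaf_map P E),
  [/\ addp E, inj_psh E, separated E & forall A x, d A x = 0 <-> loc K x].
Proof.
pose J := coind ch_dom; pose F A (y : J A) := exists x, y = ch_map A x.
have HF : subp F.
  split=> [A|A _ _ [x ->] [y ->]|A B f _ [x ->]]; first by exists 0; rewrite raddf0.
    by exists (x - y); rewrite raddfB.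
  by exists (rs P f x); rewrite pm_rs.
have [|r [rr rF rl]] := injective_summand (@coind_addp C _ _) (@coind_inj C _ _) HF.
  move=> A _ [x ->] [B [f [fc]]]; rewrite /zerop -pm_rs => /ch_map0 lx.
  by apply/ch_map0; apply: loc_loc; exists B, f.
have HE : subp (fun A (y : J A) => r A y = 0).
  split=> [A|A x y rx ry|A B f x rx]; first exact: raddf0.
    by rewrite raddfB rx ry subrr.
  by rewrite pm_rs rx raddf0.
have pK A x : r A (pm_sub (pm_id J) r A x) = 0 by rewrite /= raddfB rr subrr.
have dK A x : r A (pm_comp (pm_sub (pm_id J) r) ch_map A x) = 0 by exact: pK.
exists (subpsh HE), (corestr HE dK); split.
- exact/sub_addp/coind_addp.
- apply: (inj_psh_retract (s := sub_inc HE) (r := corestr HE pK)); last exact: coind_inj.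
  by move=> A x; apply: subcar_eq; rewrite /= (sbvP x) subr0.
- move=> A x [B [f [fc fx]]]; apply: sub_inc_inj; rewrite raddf0; apply: rl (sbvP x) _.
  by exists B, f; split=> //; have := congr1 (sub_inc HE B) fx; rewrite raddf0 pm_rs.
move=> A x; rewrite -ch_map0; split=> [d0|x0]; last first.
  by apply: sub_inc_inj; rewrite corestrE raddf0 -[LHS]/(ch_map A x - r A (ch_map A x)) x0 raddf0 subrr.
have := congr1 (sub_inc HE A) d0; rewrite corestrE raddf0 -[LHS]/(ch_map A x - r A (ch_map A x)).
move=> /eqP; rewrite subr_eq0 => /eqP E.
by apply: rF; [exists x|rewrite -E].
Qed.

End Characters.

End InjectiveHull.

(** * Sheafification and injective resolutions *)

Section Sheafification.
Variable C : addsite.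
Implicit Types (A B W X : C) (F G P J : presheaf C).
Notation covC := (@cov C).

Lemma hull_sheaf P (K : forall A, P A -> Prop) : addp P -> subp K ->
  exists (E : additive_sheaf covC) (d : presheaf_map P E),
    inj_psh E /\ forall A x, d A x = 0 <-> loc K x.
Proof.
move=> aP HK; have [E [d [aE iE sE dE]]] := hull aP HK.
by exists (AdditiveSheaf (inj_sep_sheaf aE iE sE) (addp_additive aE)), d.
Qed.

Lemma ash_addp (F : additive_sheaf covC) : addp F.
Proof. exact/additive_addp/ash_additive. Qed.

Lemma inj_psh_injective (I : additive_sheaf covC) : inj_psh I -> injective_sheaf I.
Proof.
move=> HI F G j f jm; apply: HI; [exact: ash_addp|exact: ash_addp|] => A x jx.
by have -> : x = 0 by [apply: (jm A); rewrite raddf0]; rewrite raddf0.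
Qed.

(** An injective sheaf is a retract of its hull, which has the stronger extension property for
    presheaves. *)
Lemma injective_inj_psh (I : additive_sheaf covC) : injective_sheaf I -> inj_psh I.
Proof.
move=> HI; have sI := sheaf_separated (@ash_sheaf _ _ I).
have [E [d [iE dE]]] := hull_sheaf (ash_addp (F := I)) (zero_subp I).
have [|r rE] := HI I E d (pm_id I).
  move=> A x y xy; apply/eqP; rewrite -subr_eq0; apply/eqP/sI/dE.
  by rewrite raddfB xy subrr.
exact: inj_psh_retract rE iE.
Qed.

Definition imp F G (phi : presheaf_map F G) A (y : G A) : Prop := exists x, phi A x = y.

Lemma imp_subp F G (phi : presheaf_map F G) : subp (imp phi).
Proof.
split=> [A|A _ _ [x <-] [y <-]|A B f _ [x <-]]; first by exists 0; rewrite raddf0.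
  by exists (x - y); rewrite raddfB.
by exists (rs F f x); rewrite pm_rs.
Qed.

Section Construction.
Variables (P E : presheaf C) (d : presheaf_map P E).
Hypotheses (dE : forall A x, d A x = 0 <-> loc (@zerop C P) x) (sE : separated E)
  (E_sheaf : is_sheaf covC E).

Definition shf : presheaf C := subpsh (loc_subp (imp_subp d)).

Lemma shf_unitP A x : loc (imp d) (d A x). Proof. by apply: loc_self; exists x. Qed.

Definition shf_unit : presheaf_map P shf := corestr (loc_subp (imp_subp d)) shf_unitP.

Lemma shf_unit0 A x : shf_unit A x = 0 <-> loc (@zerop C P) x.
Proof.
rewrite -dE; split=> [H|H]; last by apply: sub_inc_inj; rewrite corestrE H raddf0.
by have := congr1 (sub_inc _ A) H; rewrite corestrE raddf0.
Qed.

Lemma shf_unit_loc A (y : shf A) : loc (imp shf_unit) y.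
Proof.
have [B [f [fc [x xE]]]] := sbvP y; exists B, f; split=> //; exists x.
by apply: sub_inc_inj; rewrite corestrE xE pm_rs.
Qed.

Lemma shf_sheaf : is_sheaf covC shf.
Proof.
move=> A B f fc x comp.
have [|y [yE yU]] := E_sheaf fc (x := sub_inc _ B x).
  move=> D g h gh; rewrite -[LHS](pm_nat (sub_inc _) (g : mor D B) x) (comp D g h gh).
  exact: pm_nat.
have ly : loc (imp d) y.
  apply: loc_loc; exists B, f; split=> //; rewrite -[rs E f y]/(res E f y) yE; exact: sbvP.
have [z zE] := sub_inc_ex (loc_subp (imp_subp d)) ly; exists z; split.
  by apply: sub_inc_inj; rewrite -yE -zE; exact: pm_nat.
move=> w wx; apply: sub_inc_inj; rewrite zE; apply: yU; rewrite -wx; symmetry; exact: pm_nat.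
Qed.

Section Universal.
Variables (G : presheaf C) (phi : presheaf_map P G).
Hypothesis G_sheaf : is_sheaf covC G.

Lemma phi_loc0 A x : loc (@zerop C P) x -> phi A x = 0.
Proof.
move=> lx; apply: (sheaf_separated G_sheaf); apply: loc_map lx => B y.
by rewrite /zerop => ->; rewrite raddf0.
Qed.

(** The extension of [phi] to the sheafification is given by its graph: [z] is the value at [e] if
    this can be seen on a cover where [e] comes from [P]. *)
Definition ext_rel A (e : shf A) (z : G A) : Prop :=
  exists B (f : chom B A) x, [/\ cov f, shf_unit B x = rs shf f e & rs G f z = phi B x].

Lemma ext_rel0 A z : ext_rel (0 : shf A) z -> z = 0.
Proof.
move=> [B [f [x [fc]]]]; rewrite raddf0 => /shf_unit0/phi_loc0 -> zx.
by apply: (sheaf_separated G_sheaf); exists B, f.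
Qed.

Lemma ext_relB A (e e' : shf A) z z' : ext_rel e z -> ext_rel e' z' -> ext_rel (e - e') (z - z').
Proof.
move=> [B [f [x [fc xe zx]]]] [B' [f' [x' [fc' xe' zx']]]].
have [Q [g [v [gc vE]]]] := cov_pull f' fc.
exists Q, (ccomp f' g), (rs P v x - rs P g x'); split; first exact: cov_comp.
  by rewrite !raddfB !pm_rs xe xe' -{1}vE !rsM.
by rewrite !raddfB !pm_rs -zx -zx' -{1}vE !rsM.
Qed.

Lemma ext_relR A B (u : chom B A) (e : shf A) z : ext_rel e z -> ext_rel (rs shf u e) (rs G u z).
Proof.
move=> [D [f [x [fc xe zx]]]]; have [Q [g [v [gc vE]]]] := cov_pull u fc.
exists Q, g, (rs P v x); split=> //; first by rewrite pm_rs xe -!rsM vE.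
by rewrite pm_rs -zx -!rsM vE.
Qed.

Lemma ext_rel_ex A (e : shf A) : exists z, ext_rel e z.
Proof.
have [B [f [fc [x xE]]]] := shf_unit_loc e.
have [|z [zE _]] := G_sheaf fc (x := phi B x); last by exists z, B, f, x.
move=> D g h gh; apply/eqP; rewrite -subr_eq0; apply/eqP.
rewrite -[res G g _](pm_nat phi) -[res G h _](pm_nat phi) -raddfB; apply/phi_loc0/shf_unit0.
rewrite raddfB -[res P g x]/(rs P g x) -[res P h x]/(rs P h x) !pm_rs xE -!rsM.
have -> : ccomp f (g : chom D B) = ccomp f (h : chom D B) by [].
by rewrite subrr.
Qed.

Lemma ext_rel_uniq A (e : shf A) z z' : ext_rel e z -> ext_rel e z' -> z = z'.
Proof.
move=> H H'; apply/eqP; rewrite -subr_eq0; apply/eqP; apply: ext_rel0.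
by rewrite -(subrr e); apply: ext_relB.
Qed.

Lemma shf_extend : exists psi : presheaf_map shf G, forall A x, psi A (shf_unit A x) = phi A x.
Proof.
pose f A (e : shf A) := sval (cid (ext_rel_ex e)).
have fP A e : ext_rel e (f A e) := svalP (cid (ext_rel_ex e)).
have fB A : zmod_morphism (f A).
  by move=> e e'; apply: ext_rel_uniq (fP A _) _; apply: ext_relB.
have fr A B (u : chom B A) e : f B (rs shf u e) = rs G u (f A e).
  by apply: ext_rel_uniq (fP B _) _; apply: ext_relR.
exists (mkpm fB fr) => A x; apply: (ext_rel_uniq (fP A _)).
by exists A, (cid1 A), x; split; [exact: cov_id|rewrite rs1|rewrite rs1].
Qed.

End Universal.

Lemma shf_sheafification : is_sheafification covC shf_unit.
Proof.
split; first exact: shf_sheaf.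
move=> G phi HG; split; first exact: shf_extend.
move=> psi psi' E0 A e; apply/eqP; rewrite -subr_eq0; apply/eqP.
apply: (sheaf_separated HG); have [B [f [fc [x xE]]]] := shf_unit_loc e.
by exists B, f; split=> //; rewrite /zerop raddfB -!pm_rs -xE E0 subrr.
Qed.

End Construction.

Lemma sheafification_ex P : addp P -> exists (F : additive_sheaf covC) (u : presheaf_map P F),
  [/\ is_sheafification covC u, forall A x, u A x = 0 -> loc (@zerop C P) x &
      forall A y, loc (imp u) (y : F A)].
Proof.
move=> aP; have [E [d [iE dE]]] := hull_sheaf aP (zero_subp P).
have H := shf_sheafification dE (@ash_sheaf _ _ E).
have [Hs _] := H; exists (AdditiveSheaf Hs (addp_additive (sub_addp (ash_addp (F := E))))), (shf_unit d).
by split=> // A x => [/shf_unit0-/(_ dE)|]; [|exact: shf_unit_loc].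
Qed.

(** Both properties hold for the constructed sheafification and are carried over to [F] by the maps
    that universality provides. *)
Lemma sheafification_loc P F (u : presheaf_map P F) : addp P -> is_sheafification covC u ->
  (forall A x, u A x = 0 -> loc (@zerop C P) x) /\ (forall A (y : F A), loc (imp u) y).
Proof.
move=> aP [HF HU]; have [F0 [u0 [[HF0 HU0] k0 l0]]] := sheafification_ex aP.
have [[s sE] _] := HU F0 u0 HF0; have [[t tE] _] := HU0 F u HF; have [_ uniq_] := HU F u HF.
split=> [A x ux|A y]; first by apply: k0; rewrite -sE ux raddf0.
have ts z : t A (s A z) = z.
  by apply: (uniq_ (pm_comp t s) (pm_id F)) => B x; rewrite /= sE tE.
rewrite -(ts y); apply: loc_map (l0 A (s A y)) => B z [x <-]; exists x; by rewrite tE.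
Qed.

(** ** Injective resolutions *)

(** The state of the recursion: an injective sheaf, and in it the image of the previous map, which
    the next differential has to kill locally. *)
Record stage := Stage {
  sgG : additive_sheaf covC;
  sgI : injective_sheaf sgG;
  sgK : forall A : C, sgG A -> Prop;
  sgS : subp sgK }.

Lemma next_stage_ex (s : stage) : exists (s' : stage) (d : presheaf_map (sgG s) (sgG s')),
  (forall A x, d A x = 0 <-> loc (@sgK s) x) /\ (forall A y, @sgK s' A y <-> imp d y).
Proof.
have [E [d [iE dE]]] := hull_sheaf (ash_addp (F := sgG s)) (@sgS s).
by exists (Stage (inj_psh_injective iE) (imp_subp d)), d.
Qed.

Definition next_stage (s : stage) : stage := sval (cid (next_stage_ex s)).
Definition next_map (s : stage) : presheaf_map (sgG s) (sgG (next_stage s)) :=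
  sval (cid (svalP (cid (next_stage_ex s)))).
Lemma next_mapP s : (forall A x, next_map s A x = 0 <-> loc (@sgK s) x) /\
  (forall A y, @sgK (next_stage s) A y <-> imp (next_map s) y).
Proof. exact: (svalP (cid (svalP (cid (next_stage_ex s))))). Qed.

Lemma resolution_ex (F : additive_sheaf covC) : inhabited (injective_resolution F).
Proof.
have [E [d [iE dE]]] := hull_sheaf (ash_addp (F := F)) (zero_subp F).
pose s0 := Stage (inj_psh_injective iE) (imp_subp d); pose st n := iter n next_stage s0.
constructor; apply: (@InjectiveResolution C covC F (fun n => sgG (st n)) (fun n => next_map (st n)) d).
- by move=> n; apply: sgI.
- move=> A x y xy; apply/eqP; rewrite -subr_eq0; apply/eqP.
  by apply: (sheaf_separated (@ash_sheaf _ _ F)); apply/dE; rewrite raddfB xy subrr.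
- split=> [A x|A y /(next_mapP s0).1[B [f [fc [x xE]]]]]; last by exists B, f; split=> //; exists x.
  by apply/(next_mapP s0).1/loc_self; exists x.
move=> n; split=> [A x|A y /(next_mapP _).1[B [f [fc /(next_mapP _).2[x xE]]]]]; last first.
  by exists B, f; split=> //; exists x.
by apply/(next_mapP _).1/loc_self/(next_mapP _).2; exists x.
Qed.

End Sheafification.

(** * Acyclic resolutions and the comparison with injective ones *)

Section Resolutions.
Variable C : addsite.
Implicit Types (A B W X : C) (F G P J : presheaf C).
Notation covC := (@cov C).

(** The sheaf condition for the covers with a given fibre. *)
Definition gluing F : Prop := forall X B A (i : chom X B) (f : chom B A), csq i f ->
  [/\ forall y : F A, rs F f y = 0 -> y = 0, forall y : F A, rs F i (rs F f y) = 0 &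
      forall x : F B, rs F i x = 0 -> exists y, rs F f y = x].

Lemma sheaf_gluing F : addp F -> is_sheaf covC F -> gluing F.
Proof.
move=> aF sF X B A i f H; have fc := csq_cov H; split=> [y fy|y|x ix].
- by apply: (sheaf_separated sF); exists B, f.
- by rewrite -rsM (csq_comp0 H) addp0.
have [|y [yE _]] := sF A B f fc x; last by exists y.
move=> D g h gh; apply/eqP; rewrite -subr_eq0; apply/eqP.
have [|k kE] := @csq_exact C X B A i f D ((g : chom D B) - (h : chom D B)) H.
  by rewrite ccompBr; apply/eqP; rewrite subr_eq0; apply/eqP.
rewrite -[LHS]/(rs F (g : chom D B) x - rs F (h : chom D B) x) -addpB // -kE rsM ix.
exact: raddf0.
Qed.

Lemma prod_gluing F G : gluing F -> gluing G -> gluing (prodpsh F G).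
Proof.
move=> gF gG X B A i f H; have [F1 F3 F2] := gF _ _ _ _ _ H; have [G1 G3 G2] := gG _ _ _ _ _ H.
split=> [[y z] [/F1 /= -> /G1 /= ->]//|[y z]|[x z] [/F2 /= [y yE] /G2 /= [w wE]]].
  by rewrite -[LHS]/(rs F i (rs F f y), rs G i (rs G f z)) F3 G3.
by exists (y, w); rewrite -yE -wE.
Qed.

Lemma prod_flasque F G : flasque F -> flasque G -> flasque (prodpsh F G).
Proof.
move=> fF fG X B A i f H [x z]; have [y yE] := fF _ _ _ _ _ H x; have [w wE] := fG _ _ _ _ _ H z.
by exists (y, w); rewrite -yE -wE.
Qed.

(** Exactness and the extension of cocycles from fibres are proved by a joint induction. A local
    preimage is corrected by a cocycle so that it vanishes on the fibre and descends; cocycles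
    extend because they are coboundaries, whose preimages extend. *)
Lemma flasque_exact (L : nat -> presheaf C) (d : forall n, presheaf_map (L n) (L n.+1)) :
  (forall n, gluing (L n)) -> (forall n, flasque (L n)) ->
  (forall n A (x : L n A), d n.+1 A (d n A x) = 0) ->
  (forall A (x : L 0%N A), d 0%N A x = 0 -> x = 0) ->
  (forall n A (x : L n.+1 A), d n.+1 A x = 0 -> loc (imp (d n)) x) ->
  forall n A (x : L n.+1 A), d n.+1 A x = 0 -> exists y, d n A y = x.
Proof.
move=> gL fL dd d0 dl.
suff H n : (forall X B A (i : chom X B) (f : chom B A), csq i f ->
     forall x : L n X, d n X x = 0 -> exists y : L n B, d n B y = 0 /\ rs (L n) i y = x) /\
   (forall A (x : L n.+1 A), d n.+1 A x = 0 -> exists y, d n A y = x).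
  by move=> n; case: (H n).
have step m : (forall X B A (i : chom X B) (f : chom B A), csq i f ->
     forall x : L m X, d m X x = 0 -> exists y : L m B, d m B y = 0 /\ rs (L m) i y = x) ->
   (forall A (x : L m.+1 A), d m.+1 A x = 0 -> exists y, d m A y = x).
  move=> Z A x dx; have [B [f [fc [l lE]]]] := dl m A x dx.
  have [X [i H]] := cov_csq fc; have [g1 g3 _] := gL m.+1 _ _ _ _ _ H; have [_ _ g2] := gL m _ _ _ _ _ H.
  have [|k [dk ik]] := Z _ _ _ _ _ H (rs (L m) i l); first by rewrite pm_rs lE g3.
  have [|y yE] := g2 (l - k); first by rewrite raddfB ik subrr.
  exists y; apply/eqP; rewrite -subr_eq0; apply/eqP/g1.
  by rewrite raddfB -pm_rs yE raddfB dk subr0 lE subrr.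
elim: n => [|n [IH1 IH2]].
  have Z0 X B A (i : chom X B) (f : chom B A) : csq i f ->
      forall x : L 0%N X, d 0%N X x = 0 -> exists y : L 0%N B, d 0%N B y = 0 /\ rs (L 0%N) i y = x.
    by move=> _ x /d0 ->; exists 0; rewrite !raddf0.
  by split=> //; apply: step.
have Z X B A (i : chom X B) (f : chom B A) : csq i f ->
    forall x : L n.+1 X, d n.+1 X x = 0 -> exists y : L n.+1 B, d n.+1 B y = 0 /\ rs (L n.+1) i y = x.
  move=> H x /IH2[l <-]; have [l' <-] := fL n _ _ _ _ _ H l.
  by exists (d n B l'); rewrite dd pm_rs.
by split=> //; apply: step.
Qed.

(** ** Comparison of resolutions *)

Record resolution P (G : nat -> presheaf C) (e : presheaf_map P (G 0%N))
    (d : forall n, presheaf_map (G n) (G n.+1)) : Prop := Resolution {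
  rs_addp : forall n, addp (G n);
  rs_sheaf : forall n, is_sheaf covC (G n);
  rs_flasque : forall n, flasque (G n);
  rs_e0 : forall A x, e A x = 0 -> loc (@zerop C P) x;
  rs_de : forall A x, d 0%N A (e A x) = 0;
  rs_dd : forall n A x, d n.+1 A (d n A x) = 0;
  rs_ex0 : forall A y, d 0%N A y = 0 -> loc (imp e) y;
  rs_ex : forall n A y, d n.+1 A y = 0 -> loc (imp (d n)) y }.

Lemma loc0 F A (x : F A) (K : forall A, F A -> Prop) : is_sheaf covC F -> loc K x ->
  (forall B (y : F B), K B y -> y = 0) -> x = 0.
Proof.
move=> sF lx H; apply: (sheaf_separated sF); apply: loc_mono lx => B y; exact: H.
Qed.

Lemma pm_loc0 F G (phi : presheaf_map F G) A (x : F A) (K : forall A, F A -> Prop) :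
  is_sheaf covC G -> loc K x -> (forall B (y : F B), K B y -> phi B y = 0) -> phi A x = 0.
Proof.
move=> sG lx H; apply: (loc0 (K := @zerop C G)) => //; exact: loc_map lx.
Qed.

Section Comparison.
Variables (P : presheaf C) (G I : nat -> presheaf C) (e : presheaf_map P (G 0%N))
  (d : forall n, presheaf_map (G n) (G n.+1)) (a : presheaf_map P (I 0%N))
  (b : forall n, presheaf_map (I n) (I n.+1)).
Hypotheses (HG : resolution e d) (HI : resolution a b) (aP : addp P)
  (inI : forall n, inj_psh (I n)).

Definition comparison (phi : forall n, presheaf_map (G n) (I n)) : Prop :=
  (forall A x, phi 0%N A (e A x) = a A x) /\
  (forall n A x, phi n.+1 A (d n A x) = b n A (phi n A x)).

Lemma comparison_step n (f : presheaf_map (G n) (I n)) :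
  (forall A x, d n A x = 0 -> b n A (f A x) = 0) ->
  exists g : presheaf_map (G n.+1) (I n.+1), forall A x, g A (d n A x) = b n A (f A x).
Proof.
move=> H; have [|||g gE] := @inI (n.+1) _ _ (d n) (pm_comp (b n) f); try exact: rs_addp HG _.
  exact: H.
by exists g.
Qed.

(** The recursion carries the condition that cocycles go to cocycles, which is what the next
    extension requires. *)
Definition cstage n := {f : presheaf_map (G n) (I n) | forall A x, d n A x = 0 -> b n A (f A x) = 0}.

Lemma cstage_step_ex n (s : cstage n) : exists s' : cstage n.+1,
  forall A x, sval s' A (d n A x) = b n A (sval s A x).
Proof.
have [g gE] := comparison_step (svalP s).
have gK A x : d n.+1 A x = 0 -> b n.+1 A (g A x) = 0.
  move=> /(rs_ex HG) lx; apply: (pm_loc0 (phi := pm_comp (b n.+1) g)) lx _; first exact: rs_sheaf HI _.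
  by move=> B _ [y <-]; rewrite /= gE (rs_dd HI).
by exists (exist _ g gK).
Qed.

Lemma comparison_ex : exists phi, comparison phi.
Proof.
have [|||f fE] := @inI (0%N) _ _ e a; [exact: aP|exact: rs_addp HG _| |].
  by move=> A x /(rs_e0 HG) lx; apply: (pm_loc0 _ lx); [exact: (rs_sheaf HI)|by move=> B y ->; rewrite raddf0].
have fK A x : d 0%N A x = 0 -> b 0%N A (f A x) = 0.
  move=> /(rs_ex0 HG) lx; apply: (pm_loc0 (phi := pm_comp (b 0%N) f)) lx _; first exact: rs_sheaf HI _.
  by move=> B _ [y <-]; rewrite /= fE (rs_de HI).
pose st := fix st n : cstage n :=
  if n is m.+1 then sval (cid (cstage_step_ex (st m))) else exist _ f fK.
exists (fun n => sval (st n)); split=> // n A x.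
exact: (svalP (cid (cstage_step_ex (st n)))).
Qed.

(** By a null-homotopy of [psi - phi], constructed degree by degree from the
    injectivity of [I]. *)
Lemma comparison_uniq phi psi : comparison phi -> comparison psi ->
  forall n A (x : G n A), d n A x = 0 -> coboundary (fun m => b m A) (psi n A x - phi n A x).
Proof.
move=> [phi0 phiS] [psi0 psiS]; pose del n := pm_sub (psi n) (phi n).
have delE n A x : del n A x = psi n A x - phi n A x by [].
have delS n A x : del n.+1 A (d n A x) = b n A (del n A x).
  by rewrite !delE psiS phiS raddfB.
suff H n : exists s : presheaf_map (G n.+1) (I n),
    (forall A x, b n A (s A (d n A x)) = b n A (del n A x)) /\
    (forall A x, d n A x = 0 -> coboundary (fun m => b m A) (del n A x)).
  by move=> n; have [s [_ sE]] := H n; apply: sE.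
elim: n => [|n [s [s1 s2]]].
  have [|||s sE] := @inI (0%N) _ _ (d 0%N) (del 0%N); try exact: rs_addp HG _.
    move=> A x /(rs_ex0 HG) lx; apply: (pm_loc0 _ lx); [exact: (rs_sheaf HI)|move=> B _ [y <-]].
    by rewrite delE phi0 psi0 subrr.
  exists s; split=> A x; first by rewrite sE.
  move=> dx; suff : del 0%N A x = 0 by []; by rewrite -sE dx raddf0.
have [|||t tE] := @inI (n.+1) _ _ (d n.+1) (pm_sub (del n.+1) (pm_comp (b n) s)); try exact: rs_addp HG _.
  move=> A x /(rs_ex HG) lx; apply: (pm_loc0 _ lx); [exact: (rs_sheaf HI)|move=> B _ [y <-]].
  by rewrite -[LHS]/(del n.+1 B (d n B y) - b n B (s B (d n B y))) delS s1 subrr.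
have tE' A x : t A (d n.+1 A x) = del n.+1 A x - b n A (s A x) by exact: tE.
exists t; split=> A x; first by rewrite tE' raddfB (rs_dd HI) subr0.
by move=> dx; exists (s A x); apply/esym/eqP; rewrite -subr_eq0 -tE' dx raddf0.
Qed.

(** ** The cone of a comparison map *)

Section Cone.
Variable phi : forall n, presheaf_map (G n) (I n).
Hypothesis Hphi : comparison phi.

(** With [I] shifted by one degree; exactness on sections says that [phi] induces isomorphisms in
    cohomology. *)
Definition cone n : presheaf C := if n is m.+1 then prodpsh (G n) (I m) else G 0%N.

Definition cone_d n : presheaf_map (cone n) (cone n.+1).
Proof.
case: n => [|n].
  apply: (@mkpm C (G 0%N) (prodpsh (G 1%N) (I 0%N)) (fun A x => (d 0%N A x, phi 0%N A x))).
    by move=> A x y; rewrite !raddfB.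
  by move=> A B u x; rewrite !pm_rs.
apply: (@mkpm C (prodpsh (G n.+1) (I n)) (prodpsh (G n.+2) (I n.+1))
  (fun A t => (d n.+1 A t.1, phi n.+1 A t.1 - b n A t.2))).
  by move=> A [x y] [x' y'] /=; rewrite (raddfB (d n.+1 A)) (raddfB (phi n.+1 A)) (raddfB (b n A)) [in LHS]opprD [in LHS]addrACA -opprD.
by move=> A B u [x y] /=; rewrite !pm_rs raddfB.
Defined.

Lemma cone_d0E A x : cone_d 0 A x = (d 0%N A x, phi 0%N A x). Proof. by []. Qed.
Lemma cone_dSE n A x y : cone_d n.+1 A (x, y) = (d n.+1 A x, phi n.+1 A x - b n A y).
Proof. by []. Qed.

(** All terms are flasque sheaves, so [flasque_exact] reduces this to local exactness, a chase in
    two resolutions of the same [P]. *)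
Lemma cone_exact n A (x : cone n.+1 A) : cone_d n.+1 A x = 0 -> exists y, cone_d n A y = x.
Proof.
have [phi0 phiS] := Hphi.
apply: flasque_exact => {n A x} [[|n]|[|n]|[|n] A x|A x|[|n] A [x y]].
- by apply: sheaf_gluing; [apply: rs_addp HG _|apply: rs_sheaf HG _].
- by apply: prod_gluing; apply: sheaf_gluing; [apply: rs_addp HG _|apply: rs_sheaf HG _|apply: rs_addp HI _|apply: rs_sheaf HI _].
- exact: rs_flasque HG _.
- by apply: prod_flasque; [apply: rs_flasque HG _|apply: rs_flasque HI _].
- by rewrite cone_d0E cone_dSE (rs_dd HG) phiS subrr.
- by case: x => x y; rewrite !cone_dSE (rs_dd HG) phiS raddfB (rs_dd HI) subr0 subrr.
- rewrite cone_d0E => -[/(rs_ex0 HG)[B [f [fc [p pE]]]] fx].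
  have p0 : loc (@zerop C P) p by apply: (rs_e0 HI); rewrite -phi0 pE pm_rs fx raddf0.
  apply: (sheaf_separated (@rs_sheaf _ _ _ _ HG 0%N)); exists B, f; split=> //.
  by rewrite /zerop -pE; apply: (pm_loc0 _ p0); [exact: (rs_sheaf HG)|by move=> D y ->; rewrite raddf0].
(* [z] is a local preimage of the first component. Locally [phi z] and [y] differ by a section [p]
   of [P], and [e p] is subtracted from [z]. *)
- rewrite cone_dSE => -[/(rs_ex HG)[B [f [fc [z zE]]]]] /eqP; rewrite subr_eq0 => /eqP xy.
  have /(rs_ex0 HI)[D [g [gc [p pE]]]] : b 0%N B (phi 0%N B z - rs (I 0%N) f y) = 0.
    by rewrite raddfB -phiS zE !pm_rs xy subrr.
  exists D, (ccomp f g); split; first exact: cov_comp.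
  exists (rs (G 0%N) g z - e D p); rewrite cone_d0E -[rs (cone 1) _ _]/(rs (G 1%N) (ccomp f g) x, rs (I 0%N) (ccomp f g) y).
  rewrite !raddfB (rs_de HG) subr0 pm_rs zE -rsM phi0 pE raddfB pm_rs -rsM.
  by rewrite opprB addrCA subrr addr0.
rewrite cone_dSE => -[/(rs_ex HG)[B [f [fc [z zE]]]]] /eqP; rewrite subr_eq0 => /eqP xy.
have /(rs_ex HI)[D [g [gc [w wE]]]] : b n.+1 B (phi n.+1 B z - rs (I n.+1) f y) = 0.
  by rewrite raddfB -phiS zE !pm_rs xy subrr.
exists D, (ccomp f g); split; first exact: cov_comp.
exists (rs (G n.+1) g z, w); rewrite cone_dSE -[rs (cone n.+2) _ _]/(rs (G n.+2) (ccomp f g) x, rs (I n.+1) (ccomp f g) y).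
rewrite pm_rs zE -rsM wE raddfB pm_rs -rsM.
by rewrite opprB addrCA subrr addr0.
Qed.

Lemma cone_inj n A (x : G n A) : d n A x = 0 -> coboundary (fun m => b m A) (phi n A x) ->
  coboundary (fun m => d m A) x.
Proof.
case: n x => [|n] x dx /= => [fx|[y yE]].
  have [B [f [fc [p pE]]]] := rs_ex0 HG dx; have [phi0 _] := Hphi.
  have p0 : loc (@zerop C P) p by apply: (rs_e0 HI); rewrite -phi0 pE pm_rs fx raddf0.
  apply: (sheaf_separated (@rs_sheaf _ _ _ _ HG 0%N)); exists B, f; split=> //.
  by rewrite /zerop -pE; apply: (pm_loc0 _ p0); [exact: (rs_sheaf HG)|by move=> D y ->; rewrite raddf0].
have [|z zE] := @cone_exact n A (x, y); first by rewrite cone_dSE dx yE subrr.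
by case: n x y dx yE z zE => [|n] x y _ _ => [z|[z w]] [zE _]; exists z.
Qed.

Lemma cone_surj n A (y : I n A) : b n A y = 0 ->
  exists x, d n A x = 0 /\ coboundary (fun m => b m A) (phi n A x - y).
Proof.
move=> by0; have [|z zE] := @cone_exact n A (0, y).
  by rewrite cone_dSE raddf0 by0 subr0 raddf0.
case: n y by0 z zE => [|n] y _ => [z|[z w]] [z0 zy]; exists z; split=> //=.
  by rewrite zy subrr.
by exists w; rewrite -zy opprB addrCA subrr addr0.
Qed.

End Cone.

End Comparison.

End Resolutions.

(** * The site of perfect even modules *)

Section EvenTopology.
Variable R : e1_ring.
Notation S := (module_stable R).
Notation T := (hoc S).
Notation OM := (OmT S).
Notation SH := (ShT S).
Notation C := (Perf_ev R).
Notation PE := (@perfect_even R).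

Definition ob (A : C) : S := sval A.

Definition even_preadditive : preadditive :=
  @Preadditive C (fun A B : C => GRing.Zmodule.class (thom (ob A) (ob B))).
Notation E := even_preadditive.

Lemma eccompDl (A B X : E) (f g : chom B X) (h : chom A B) :
  ccomp (f + g) h = ccomp f h + ccomp g h.
Proof. exact: (@tcompDl S (ob A) (ob B) (ob X)). Qed.

Lemma eccompDr (A B X : E) (f g : chom A B) (h : chom B X) :
  ccomp h (f + g) = ccomp h f + ccomp h g.
Proof. exact: (@tcompDr S (ob A) (ob B) (ob X)). Qed.

Definition zeroC : E := exist _ (pt S) (pe_pt R).

Lemma zeroC_zero : is_zero_obj zeroC.
Proof. by move=> A; exact: (@is_zero_pt S (ob A)). Qed.

Lemma chom_zeroE (A B : E) (f : chom A B) : f = 0 -> is_zero_hom f.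
Proof.
move=> ->; exists zeroC; split; first exact: zeroC_zero.
exists (0 : chom zeroC B), (0 : chom A zeroC); symmetry; exact: (@tcomp0l S (ob A) (pt S) (ob B)).
Qed.

Lemma even_biprod (A : E) : exists (P : E) i1 i2 p1 p2, @biproduct E A A P i1 i2 p1 p2.
Proof.
pose P : E := exist _ (prd (ob A) (ob A)) (pe_prd (svalP A) (svalP A)).
have [e11 e22 e12 e21 U1 U2] := prd_biproduct (ob A) (ob A).
exists P, (prd1 (ob A) (ob A)), (prd2 (ob A) (ob A)), (ho (pr1 (ob A) (ob A))), (ho (pr2 (ob A) (ob A))).
split.
- exact: e11.
- exact: e22.
- apply: chom_zeroE; exact: (zero_hom0 e12).
- apply: chom_zeroE; exact: (zero_hom0 e21).
- by move=> W; exact: (U1 (ob W)).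
by move=> W; exact: (U2 (ob W)).
Qed.

Definition ecsq (X B A : E) (i : chom X B) (f : chom B A) : Prop :=
  fs (i : @mor T (ob X) (ob B)) (f : @mor T (ob B) (ob A)).

Definition ecov (B A : E) (f : chom B A) : Prop := @even_epi R B A f.

Lemma ecovP (A B : E) (f : chom B A) : ecov f <-> cover (f : @mor T (ob B) (ob A)).
Proof.
split=> [[X [i [/fsP H pX]]]|[_ [X [i [H pX]]]]]; first by split; [exact: (svalP B)|exists X, i].
by exists X, i; split=> //; apply/fsP.
Qed.

Definition even_site : addsite.
Proof.
apply: (@AddSite E eccompDl eccompDr (ex_intro _ zeroC zeroC_zero) even_biprod ecov _ _ _ ecsq).
- by move=> A; apply/ecovP; exact: (cover_id (svalP A)).
- by move=> A B X f g /ecovP Hf /ecovP Hg; apply/ecovP; exact: (cover_comp Hf Hg).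
- move=> A B X f u /ecovP Hf.
  have [Q [g [v [Hg e]]]] := cover_pull (u : @mor T (ob X) (ob A)) (svalP X) Hf.
  exists (exist _ Q (proj1 Hg)), g, v; split; [exact/ecovP|exact: e].
- by move=> A B f /ecovP[_ [X [i [H pX]]]]; exists (exist _ X pX), i.
- move=> X B A i f H; apply/ecovP; split; first exact: (svalP B).
  by exists (ob X), i; split=> //; exact: (svalP X).
- by move=> X B A i f H; exact: (fs_comp0 H).
- by move=> X B A i f W g H g0; have [h hE] := fs_exact H g0; exists h.
move=> X B A i f W x H x0; have [Q [g [gc gE]]] := cover_mono H (svalP W) (svalP A) x0.
exists (exist _ Q (proj1 gc)), g; split; [exact/ecovP|exact: gE].
Defined.

(** ** The presheaves [pi_n map] *)

(** Two encodings are removed at once: the presented group by [ungen], and the shifts of [A] by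
    adjunction. Exactness of fibre sequences can then be applied. *)
Definition tau n (A M : S) : @pi_map R n A M -> thom A (SN S n M) :=
  match n return @pi_map R n A M -> thom A (SN S n M) with
  | Posz k => fun x => adjn (@ungen S (iter k SH A) M x)
  | Negz k => fun x => @ungen S A (iter k.+1 SH M) x
  end.

Lemma adjnB k (A M : S) (u v : thom (iter k SH A) M) : adjn (u - v) = adjn u - adjn v.
Proof. by apply: (addIr (adjn v)); rewrite -adjnD !subrK. Qed.

Lemma tauB n (A M : S) (x y : @pi_map R n A M) : tau (x - y) = tau x - tau y.
Proof.
case: n x y => k x y; last exact: (@ungenB S (A : S) (iter k.+1 SH M) x y).
have e := @ungenB S (iter k SH A) (M : S) x y.
exact: etrans (congr1 (fun u => adjn (u : thom (iter k SH A) (M : S))) e) (adjnB _ _).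
Qed.

Lemma tau_inj n (A M : S) (x y : @pi_map R n A M) : tau x = tau y -> x = y.
Proof.
case: n x y => k x y.
  by move=> /adjn_inj H; exact: (@ungen_inj S (iter k SH A) (M : S) x y H).
by move=> H; exact: (@ungen_inj S (A : S) (iter k.+1 SH M) x y H).
Qed.

Lemma tau_surj n (A M : S) (u : thom (A : S) (SN S n M)) : exists x : @pi_map R n A M, tau x = u.
Proof.
case: n u => k u.
  have [w wE] := @adjn_surj S k A M u; exists (gen w); rewrite -wE.
  exact: (congr1 (fun v => adjn (v : thom (iter k SH A) (M : S))) (@genK S (iter k SH A) (M : S) w)).
exists (gen u); exact: (@genK S (A : S) (iter k.+1 SH M) u).
Qed.

Lemma tau_nat n (A M A' M' : S) (g : @mor T M M') (f : @mor T A' A) (x : @pi_map R n A M) :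
  tau (@pi_map_map R n A M A' M' g f x) = fmap (SN S n) g \oc tau x \oc f.
Proof.
case: n x => k x.
  have e := @ungen_map S (iter k SH A) M (iter k SH A') M' g (iter_fmap SH k f) x.
  exact: etrans (congr1 (fun v => @adjn S k A' M' v) e) (@adjn_nat S k A A' M M' f g (@ungen S (iter k SH A) M x)).
exact: (@ungen_map S A (iter k.+1 SH M) A' (iter k.+1 SH M') (iter_fmap SH k.+1 g) f x).
Qed.

Lemma tau0 n (A M : S) : tau (0 : @pi_map R n A M) = 0.
Proof. by rewrite -(subrr 0) tauB subrr. Qed.

Lemma tau_eq0 n (A M : S) (x : @pi_map R n A M) : tau x = 0 -> x = 0.
Proof. by rewrite -(tau0 n A M) => /tau_inj. Qed.

Notation PI n M := (@pi_presheaf R n M : presheaf even_site).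

Lemma tau_rs n (M : S) (A B : even_site) (f : chom B A) (x : PI n M A) :
  tau (rs (PI n M) f x : @pi_map R n (ob B) M) = (tau (x : @pi_map R n (ob A) M) \oc (f : @mor T (ob B) (ob A))).
Proof.
have := @tau_nat n (ob A) M (ob B) M (@idc T M) f x.
by rewrite fmap1 comp1f => <-.
Qed.

Lemma pi_addp n (M : S) : addp (PI n M).
Proof.
move=> A B f g x; apply: tau_inj; rewrite tau_rs.
have tauD (y z : @pi_map R n (ob B) M) : tau (y + z) = tau y + tau z.
  by rewrite -{1}[z]opprK tauB -[- z]sub0r tauB tau0 sub0r opprK.
rewrite tauD !tau_rs; exact: (@tcompDr S (ob B) (ob A) (SN S n M) (tau x) f g).
Qed.

End EvenTopology.

(** * The envelopes give a flasque resolution *)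

Section EvenResolution.
Variable R : e1_ring.
Notation S := (module_stable R).
Notation T := (hoc S).
Notation OM := (OmT S).
Notation SH := (ShT S).
Notation PE := (@perfect_even R).
Notation ES := (even_site R).
Notation PI n M := (@pi_presheaf R n M : presheaf ES).

Definition oddnul (W : S) : Prop := forall A : S, PE A -> nul A (OM W) /\ nul A (SH W).

Section Flasque.
Variables (n : int) (M : S).
Hypothesis HW : oddnul (SN S n M).

(** By exactness a section that vanishes on the fibre [X] of the cover descends. It descends
    uniquely, because the ambiguity comes from maps out of [SH X], which vanish. *)
Lemma pi_sheaf : is_sheaf (@cov ES) (PI n M).
Proof.
move=> A B f fc x comp; have [X [i H]] := @cov_csq ES A B f fc.
have ix : @tau R n (ob B) M x \oc (i : @mor T (ob X) (ob B)) = tzero _ _.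
  rewrite -(tau_rs (M := M) (i : chom X B)).
  have -> : rs (PI n M) (i : chom X B) x = 0.
    rewrite -(addp0 X x (@pi_addp R n M)); apply: comp.
    exact: etrans (csq_comp0 H) (esym (ccomp0r X (f : chom B A))).
  exact: (tau0 n (ob X) M).
have [v vE] := fs_contra (H : fs _ _) ix; have [y yE] := tau_surj (v : thom (ob A) (SN S n M)).
exists y; split; first by apply: tau_inj; rewrite -[res _ _ _]/(rs (PI n M) (f : chom B A) y) tau_rs yE.
move=> z zx; apply: tau_inj; rewrite yE.
have zE : @tau R n (ob A) M z \oc (f : @mor T (ob B) (ob A)) = tau x by rewrite -zx -(tau_rs (M := M)).
have [d [D _]] := fs_rotr (H : fs _ _).
pose w : thom (ob A) (SN S n M) := (v : thom (ob A) (SN S n M)) - @tau R n (ob A) M z.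
have [|u uE] := @fs_contra S _ _ _ _ _ _ w D.
  rewrite -[LHS]/(tcomp w (f : thom (ob B) (ob A))) tcompBl /tcomp zE vE; exact: (@subrr (thom _ _)).
apply: (@subr0_eq (thom _ _)); rewrite -/w -uE.
have -> : u = tzero _ _ by apply: (nul_Sh (HW (svalP X)).1).
exact: tzero_r.
Qed.

(** The obstruction to extending from the fibre to [B] is a map out of [OM A], equivalently a map
    from [A] to the shift of the target. *)
Lemma pi_flasque : flasque (PI n M).
Proof.
move=> X B A i f H x; have [d [D _]] := fs_rotl (H : fs _ _).
have [|v vE] := @fs_contra S _ _ _ _ _ _ (@tau R n (ob X) M x) D.
  apply: nul_ShSh; apply: (nul_isol (isom_sym (ShOm_isom (ob A)))).
  exact: (HW (svalP A)).2.
have [y yE] := tau_surj (v : thom (ob B) (SN S n M)); exists y.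
by apply: tau_inj; rewrite tau_rs yE.
Qed.

End Flasque.

Definition pi_pm n (M N : S) (g : @mor T M N) : presheaf_map (PI n M) (PI n N).
Proof.
refine (@PresheafMap ES (PI n M) (PI n N) (fun A => @pi_presheaf_map R n M N g A) _).
move=> A B f x; rewrite -[LHS](@pi_map_mapM R) -[RHS](@pi_map_mapM R).
by congr (pi_map_map n _ _ x); rewrite ?(@compf1 T) ?(@comp1f T).
Defined.

Lemma tau_pm n (M N : S) (g : @mor T M N) (A : ES) (x : PI n M A) :
  @tau R n (ob A) N (pi_pm n g A x) = fmap (SN S n) g \oc @tau R n (ob A) M x.
Proof. by have := @tau_nat R n (ob A) M (ob A) N g (@idc T _) x; rewrite compf1. Qed.

(** ** Local injectivity and surjectivity *)

Definition lnul (A : S) X (u : @mor T A X) : Prop :=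
  exists B (f : @mor T B A), cover f /\ u \oc f = tzero B X.

(** [u] comes from a map to [OM Z], an odd shift of a flat module, and such maps are killed by a
    cover. *)
Lemma flat_inj (X Y Z : S) (f : @mor T X Y) (g : @mor T Y Z) A (u : @mor T A X) : PE A ->
  fs f g -> flat false Z -> f \oc u = tzero A Y -> lnul u.
Proof.
move=> pA H fZ fu; have [d [D _]] := fs_rotl H; have [w wE] := fs_exact D fu.
have [B [b [bc bE]]] := cover_flat w pA (flat_Om fZ).
by exists B, b; split=> //; rewrite -wE -compA bE tzero_l.
Qed.

Definition locnul (X : S) : Prop := forall (A : S) (u : @mor T A X), PE A -> lnul u.

Lemma locnul_iso (X Y : S) : @isomorphic T X Y -> locnul X -> locnul Y.
Proof.
case=> f [g [gf fg]] H A u pA; have [B [b [bc bE]]] := H A (g \oc u) pA.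
by exists B, b; split=> //; rewrite -[u](@comp1f T) -fg -(compA f) -compA bE tzero_l.
Qed.

(** The image of [u] in [SH (SH X)] is locally zero by flatness, so [u] comes locally from [SH Y],
    to which all maps vanish. Two cofibres of [f] occur: [Z'] is known to be flat, and [Z] is the
    one in the sequence. *)
Lemma locnul_step (X Y Z : S) (f : @mor T X Y) (g : @mor T Y Z) (Z' : S) (g' : @mor T Y Z') :
  fs f g -> fs f g' -> flat false Z' -> oddnul Y -> locnul (SH Z).
Proof.
move=> H H' fZ nY A u pA; have [d [D1 D2]] := fs_rotr (fs_Sh H).
have [||B [b [bc bE]]] := @flat_inj _ _ _ _ _ A (d \oc u) pA (fs_Sh (fs_Sh H')).
- by have := flat_Sh (flat_Sh fZ).
- by rewrite compA (fs_comp0 D2) tzero_r.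
have [|y yE] := @fs_exact S _ _ _ _ _ _ (u \oc b) D1; first by rewrite compA.
exists B, b; split=> //; rewrite -yE ((nY B bc.1).2 y); exact: tzero_l.
Qed.

Lemma loc_surj (X Y Z : S) (f : @mor T X Y) (g : @mor T Y Z) A (z : @mor T A Z) : PE A ->
  fs f g -> locnul (SH X) -> exists B (b : @mor T B A) y, cover b /\ g \oc y = z \oc b.
Proof.
move=> pA H nX; have [d [D _]] := fs_rotr H; have [B [b [bc bE]]] := nX A (d \oc z) pA.
have [|y yE] := @fs_exact S _ _ _ _ _ _ (z \oc b) D; first by rewrite compA.
by exists B, b, y.
Qed.

Section Envelopes.
Variables (M : S) (M_even : @homologically_even R M) (C E : nat -> S)
  (e : forall i, @mor T (@prev_cofib R M C i) (E i)) (c : forall i, @mor T (E i) (C i)).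
Hypotheses (e_env : forall i, @pi_even_envelope R _ _ (e i))
  (c_cof : forall i, @fibre_sequence R _ _ _ (e i) (c i)).
Variable q : int.

Notation F := (SN S (q * 2)).

Lemma env_fs i : fs (fmap F (e i)) (fmap F (c i)).
Proof. by apply: fs_SN; apply/fsP. Qed.

Lemma env_flat i : exists (Z : S) (g : @mor T (F (E i)) Z), fs (fmap F (e i)) g /\ flat false Z.
Proof.
have [[Z [g [/fsP H fZ]]] _ _] := e_env i.
exists (F Z), (fmap F g); split; first exact: fs_SN.
exact: flat_even.
Qed.

Lemma env_oddnul i : oddnul (F (E i)).
Proof.
have [_ evE _] := e_env i; move=> A pA; split.
  exact: nul_iso (isom_sym (SN_Om (q * 2) (E i))) (@vanish R (E i) evE A q pA).
apply: nul_iso (isom_sym (SN_Sh (q * 2) (E i))) _.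
have -> : q * 2 - 1 = (q - 1) * 2 + 1 by lia.
exact: (@vanish R (E i) evE A (q - 1) pA).
Qed.

Lemma M_locnul : locnul (SH (F M)).
Proof.
apply: locnul_iso (isom_sym (SN_Sh (q * 2) M)) _.
have -> : q * 2 - 1 = (q - 1) * 2 + 1 by lia.
move=> A u pA; pose A' : ES := exist _ A pA.
(* The hypothesis on [M] is applied to the constructed sheafification, whose unit kills only locally
   zero sections. *)
have [G [v [sv v0 _]]] := sheafification_ex (@pi_addp R ((q - 1) * 2 + 1) M).
have [x xE] := tau_surj u.
have [B [b [bc bx]]] := v0 A' x (M_even sv (v A' x)).
exists (ob B), b; split; first exact: (proj1 (@ecovP R A' B b) bc).
rewrite -xE -[LHS](@tau_rs R _ M A' B b x) bx; exact: tau0.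
Qed.

Lemma prev_locnul i : locnul (SH (F (@prev_cofib R M C i))).
Proof.
case: i => [|i]; first exact: M_locnul.
have [Z [g [H fZ]]] := env_flat i.
exact: locnul_step (env_fs i) H fZ (env_oddnul i).
Qed.

Lemma env_inj i (A : ES) (x : PI (q * 2) (@prev_cofib R M C i) A) :
  pi_pm (q * 2) (e i) A x = 0 -> loc (@zerop ES (PI (q * 2) (@prev_cofib R M C i))) x.
Proof.
move=> ex; have [Z [g [H fZ]]] := env_flat i.
have [|B [b [bc bE]]] := flat_inj (u := tau x) (svalP A) H fZ.
  by rewrite -tau_pm ex; apply: tau0.
pose B' : ES := exist _ B bc.1.
exists B', b; split; first exact: (proj2 (@ecovP R A B' b) bc).
by apply: tau_eq0; exact: etrans (@tau_rs R _ _ A B' b x) bE.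
Qed.

Lemma env_exact i (A : ES) (y : PI (q * 2) (E i) A) :
  pi_pm (q * 2) (c i) A y = 0 -> imp (pi_pm (q * 2) (e i)) y.
Proof.
move=> cy; have [|u uE] := fs_exact (env_fs i) (u := tau y).
  by rewrite -tau_pm cy; apply: tau0.
have [x xE] := tau_surj (u : thom (ob A) (F (@prev_cofib R M C i))); exists x.
by apply: tau_inj; rewrite tau_pm xE.
Qed.

Lemma env_surj i (A : ES) (z : PI (q * 2) (C i) A) : loc (imp (pi_pm (q * 2) (c i))) z.
Proof.
have [B [b [u [bc uE]]]] := loc_surj (tau z) (svalP A) (env_fs i) (@prev_locnul i).
pose B' : ES := exist _ B bc.1.
exists B', b; split; first exact: (proj2 (@ecovP R A B' b) bc).
have [y yE] := tau_surj (u : thom (ob B') (F (E i))); exists y.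
apply: tau_inj; exact: etrans (@tau_pm (q * 2) (E i) (C i) (c i) B' y)
  (etrans (congr1 (fun w => fmap F (c i) \oc w) yE) (etrans uE (esym (@tau_rs R _ (C i) A B' b z)))).
Qed.

Lemma env_comp0 i (A : ES) (x : PI (q * 2) (@prev_cofib R M C i) A) :
  pi_pm (q * 2) (c i) A (pi_pm (q * 2) (e i) A x) = 0.
Proof.
apply: tau_eq0; rewrite !tau_pm compA (fs_comp0 (env_fs i)); exact: tzero_r.
Qed.

Definition env_d i : presheaf_map (PI (q * 2) (E i)) (PI (q * 2) (E i.+1)) :=
  pi_pm (q * 2) (@envelope_d R M C E e c i).

Lemma env_dE i A (x : PI (q * 2) (E i) A) :
  env_d i A x = pi_pm (q * 2) (e i.+1 : @mor T (C i) (E i.+1)) A (pi_pm (q * 2) (c i) A x).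
Proof.
apply: tau_inj; rewrite !tau_pm compA; congr (_ \oc _).
exact: (fmapM F (e i.+1 : @mor T (C i) (E i.+1)) (c i)).
Qed.

(** Since the next envelope is locally injective, a cocycle in [E_(n+1)] comes locally from [C_n],
    and then from [E_n], as [E_n -> C_n] is locally surjective. For [n = 0] this surjectivity rests
    on [M] being homologically even. *)
Lemma env_resolution : resolution (pi_pm (q * 2) (e 0%N) : presheaf_map (PI (q * 2) M) _) env_d.
Proof.
split.
- by move=> n; apply: pi_addp.
- by move=> n; apply: pi_sheaf; apply: env_oddnul.
- by move=> n; apply: pi_flasque; apply: env_oddnul.
- by move=> A x; apply: (@env_inj 0%N).
- by move=> A x; rewrite env_dE (@env_comp0 0%N) raddf0.
- by move=> n A x; rewrite !env_dE (@env_comp0 n.+1) raddf0.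
- move=> A y; rewrite env_dE => /(@env_inj 1%N)[B [f [fc fy]]].
  by exists B, f; split=> //; apply: (@env_exact 0%N); rewrite pm_rs.
move=> n A y; rewrite env_dE => /(@env_inj n.+2)[B [f [fc fy]]].
apply: loc_loc; exists B, f; split=> //.
have [|x xE] := @env_exact n.+1 B (rs (PI (q * 2) (E n.+1)) f y); first by rewrite pm_rs.
have [D [g [gc [z zE]]]] := @env_surj n B x.
exists D, g; split=> //; exists z.
by rewrite env_dE zE -xE pm_rs.
Qed.

End Envelopes.

End EvenResolution.

(** ** The map on cohomology induced by a map of complexes *)

Section CohomologyMap.
Variables (K L : nat -> zmodType) (d : forall n, {additive K n -> K n.+1})
  (b : forall n, {additive L n -> L n.+1}) (f : forall n, {additive K n -> L n}).
Hypothesis fd : forall n x, f n.+1 (d n x) = b n (f n x).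
Variable n : nat.

Lemma cocycle_map_proof (x : cocycle d n) : b n (f n (sval x)) = 0.
Proof. by rewrite -fd (svalP x) raddf0. Qed.

Definition cocycle_map (x : cocycle d n) : cocycle b n := exist _ (f n (sval x)) (cocycle_map_proof x).

Lemma cocycle_eq (x y : cocycle b n) : sval x = sval y -> x = y.
Proof.
case: x y => [x Hx] [y Hy] /= E; case: y / E Hy => Hy; congr exist; exact: Prop_irrelevance.
Qed.

Lemma coboundary_map (x : K n) : coboundary d x -> coboundary b (f n x).
Proof.
case: n x => [x ->|m x [y <-]]; first exact: raddf0.
by exists (f m y); rewrite fd.
Qed.

Lemma cocycle_map_cong (x y : cocycle_pregroup d n) : pg_eq x y ->
  pg_eq (cocycle_map x : cocycle_pregroup b n) (cocycle_map y : cocycle_pregroup b n).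
Proof. by move=> /coboundary_map; rewrite raddfB. Qed.

Definition cohomology_map : {additive cohomology d n -> cohomology b n}.
Proof.
apply: (@qmap (cocycle_pregroup d n) (cocycle_pregroup b n) cocycle_map cocycle_map_cong).
  by move=> x y; apply: cocycle_eq; rewrite /= raddfD.
by move=> x; apply: cocycle_eq; rewrite /= raddfN.
Defined.

Lemma cohomology_mapE (x : K n) (dx : d n x = 0) (fx : b n (f n x) = 0) :
  cohomology_map (cohomology_class dx) = cohomology_class fx.
Proof.
rewrite /cohomology_map /cohomology_class qmapE; congr qcls; exact: cocycle_eq.
Qed.

Lemma cohomology_map_bij :
  (forall x, d n x = 0 -> coboundary b (f n x) -> coboundary d x) ->
  (forall y, b n y = 0 -> exists x, d n x = 0 /\ coboundary b (f n x - y)) ->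
  bijective cohomology_map.
Proof.
move=> inj sur.
have I : injective cohomology_map.
  move=> u v; rewrite -(qrepK u) -(qrepK v); move: (qrep u) (qrep v) => x y {u v}.
  rewrite /cohomology_map !qmapE => /qclsP H; apply/qclsP; apply: inj.
    by rewrite raddfB (svalP x) (svalP y) subrr.
  by rewrite raddfB.
have Sj v : exists u, cohomology_map u = v.
  have [y0 yE] : exists y, v = qcls y by exists (qrep v); rewrite qrepK.
  have [x [dx cx]] := sur _ (svalP y0); exists (cohomology_class dx).
  by rewrite /cohomology_map /cohomology_class qmapE yE; apply/qclsP.
exists (fun v => sval (cid (Sj v))) => [u|v]; last exact: (svalP (cid (Sj v))).
by apply: I; rewrite (svalP (cid (Sj _))).
Qed.

End CohomologyMap.

(** * The comparison isomorphism *)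

Lemma even_ires_inj (R : e1_ring) (M : Ho R) (q : int) (D : even_resolution M q) n :
  @inj_psh (even_site R) (ires D n).
Proof.
have iI : @injective_sheaf (even_site R) (@cov (even_site R)) (ires D n) := @ires_inj _ _ _ D n.
exact: (@injective_inj_psh (even_site R) (ires D n) iI).
Qed.

(** The augmentation is composed with the sheafification map, so that both resolutions start at the
    presheaf of [M]; injective sheaves are flasque by [inj_sep_flasque]. *)
Lemma even_ires_resolution (R : e1_ring) (M : Ho R) (q : int) (D : even_resolution M q) :
  @resolution (even_site R) (pi_presheaf (q * 2) M) (fun n => ires D n)
    (pm_comp (C := even_site R) (ires_aug D) (even_unit D)) (ires_d D).
Proof.
have [u0 ul] := @sheafification_loc (even_site R) _ _ (even_unit D) (@pi_addp R (q * 2) M)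
  (even_sheafification D).
have aI n : @addp (even_site R) (ires D n) := @ash_addp (even_site R) (ires D n).
have [ae ak] := ires_exact0 D.
split.
- exact: aI.
- by move=> n; exact: (@ash_sheaf _ _ (ires D n)).
- move=> n; apply: inj_sep_flasque; first exact: aI.
    exact: even_ires_inj.
  exact: (@sheaf_separated (even_site R) _ (@ash_sheaf _ _ (ires D n))).
- move=> A x ax; apply: u0; apply: (@ires_mono _ _ _ D A); rewrite [LHS]ax.
  by rewrite raddf0.
- by move=> A x; apply: ae.
- by move=> n A x; have [H _] := ires_exact D n; apply: H.
- move=> A y /ak[B [f [fc [x xE]]]]; have [B' [g [gc [z zE]]]] := ul B x.
  pose f' : @chom (even_site R) B A := f.
  exists B', (ccomp f' g); split; first exact: (@cov_comp (even_site R) A B B' f' g fc gc).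
  exists z; rewrite (@rsM (even_site R)) -[rs _ f' y]xE -(@pm_rs (even_site R)) -zE; exact: erefl.
move=> n A y; have [_ H] := ires_exact D n; move=> /H[B [f [fc [x xE]]]].
by exists B, f; split=> //; exists x.
Qed.

Theorem theorem1p7 (R : e1_ring) (M : Ho R)
    (M_even : homologically_even M)
    (C E : nat -> Ho R)
    (e : forall i : nat, mor (prev_cofib M C i) (E i))
    (c : forall i : nat, mor (E i) (C i))
    (e_envelope : forall i : nat, pi_even_envelope (e i))
    (c_cofib : forall i : nat, fibre_sequence (e i) (c i))
    (p : nat) (q : int) :
  inhabited (even_resolution M q) /\
  forall D : even_resolution M q,
    exists theta :
        {additive envelope_cohomology e c q p -> even_cohomology D p},
      bijective theta /\ is_canonical theta.
Proof.
have aP := @pi_addp R (q * 2) M; split.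
  have [F [u [uS _ _]]] := sheafification_ex aP.
  have [r] := @resolution_ex (even_site R) F.
  constructor; exact: (@EvenResolution R M q F u uS r).
move=> D; have HG := env_resolution M_even e_envelope c_cofib q.
have HI := even_ires_resolution D.
have inI := @even_ires_inj R M q D.
have [phi Hphi] := comparison_ex HG HI aP inI; have [phi0 phiS] := Hphi.
pose U : even_site R := unit_Perf_ev R.
pose theta := @cohomology_map (fun i => homotopy_group (q * 2) (E i)) (fun n => ires D n U)
  (fun i => homotopy_group_map (q * 2) (envelope_d e c i)) (fun n => ires_d D n U)
  (fun n => phi n U) (fun n x => phiS n U x) p.
exists theta; split.
  (* Both halves are the exactness of the cone of [phi] on sections over the unit module. *)
  apply: cohomology_map_bij => [x dx fx|y dy].
    have H := @cone_inj (even_site R) _ _ _ _ _ _ _ HG HI phi Hphi p U x dx fx. exact: H.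
  exact: (cone_surj HG HI Hphi dy).
split; first by exists phi.
move=> psi [psi0 psiS] x dx dy.
have dx' : ires_d D p U (phi p U x) = 0 by rewrite -[LHS](phiS p U x) [env_d _ _ _ _ _ _]dx raddf0.
transitivity (cohomology_class (d := fun i => ires_d D i U) dx'); first exact: cohomology_mapE.
(* Any other comparison map differs from [phi] on cocycles by coboundaries, so the class does not
   depend on it. *)
have H := @comparison_uniq (even_site R) _ _ _ _ _ _ _ HG HI inI psi phi (conj psi0 psiS) Hphi p U x dx.
apply/(qclsP (G := cocycle_pregroup (fun i => ires_d D i U) p)); exact: H.
Qed.
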